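(* Let $W$ be a finite Coxeter group acting on $\mathbb{R}^n$, with open chamber $C^\circ$. Then Brownian motion conditioned to stay within the chamber $C^\circ$ is the same process as the diffusion on $C^\circ$ with constant infinitesimal variance $\sigma_{ij}(x)=\delta_{ij}$ and with drift consisting of a repulsive force from every hyperplane of reflection of $W$ (not merely the walls of the chamber), inversely proportional to the distance from that hyperplane; precisely, the drift vector at $x\in C^\circ$ is $$\mu(x)=\sum_{H}\frac{u_H}{d(x,H)},$$ the sum being over all hyperplanes of reflection $H$ of $W$, where $d(x,H)$ is the Euclidean distance from $x$ to $H$ and $u_H$ is the unit normal vector of $H$ pointing to the side of $H$ containing $C^\circ$. Equivalently, $\mu(x)=\sum_{\alpha>0}\frac{\alpha}{(\alpha,x)}$, the sum being over the positive roots.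
   Context: $W$ is generated by orthogonal reflections in hyperplanes through the origin; there is one positive root $\alpha$ (normal vector) for each hyperplane of reflection, chosen so that $C^\circ=\{x:(\alpha,x)>0\text{ for all positive roots }\alpha\}$. Let $h(x)=\prod_{\alpha>0}(\alpha,x)$, which is harmonic on $\mathbb{R}^n$, positive on $C^\circ$ and zero on its boundary. Brownian motion conditioned to stay within $C^\circ$ is the Doob $h$-transform: the Markov process on $C^\circ$ with transition density $\frac{h(y)}{h(x)}b_t(x,y)$, where $b_t(x,\cdot)$ is the density at time $t$ of standard $n$-dimensional Brownian motion started at $x$ and killed on first leaving $C^\circ$. A diffusion with drift $\mu$ and infinitesimal variance $\sigma_{ij}=\delta_{ij}$ is one with infinitesimal generator $\frac12\Delta+\mu\cdot\nabla$. *)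

(* Defs.v *)
From HB Require Import structures.
From mathcomp Require Import all_boot all_order all_algebra finmap.
From mathcomp Require Import all_classical all_reals all_analysis.

Set Implicit Arguments.
Unset Strict Implicit.
Unset Printing Implicit Defensive.

Import Order.TTheory GRing.Theory Num.Theory.
Import numFieldNormedType.Exports.

Local Open Scope classical_set_scope.
Local Open Scope ring_scope.

Section Euclidean.
Context {R : realType} {n : nat}.
Implicit Types (a x y : 'rV[R]_n) (H C : set 'rV[R]_n) (W : set 'M[R]_n).

Definition dot x y : R := \sum_(i < n) x 0 i * y 0 i.

(* The library norm on 'rV is the sup norm, hence a separate Euclidean norm. *)
Definition enorm x : R := Num.sqrt (dot x x).

Definition dist x H : R := inf [set enorm (x - y) | y in H].

Definition hplane a : set 'rV[R]_n := [set x | dot a x = 0].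

(* Matrices act on row vectors on the right:
   x *m refl a = x - (2 (a, x) / (a, a)) a. *)
Definition refl a : 'M[R]_n := 1%:M - (2 / dot a a) *: (a^T *m a).

(* Reflections are involutions, so their finite products form a group. *)
Definition finite_reflection_group W : Prop :=
  finite_set W /\
  exists2 S : set 'rV[R]_n, (forall a, S a -> a != 0) &
    W = [set \big[mulmx/1%:M]_(a <- s) refl a | s in
          [set s : seq 'rV[R]_n | forall a, a \in s -> S a]].

Definition refl_hplanes W : set (set 'rV[R]_n) :=
  [set H | exists a, [/\ a != 0, W (refl a) & H = hplane a]].

Definition open_chamber W C : Prop :=
  exists2 x, (~` \bigcup_(H in refl_hplanes W) H) x &
    C = connected_component (~` \bigcup_(H in refl_hplanes W) H) x.

(* One normal vector, of arbitrary length, for each hyperplane of reflection. *)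
Definition positive_roots W C (pos : {fset 'rV[R]_n}) : Prop :=
  set_bij [set` pos] (refl_hplanes W) hplane /\
  C = [set x | forall a, a \in pos -> 0 < dot a x].

Definition unit_normal C H : 'rV[R]_n :=
  xget 0 [set u | [/\ enorm u = 1, H = hplane u & forall x, C x -> 0 < dot u x]].

Definition repulsive_drift W C x : 'rV[R]_n :=
  \sum_(H \in refl_hplanes W) (dist x H)^-1 *: unit_normal C H.

Definition root_drift (pos : {fset 'rV[R]_n}) x : 'rV[R]_n :=
  \sum_(a <- pos) (dot a x)^-1 *: a.

Definition root_prod (pos : {fset 'rV[R]_n}) x : R := \prod_(a <- pos) dot a x.

End Euclidean.

Section Generator.
Context {R : realType} {n : nat}.
Implicit Types (C : set 'rV[R]_n) (f : 'rV[R]_n -> R).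

Definition partial (i : 'I_n) f : 'rV[R]_n -> R := 'D_(delta_mx 0 i) f.

Definition C2 f : Prop :=
  continuous f /\
  forall i : 'I_n,
    [/\ forall x, derivable f x (delta_mx 0 i), continuous (partial i f) &
      forall j : 'I_n, (forall x, derivable (partial i f) x (delta_mx 0 j)) /\
                       continuous (partial j (partial i f))].

(* C^2 functions with compact support contained in C, extended by 0. *)
Definition C2c C f : Prop :=
  C2 f /\ exists2 K, compact K /\ K `<=` C & forall x, ~ K x -> f x = 0.

Definition laplacian f x : R := \sum_(i < n) partial i (partial i f) x.

Definition gradient f x : 'rV[R]_n := \row_i partial i f x.

Definition diffusion_op (mu : 'rV[R]_n -> 'rV[R]_n) f x : R :=
  2^-1 * laplacian f x + dot (mu x) (gradient f x).

End Generator.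

Notation borel_rV R n := (g_sigma_algebraType (@open 'rV[R]_n)).

(* Lebesgue measure on the Borel sets of R^n, as an iterated product:
   the measure of A is the integral over t of the measure of its section
   {v | (t, v) in A}. *)
Fixpoint lebesgue_rV (R : realType) (n : nat) : set (borel_rV R n) -> \bar R :=
  match n return set (borel_rV R n) -> \bar R with
  | 0 => fun A => dirac (0 : borel_rV R 0) A
  | m.+1 => fun A => (\int[@lebesgue_measure R]_t
      @lebesgue_rV R m
        [set v : 'rV[R]_m | A (row_mx (const_mx t : 'rV[R]_1) v : 'rV[R]_(m.+1))])%E
  end.

Section Processes.
Context {R : realType} {n : nat} {d : measure_display} {T : measurableType d}.
Implicit Types (P : probability T R) (X B : R -> T -> 'rV[R]_n).
Implicit Types (C : set 'rV[R]_n) (mu : 'rV[R]_n -> 'rV[R]_n).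

Definition continuous_process X : Prop :=
  (forall t : R, 0 <= t ->
     measurable_fun setT (X t : T -> borel_rV R n)) /\
  (forall w, {within `[0, +oo[, continuous (fun t => X t w)}).

(* Standard Brownian motion started at 0: the coordinates of the increments
   over consecutive time intervals are mutually independent and centred normal,
   with variance the length of the interval. *)
Definition brownian_motion P B : Prop :=
  [/\ continuous_process B,
      forall w, B 0 w = 0 &
      forall (m : nat) (t : nat -> R) (A : nat -> 'I_n -> set R),
        0 <= t 0%N -> (forall k, t k < t k.+1) ->
        (forall k i, measurable (A k i)) ->
        P [set w | forall (k : 'I_m) (i : 'I_n),
                     A k i ((B (t k.+1) w - B (t k) w) 0 i)] =
        (\prod_(k < m) \prod_(i < n)
           normal_prob 0 (Num.sqrt (t k.+1 - t k)) (A k i))%E].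

(* +oo if the process never leaves C. *)
Definition exit_time C X (w : T) : \bar R :=
  ereal_inf [set t%:E | t in [set t : R | 0 <= t /\ ~ C (X t w)]].

(* b t x is a density of x + B_t on the event that x + B has not left C by
   time t. *)
Definition killed_density P B C (b : R -> 'rV[R]_n -> 'rV[R]_n -> R) : Prop :=
  forall (t : R) x, 0 < t -> C x ->
    [/\ measurable_fun setT (b t x : borel_rV R n -> R),
        forall y, 0 <= b t x y &
        forall A : set (borel_rV R n), measurable A ->
          P [set w | A (x + B t w) /\
                     (t%:E < exit_time C (fun s w' => (x + B s w')%R) w)%E] =
          (\int[@lebesgue_rV R n]_(y in A) (b t x y)%:E)%E].

End Processes.

Section MarkovProcesses.
Context {R : realType} {n : nat}.
Implicit Types (C : set 'rV[R]_n) (mu : 'rV[R]_n -> 'rV[R]_n).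
Implicit Types (Q : R -> R.-pker (borel_rV R n) ~> (borel_rV R n)).
Implicit Types (p : R -> 'rV[R]_n -> 'rV[R]_n -> R).

(* Transition function of a Markov process living on C for ever.  Only the
   values Q t x with t > 0 and x in C are meaningful. *)
Definition markov_semigroup C Q : Prop :=
  (forall (t : R) x, 0 < t -> C x -> Q t x C = 1%E) /\
  (forall (s t : R) x (A : set (borel_rV R n)), 0 < s -> 0 < t -> C x ->
     measurable A -> Q (s + t) x A = (\int[Q s x]_(y in C) Q t y A)%E).

Definition has_transition_density C Q p : Prop :=
  forall (t : R) x (A : set (borel_rV R n)), 0 < t -> C x -> measurable A ->
    Q t x A = (\int[@lebesgue_rV R n]_(y in A `&` C) (p t x y)%:E)%E.

Definition doob_transform (h : 'rV[R]_n -> R) p : R -> 'rV[R]_n -> 'rV[R]_n -> R :=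
  fun t x y => h y / h x * p t x y.

(* Q has generator L on the C^2 functions with compact support in C.
   The limit at t -> 0+ is in the supremum norm on C. *)
Definition has_generator C Q (L : ('rV[R]_n -> R) -> 'rV[R]_n -> R) : Prop :=
  forall f, C2c C f ->
    {uniform C, (fun (t : R) (x : 'rV[R]_n) =>
       (\int[Q t x]_(y in setT) f y - f x) / t) @ 0^'+ --> L f}.

Section Process.
Context {d : measure_display} {T : measurableType d}.
Implicit Types (P : probability T R) (X : R -> T -> 'rV[R]_n).

(* Sigma-algebra generated by X up to time s. *)
Definition history X (s : R) : set (set T) :=
  <<s [set G | exists u (A : set (borel_rV R n)),
                 [/\ 0 <= u <= s, measurable A & G = X u @^-1` A]] >>.

Definition markov_process P X C Q : Prop :=
  [/\ markov_semigroup C Q,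
      continuous_process X,
      forall (t : R) w, 0 <= t -> C (X t w) &
      forall (s t : R) (F : set T) (A : set (borel_rV R n)),
        0 <= s -> 0 < t -> history X s F -> measurable A ->
        P (F `&` X (s + t) @^-1` A) = (\int[P]_(w in F) Q t (X s w) A)%E].

Definition conditioned_brownian_motion P X C p (h : 'rV[R]_n -> R) : Prop :=
  exists2 Q, markov_process P X C Q &
             has_transition_density C Q (doob_transform h p).

Definition diffusion P X C mu : Prop :=
  exists2 Q, markov_process P X C Q & has_generator C Q (diffusion_op mu).

End Process.
End MarkovProcesses.

(* Main.v *)
(** Let h be the product of the positive roots. Its logarithmic gradient is the sum
    of alpha / (alpha, x), and h is harmonic because its Laplacian is an
    antisymmetric polynomial of smaller degree; hence (1/h) (Laplacian / 2) h is
    the generator Laplacian / 2 + mu . grad of the statement.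

    The law of the killed motion is computed by images: if u is antisymmetric under
    W, then E u(x + B_t) on the event of no exit equals the full expectation, so
    the killed semigroup K_t acts on C^2 functions compactly supported in C as the
    heat semigroup on their antisymmetrizations.

    Two comparison arguments, applied to convex truncations of caloric functions
    (so that everything has compact support in C), give K_t h = h: the bound from
    above compares images with h, the bound from below compares h with
    h (1 - (|x|^2 + (n + 2 N)(t - s)) / k). So the h-transform of K_t is a
    conservative Markov semigroup Q0.

    A Markov semigroup Q on C with the same generator dominates Q0 by a third
    comparison, of Q with K_t g / h; both have mass one, so Q = Q0. Conversely Q0
    has that generator uniformly on C: on a compact set h is bounded below, and
    away from the support of f the motion needs to cross two shells, which costs
    O(t^2) relative to h. *)

Require Import Defs.
From HB Require Import structures.
From mathcomp Require Import all_boot all_order all_algebra finmap.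
From mathcomp Require Import all_classical all_reals all_analysis.
From mathcomp Require Import measurable_realfun.
From mathcomp Require Import ring lra.

Set Implicit Arguments.
Unset Strict Implicit.
Unset Printing Implicit Defensive.

Import Order.TTheory GRing.Theory Num.Theory.
Import numFieldNormedType.Exports.

Local Open Scope classical_set_scope.
Local Open Scope ring_scope.

(** * Reflection groups and their chambers *)

(** The generator is prescribed only on test functions, so a comparison needs a truncated solution
    that is still a test function at every time. The antisymmetric caloric functions vanish on the
    walls and decay at infinity, both uniformly on bounded time intervals; hence they exceed a level
    e > 0 only inside one fixed compact subset of C. Truncating at e costs at most 2 e, which
    disappears at the end.

    Differentiation in time is replaced by one-sided difference estimates: a right continuous
    function whose backward increments satisfy F (s - r) - F s <= e r for small r, whatever e > 0,
    satisfies F 0 <= F t ([dini_le]). The errors must be uniform in space to pass through a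
    semigroup, whence the classes of functions with bounded, uniformly continuous derivatives.

    The formula of images is proved on a time grid. The walk is stopped when some root falls to a
    level e or below. Antisymmetry and a Lipschitz bound make the solution small near the wall,
    while fourth moments of the increments control the jumps that land far beyond it: N steps of
    length t / N contribute N times (t / N)^2. *)

Section Dot.
Context {R : realType} {n : nat}.
Implicit Types (a b x y z : 'rV[R]_n) (w : 'M[R]_n).

Lemma dotC x y : dot x y = dot y x.
Proof. by apply: eq_bigr => i _; rewrite mulrC. Qed.

Lemma dotDl x y z : dot (x + y) z = dot x z + dot y z.
Proof. by rewrite /dot -big_split; apply: eq_bigr => i _; rewrite mxE mulrDl. Qed.

Lemma dotDr x y z : dot x (y + z) = dot x y + dot x z.
Proof. by rewrite dotC dotDl !(dotC x). Qed.

Lemma dotZl (c : R) x y : dot (c *: x) y = c * dot x y.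
Proof. by rewrite /dot mulr_sumr; apply: eq_bigr => i _; rewrite mxE mulrA. Qed.

Lemma dotZr (c : R) x y : dot x (c *: y) = c * dot x y.
Proof. by rewrite dotC dotZl dotC. Qed.

Lemma dotNl x y : dot (- x) y = - dot x y.
Proof. by rewrite -scaleN1r dotZl mulN1r. Qed.

Lemma dotNr x y : dot x (- y) = - dot x y.
Proof. by rewrite dotC dotNl dotC. Qed.

Lemma dotBl x y z : dot (x - y) z = dot x z - dot y z.
Proof. by rewrite dotDl dotNl. Qed.

Lemma dotBr x y z : dot x (y - z) = dot x y - dot x z.
Proof. by rewrite dotDr dotNr. Qed.

Lemma dot0l y : dot 0 y = 0.
Proof. by rewrite -(scale0r 0) dotZl mul0r. Qed.

Lemma dot0r y : dot y 0 = 0.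
Proof. by rewrite dotC dot0l. Qed.

Lemma dot_suml (I : Type) (r : seq I) (P : pred I) (F : I -> 'rV[R]_n) y :
  dot (\sum_(i <- r | P i) F i) y = \sum_(i <- r | P i) dot (F i) y.
Proof. by apply: (big_morph (dot^~ y)) => [u v|]; rewrite ?dotDl ?dot0l. Qed.

Lemma dot_sumr (I : Type) (r : seq I) (P : pred I) (F : I -> 'rV[R]_n) y :
  dot y (\sum_(i <- r | P i) F i) = \sum_(i <- r | P i) dot y (F i).
Proof. by rewrite dotC dot_suml; apply: eq_bigr => i _; rewrite dotC. Qed.

Lemma dot_ge0 x : 0 <= dot x x.
Proof. by apply: sumr_ge0 => i _; rewrite -expr2 sqr_ge0. Qed.

Lemma dot_eq0 x : (dot x x == 0) = (x == 0).
Proof.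
apply/idP/idP => [|/eqP->]; last by rewrite dot0l.
rewrite psumr_eq0 => [/allP H|i _]; last by rewrite -expr2 sqr_ge0.
apply/eqP/rowP => i; rewrite mxE; apply/eqP.
by rewrite -sqrf_eq0 expr2; apply: H; rewrite mem_index_enum.
Qed.

Lemma dot_gt0 x : x != 0 -> 0 < dot x x.
Proof. by move=> x0; rewrite lt_neqAle dot_ge0 eq_sym dot_eq0 x0. Qed.

Lemma dot_delta i x : dot (delta_mx 0 i) x = x 0 i.
Proof.
rewrite /dot (bigD1 i) //= big1 ?addr0; first by rewrite mxE !eqxx mul1r.
by move=> j ji; rewrite mxE eqxx (negbTE ji) mul0r.
Qed.

Lemma dotE x y : dot x y = (x *m y^T) 0 0.
Proof. by rewrite !mxE; apply: eq_bigr => i _; rewrite mxE. Qed.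

Lemma dot_mulmxr x y w : dot x (y *m w) = dot (x *m w^T) y.
Proof. by rewrite !dotE trmx_mul mulmxA. Qed.

Lemma reflE a x : x *m refl a = x - (2 * dot a x / dot a a) *: a.
Proof.
rewrite /refl mulmxBr mulmx1 -scalemxAr mulmxA; congr (x - _).
rewrite [x *m a^T]mx11_scalar -dotE dotC mul_scalar_mx scalerA; congr (_ *: _).
by rewrite mulrAC.
Qed.

Lemma eq_mulrow (A B : 'M[R]_n) : (forall x : 'rV[R]_n, x *m A = x *m B) -> A = B.
Proof. by move=> H; apply/row_matrixP => i; rewrite !rowE H. Qed.

Lemma tr_refl a : (refl a)^T = refl a.
Proof. by rewrite /refl linearB linearZ /= trmx1 trmx_mul trmxK. Qed.

Lemma dot_refl a x y : dot x (y *m refl a) = dot (x *m refl a) y.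
Proof. by rewrite dot_mulmxr tr_refl. Qed.

Lemma refl_neg a : a != 0 -> a *m refl a = - a.
Proof.
move=> a0; rewrite reflE mulfK ?dot_eq0 // scaler_nat mulr2n opprD addrA.
by rewrite subrr add0r.
Qed.

Lemma refl_fix a x : dot a x = 0 -> x *m refl a = x.
Proof. by move=> ax; rewrite reflE ax mulr0 mul0r scale0r subr0. Qed.

Lemma reflK a : a != 0 -> refl a *m refl a = 1%:M.
Proof.
move=> a0; apply: eq_mulrow => x; rewrite mulmxA mulmx1 [x *m refl a]reflE.
rewrite mulmxBl -scalemxAl refl_neg // scalerN opprK reflE addrNK //.
Qed.

Lemma reflZ (c : R) a : c != 0 -> refl (c *: a) = refl a.
Proof.
move=> c0; apply: eq_mulrow => x; rewrite !reflE; congr (x - _).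
rewrite !dotZl dotZr scalerA; congr (_ *: _).
case: (eqVneq (dot a a) 0) => [->|a0]; first by rewrite !mulr0 invr0 !(mulr0, mul0r).
by field; rewrite a0 c0.
Qed.

Lemma refl_conj a w : w *m w^T = 1%:M -> refl (a *m w) = w^T *m refl a *m w.
Proof.
move=> ww; apply: eq_mulrow => x; rewrite !mulmxA !reflE mulmxBl -scalemxAl.
have wTw : w^T *m w = 1%:M by apply: mulmx1C.
rewrite -mulmxA wTw mulmx1; congr (x - _ *: _).
have -> : dot a (x *m w^T) = dot (a *m w) x by rewrite dot_mulmxr trmxK.
by rewrite dot_mulmxr -mulmxA ww mulmx1.
Qed.

(** The component y of b orthogonal to a lies in the hyperplane of a, hence in that of b, so (y, y)
    = (b, y) = 0. *)
Lemma hplane_sub a b : a != 0 -> hplane a `<=` hplane b ->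
  b = (dot a b / dot a a) *: a.
Proof.
move=> a0 ab; have aa0 : dot a a != 0 by rewrite dot_eq0.
apply/eqP; rewrite -subr_eq0 -dot_eq0; set y := b - _.
have ay : dot a y = 0 by rewrite dotBr dotZr divfK // subrr.
rewrite {1}/y dotBl dotZl ay mulr0 subr0; apply/eqP.
exact: (ab y).
Qed.

(** Finitely many strict inequalities survive a small step. This keeps points inside the chamber and
    generic vectors generic. *)
Lemma small_pert (I : eqType) (s : seq I) (f g : I -> R) :
  (forall i, i \in s -> 0 < f i) ->
  exists2 e, 0 < e & forall i, i \in s -> 0 < f i + e * g i.
Proof.
elim: s => [|i s IH] fs; first by exists 1.
have [|e e0 He] := IH; first by move=> j js; apply: fs; rewrite in_cons js orbT.
have fi : 0 < f i by apply: fs; rewrite mem_head.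
pose e' := Num.min e (f i / (2 * (`|g i| + 1))).
have e'0 : 0 < e'.
  by rewrite lt_min e0 /= divr_gt0 // mulr_gt0 // ltr_pwDr.
exists e' => // j; rewrite in_cons => /predU1P[->|js].
  have : e' * (2 * (`|g i| + 1)) <= f i.
    by rewrite -ler_pdivlMr ?mulr_gt0 ?ltr_pwDr // ge_min lexx orbT.
  have := ler_norm (- g i); rewrite normrN => h1 h2.
  have h3 : e' * (- g i) <= e' * `|g i| by rewrite ler_wpM2l // ltW.
  nra.
have := He j js; have fj : 0 < f j by apply: fs; rewrite in_cons js orbT.
have e'e : e' <= e by rewrite ge_min lexx.
have [gj|gj] := leP 0 (g j); first by move=> _; rewrite ltr_wpDr // mulr_ge0 // ltW.
by move=> h; apply: (lt_le_trans h); rewrite lerD2l ler_wnM2r // ltW.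
Qed.

(** Finitely many hyperplanes do not cover the space. If the vector found for s is orthogonal to the
    new a, a small step along a makes it generic for a as well. *)
Lemma generic_vector (s : seq 'rV[R]_n) : (forall a, a \in s -> a != 0) ->
  exists e, forall a, a \in s -> dot a e != 0.
Proof.
elim: s => [|a s IH] hs; first by exists 0.
have [|e he] := IH; first by move=> b bs; apply: hs; rewrite in_cons bs orbT.
have a0 : a != 0 by apply: hs; rewrite mem_head.
have [ae|ae] := eqVneq (dot a e) 0; last first.
  by exists e => b; rewrite in_cons => /predU1P[->|/he].
(* With these two functions, f + t g equals the sign of (b, e) times (b, e + t a), so its positivity
   excludes a zero. *)
have [|t t0 ht] := @small_pert _ s (fun b => `|dot b e|)
  (fun b => Num.sg (dot b e) * dot b a).
  by move=> b /he; rewrite normr_gt0.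
exists (e + t *: a) => b; rewrite dotDr dotZr in_cons => /predU1P[->|bs].
  by rewrite ae add0r mulf_neq0 ?gt_eqF // dot_gt0.
have := ht b bs; rewrite normrEsg mulrCA -mulrDr.
by apply: contraTneq => ->; rewrite mulr0 ltxx.
Qed.

End Dot.

(** * Simple roots, and the free action of W on chambers *)

Class reflection_chamber (R : realType) (n : nat) (W : set 'M[R]_n)
    (C : set 'rV[R]_n) (pos : {fset 'rV[R]_n}) : Prop := ReflectionChamber {
  chamber_group : finite_reflection_group W;
  chamber_open : open_chamber W C;
  chamber_roots : positive_roots W C pos }.

Definition is_root (R : realType) (n : nat) (W : set 'M[R]_n) (r : 'rV[R]_n) :=
  r != 0 /\ W (refl r).

Definition prod_refl (R : realType) (n : nat) (s : seq 'rV[R]_n) : 'M[R]_n :=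
  \big[mulmx/1%:M]_(a <- s) refl a.

Section ReflectionGroup.
Context {R : realType} {n : nat} {W : set 'M[R]_n} {C : set 'rV[R]_n}.
Context {pos : {fset 'rV[R]_n}} {hcox : reflection_chamber W C pos}.
Implicit Types (a b c r x y z : 'rV[R]_n) (u w : 'M[R]_n) (s : seq 'rV[R]_n).

Lemma prod_refl_cons a s : prod_refl (a :: s) = refl a *m prod_refl s.
Proof. by rewrite /prod_refl big_cons. Qed.

Lemma prod_refl_cat s1 s2 : prod_refl (s1 ++ s2) = prod_refl s1 *m prod_refl s2.
Proof.
elim: s1 => [|a s IH]; first by rewrite /prod_refl big_nil mul1mx.
by rewrite !prod_refl_cons IH mulmxA.
Qed.

Lemma prod_refl1 a : prod_refl [:: a] = refl a.
Proof. by rewrite prod_refl_cons /prod_refl big_nil mulmx1. Qed.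

Lemma tr_prod_refl s : (prod_refl s)^T = prod_refl (rev s).
Proof.
elim: s => [|a s IH]; first by rewrite /prod_refl !big_nil trmx1.
by rewrite prod_refl_cons trmx_mul IH tr_refl rev_cons -cats1 prod_refl_cat prod_refl1.
Qed.

Lemma prod_refl_orth s : (forall a, a \in s -> a != 0) ->
  prod_refl s *m (prod_refl s)^T = 1%:M.
Proof.
elim: s => [|a s IH] hs; first by rewrite /prod_refl !big_nil trmx1 mulmx1.
rewrite prod_refl_cons trmx_mul mulmxA -(mulmxA (refl a)) IH; last first.
  by move=> b bs; apply: hs; rewrite in_cons bs orbT.
by rewrite mulmx1 tr_refl reflK // hs // mem_head.
Qed.

Lemma group_gen w : W w -> exists2 s, w = prod_refl s & forall a, a \in s -> is_root W a.
Proof.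
case: chamber_group => _ [S S0 WE]; rewrite {1}WE => -[s /= hs <-]; exists s => // a /hs Sa.
split; first exact: S0.
by rewrite WE; exists [:: a]; [move=> b; rewrite inE => /eqP->|exact: prod_refl1].
Qed.

Lemma group1 : W 1%:M.
Proof. by case: chamber_group => _ [S S0 ->]; exists [::] => //; rewrite big_nil. Qed.

Lemma groupM u w : W u -> W w -> W (u *m w).
Proof.
case: chamber_group => _ [S S0 ->] [s hs <-] [s' hs' <-].
exists (s ++ s'); last exact: prod_refl_cat.
by move=> a; rewrite mem_cat => /orP[/hs|/hs'].
Qed.

Lemma group_orth w : W w -> w *m w^T = 1%:M.
Proof.
by move=> /group_gen[s -> hs]; apply: prod_refl_orth => a /hs[].
Qed.

Lemma group_orthT w : W w -> w^T *m w = 1%:M.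
Proof. by move=> /group_orth h; apply: mulmx1C. Qed.

Lemma groupT w : W w -> W w^T.
Proof.
case: chamber_group => _ [S S0 ->] [s hs <-].
exists (rev s); first by move=> a; rewrite mem_rev => /hs.
by rewrite -[RHS]/((prod_refl s)^T) tr_prod_refl.
Qed.

Lemma dot_group w x y : W w -> dot (x *m w) (y *m w) = dot x y.
Proof. by move=> /group_orth h; rewrite dot_mulmxr -mulmxA h mulmx1. Qed.

Lemma mulmx_group_eq0 w x : W w -> (x *m w == 0) = (x == 0).
Proof. by move=> Ww; rewrite -!dot_eq0 dot_group. Qed.

Lemma root_group r w : is_root W r -> W w -> is_root W (r *m w).
Proof.
move=> [r0 Wr] Ww; split; first by rewrite mulmx_group_eq0.
rewrite refl_conj ?group_orth //; apply: groupM => //; apply: groupM => //.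
exact: groupT.
Qed.

Lemma chamberE : C = [set x | forall a, a \in pos -> 0 < dot a x].
Proof. by case: chamber_roots. Qed.

Lemma chamber_nonempty : exists x, C x.
Proof. have [x xH ->] := chamber_open; exists x; exact: connected_component_refl. Qed.

Lemma chamber_dot a x : a \in pos -> C x -> 0 < dot a x.
Proof. by move=> ap; rewrite chamberE => /(_ a ap). Qed.

Lemma pos_neq0 a : a \in pos -> a != 0.
Proof.
move=> ap; have [x Cx] := chamber_nonempty.
by apply: contraTneq (chamber_dot ap Cx) => ->; rewrite dot0l ltxx.
Qed.

Lemma pos_root a : a \in pos -> is_root W a.
Proof.
move=> ap; have a0 := pos_neq0 ap; split => //.
case: chamber_roots => -[/(_ a) h _ _] _; have [b [b0 Wb E]] := h ap.
have bE : a = (dot b a / dot b b) *: b by apply: hplane_sub => //; rewrite E.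
by rewrite bE reflZ //; apply: contraNneq a0 => k0; rewrite bE k0 scale0r.
Qed.

Lemma root_pos r : is_root W r -> exists2 a, a \in pos & exists2 k, k != 0 & r = k *: a.
Proof.
move=> [r0 Wr]; case: chamber_roots => -[_ _ sur] _.
have [|a /= ap E] := sur (hplane r); first by exists r.
have rE : r = (dot a r / dot a a) *: a.
  by apply: hplane_sub; [exact: pos_neq0|rewrite E].
exists a => //; exists (dot a r / dot a a) => //.
by apply: contraNneq r0 => k0; rewrite rE k0 scale0r.
Qed.

Lemma pos_inj a b k : a \in pos -> b \in pos -> b = k *: a -> a = b.
Proof.
move=> ap bp E; case: chamber_roots => -[_ inj _] _; apply: inj; rewrite ?inE //=.
have k0 : k != 0 by apply: contraNneq (pos_neq0 bp) => k0; rewrite E k0 scale0r.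
apply/seteqP; split => x; rewrite /hplane /= E dotZl; first by move=> ->; rewrite mulr0.
by move=> /eqP; rewrite mulf_eq0 (negbTE k0) => /eqP.
Qed.

(** Simple roots are introduced as an irredundant system of inequalities for C chosen among the
    positive roots: a set with this property from which no element can be removed. *)
Definition cuts (D : {fset 'rV[R]_n}) : Prop :=
  (D `<=` pos)%fset /\ forall x, (forall a, a \in D -> 0 < dot a x) -> C x.

Lemma exists_simple : exists D, cuts D /\ forall a, a \in D -> ~ cuts (D `\ a)%fset.
Proof.
have [] := @ex_minnP (fun k => `[< exists D, cuts D /\ #|` D|%fset = k >]).
  exists #|` pos|%fset; apply/asboolP; exists pos; split => //; split.
    exact: fsubset_refl.
  by rewrite chamberE.
move=> m /asboolP[D [cD cm]] hm; exists D; split => // a aD cDa.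
have := hm #|` (D `\ a)%fset|%fset; rewrite -cm (cardfsD1 a D) aD add1n ltnn => /(_ _)/negP; apply => //.
by apply/asboolP; exists (D `\ a)%fset.
Qed.

Definition simple : {fset 'rV[R]_n} := projT1 (cid exists_simple).

Lemma simple_cuts : cuts simple.
Proof. by rewrite /simple; case: cid => D []. Qed.

Lemma simple_min a : a \in simple -> ~ cuts (simple `\ a)%fset.
Proof. by rewrite /simple; case: cid => D [_ h] /=; exact: h. Qed.

Lemma simple_pos a : a \in simple -> a \in pos.
Proof. by have [/fsubsetP h _] := simple_cuts; exact: h. Qed.

Lemma simple_root a : a \in simple -> is_root W a.
Proof. by move=> /simple_pos/pos_root. Qed.

(** Irredundancy gives a point q outside C that violates only the inequality of a; p is where the
    segment from a point of C to q meets the hyperplane of a. If another positive root b were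
    nonpositive at p, a small step from p that increases a and does not increase b would enter C,
    where b is positive. *)
Lemma wall_point a : a \in simple ->
  exists2 p, dot a p = 0 & forall b, b \in pos -> b != a -> 0 < dot b p.
Proof.
move=> aD; have [sub cutD] := simple_cuts; have ap := simple_pos aD.
have [x0 Cx0] := chamber_nonempty.
have [q hq nCq] : exists2 q, (forall b, b \in simple -> b != a -> 0 < dot b q) & ~ C q.
  apply: contrapT => H; apply: (simple_min aD); split.
    exact: fsubset_trans (fsubD1set _ _) sub.
  move=> x hx; apply: contrapT => nCx; apply: H; exists x => // b bD ba.
  by apply: hx; rewrite !inE ba bD.
have aq : dot a q <= 0.
  rewrite leNgt; apply/negP => aq; apply: nCq; apply: cutD => b bD.
  by have [->//|ba] := eqVneq b a; exact: hq.
have ax0 := chamber_dot ap Cx0.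
pose t := dot a x0 / (dot a x0 - dot a q).
have den : 0 < dot a x0 - dot a q by rewrite subr_gt0 (le_lt_trans aq).
have t0 : 0 < t by rewrite divr_gt0.
have t1 : t <= 1 by rewrite ler_pdivrMr // mul1r lerBrDr gerDl.
pose p := x0 + t *: (q - x0).
have dp b : dot b p = (1 - t) * dot b x0 + t * dot b q.
  by rewrite dotDr dotZr dotBr; ring.
have ap0 : dot a p = 0 by rewrite dp /t; field; rewrite gt_eqF.
have Dp b : b \in simple -> b != a -> 0 < dot b p.
  move=> bD ba; have hb := hq b bD ba; rewrite dp ltr_wpDl ?(mulr_gt0 t0 hb) //.
  by rewrite mulr_ge0 ?subr_ge0 // ltW // (chamber_dot (simple_pos bD)).
exists p => // b bp ba; rewrite ltNge; apply/negP => bp0.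
pose y := b - (dot a b / dot a a) *: a.
have aa : 0 < dot a a by rewrite dot_gt0 // pos_neq0.
have ay : dot a y = 0 by rewrite dotBr dotZr divfK ?subrr // gt_eqF.
have y0 : y != 0.
  apply: contra_neq ba => /eqP; rewrite subr_eq0 => /eqP E.
  by rewrite (pos_inj ap bp E).
have yy : 0 < dot y y by exact: dot_gt0.
have by_ : dot b y = dot y y.
  by rewrite [in RHS]/y dotBl dotZl ay mulr0 subr0.
pose k := dot y y / (`|dot a b| + 1).
have nb : 0 < `|dot a b| + 1 by rewrite ltr_wpDl.
have k0 : 0 < k by rewrite divr_gt0.
pose v := k *: a - y.
have [e e0 he] := @small_pert _ _ (enum_fset (simple `\ a)%fset)
  (fun c => dot c p) (fun c => dot c v) (fun c h => ltac:(
    move: h; rewrite !inE => /andP[h1 h2]; exact: Dp)).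
have : C (p + e *: v).
  apply: cutD => c cD; rewrite dotDr dotZr.
  have [->|ca] := eqVneq c a.
    by rewrite ap0 add0r dotBr ay subr0 dotZr !mulr_gt0.
  by apply: he; rewrite !inE ca cD.
move=> /(chamber_dot bp); rewrite dotDr dotZr dotBr dotZr by_ (dotC b a).
apply/negP; rewrite -leNgt.
have : k * dot a b <= dot y y.
  have : k * (`|dot a b| + 1) = dot y y by rewrite divfK // gt_eqF.
  by have := ler_norm (dot a b); nra.
by nra.
Qed.

(** The image of b is a multiple of a positive root, so its sign on C can be read at the wall point
    p. Since p is fixed by the reflection, the value there is (b, p) > 0, which also rules out a
    multiple of a. *)
Lemma simple_refl_pos a b x : a \in simple -> b \in pos -> b != a -> C x ->
  0 < dot (b *m refl a) x.
Proof.
move=> aD bp ba Cx; have [p ap hp] := wall_point aD.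
have [_ Wa] := simple_root aD.
have [b' b'p [k k0 E]] := root_pos (root_group (pos_root bp) Wa).
have : 0 < dot (b *m refl a) p by rewrite -dot_refl refl_fix // hp.
rewrite E !dotZl; have [->|b'a] := eqVneq b' a; first by rewrite ap mulr0 ltxx.
by rewrite pmulr_lgt0 ?hp // => kp; rewrite mulr_gt0 // chamber_dot.
Qed.

Definition simple_word s : Prop := forall a, a \in s -> a \in simple.

Lemma prod_simple s : simple_word s -> W (prod_refl s).
Proof.
elim: s => [|a s IH] hs; first by rewrite /prod_refl big_nil; exact: group1.
rewrite prod_refl_cons; apply: groupM.
  by have [] := simple_root (hs a (mem_head _ _)).
by apply: IH => b bs; apply: hs; rewrite in_cons bs orbT.
Qed.

Lemma seq_max (I : eqType) (s : seq I) (f : I -> R) i0 : i0 \in s ->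
  exists2 i, i \in s & forall j, j \in s -> f j <= f i.
Proof.
elim: s i0 => // i s IH _ _; case: s IH => [_|k s /(_ k (mem_head _ _))[v vs hv]].
  by exists i; rewrite ?mem_head // => u; rewrite inE => /eqP->.
have [iv|vi] := leP (f i) (f v).
  by exists v => [|u]; rewrite in_cons ?vs ?orbT // => /predU1P[->|/hv].
exists i => [|u]; rewrite ?mem_head // in_cons => /predU1P[->//|/hv h].
exact: le_trans h (ltW vi).
Qed.

Lemma finite_max (A : set 'M[R]_n) (f : 'M[R]_n -> R) : finite_set A -> A !=set0 ->
  exists2 w, A w & forall u, A u -> f u <= f w.
Proof.
move=> /finite_seqP[s ->] [w0 /= w0s].
by have [w ws hw] := seq_max f w0s; exists w.
Qed.

Definition simple_group : set 'M[R]_n := [set prod_refl s | s in simple_word].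

Lemma simple_group_sub : simple_group `<=` W.
Proof. by move=> _ [s hs <-]; exact: prod_simple. Qed.

Lemma simple_groupM u w : simple_group u -> simple_group w -> simple_group (u *m w).
Proof.
move=> [s hs <-] [s' hs' <-]; exists (s ++ s'); last exact: prod_refl_cat.
by move=> a; rewrite mem_cat => /orP[/hs|/hs'].
Qed.

Lemma simple_groupT w : simple_group w -> simple_group w^T.
Proof.
move=> [s hs <-]; exists (rev s); last by rewrite tr_prod_refl.
by move=> a; rewrite mem_rev => /hs.
Qed.

Lemma simple_group_refl a : a \in simple -> simple_group (refl a).
Proof. by move=> aD; exists [:: a]; rewrite ?prod_refl1 // => b; rewrite inE => /eqP->. Qed.

Lemma simple_group1 : simple_group 1%:M.
Proof. by exists [::]; rewrite /prod_refl ?big_nil. Qed.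

Lemma group_finite : finite_set W.
Proof. by case: chamber_group. Qed.

(** Take w maximizing (x0, z w) for some x0 in C. A simple root negative at z w would give, by its
    reflection, a strictly larger value. *)
Lemma to_closed_chamber z :
  exists2 w, simple_group w & forall a, a \in simple -> 0 <= dot a (z *m w).
Proof.
have [x0 Cx0] := chamber_nonempty.
have [||w Sw hw] := @finite_max simple_group (fun w => dot x0 (z *m w)).
- exact: sub_finite_set simple_group_sub group_finite.
- by exists 1%:M; exact: simple_group1.
exists w => // a aD; rewrite leNgt; apply/negP => az.
have := hw _ (simple_groupM Sw (simple_group_refl aD)).
rewrite mulmxA reflE dotBr dotZr gerDl oppr_le0 leNgt => /negP; apply.
have aa : 0 < dot a a by rewrite dot_gt0 // pos_neq0 // simple_pos.
have ax0 := chamber_dot (simple_pos aD) Cx0.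
by rewrite (dotC x0) pmulr_llt0 // pmulr_llt0 ?invr_gt0 // pmulr_rlt0.
Qed.

(** Choose q on the hyperplane of r and on no other one, and move it to the closed chamber by w.
    There it lies on the wall of some simple a, since C meets no hyperplane; pulled back by w, this
    wall contains q and must be the hyperplane of r. *)
Lemma refl_simple r : is_root W r -> exists w a,
  [/\ simple_group w, a \in simple & refl r = w *m refl a *m w^T].
Proof.
move=> rr; have [b bp [k k0 rE]] := root_pos rr.
have b0 := pos_neq0 bp; have bb : dot b b != 0 by rewrite dot_eq0.
pose pr c := c - (dot c b / dot b b) *: b.
have [|e he] := @generic_vector _ _ [seq pr c | c <- enum_fset pos & c != b].
  move=> _ /mapP[c + ->]; rewrite mem_filter => /andP[cb cp].
  apply: contra_neq cb => /eqP; rewrite subr_eq0 => /eqP E.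
  by rewrite (pos_inj bp cp E).
pose q := pr e.
have bq : dot b q = 0 by rewrite dotBr dotZr (dotC e) divfK ?subrr.
have hq c : c \in pos -> c != b -> dot c q != 0.
  move=> cp cb; have -> : dot c q = dot (pr c) e.
    by rewrite dotBr dotBl dotZr dotZl (dotC e); ring.
  by apply: he; apply: map_f; rewrite mem_filter cb.
have [w Sw hw] := to_closed_chamber q.
have Ww := simple_group_sub Sw.
have [a aD aq] : exists2 a, a \in simple & dot a (q *m w) = 0.
  apply: contrapT => H; have : C (q *m w).
    have [_] := simple_cuts; apply => a aD; rewrite lt_neqAle hw // andbT eq_sym.
    by apply/eqP => h; apply: H; exists a.
  have [b' b'p [k' k'0 E]] := root_pos (root_group (pos_root bp) Ww).
  move=> /(chamber_dot b'p); have : dot (b *m w) (q *m w) = 0 by rewrite dot_group.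
  by rewrite E dotZl => /eqP; rewrite mulf_eq0 (negbTE k'0) => /eqP ->; rewrite ltxx.
exists w, a; split => //.
have WwT := groupT Ww.
have [b' b'p [k' k'0 E]] := root_pos (root_group (simple_root aD) WwT).
have : dot b' q = 0.
  move: aq; rewrite dot_mulmxr E dotZl => /eqP; rewrite mulf_eq0 (negbTE k'0).
  by move/eqP.
have [b'b _|b'b /eqP] := eqVneq b' b; last by rewrite (negbTE (hq _ b'p b'b)).
have := refl_conj a (group_orth WwT); rewrite trmxK => <-.
by rewrite E b'b reflZ // rE reflZ.
Qed.

Lemma group_simple : W `<=` simple_group.
Proof.
move=> _ /group_gen[s -> hs]; elim: s hs => [|a s IH] hs.
  by rewrite /prod_refl big_nil; exact: simple_group1.
rewrite prod_refl_cons; apply: simple_groupM; last first.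
  by apply: IH => b bs; apply: hs; rewrite in_cons bs orbT.
have [w [b [Sw bD ->]]] := refl_simple (hs a (mem_head _ _)).
apply: simple_groupM; last exact: simple_groupT.
by apply: simple_groupM => //; exact: simple_group_refl.
Qed.

(* s1 is the longest prefix of s before the image of r turns negative. *)
Lemma exchange s r x : simple_word s -> is_root W r -> C x -> 0 < dot r x ->
  dot (r *m prod_refl s) x < 0 ->
  exists s1 a s2, s = s1 ++ a :: s2 /\ refl (r *m prod_refl s1) = refl a.
Proof.
move=> + + Cx; elim: s r => [|a s IH] r hs rr rx.
  by rewrite /prod_refl big_nil mulmx1 ltNge (ltW rx).
have aD := hs a (mem_head _ _); have [a0 Wa] := simple_root aD.
rewrite prod_refl_cons mulmxA => rsx.
have [b bp [k k0 rE]] := root_pos rr.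
have kp : 0 < k by move: rx; rewrite rE dotZl pmulr_lgt0 // chamber_dot.
have [ba|ba] := eqVneq b a.
  exists [::], a, s; split => //.
  by rewrite /prod_refl big_nil mulmx1 rE ba reflZ.
have [||||s1 [c [s2 [-> E]]]] := IH (r *m refl a).
- by move=> c cs; apply: hs; rewrite in_cons cs orbT.
- exact: root_group.
- by rewrite rE -scalemxAl dotZl mulr_gt0 // simple_refl_pos.
- exact: rsx.
by exists (a :: s1), c, s2; split; rewrite // prod_refl_cons mulmxA.
Qed.

(** Deletion argument. If z and its image both lie in C, the first letter a of the word becomes
    negative along the rest of it; [exchange] finds the letter b where this happens, and the word
    with a and b deleted has the same product. The induction is on a bound m because the length
    drops by two. *)
Lemma chamber_free_word m s z : (size s <= m)%N -> simple_word s ->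
  C z -> C (z *m prod_refl s) -> prod_refl s = 1%:M.
Proof.
elim: m s => [|m IH] [|a s] //=; try by rewrite /prod_refl big_nil.
rewrite ltnS => sm hs Cz; rewrite prod_refl_cons mulmxA => Czs.
have aD := hs a (mem_head _ _); have ra := simple_root aD; have [a0 Wa] := ra.
have hs' : simple_word s by move=> b bs; apply: hs; rewrite in_cons bs orbT.
have [|s1 [b [s2 [sE E]]]] := @exchange s a _ hs' ra Czs (chamber_dot (simple_pos aD) Czs).
  rewrite dot_group; last exact: prod_simple.
  by rewrite dot_refl refl_neg // dotNl oppr_lt0 chamber_dot // simple_pos.
have hs1 : simple_word s1 by move=> c cs; apply: hs'; rewrite sE mem_cat cs.
have hs2 : simple_word s2.
  by move=> c cs; apply: hs'; rewrite sE mem_cat in_cons cs !orbT.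
have b0 : b != 0 by have [] := simple_root (hs' b ltac:(by rewrite sE mem_cat mem_head orbT)).
have W1 := prod_simple hs1.
have EE : refl a *m prod_refl s = prod_refl (s1 ++ s2).
  move: E; rewrite refl_conj ?group_orth // sE !prod_refl_cat prod_refl_cons => E.
  have -> : prod_refl s1 *m (refl b *m prod_refl s2) =
            refl a *m prod_refl s1 *m prod_refl s2.
    rewrite -E !mulmxA (group_orth W1) mul1mx //.
  by rewrite !mulmxA reflK // mul1mx.
rewrite EE; apply: (IH _ _ _ Cz).
- by apply: leq_trans sm; rewrite sE !size_cat /= addnS.
- by move=> c; rewrite mem_cat => /orP[/hs1|/hs2].
- by rewrite -EE mulmxA.
Qed.

Lemma chamber_free w z : W w -> C z -> C (z *m w) -> w = 1%:M.
Proof. by move=> /group_simple[s hs <-]; exact: chamber_free_word (leqnn _) hs. Qed.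

Lemma chamber_unique u w z : W u -> W w -> C (z *m u) -> C (z *m w) -> u = w.
Proof.
move=> Wu Ww Cu Cw; have : u^T *m w = 1%:M.
  apply: (@chamber_free _ (z *m u)) => //; first by apply: groupM => //; exact: groupT.
  by rewrite mulmxA -(mulmxA z) group_orth // mulmx1.
by move=> h; rewrite -[w]mul1mx -(group_orth Wu) -mulmxA h mulmx1.
Qed.

End ReflectionGroup.

(** * The product of the positive roots is antisymmetric and harmonic *)

Section LinearProducts.
Context {R : realType} {n : nat}.
Implicit Types (a b x y : 'rV[R]_n) (s : seq 'rV[R]_n).

Definition lprod s x : R := \prod_(a <- s) dot a x.

(** With [rest], the gradient and the Laplacian of a product of distinct linear forms become
    explicit sums ([lgrad], [llap]). The algebra is done on them, and [d1_lprod] and [trace_lprod]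
    identify them with derivatives later. *)
Definition rest s a : seq 'rV[R]_n := [seq b <- s | b != a].

Definition lgrad s x : 'rV[R]_n := \sum_(a <- s) lprod (rest s a) x *: a.

Definition llap s x : R := \sum_(a <- s) dot a (lgrad (rest s a) x).

Lemma lprod_cons a s x : lprod (a :: s) x = dot a x * lprod s x.
Proof. by rewrite /lprod big_cons. Qed.

Lemma rest_notin s a : a \notin s -> rest s a = s.
Proof.
move=> ans; apply/all_filterP/allP => b bs; by apply: contraNneq ans => <-.
Qed.

Lemma uniq_rest s a : uniq s -> uniq (rest s a).
Proof. exact: filter_uniq. Qed.

Lemma mem_rest s a b : (b \in rest s a) = (b != a) && (b \in s).
Proof. exact: mem_filter. Qed.

Lemma restC s a b : rest (rest s a) b = rest (rest s b) a.
Proof. by rewrite /rest -!filter_predI; apply: eq_filter => c /=; rewrite andbC. Qed.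

Lemma size_rest s a : uniq s -> a \in s -> (size (rest s a)).+1 = size s.
Proof.
move=> us as_; rewrite size_filter -(count_predC (pred1 a) s) addnC.
rewrite (count_uniq_mem a us) as_ addn1; congr _.+1; exact: eq_count.
Qed.

Lemma lprodD1 s a x : uniq s -> a \in s -> lprod s x = dot a x * lprod (rest s a) x.
Proof. by move=> us as_; rewrite /lprod (bigD1_seq a) //= big_filter. Qed.

Lemma lprod0 s a x : a \in s -> dot a x = 0 -> lprod s x = 0.
Proof. by move=> as_ ax; rewrite /lprod (big_rem a) //= ax mul0r. Qed.

Lemma lgrad_euler s x : uniq s -> dot x (lgrad s x) = (size s)%:R * lprod s x.
Proof.
move=> us; rewrite /lgrad dot_sumr big_seq_cond.
rewrite (eq_bigr (fun=> lprod s x)); last first.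
  by move=> a /andP[as_ _]; rewrite dotZr dotC mulrC -lprodD1.
by rewrite -big_seq_cond big_const_seq count_predT iter_addr_0 mulr_natl.
Qed.

Lemma lprod_neq0 s x : (forall a, a \in s -> dot a x != 0) -> lprod s x != 0.
Proof.
by move=> h; rewrite /lprod prodf_seq_neq0; apply/allP => a /h.
Qed.

Lemma lgrad_div s x : uniq s -> (forall a, a \in s -> dot a x != 0) ->
  (lprod s x)^-1 *: lgrad s x = \sum_(a <- s) (dot a x)^-1 *: a.
Proof.
move=> us h; rewrite scaler_sumr; apply: eq_big_seq => a as_.
rewrite scalerA (lprodD1 x us as_) invfM mulrAC mulrC mulrCA; congr (_ *: _).
by rewrite mulVf ?mulr1 // lprod_neq0 // => b; rewrite mem_rest => /andP[_ /h].
Qed.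

(** The restriction of [lprod s] to the line through x in the direction y, as a polynomial in one
    variable, so that degrees and roots can be counted. *)
Definition lpoly s x y : {poly R} :=
  \prod_(a <- s) ((dot a x)%:P + (dot a y) *: 'X).

Lemma lpolyE s x y (t : R) : (lpoly s x y).[t] = lprod s (x + t *: y).
Proof.
rewrite horner_prod; apply: eq_bigr => a _.
by rewrite hornerD hornerC hornerZ hornerX dotDr dotZr mulrC.
Qed.

Lemma size_lpoly s x y : (size (lpoly s x y) <= (size s).+1)%N.
Proof.
elim: s => [|a s IH]; first by rewrite /lpoly big_nil size_poly1.
rewrite /lpoly big_cons (leq_trans (size_polyMleq _ _)) //.
have h : (size ((dot a x)%:P + dot a y *: 'X)%R <= 2)%N.
  rewrite (leq_trans (size_polyD _ _)) // geq_max.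
  rewrite (leq_trans (size_polyC_leq1 _)) //=.
  by rewrite (leq_trans (size_scale_leq _ _)) // size_polyX.
have := leq_add h IH; rewrite -/(lpoly s x y) add2n.
by case: (size _ + size _)%N.
Qed.

Lemma deriv_lpoly0 s x y : uniq s -> ((lpoly s x y)^`()).[0] = dot y (lgrad s x).
Proof.
elim: s => [|a s IH] /=.
  by rewrite /lpoly /lgrad !big_nil -polyC1 derivC hornerC dot0r.
move=> /andP[ans us].
rewrite /lpoly big_cons -/(lpoly s x y) derivM hornerD !hornerM IH // derivD derivC add0r.
rewrite derivZ derivX lpolyE scale0r addr0 hornerD !hornerZ hornerC hornerX mulr0 addr0.
rewrite /lgrad big_cons dotDr dotZr {1}/rest /= eqxx /= -/(rest s a) rest_notin //.
rewrite -[in RHS](dotC a) hornerC mulr1 mulrC; congr (_ + _).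
rewrite !dot_sumr mulr_sumr; apply: eq_big_seq => b bs.
rewrite !dotZr /rest /= ifT ?lprod_cons ?mulrA //.
by apply: contraNneq ans => ->.
Qed.

Lemma poly_eq0 (p : {poly R}) : (forall t, p.[t] = 0) -> p = 0.
Proof.
move=> h; apply/eqP; apply: contraT => p0.
have := @max_poly_roots _ p [seq i%:R | i <- iota 0 (size p)] p0.
rewrite size_map size_iota ltnn => -> //.
  by apply/allP => t _; rewrite rootE h.
by rewrite map_inj_uniq ?iota_uniq // => i j /eqP; rewrite eqr_nat => /eqP.
Qed.

End LinearProducts.

(** * The sign character of W and antisymmetrization *)

Section Signs.
Context {R : realType} {n : nat} {W : set 'M[R]_n} {C : set 'rV[R]_n}.
Context {pos : {fset 'rV[R]_n}} {hcox : reflection_chamber W C pos}.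
Implicit Types (a b c r x y z : 'rV[R]_n) (u w : 'M[R]_n).
Local Notation h := (root_prod pos).

Lemma root_prod_gt0 x : C x -> 0 < h x.
Proof.
by move=> Cx; rewrite /root_prod big_seq_cond prodr_gt0 // => a /andP[ap _]; exact: chamber_dot.
Qed.

Definition chamber_base : 'rV[R]_n := projT1 (cid (chamber_nonempty (hcox := hcox))).

Lemma chamber_baseP : C chamber_base.
Proof. by rewrite /chamber_base; case: cid. Qed.

Lemma base_gt0 : 0 < h chamber_base.
Proof. exact/root_prod_gt0/chamber_baseP. Qed.

Lemma base_neq0 : h chamber_base != 0.
Proof. by rewrite gt_eqF // base_gt0. Qed.

(** The reflection permutes the positive roots up to scalars, which appear because roots have
    arbitrary length; hence h is multiplied by the product k of these scalars. Being an involution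
    it has k^2 = 1, and k < 0 because only the scalar of a itself is negative
    ([simple_refl_pos]). *)
Lemma root_prod_simple a x : a \in simple -> h (x *m refl a) = - h x.
Proof.
move=> aD; have ra := simple_root aD; have [a0 Wa] := ra.
have [f hf] : exists f : 'rV[R]_n -> 'rV[R]_n * R, forall b, b \in pos ->
    (f b).1 \in pos /\ b *m refl a = (f b).2 *: (f b).1.
  suff /choice[f hf] : forall b, exists q : 'rV[R]_n * R,
      b \in pos -> q.1 \in pos /\ b *m refl a = q.2 *: q.1 by exists f.
  move=> b; have [bp|_] := boolP (b \in pos); last by exists (0, 0).
  have [b' b'p [k _ E]] := root_pos (root_group (pos_root bp) Wa).
  by exists (b', k).
have perm : perm_eq [seq (f b).1 | b <- enum_fset pos] (enum_fset pos).
  have um : uniq [seq (f b).1 | b <- enum_fset pos].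
    rewrite map_inj_in_uniq ?fset_uniq // => b c bp cp E.
    have [_ Eb] := hf b bp; have [_ Ec] := hf c cp.
    have kc : (f c).2 != 0.
      apply: contraNneq (pos_neq0 cp) => k0.
      by rewrite -(mulmx_group_eq0 _ Wa) Ec k0 scale0r.
    apply/esym; apply: (pos_inj (k := (f b).2 / (f c).2) cp bp).
    rewrite -[LHS]mulmx1 -(reflK a0) mulmxA Eb -scalemxAl E -scalerA; congr (_ *: _).
    apply: (scalerI kc); rewrite scalerA divff // scale1r scalemxAl -Ec -mulmxA reflK //.
    exact: mulmx1.
  apply: uniq_perm => //; first exact: fset_uniq.
  have [||//] := uniq_min_size um (_ : {subset _ <= enum_fset pos}).
    by move=> c /mapP[b bp ->]; have [] := hf b bp.
  by rewrite size_map.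
have key y : h (y *m refl a) = (\prod_(b <- pos) (f b).2) * h y.
  rewrite {1}/root_prod.
  have -> : \prod_(b <- pos) dot b (y *m refl a) =
            \prod_(b <- pos) ((f b).2 * dot (f b).1 y).
    by apply: eq_big_seq => b bp; rewrite dot_refl (hf b bp).2 dotZl.
  rewrite big_split /=; congr (_ * _).
  by rewrite -(big_map (fun b => (f b).1) xpredT (fun b => dot b y)) (perm_big _ perm).
set k := (\prod_(b <- pos) (f b).2) in key.
have h0 := root_prod_gt0 chamber_baseP.
have k2 : k ^+ 2 = 1.
  have : h (chamber_base *m refl a *m refl a) = h chamber_base.
    by rewrite -mulmxA reflK // mulmx1.
  rewrite !key mulrA => E.
  by apply: (@mulIf _ (h chamber_base)); rewrite ?gt_eqF // expr2 E mul1r.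
have fa : (f a).2 < 0.
  have ap := simple_pos aD; have [fp E] := hf a ap.
  have h1 : 0 < dot a chamber_base by apply: chamber_dot => //; exact: chamber_baseP.
  have h2 : 0 < dot (f a).1 chamber_base.
    by apply: chamber_dot => //; exact: chamber_baseP.
  rewrite -(pmulr_llt0 _ h2) -dotZl -E refl_neg //.
  by rewrite dotNl oppr_lt0.
have kn : k < 0.
  rewrite /k (bigD1_seq a) ?fset_uniq ?simple_pos //= nmulr_rlt0 //.
  rewrite big_seq_cond prodr_gt0 // => b /andP[bp ba].
  have [fp E] := hf b bp; have := simple_refl_pos aD bp ba chamber_baseP.
  have h2 : 0 < dot (f b).1 chamber_base.
    by apply: chamber_dot => //; exact: chamber_baseP.
  by rewrite E dotZl pmulr_lgt0.
move/eqP: k2; rewrite sqrf_eq1 => /orP[/eqP k1|/eqP k1].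
  by move: kn; rewrite k1 ltr10.
by rewrite key k1 mulN1r.
Qed.

(** The sign character of W, with value -1 on reflections, read off from h at one point of C. *)
Definition sgnW w : R := h (chamber_base *m w) / h chamber_base.

Lemma root_prod_sgn w : W w -> exists2 e : R, e ^+ 2 = 1 & forall x, h (x *m w) = e * h x.
Proof.
move=> /group_simple[s hs <-]; elim: s hs => [|a s IH] hs.
  exists 1; rewrite ?expr1n // => x.
  by rewrite /prod_refl big_nil mulmx1 mul1r.
have [|e e2 he] := IH; first by move=> b bs; apply: hs; rewrite in_cons bs orbT.
exists (- e); first by rewrite sqrrN.
move=> x; rewrite prod_refl_cons mulmxA he root_prod_simple ?mulrN ?mulNr //.
exact/hs/mem_head.
Qed.

Lemma root_prod_group w x : W w -> h (x *m w) = sgnW w * h x.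
Proof.
move=> /root_prod_sgn[e _ he]; rewrite /sgnW !he mulfK //.
exact: base_neq0.
Qed.

Lemma sgnW_sqr w : W w -> sgnW w * sgnW w = 1.
Proof.
move=> /root_prod_sgn[e e2 he]; rewrite /sgnW !he mulfK -?expr2 //.
exact: base_neq0.
Qed.

Lemma sgnW1 : sgnW 1%:M = 1.
Proof.
by rewrite /sgnW mulmx1 divff // base_neq0.
Qed.

Lemma sgnWM u w : W u -> W w -> sgnW (u *m w) = sgnW u * sgnW w.
Proof.
move=> Wu Ww; have h0 := root_prod_gt0 chamber_baseP.
rewrite {1}/sgnW mulmxA root_prod_group // root_prod_group // mulrA mulfK ?gt_eqF //.
exact: mulrC.
Qed.

Lemma sgnWT w : W w -> sgnW w^T = sgnW w.
Proof.
move=> Ww; have := sgnWM Ww (groupT Ww); rewrite group_orth // sgnW1 => E.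
by rewrite -[LHS]mul1r -(sgnW_sqr Ww) -mulrA -E mulr1.
Qed.

Lemma sgnW_refl r : is_root W r -> sgnW (refl r) = -1.
Proof.
move=> /refl_simple[w [a [Sw aD ->]]].
have Ww := simple_group_sub Sw; have [a0 Wa] := simple_root aD.
have WwT : W w^T by exact: groupT.
have WwA : W (w *m refl a) by exact: groupM.
rewrite sgnWM // sgnWM //.
rewrite sgnWT // mulrAC sgnW_sqr // mul1r /sgnW root_prod_simple //.
by rewrite mulNr divff // base_neq0.
Qed.

Definition antisymmetric (g : 'rV[R]_n -> R) : Prop :=
  forall w x, W w -> g (x *m w) = sgnW w * g x.

Definition antisym (g : 'rV[R]_n -> R) x : R :=
  \sum_(w <- fset_set W) sgnW w * g (x *m w).

Lemma mem_groupP w : reflect (W w) (w \in fset_set W).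
Proof. by rewrite in_fset_set ?inE; [exact: asboolP|exact: group_finite]. Qed.

Lemma group_shift u : W u ->
  perm_eq [seq u *m w | w <- enum_fset (fset_set W)] (enum_fset (fset_set W)).
Proof.
move=> Wu.
have um : uniq [seq u *m w | w <- enum_fset (fset_set W)].
  rewrite map_inj_in_uniq ?fset_uniq // => w w' _ _ E.
  by rewrite -[w]mul1mx -[w']mul1mx -(group_orthT Wu) -!mulmxA E.
apply: uniq_perm => //; first exact: fset_uniq.
have [||//] := uniq_min_size um (_ : {subset _ <= enum_fset (fset_set W)}).
  by move=> c /mapP[b /mem_groupP Wb ->]; exact/mem_groupP/groupM.
by rewrite size_map.
Qed.

Lemma antisym_antisymmetric g : antisymmetric (antisym g).
Proof.
move=> u x Wu; rewrite /antisym -[in RHS](perm_big _ (group_shift Wu)) /= big_map mulr_sumr.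
apply: eq_big_seq => w /mem_groupP Ww.
by rewrite sgnWM // mulmxA -mulrA mulrA sgnW_sqr // mul1r.
Qed.

(** At most one element of W brings a given point into C ([chamber_unique]), so at most one term of
    the orbit sum survives. *)
Lemma sum_orbit (f : 'M[R]_n -> 'rV[R]_n -> R) w z : W w -> C (z *m w) ->
  (forall u y, ~ C y -> f u y = 0) ->
  \sum_(u <- fset_set W) f u (z *m u) = f w (z *m w).
Proof.
move=> Ww Cw f0; rewrite (bigD1_seq w) ?fset_uniq //=; last exact/mem_groupP.
rewrite big_seq_cond big1 ?addr0 // => u /andP[/mem_groupP Wu uw].
apply: f0 => Cu; move/eqP: uw; apply; exact: chamber_unique Wu Ww Cu Cw.
Qed.

Lemma antisym_chamber g x : (forall y, ~ C y -> g y = 0) -> C x -> antisym g x = g x.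
Proof.
move=> g0 Cx; rewrite /antisym (@sum_orbit (fun u y => sgnW u * g y) 1%:M).
- by rewrite sgnW1 mul1r mulmx1.
- exact: group1.
- by rewrite mulmx1.
- by move=> u y Cy; rewrite g0 // mulr0.
Qed.

End Signs.

(** * Harmonicity of the product of the positive roots *)

Section Harmonic.
Context {R : realType} {n : nat} {W : set 'M[R]_n} {C : set 'rV[R]_n}.
Context {pos : {fset 'rV[R]_n}} {hcox : reflection_chamber W C pos}.
Implicit Types (a b c r x z : 'rV[R]_n).

Lemma root_prodE x : root_prod pos x = lprod pos x.
Proof. by []. Qed.

(* By antisymmetry of the full product, the product of the other linear forms
   is even along the line through z in the direction a. *)
Lemma lgrad_even a z : a \in pos -> dot a z = 0 -> dot a (lgrad (rest pos a) z) = 0.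
Proof.
move=> ap az; have [a0 Wa] := pos_root ap.
have us : uniq (rest pos a) by apply: uniq_rest; exact: fset_uniq.
rewrite -deriv_lpoly0 //; set p := lpoly _ _ _.
have aa : dot a a != 0 by rewrite dot_eq0.
have ht t : 'X.[t] * p.[t] = 'X.[t] * p.[- t].
  rewrite hornerX !lpolyE; have := @root_prod_group _ _ _ _ _ hcox _ (z + t *: a) Wa.
  rewrite sgnW_refl; last exact: pos_root.
  rewrite mulmxDl refl_fix // -scalemxAl refl_neg // scalerN -scaleNr.
  rewrite !root_prodE !(lprodD1 _ (fset_uniq pos) ap) !dotDr !dotZr az !add0r.
  move=> E; apply: (mulIf aa); rewrite mulrAC [RHS]mulrAC; move: E.
  by rewrite !mulNr mul1r => /oppr_inj ->.
have E : 'X * (p - (p \Po (- 'X))) = 0.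
  apply: poly_eq0 => t; rewrite hornerM hornerD hornerN horner_comp hornerN.
  by rewrite mulrDr mulrN ht [in 'X.[t] * _]hornerX hornerX subrr.
have : p = p \Po (- 'X).
  by move/eqP: E; rewrite mulf_eq0 polyX_eq0 /= subr_eq0 => /eqP.
move=> /(congr1 (fun q => q^`().[0])) /=.
rewrite deriv_comp hornerM horner_comp !derivN derivX !hornerN hornerX oppr0 hornerC.
rewrite mulrN1 => /eqP; rewrite -addr_eq0 -mulr2n mulrn_eq0 => /eqP //.
Qed.

(** In the double sum over pairs of roots, a term in which neither root is a keeps the factor (a, z)
    = 0. The terms with first root a and those with second root a both add up to the quantity that
    vanishes by [lgrad_even]. *)
Lemma llap_wall a z : a \in pos -> dot a z = 0 -> llap pos z = 0.
Proof.
move=> ap az; rewrite /llap (bigD1_seq a) ?fset_uniq //= lgrad_even // add0r.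
rewrite -[RHS](lgrad_even ap az) -big_filter -/(rest _ _) {2}/lgrad dot_sumr.
have up : uniq pos by exact: fset_uniq.
apply: eq_big_seq => b; rewrite mem_rest => /andP[ba bp].
rewrite restC /lgrad dot_sumr (bigD1_seq a) /= ?uniq_rest //; last first.
  by rewrite mem_rest eq_sym ba.
rewrite dotZr [in RHS]dotZr (dotC b) big_seq_cond big1 ?addr0 //.
move=> c /andP[cb ca]; rewrite dotZr (@lprod0 _ _ _ a) ?mul0r //.
by rewrite !mem_rest eq_sym ca eq_sym ba ap.
Qed.

(* Along a generic line the Laplacian is a polynomial of degree at most N - 2
   which vanishes at the N crossings with the hyperplanes. *)
Lemma llap0 x : C x -> llap pos x = 0.
Proof.
move=> Cx; have up : uniq pos by exact: fset_uniq.
have dx a : a \in pos -> dot a x != 0 by move=> ap; rewrite gt_eqF // chamber_dot.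
(* The line through x in the direction e meets the hyperplanes of a and b at the same parameter
   exactly when e is orthogonal to (a, x) b - (b, x) a. Avoiding these vectors makes the crossings
   distinct. *)
pose prs := [seq dot q.1 x *: q.2 - dot q.2 x *: q.1
             | q <- [seq (a, b) | a <- enum_fset pos, b <- enum_fset pos] & q.1 != q.2].
have [|e he] := @generic_vector _ _ (enum_fset pos ++ prs).
  move=> v; rewrite mem_cat => /orP[/pos_neq0//|/mapP[[a b]]].
  rewrite mem_filter /= => /andP[ab /allpairsP[[a' b'] /= [ap bp [? ?]]]] ->; subst a' b'.
  apply: contra_neq ab => /eqP; rewrite subr_eq0 => /eqP E.
  apply: (@pos_inj _ _ _ _ _ _ a b (dot b x / dot a x)) => //.
  by rewrite mulrC -scalerA -E scalerA mulVf ?dx // scale1r.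
have ae a : a \in pos -> dot a e != 0 by move=> ap; apply: he; rewrite mem_cat ap.
pose t a := - (dot a x / dot a e).
have ta a : a \in pos -> dot a (x + t a *: e) = 0.
  by move=> ap; rewrite dotDr dotZr mulNr divfK ?ae // subrr.
pose Q := \sum_(a <- pos) \sum_(b <- rest pos a)
  dot a b *: lpoly (rest (rest pos a) b) x e.
have QE (r : R) : Q.[r] = llap pos (x + r *: e).
  rewrite /Q horner_sum; apply: eq_bigr => a _.
  rewrite horner_sum /lgrad dot_sumr; apply: eq_bigr => b _.
  by rewrite hornerZ lpolyE dotZr mulrC.
have sQ : (size Q <= (size pos).-1)%N.
  rewrite /Q; apply: (leq_trans (size_sum _ _ _)).
  apply/bigmax_leqP_seq => a ap _; apply: (leq_trans (size_sum _ _ _)).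
  apply/bigmax_leqP_seq => b bp _; apply: (leq_trans (size_scale_leq _ _)).
  apply: (leq_trans (size_lpoly _ _ _)).
  by rewrite size_rest ?uniq_rest // -(size_rest up ap).
have -> : x = x + 0 *: e by rewrite scale0r addr0.
rewrite -QE; have [->|Q0] := eqVneq Q 0; first by rewrite horner0.
have := @max_poly_roots _ Q (map t pos) Q0; rewrite size_map => H.
have : (size pos < size Q)%N.
  apply: H.
    by apply/allP => _ /mapP[a ap ->]; rewrite rootE QE (llap_wall ap) // ta.
  rewrite map_inj_in_uniq // => a b ap bp /oppr_inj E.
  apply: contraTeq isT => ab.
  have H' : dot (dot a x *: b - dot b x *: a) e != 0.
    apply: he; rewrite mem_cat; apply/orP; right; apply/mapP; exists (a, b) => //.
    by rewrite mem_filter /= ab; apply/allpairsP; exists (a, b).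
  move: H'; rewrite dotBl !dotZl subr_eq0 => /eqP; case.
  have := congr1 (fun r : R => r * (dot a e * dot b e)) E.
  have E' (p k l : R) : k != 0 -> p / k * (k * l) = p * l by move=> k0; field.
  by rewrite E' ?ae // (mulrC (dot a e)) E' ?ae.
by move=> /leq_trans/(_ sQ); rewrite ltnNge leq_pred.
Qed.

Lemma root_driftE x : C x -> root_drift pos x = (root_prod pos x)^-1 *: lgrad pos x.
Proof.
move=> Cx; rewrite root_prodE lgrad_div ?fset_uniq //.
by move=> a ap; rewrite gt_eqF // chamber_dot.
Qed.

End Harmonic.

(** * The two expressions of the drift *)

Section Drift.
Context {R : realType} {n : nat} {W : set 'M[R]_n} {C : set 'rV[R]_n}.
Context {pos : {fset 'rV[R]_n}} {hcox : reflection_chamber W C pos}.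
Implicit Types (a x y : 'rV[R]_n).

Lemma enorm_gt0 a : a != 0 -> 0 < enorm a.
Proof. by move=> a0; rewrite sqrtr_gt0 dot_gt0. Qed.

Lemma sqr_enorm a : enorm a ^+ 2 = dot a a.
Proof. by rewrite sqr_sqrtr // dot_ge0. Qed.

Lemma enorm_ge0 a : 0 <= enorm a.
Proof. exact: sqrtr_ge0. Qed.

Lemma cauchy_schwarz a x : dot a x <= enorm a * enorm x.
Proof.
have [->|a0] := eqVneq a 0; first by rewrite dot0l mulr_ge0 ?enorm_ge0.
have aa := dot_gt0 a0.
have [ax|ax] := leP (dot a x) 0.
  by apply: le_trans ax _; rewrite mulr_ge0 ?enorm_ge0.
rewrite -(@ler_pXn2r _ 2) ?nnegrE ?mulr_ge0 ?enorm_ge0 ?(ltW ax) // exprMn !sqr_enorm.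
have := dot_ge0 (dot a a *: x - dot a x *: a).
rewrite dotBl !dotBr !dotZl !dotZr (dotC x a) => H.
have : 0 <= dot a a * (dot a a * dot x x - dot a x ^+ 2).
  by apply: le_trans H _; rewrite le_eqVlt; apply/orP; left; apply/eqP; ring.
by rewrite pmulr_rge0 // subr_ge0.
Qed.

(** The orthogonal projection of x attains the infimum, and the lower bound is the Cauchy-Schwarz
    inequality for a and x - y. *)
Lemma dist_hplane a x : a != 0 -> 0 < dot a x -> dist x (hplane a) = dot a x / enorm a.
Proof.
move=> a0 ax; have na := enorm_gt0 a0.
have attained : [set enorm (x - y) | y in hplane a] (dot a x / enorm a).
  exists (x - (dot a x / dot a a) *: a).
    by rewrite /hplane /= dotBr dotZr divfK ?subrr // dot_eq0.
  rewrite subKr /enorm dotZl dotZr mulrA -expr2 sqrtrM ?sqr_ge0 //.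
  rewrite sqrtr_sqr ger0_norm; last by rewrite ltW // divr_gt0 // dot_gt0.
  rewrite -/(enorm a) -sqr_enorm; field; exact: lt0r_neq0.
have lb : lbound [set enorm (x - y) | y in hplane a] (dot a x / enorm a).
  move=> _ [y ay <-]; rewrite ler_pdivrMr // mulrC.
  by have := cauchy_schwarz a (x - y); rewrite dotBr ay subr0.
apply/eqP; rewrite eq_le; apply/andP; split.
  by apply: ge_inf => //; exists (dot a x / enorm a).
by apply: lb_le_inf => //; exists (dot a x / enorm a).
Qed.

Lemma unit_normalE a : a \in pos -> unit_normal C (hplane a) = (enorm a)^-1 *: a.
Proof.
move=> ap; have a0 : a != 0 by exact: pos_neq0.
have na := enorm_gt0 a0.
apply: xget_unique.
  split.
  - rewrite /enorm dotZl dotZr mulrA -expr2 sqrtrM ?sqr_ge0 // sqrtr_sqr.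
    by rewrite ger0_norm ?invr_ge0 ?enorm_ge0 // mulVf // gt_eqF.
  - apply/seteqP; split => x; rewrite /hplane /= dotZl; first by move=> ->; rewrite mulr0.
    by move=> /eqP; rewrite mulf_eq0 invr_eq0 gt_eqF //= => /eqP.
  - by move=> x Cx; rewrite dotZl mulr_gt0 ?invr_gt0 // chamber_dot.
move=> v [v1 E vC].
have v0 : v != 0 by apply/eqP => vz; move/eqP: v1; rewrite vz /enorm dot0l sqrtr0 eq_sym oner_eq0.
have vE : v = (dot a v / dot a a) *: a by apply: hplane_sub => //; rewrite E.
set k := _ / _ in vE; have [x Cx] := chamber_nonempty (hcox := hcox).
have kp : 0 < k.
  by have := vC x Cx; rewrite vE dotZl pmulr_lgt0 // chamber_dot.
have : k * enorm a = 1.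
  rewrite -v1 vE /enorm dotZl dotZr mulrA -expr2 sqrtrM ?sqr_ge0 // sqrtr_sqr.
  by rewrite ger0_norm // ltW.
move=> k1; rewrite vE; congr (_ *: _); apply: (mulIf (lt0r_neq0 na)).
by rewrite k1 mulVf // gt_eqF.
Qed.

Lemma repulsive_driftE x : C x -> repulsive_drift W C x = root_drift pos x.
Proof.
move=> Cx; have [bij _] := chamber_roots (reflection_chamber := hcox).
rewrite /repulsive_drift (reindex_fsbig _ _ _ _ bij) fsbig_finite //= set_fsetK.
apply: eq_big_seq => a ap.
have a0 : a != 0 by exact: pos_neq0.
have na := enorm_gt0 a0.
rewrite dist_hplane // ?chamber_dot // unit_normalE // scalerA; congr (_ *: _).
have h1 : dot a x != 0 by rewrite gt_eqF // chamber_dot.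
by field; rewrite h1 gt_eqF.
Qed.

End Drift.

(** * Differential calculus on row vectors *)

Section NormedModules.
Context {R : realType}.
Implicit Types (V U : normedModType R).

Lemma near_all V (x : V) (P : V -> Prop) : (forall y, P y) -> \forall y \near x, P y.
Proof. by move=> H; apply: nearW. Qed.

Lemma continuous_atP V U (f : V -> U) (x : V) :
  (forall e : R, 0 < e -> \forall y \near x, `|f x - f y| <= e) -> {for x, continuous f}.
Proof. by move=> H; apply/cvgrPdist_le => e; exact: H. Qed.

Lemma continuous_near V U (f g : V -> U) (x : V) : (\forall y \near x, f y = g y) ->
  {for x, continuous f} -> {for x, continuous g}.
Proof.
move=> fg fc; rewrite /prop_for /continuous_at -(nbhs_singleton fg).
by apply: cvg_trans fc; apply: near_eq_cvg; apply: filterS fg => y ->.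
Qed.

Lemma near0_shift V (x : V) (P : V -> Prop) :
  (\forall y \near x, P y) -> \forall h \near (0 : V), P (h + x).
Proof. by rewrite (near_shift 0) subr0. Qed.

Lemma near_normB V (x : V) (e : R) : 0 < e -> \forall y \near x, `|x - y| < e.
Proof. by move=> e0; apply: (@cvgr_dist_lt _ _ _ (nbhs x) _ id x cvg_id). Qed.

Lemma is_diff_nearP V (f : V -> R) (p : {linear V -> R}) (x : V) : continuous p ->
  is_diff x f p <-> forall e : R, 0 < e ->
    \forall h \near (0 : V), `|f (h + x) - f x - p h| <= e * `|h|.
Proof.
move=> pc; split=> [[/diff_locallyP[_ E] dE] e e0|H].
  have /eqaddoP := E; rewrite dE => /(_ e e0); apply: filterS => h /=.
  by rewrite !fctE opprD addrA.
have E : f \o shift x = cst (f x) + p +o_ 0 id.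
  apply/eqaddoP => e e0; have := H e e0; apply: filterS => h /=.
  by rewrite !fctE opprD addrA.
split; last exact: (diff_unique pc E).
by apply/diff_locallyP; rewrite (diff_unique pc E).
Qed.

End NormedModules.

Section Differentiability.
Context {R : realType} {n : nat}.
Implicit Types (f g : 'rV[R]_n -> R) (df dg : 'rV[R]_n -> 'rV[R]_n).
Implicit Types (p x v : 'rV[R]_n).

Lemma coord_le_norm x i : `|x 0 i| <= `|x|.
Proof. by rewrite [ `|x|]mx_normrE; apply: (le_bigmax _ _ (0, i)). Qed.

Lemma norm_le_coord x (c : R) : 0 <= c -> (forall i, `|x 0 i| <= c) -> `|x| <= c.
Proof.
move=> c0 h; rewrite [ `|x|]mx_normrE; apply: bigmax_le => //= -[i j] _ /=.
by rewrite (ord1 i).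
Qed.

Lemma norm_lt_coord x (c : R) : 0 < c -> (forall i, `|x 0 i| < c) -> `|x| < c.
Proof.
move=> c0 h; rewrite [ `|x|]mx_normrE; apply: bigmax_lt => //= -[i j] _ /=.
by rewrite (ord1 i).
Qed.

Lemma normr_dot p (h : 'rV[R]_n) : `|dot p h| <= n%:R * `|p| * `|h|.
Proof.
apply: (le_trans (ler_norm_sum _ _ _)).
rewrite -mulrA mulr_natl -[X in _ <= _ *+ X]card_ord -sumr_const.
by apply: ler_sum => i _; rewrite normrM ler_pM // coord_le_norm.
Qed.

Definition dotp p : 'rV[R]_n -> R := dot p.

Let dotp_linear p : linear (dotp p).
Proof. by move=> c u v; rewrite /dotp dotDr dotZr. Qed.

HB.instance Definition _ p := GRing.isLinear.Build R _ _ _ (dotp p) (dotp_linear p).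

Lemma dot_continuous p : continuous (dot p).
Proof.
move=> x; apply: continuous_atP => e e0.
pose c := n%:R * `|p| + 1; have c0 : 0 < c by rewrite ltr_wpDl // mulr_ge0.
have := near_normB x (divr_gt0 e0 c0).
apply: filterS => y /ltW hy; rewrite -dotBr; apply: (le_trans (normr_dot _ _)).
rewrite -(divfK (lt0r_neq0 c0) e) mulrC ler_pM // ?mulr_ge0 //.
by rewrite lerDl.
Qed.

Lemma rV_continuous (T : topologicalType) (F : T -> 'rV[R]_n) (t : T) :
  (forall i : 'I_n, {for t, continuous (fun y : T => F y 0 i : R)}) -> {for t, continuous F}.
Proof.
move=> H; apply/cvgrPdist_lt => e e0.
have : \forall y \near t, forall i : 'I_n, `|F t 0 i - F y 0 i| < e.
  apply: filter_forall => i; have /cvgrPdist_lt := H i; exact.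
by apply: filterS => y hy; apply: norm_lt_coord => // i; rewrite !mxE.
Qed.

Lemma coord_continuous_at (T : topologicalType) (F : T -> 'rV[R]_n) (t : T) (i : 'I_n) :
  {for t, continuous F} -> {for t, continuous (fun y : T => F y 0 i : R)}.
Proof.
by move=> H; apply: (@continuous_comp _ _ _ F (fun M : 'rV[R]_n => M 0 i)) => //; exact: coord_continuous.
Qed.

Lemma is_gradP x f p : is_diff x f (dot p) <-> forall e : R, 0 < e ->
    \forall h \near (0 : 'rV[R]_n), `|f (h + x) - f x - dot p h| <= e * `|h|.
Proof. exact: (@is_diff_nearP R _ f (dotp p) x (@dot_continuous p)). Qed.

(** Pointwise continuous differentiability with the gradient field given explicitly. Closure rules
    then produce derivatives as terms, and [d1_near] makes the notion local. *)
Definition d1 f df x : Prop := is_diff x f (dot (df x)) /\ {for x, continuous df}.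

Lemma d1_continuous f df x : d1 f df x -> {for x, continuous f}.
Proof. by move=> [[h _] _]; exact: differentiable_continuous. Qed.

Lemma d1_near f g df dg x : (\forall y \near x, f y = g y) ->
  (\forall y \near x, df y = dg y) -> d1 f df x -> d1 g dg x.
Proof.
move=> fg dfg [/is_gradP fd dfc]; have E := nbhs_singleton dfg.
have Ef := nbhs_singleton fg; split.
  apply/is_gradP => e e0; rewrite -E -Ef.
  have fg' := near0_shift fg.
  by apply: filterS2 fg' (fd e e0) => h ->.
exact: continuous_near dfg dfc.
Qed.

Lemma d1_eq f g df dg x : f =1 g -> df =1 dg -> d1 f df x -> d1 g dg x.
Proof. by move=> /funext-> /funext->. Qed.

Lemma d1_cst (c : R) x : d1 (fun=> c) (fun=> 0) x.
Proof.
split; last exact: cst_continuous.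
by apply/is_gradP => e e0; apply: near_all => h; rewrite subrr dot0l subr0 normr0 mulr_ge0 // ltW.
Qed.

Lemma d1_dot p x : d1 (dot p) (fun=> p) x.
Proof.
split; last exact: cst_continuous.
apply/is_gradP => e e0; apply: near_all => h.
by rewrite dotDr addrK subrr normr0 mulr_ge0 // ltW.
Qed.

Lemma d1D f g df dg x : d1 f df x -> d1 g dg x ->
  d1 (fun y => f y + g y) (fun y => df y + dg y) x.
Proof.
move=> [fd fc] [gd gc]; split; last exact: continuousD.
by apply: is_diff_eq (is_diffD fd gd) _; apply/funext => h /=; rewrite dotDl.
Qed.

Lemma d1M f g df dg x : d1 f df x -> d1 g dg x ->
  d1 (fun y => f y * g y) (fun y => f y *: dg y + g y *: df y) x.
Proof.
move=> F G; have fc0 := d1_continuous F; have gc0 := d1_continuous G.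
move: F G => [fd fc] [gd gc]; split.
  by apply: is_diff_eq (is_diffM fd gd) _; apply/funext => h /=; rewrite dotDl !dotZl.
by apply: continuousD; apply: continuousZ.
Qed.

Lemma d1Z (c : R) f df x : d1 f df x -> d1 (fun y => c * f y) (fun y => c *: df y) x.
Proof.
move=> F; apply: d1_eq (d1M (d1_cst c x) F) => y //.
by rewrite scaler0 addr0.
Qed.

Lemma d1_sum (I : Type) (r : seq I) (F : I -> 'rV[R]_n -> R)
    (dF : I -> 'rV[R]_n -> 'rV[R]_n) x : (forall i, d1 (F i) (dF i) x) ->
  d1 (fun y => \sum_(i <- r) F i y) (fun y => \sum_(i <- r) dF i y) x.
Proof.
move=> H; elim: r => [|i r IH].
  by apply: d1_eq (d1_cst 0 x) => y; rewrite big_nil.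
by apply: d1_eq (d1D (H i) IH) => y; rewrite big_cons.
Qed.

Lemma d1_comp (k dk : R -> R) f df x : d1 f df x -> is_derive (f x) 1 k (dk (f x)) ->
  {for f x, continuous dk} -> d1 (fun y => k (f y)) (fun y => dk (f y) *: df y) x.
Proof.
move=> F kd kc; have fc0 := d1_continuous F; move: F => [fd fc]; split; last first.
  by apply: continuousZ => //; exact: continuous_comp.
have kd' : is_diff (f x) k (fun r => r *: dk (f x)).
  split; first by apply/derivable1_diffP; exact: ex_derive.
  rewrite deriv1E; last exact: ex_derive.
  by rewrite derive1E derive_val.
apply: is_diff_eq (is_diff_comp fd kd') _; apply/funext => h /=.
by rewrite dotZl [LHS]mulrC.
Qed.

Lemma norm_mulmx (w : 'M[R]_n) (h : 'rV[R]_n) : `|h *m w| <= n%:R * `|w| * `|h|.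
Proof.
apply: norm_le_coord => [|j]; first by rewrite !mulr_ge0.
rewrite mxE; apply: (le_trans (ler_norm_sum _ _ _)).
rewrite -mulrA mulr_natl -[X in _ <= _ *+ X]card_ord -sumr_const.
apply: ler_sum => i _; rewrite normrM mulrC ler_pM // ?coord_le_norm //.
by rewrite [ `|w|]mx_normrE; apply: (le_bigmax _ _ (i, j)).
Qed.

Lemma mulmx_continuous (w : 'M[R]_n) : continuous (fun y : 'rV[R]_n => y *m w).
Proof.
move=> x; apply: rV_continuous => i.
have -> : (fun y : 'rV[R]_n => (y *m w) 0 i) = dot (\row_j w j i).
  by apply/funext => y; rewrite dotC mxE; apply: eq_bigr => j _; rewrite mxE.
exact: dot_continuous.
Qed.

Lemma d1_mulmx (w : 'M[R]_n) f df x : d1 f df (x *m w) ->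
  d1 (fun y => f (y *m w)) (fun y => df (y *m w) *m w^T) x.
Proof.
move=> [/is_gradP fd fc]; split; last first.
  exact: (continuous_comp (continuous_comp (@mulmx_continuous w x) fc) (@mulmx_continuous w^T _)).
apply/is_gradP => e e0.
pose c := n%:R * `|w| + 1; have c0 : 0 < c by rewrite ltr_wpDl // mulr_ge0.
have H := fd (e / c) (divr_gt0 e0 c0).
have : \forall h \near (0 : 'rV[R]_n), `|f (h *m w + x *m w) - f (x *m w) - dot (df (x *m w)) (h *m w)| <= e / c * `|h *m w|.
  have := @mulmx_continuous w 0; rewrite /continuous_at mul0mx => Hw; exact: (Hw _ H).
apply: filterS => h; rewrite -mulmxDl dot_mulmxr => /le_trans; apply.
rewrite mulrAC ler_pdivrMr // mulrAC -mulrA ler_pM2l // mulrC.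
rewrite [leRHS]mulrC; apply: (le_trans (norm_mulmx _ _)); apply: ler_wpM2r => //.
by rewrite lerDl.
Qed.

Lemma d1_is_derive f df x v : d1 f df x -> is_derive x v f (dot (df x) v).
Proof.
move=> [[fd E] _]; split; first exact: diff_derivable.
by rewrite deriveE // E.
Qed.

Lemma is_derive_line f (y : 'rV[R]_n) v (s d : R) : is_derive (y + s *: v) v f d ->
  is_derive s 1 (fun r => f (y + r *: v)) d.
Proof.
move=> [fd fE].
have E : (fun h : R => h^-1 *: (f (y + (h *: 1 + s) *: v) - f (y + s *: v))) =
         (fun h : R => h^-1 *: (f (h *: v + (y + s *: v)) - f (y + s *: v))).
  apply/funext => h; congr (_ *: (f _ - _)).
  by rewrite -[h *: 1]/(h * 1) mulr1 scalerDl addrCA.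
split; first by move: fd; rewrite /derivable E.
by rewrite -fE /derive E.
Qed.

Lemma mvt01 (g dg : R -> R) : (forall s : R, is_derive s 1 g (dg s)) ->
  exists2 t, 0 <= t <= 1 & g 1 - g 0 = dg t.
Proof.
move=> H; have [|t] := @MVT_segment R g dg 0 1 ler01.
  apply: continuous_subspaceT => s; apply: differentiable_continuous.
  by apply/derivable1_diffP; exact: ex_derive.
by rewrite in_itv /= subr0 mulr1 => ?; exists t.
Qed.

(** The corners of the path from 0 to h that switches on one coordinate at a time. *)
Definition stair (h : 'rV[R]_n) (k : nat) : 'rV[R]_n := \row_i (if (i < k)%N then h 0 i else 0).

Lemma norm_stair (h : 'rV[R]_n) k : `|stair h k| <= `|h|.
Proof.
apply: norm_le_coord => // i; rewrite mxE; case: ifP => _; last by rewrite normr0.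
exact: coord_le_norm.
Qed.

(** The definition of [C2] speaks of partial derivatives only. The increment is telescoped along
    [stair], the mean value theorem is applied on each edge, and continuity of the partial
    derivatives at x replaces their values on the edges by those at x. *)
Lemma C1_is_diff f df x :
  (forall (y : 'rV[R]_n) i, is_derive y (delta_mx 0 i) f (df y 0 i)) ->
  {for x, continuous df} -> is_diff x f (dot (df x)).
Proof.
move=> fd dfc; apply/is_gradP => e e0.
have n1 : 0 < n%:R + 1 :> R by rewrite ltr_wpDl.
have /cvgrPdist_lt/(_ (e / (n%:R + 1)) (divr_gt0 e0 n1)) := dfc.
move=> /nbhs_ballP[r /= r0 hr].
apply/nbhs_ballP; exists (r / 2); first by rewrite /= divr_gt0.
move=> h; rewrite -ball_normE /= sub0r normrN => hr2.
have step (i : 'I_n) : `|f (stair h i.+1 + x) - f (stair h i + x) - df x 0 i * h 0 i|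
    <= e / (n%:R + 1) * `|h|.
  pose y := stair h i + x.
  pose g (s : R) := f (y + (h 0 i * s) *: delta_mx 0 i).
  have gd (s : R) : is_derive s 1 g (df (y + (h 0 i * s) *: delta_mx 0 i) 0 i * h 0 i).
    have H := @is_derive_line f y (delta_mx 0 i) (h 0 i * s) _ (fd _ i).
    have H2 : is_derive s 1 (h 0 i \*: id) (h 0 i).
      by apply: is_derive_eq (is_deriveZ (h 0 i) (is_derive_id s 1)) _; exact: mulr1.
    exact: (is_derive1_comp H H2).
  have [t /andP[t0 t1] gE] := mvt01 gd.
  have g0 : g 0 = f (stair h i + x) by rewrite /g mulr0 scale0r addr0.
  have g1 : g 1 = f (stair h i.+1 + x).
    rewrite /g mulr1 /y addrAC; congr (f (_ + _)); apply/rowP => j; rewrite !mxE eqxx /=.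
    have [->|ji] := eqVneq j i; first by rewrite ltnn ltnSn mulr1 add0r.
    by rewrite mulr0 addr0 ltnS [in RHS]leq_eqVlt (inj_eq val_inj) (negbTE ji).
  rewrite -g1 -g0 gE -mulrBl normrM ler_pM ?coord_le_norm //.
  set z := y + _; apply: (le_trans (y := `|df x - df z|)).
    by have := coord_le_norm (df x - df z) i; rewrite !mxE distrC.
  apply/ltW/hr; rewrite -ball_normE /= distrC /z /y addrAC addrK.
  rewrite (le_lt_trans (ler_normD _ _)) // (splitr r) ltr_leD //.
    by apply: le_lt_trans hr2; exact: norm_stair.
  apply: le_trans (ltW hr2); rewrite normrZ.
  have d1n : `|delta_mx 0 i : 'rV[R]_n| <= 1.
    apply: norm_le_coord => // j; rewrite mxE eqxx /=.
    by case: (j == i); rewrite ?normr1 ?normr0.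
  apply: le_trans (ler_wpM2l _ d1n) _ => //; rewrite mulr1 normrM.
  rewrite -[leRHS]mulr1 ler_pM ?coord_le_norm // ger0_norm //.
have tele : f (h + x) - f x = \sum_(i < n) (f (stair h i.+1 + x) - f (stair h i + x)).
  rewrite -(big_mkord xpredT (fun i => f (stair h i.+1 + x) - f (stair h i + x))).
  rewrite telescope_sumr //; congr (f _ - f _).
    congr (_ + _); apply/rowP => i; rewrite mxE; by rewrite ltn_ord.
  by rewrite (_ : stair h 0 = 0) ?add0r //; apply/rowP => i; rewrite !mxE.
rewrite tele /dot -sumrB; apply: (le_trans (ler_norm_sum _ _ _)).
apply: (le_trans (ler_sum _ (fun i _ => step i))).
rewrite sumr_const card_ord -[leLHS]mulr_natl mulrA ler_wpM2r //.
rewrite mulrC -mulrA ler_piMr ?(ltW e0) // mulrC ler_pdivrMr // mul1r lerDl //.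
Qed.

End Differentiability.

(** * Second derivatives and the Laplacian *)

Section SecondOrder.
Context {R : realType} {n : nat}.
Implicit Types (f g : 'rV[R]_n -> R) (df dg : 'rV[R]_n -> 'rV[R]_n).
Implicit Types (ddf ddg : 'I_n -> 'rV[R]_n -> 'rV[R]_n) (p x : 'rV[R]_n).

(** Here [ddf i] is the i-th row of the Hessian, so that [trace ddf] is the Laplacian. *)
Definition d2 f df ddf x : Prop :=
  d1 f df x /\ forall i, d1 (fun y => df y 0 i) (ddf i) x.

Definition trace ddf x : R := \sum_(i < n) ddf i x 0 i.

Lemma partialE f df x i : d1 f df x -> partial i f x = df x 0 i.
Proof.
by move=> /d1_is_derive-/(_ (delta_mx 0 i)) H; rewrite /partial derive_val dotC dot_delta.
Qed.

Lemma d2_C2 f df ddf : (forall x, d2 f df ddf x) -> C2 f.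
Proof.
move=> H; have pf i : partial i f = fun y => df y 0 i.
  by apply/funext => y; apply: partialE; exact: (H y).1.
split=> [x|i]; first by have [/d1_continuous] := H x.
split.
- by move=> x; have [/d1_is_derive-/(_ (delta_mx 0 i)) h _] := H x; exact: ex_derive.
- by move=> x; rewrite pf; have [_ /(_ i)/d1_continuous] := H x.
- move=> j; have pij : partial j (partial i f) = fun y => ddf i y 0 j.
    by apply/funext => y; rewrite pf; apply: partialE; exact: (H y).2.
  split=> x; last first.
    rewrite pij; apply: coord_continuous_at; by have [_ /(_ i)[_]] := H x.
  rewrite pf; have [_ /(_ i)/d1_is_derive-/(_ (delta_mx 0 j)) h] := H x.
  exact: ex_derive.
Qed.

Lemma C2_d1 f x : (forall i : 'I_n, (forall y, derivable f y (delta_mx 0 i)) /\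
  continuous (partial i f)) -> d1 f (gradient f) x.
Proof.
move=> H; have gc : {for x, continuous (gradient f)}.
  apply: rV_continuous => i; have -> : (fun y => gradient f y 0 i) = partial i f.
    by apply/funext => y; rewrite mxE.
  exact: (H i).2.
split=> //; apply: C1_is_diff gc => y i; rewrite mxE.
by apply: DeriveDef => //; exact: (H i).1.
Qed.

Lemma C2_d2 f x : C2 f -> d2 f (gradient f) (fun i => gradient (partial i f)) x.
Proof.
move=> [_ H]; split=> [|i]; first by apply: C2_d1 => i; have [h1 h2 _] := H i.
have -> : (fun y => gradient f y 0 i) = partial i f by apply/funext => y; rewrite mxE.
by apply: C2_d1 => j; have [_ _ /(_ j)] := H i.
Qed.

Lemma d2_gradient f df ddf x : d2 f df ddf x -> gradient f x = df x.
Proof. by move=> [H _]; apply/rowP => i; rewrite mxE; exact: partialE. Qed.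

Lemma d2_near f g df ddf dg ddg x : (\forall y \near x, f y = g y) ->
  (\forall y \near x, df y = dg y) -> (forall i, \forall y \near x, ddf i y = ddg i y) ->
  d2 f df ddf x -> d2 g dg ddg x.
Proof.
move=> h1 h2 h3 [F1 F2]; split; first exact: d1_near F1.
by move=> i; apply: d1_near (F2 i) => //; apply: filterS h2 => y ->.
Qed.

Lemma laplacianE f df ddf x : (\forall y \near x, d2 f df ddf y) ->
  laplacian f x = trace ddf x.
Proof.
move=> H; apply: eq_bigr => i _; have Hx := nbhs_singleton H.
have : d1 (partial i f) (ddf i) x.
  apply: d1_near (Hx.2 i); last exact: near_all.
  by apply: filterS H => y [Hy _]; rewrite (partialE _ Hy).
by move=> /partialE ->.
Qed.

Lemma d2_cst (c : R) x : d2 (fun=> c) (fun=> 0) (fun _ _ => 0) x.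
Proof.
split=> [|i]; first exact: d1_cst.
by apply: d1_eq (d1_cst 0 x) => y //; rewrite mxE.
Qed.

Lemma d2_dot p x : d2 (dot p) (fun=> p) (fun _ _ => 0) x.
Proof. by split=> [|i]; [exact: d1_dot|exact: d1_cst]. Qed.

Lemma d2D f df ddf g dg ddg x : d2 f df ddf x -> d2 g dg ddg x ->
  d2 (fun y => f y + g y) (fun y => df y + dg y) (fun i y => ddf i y + ddg i y) x.
Proof.
move=> [F1 F2] [G1 G2]; split=> [|i]; first exact: d1D.
by apply: d1_eq (d1D (F2 i) (G2 i)) => y //; rewrite mxE.
Qed.

Lemma d2Z (c : R) f df ddf x : d2 f df ddf x ->
  d2 (fun y => c * f y) (fun y => c *: df y) (fun i y => c *: ddf i y) x.
Proof.
move=> [F1 F2]; split=> [|i]; first exact: d1Z.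
by apply: d1_eq (d1Z c (F2 i)) => y //; rewrite mxE.
Qed.

Lemma d2M f df ddf g dg ddg x : d2 f df ddf x -> d2 g dg ddg x ->
  d2 (fun y => f y * g y) (fun y => f y *: dg y + g y *: df y)
     (fun i y => (f y *: ddg i y + dg y 0 i *: df y) +
                 (g y *: ddf i y + df y 0 i *: dg y)) x.
Proof.
move=> [F1 F2] [G1 G2]; split=> [|i]; first exact: d1M.
by apply: d1_eq (d1D (d1M F1 (G2 i)) (d1M G1 (F2 i))) => y //; rewrite !mxE.
Qed.

Lemma d2_comp (k dk ddk : R -> R) f df ddf x : d2 f df ddf x ->
  is_derive (f x) 1 k (dk (f x)) -> is_derive (f x) 1 dk (ddk (f x)) ->
  {for f x, continuous ddk} ->
  d2 (fun y => k (f y)) (fun y => dk (f y) *: df y)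
     (fun i y => dk (f y) *: ddf i y + df y 0 i *: (ddk (f y) *: df y)) x.
Proof.
move=> [F1 F2] h1 h2 h3; split=> [|i].
  apply: d1_comp => //; apply: differentiable_continuous.
  by apply/derivable1_diffP; exact: ex_derive.
by apply: d1_eq (d1M (d1_comp F1 h2 h3) (F2 i)) => y //; rewrite mxE.
Qed.

(** Orthogonal invariance of the Laplacian: the new Hessian is the old one conjugated by w, and the
    columns of w are orthonormal. *)
Lemma trace_mulmx (w : 'M[R]_n) ddf x : w^T *m w = 1%:M ->
  trace (fun i y => \sum_(j < n) w i j *: (ddf j (y *m w) *m w^T)) x = trace ddf (x *m w).
Proof.
move=> ww; rewrite /trace.
transitivity (\sum_(i < n) \sum_(j < n) \sum_(k < n)
    w i j * (ddf j (x *m w) 0 k * w i k)).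
  apply: eq_bigr => i _; rewrite summxE; apply: eq_bigr => j _; rewrite !mxE mulr_sumr.
  by apply: eq_bigr => k _; rewrite mxE.
rewrite exchange_big; apply: eq_bigr => j _ /=; rewrite exchange_big /=.
transitivity (\sum_(k < n) ddf j (x *m w) 0 k * (w^T *m w) j k).
  apply: eq_bigr => k _; rewrite mxE mulr_sumr; apply: eq_bigr => i _.
  by rewrite mxE mulrCA.
rewrite ww (bigD1 j) //= mxE eqxx mulr1 big1 ?addr0 // => k kj.
by rewrite mxE eq_sym (negbTE kj) mulr0.
Qed.

Lemma traceD ddf ddg x : trace (fun i y => ddf i y + ddg i y) x = trace ddf x + trace ddg x.
Proof. by rewrite /trace -big_split; apply: eq_bigr => i _; rewrite mxE. Qed.

Lemma traceZ (c : R) ddf x : trace (fun i y => c *: ddf i y) x = c * trace ddf x.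
Proof. by rewrite /trace mulr_sumr; apply: eq_bigr => i _; rewrite mxE. Qed.

Lemma traceM f df ddf g dg ddg x :
  trace (fun i y => (f y *: ddg i y + dg y 0 i *: df y) +
                    (g y *: ddf i y + df y 0 i *: dg y)) x =
  f x * trace ddg x + g x * trace ddf x + 2 * dot (df x) (dg x).
Proof.
rewrite /trace /dot !mulr_sumr -!big_split /=; apply: eq_bigr => i _; rewrite !mxE; ring.
Qed.

Lemma trace_comp (k1 k2 : R -> R) f df ddf x :
  trace (fun i y => k1 (f y) *: ddf i y + df y 0 i *: (k2 (f y) *: df y)) x =
  k1 (f x) * trace ddf x + k2 (f x) * dot (df x) (df x).
Proof.
rewrite /trace /dot !mulr_sumr -big_split /=; apply: eq_bigr => i _; rewrite !mxE; ring.
Qed.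

Lemma d1_lprod (s : seq 'rV[R]_n) x : uniq s -> d1 (lprod s) (lgrad s) x.
Proof.
elim: s => [_|a s IH /= /andP[ans us]].
  by apply: d1_eq (d1_cst 1 x) => y; rewrite /lprod /lgrad big_nil.
apply: d1_eq (d1M (d1_dot a x) (IH us)) => y; first by rewrite lprod_cons.
rewrite [in RHS]/lgrad big_cons /rest /= eqxx /= -/(rest s a) rest_notin //.
rewrite addrC; congr (_ + _); rewrite /lgrad scaler_sumr; apply: eq_big_seq => b bs.
by rewrite ifT ?lprod_cons ?scalerA //; apply: contraNneq ans => ->.
Qed.

Lemma d2_lprod (s : seq 'rV[R]_n) x : uniq s ->
  d2 (lprod s) (lgrad s) (fun i y => \sum_(a <- s) a 0 i *: lgrad (rest s a) y) x.
Proof.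
move=> us; split=> [|i]; first exact: d1_lprod.
apply: d1_eq (d1_sum s (fun a => d1Z (a 0 i) (d1_lprod x (uniq_rest a us)))) => y //.
by rewrite /lgrad summxE; apply: eq_bigr => a _; rewrite mxE mulrC.
Qed.

Lemma trace_lprod (s : seq 'rV[R]_n) x :
  trace (fun i y => \sum_(a <- s) a 0 i *: lgrad (rest s a) y) x = llap s x.
Proof.
rewrite /trace /llap; under eq_bigr do rewrite summxE.
rewrite exchange_big /=; apply: eq_bigr => a _.
by rewrite /dot; apply: eq_bigr => i _; rewrite mxE.
Qed.

Lemma d2_dotxx x : d2 (fun y => dot y y) (fun y => 2 *: y)
  (fun i _ => 2 *: delta_mx 0 i) x.
Proof.
have F i : d1 (fun y : 'rV[R]_n => y 0 i) (fun=> delta_mx 0 i) x.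
  by apply: d1_eq (d1_dot (delta_mx 0 i) x) => y //; rewrite dot_delta.
split=> [|i]; last first.
  by apply: d1_eq (d1Z 2 (F i)) => y //; rewrite mxE.
apply: d1_eq (d1_sum (index_enum _) (fun i => d1M (F i) (F i))) => y //.
apply/rowP => j; rewrite summxE (bigD1 j) //= big1.
  by rewrite !mxE !eqxx !mulr1 addr0 mulr2n mulrDl !mul1r.
by move=> i ij; rewrite !mxE (eq_sym j) (negbTE ij) andbF !mulr0 addr0.
Qed.

Lemma trace_dotxx x : trace (fun i _ => 2 *: (delta_mx 0 i : 'rV[R]_n)) x = 2 * n%:R.
Proof.
rewrite /trace; under eq_bigr do rewrite !mxE !eqxx mulr1.
by rewrite sumr_const card_ord mulr_natr.
Qed.

End SecondOrder.

(** * A convex truncation of class C^2 *)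

Section Truncation.
Context {R : realType}.
Implicit Types (r h e : R).

Definition pos1 r : R := Num.max r 0.
Definition pos2 r : R := pos1 r ^+ 2 / 2.
Definition pos3 r : R := pos1 r ^+ 3 / 6.

Lemma pos1P r : (0 <= r /\ pos1 r = r) \/ (r <= 0 /\ pos1 r = 0).
Proof.
rewrite /pos1; have [r0|r0] := leP r 0; [right|left]; split => //.
exact: ltW.
Qed.

Lemma is_derive_bound (k : R -> R) r (d M : R) :
  (forall h, `|h| <= 1 -> `|k (r + h) - k r - d * h| <= M * h ^+ 2) ->
  is_derive r 1 k d.
Proof.
move=> H; have M0 : 0 <= M.
  have := H 1; rewrite normr1 lexx expr1n !mulr1 => /(_ isT) h.
  exact: le_trans (normr_ge0 _) h.
have L : h^-1 *: ((k \o shift r) (h *: 1) - k r) @[h --> 0^'] --> d.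
  apply/cvgrPdist_le => e e0.
  pose c := Num.min 1 (e / (M + 1)).
  have M1 : 0 < M + 1 by rewrite ltr_wpDl.
  have c0 : 0 < c by rewrite lt_min ltr01 divr_gt0.
  have hc : \forall h \near (0 : R)^', `|h| < c.
    by apply: dnbhs0_lt.
  have hn : \forall h \near (0 : R)^', h != 0 by exact: nbhs_dnbhs_neq.
  apply: filterS2 hc hn => h; rewrite lt_min => /andP[/ltW h1 h2] h0 /=.
  rewrite -[h *: 1]/(h * 1) mulr1 (addrC h).
  have -> : d - h^-1 *: (k (r + h) - k r) = - (h^-1 * (k (r + h) - k r - d * h)).
    by rewrite -[_ *: _]/(_ * _); field.
  rewrite normrN normrM normfV ler_pdivrMl ?normr_gt0 //.
  apply: le_trans (H h h1) _; rewrite -(real_normK (num_real h)).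
  rewrite ltr_pdivlMr // in h2; have := normr_ge0 h; nra.
by split; [apply/cvg_ex; exists d | exact/cvg_lim].
Qed.

Lemma pos3_derive r : is_derive r 1 pos3 (pos2 r).
Proof.
apply: (@is_derive_bound _ _ _ (`|r| + 1)) => h; rewrite ler_norml => /andP[h1 h2].
have r0 := ler_norm r; have r1 := ler_norm (- r); rewrite normrN in r1.
rewrite ler_norml /pos3 /pos2.
have [[a ->]|[a ->]] := pos1P (r + h); have [[b ->]|[b ->]] := pos1P r;
  apply/andP; split; nra.
Qed.

Lemma pos2_derive r : is_derive r 1 pos2 (pos1 r).
Proof.
apply: (@is_derive_bound _ _ _ 1) => h _; rewrite ler_norml /pos2.
have [[a ->]|[a ->]] := pos1P (r + h); have [[b ->]|[b ->]] := pos1P r;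
  apply/andP; split; nra.
Qed.

Lemma pos1_continuous : continuous pos1.
Proof.
move=> r; apply: continuous_atP => e e0; have := near_normB r e0.
apply: filterS => y /ltW; rewrite !ler_norml => /andP[h1 h2].
by have [[a ->]|[a ->]] := pos1P r; have [[b ->]|[b ->]] := pos1P y; apply/andP; split; lra.
Qed.

(* A second-order difference of cubes: a C^2 convex nondecreasing function that
   vanishes on (-oo, e] and is r - 2 e for r >= 3 e. *)
Definition soft (p : R -> R) e r : R := p (r / e - 1) - 2 * p (r / e - 2) + p (r / e - 3).
Definition trunc e r : R := e * soft pos3 e r.
Definition dtrunc e r : R := soft pos2 e r.
Definition ddtrunc e r : R := soft pos1 e r / e.

Lemma soft_derive (p dp : R -> R) e r : 0 < e -> (forall s : R, is_derive s 1 p (dp s)) ->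
  is_derive r 1 (soft p e) (soft dp e r / e).
Proof.
move=> e0 H.
have D (c : R) : is_derive r 1 (fun r => p (r / e - c)) (dp (r / e - c) / e).
  have H2 : is_derive r 1 (fun r => r / e - c) e^-1.
    have h1 : is_derive r 1 (e^-1 \*: id - cst c) (e^-1 *: 1 - 0).
      by apply: is_deriveB; apply: is_deriveZ.
    have -> : (fun r => r / e - c) = e^-1 \*: id - cst c.
      by apply/funext => s; rewrite !fctE mulrC.
    by apply: (is_derive_eq h1); rewrite subr0; exact: mulr1.
  exact: (is_derive1_comp (H _) H2).
have := is_deriveD (is_deriveB (D 1) (is_deriveZ 2 (D 2))) (D 3).
move=> h; apply: (is_derive_eq h).
by rewrite /soft -[_ *: _]/(_ * _); ring.
Qed.

Lemma trunc_derive e r : 0 < e -> is_derive r 1 (trunc e) (dtrunc e r).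
Proof.
move=> e0; have := is_deriveZ e (soft_derive r e0 pos3_derive).
move=> h; apply: (is_derive_eq h); rewrite -[_ *: _]/(_ * _).
by rewrite mulrC divfK // gt_eqF.
Qed.

Lemma dtrunc_derive e r : 0 < e -> is_derive r 1 (dtrunc e) (ddtrunc e r).
Proof. by move=> e0; exact: soft_derive e0 pos2_derive. Qed.

Lemma ddtrunc_continuous e : continuous (ddtrunc e).
Proof.
move=> r; have D (c : R) : {for r, continuous (fun s : R => pos1 (s / e - c))}.
  apply: (continuous_comp (f := fun s : R => s / e - c)); last exact: pos1_continuous.
  apply: continuousB; last exact: cst_continuous.
  by apply: continuousM; [exact: cvg_id|exact: cst_continuous].
apply: continuousM; last exact: cst_continuous.
apply: continuousD => //; apply: continuousB => //.
by apply: continuousM => //; exact: cst_continuous.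
Qed.

Lemma trunc_eq0 e r : 0 < e -> r <= e -> [/\ trunc e r = 0, dtrunc e r = 0 & ddtrunc e r = 0].
Proof.
move=> e0 re; have s1 : r / e <= 1 by rewrite ler_pdivrMr // mul1r.
rewrite /trunc /dtrunc /ddtrunc /soft /pos3 /pos2.
have p0 c : r / e <= c -> pos1 (r / e - c) = 0 by move=> h; rewrite /pos1 max_r // subr_le0.
have [p1 p2 p3] : [/\ pos1 (r / e - 1) = 0, pos1 (r / e - 2) = 0 & pos1 (r / e - 3) = 0].
  by split; apply: p0; lra.
by rewrite p1 p2 p3 !expr0n /= !(mul0r, mulr0, subr0, addr0).
Qed.

(** For e = 1 the second difference of [pos1] is the tent function on [1, 3] with height 1 at 2. The
    other two functions are its successive antiderivatives, whence the bounds; they are checked on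
    each polynomial piece. *)
Lemma soft_bounds (s : R) : [/\ 0 <= soft pos3 1 s, s - 2 <= soft pos3 1 s,
  soft pos3 1 s <= pos1 s, 0 <= soft pos2 1 s <= 1 & 0 <= soft pos1 1 s <= 1].
Proof.
rewrite /soft /pos3 /pos2 divr1.
have [[a ->]|[a ->]] := pos1P (s - 1); have [[b ->]|[b ->]] := pos1P (s - 2);
  have [[c ->]|[c ->]] := pos1P (s - 3); have [[d ->]|[d ->]] := pos1P s; try lra.
- have p3 := exprn_ge0 3 c; have p2 := exprn_ge0 2 c.
  by split; try (apply/andP; split); nra.
- have c' : 0 <= 3 - s by lra.
  have p3 := exprn_ge0 3 c'; have p2 := exprn_ge0 2 c'; have q3 := exprn_ge0 3 a.
  have r3 : (3 - s) ^+ 3 <= 1 by rewrite exprn_ile1 //; lra.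
  have r2 : (3 - s) ^+ 2 <= 1 by rewrite exprn_ile1 //; lra.
  by split; try (apply/andP; split); nra.
- have b' : 0 <= 2 - s by lra.
  have p3 := exprn_ge0 3 a; have p2 := exprn_ge0 2 a.
  have r3 : (s - 1) ^+ 3 <= 1 by rewrite exprn_ile1 //; lra.
  have r2 : (s - 1) ^+ 2 <= 1 by rewrite exprn_ile1 //; lra.
  by split; try (apply/andP; split); nra.
- by split; try (apply/andP; split); lra.
- by split; try (apply/andP; split); lra.
Qed.

Lemma softE (p : R -> R) e r : soft p e r = soft p 1 (r / e).
Proof. by rewrite /soft divr1. Qed.

Lemma trunc_bounds e r : 0 < e -> [/\ 0 <= trunc e r, r - 2 * e <= trunc e r,
  trunc e r <= pos1 r, 0 <= dtrunc e r <= 1 & 0 <= ddtrunc e r <= e^-1].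
Proof.
move=> e0; rewrite /trunc /dtrunc /ddtrunc !(softE _ e).
have re : r = e * (r / e) by rewrite mulrC divfK // gt_eqF.
have p1 : pos1 r = e * pos1 (r / e).
  by rewrite /pos1 maxr_pMr ?(ltW e0) // mulr0 -re.
have [h1 h2 h3 h4 /andP[h5 h6]] := soft_bounds (r / e); split => //.
- by rewrite mulr_ge0 // ltW.
- by rewrite [X in X - _]re (mulrC 2) -mulrBr ler_pM2l.
- by rewrite p1 ler_pM2l.
- by rewrite divr_ge0 ?(ltW e0) //= ler_pdivrMr // mulVf // gt_eqF.
Qed.

Lemma mvt (g dg : R -> R) (a b : R) : (forall s : R, is_derive s 1 g (dg s)) ->
  exists2 c : R, `|c - a| <= `|b - a| & g b - g a = dg c * (b - a).
Proof.
move=> H; have cg i : {within i, continuous g}.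
  apply: continuous_subspaceT => s; apply: differentiable_continuous.
  by apply/derivable1_diffP; exact: ex_derive.
have [ab|ab] := leP a b.
  have [|c] := @MVT_segment R g dg a b ab; first exact: cg.
  rewrite in_itv /= => /andP[ac cb] E; exists c => //.
  by rewrite !ger0_norm ?subr_ge0 // lerD2r.
have [|c] := @MVT_segment R g dg b a (ltW ab); first exact: cg.
rewrite in_itv /= => /andP[ac cb] E; exists c; last by rewrite -opprB E; ring.
by rewrite !ler0_norm ?subr_le0 ?(ltW ab) // lerN2 lerD2r.
Qed.

Lemma taylor1 (g dg ddg : R -> R) (M a b : R) : (forall s : R, is_derive s 1 g (dg s)) ->
  (forall s : R, is_derive s 1 dg (ddg s)) -> (forall s, `|ddg s| <= M) ->
  `|g b - g a - dg a * (b - a)| <= M * (b - a) ^+ 2.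
Proof.
move=> H1 H2 hM; have [c hc ->] := mvt a b H1; rewrite -mulrBl.
have [d hd ->] := mvt a c H2; rewrite !normrM -mulrA ler_pM // ?mulr_ge0 //.
by rewrite -(real_normK (num_real (b - a))) expr2 ler_wpM2r.
Qed.

End Truncation.

(** * Functions with compact support in an open set *)

Section CompactSupport.
Context {R : realType} {n : nat}.
Implicit Types (f F : 'rV[R]_n -> R) (K C : set 'rV[R]_n).

Lemma open_near C (x : 'rV[R]_n) : open C -> C x -> \forall y \near x, C y.
Proof. by move=> oC Cx; apply: open_nbhs_nbhs. Qed.

Lemma near_near (P : 'rV[R]_n -> Prop) (x : 'rV[R]_n) :
  (\forall y \near x, P y) -> \forall y \near x, \forall z \near y, P z.
Proof. by move=> /nbhs_interior. Qed.

Lemma compact_rV_closed K : compact K -> closed K.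
Proof. by apply: compact_closed; exact: norm_hausdorff. Qed.

(** The derivative fields may change from point to point: near each point they must agree with the
    gradient and with the partial derivatives of f, which are therefore regular there. *)
Lemma C2_local f : (forall x : 'rV[R]_n, exists df ddf, \forall y \near x, d2 f df ddf y) -> C2 f.
Proof.
move=> H; apply: (@d2_C2 _ _ _ (gradient f) (fun i => gradient (partial i f))) => x.
have [df [ddf hx]] := H x.
have gE : \forall y \near x, gradient f y = df y.
  by apply: filterS hx => y; exact: d2_gradient.
apply: d2_near (nbhs_singleton hx) => [||i].
- exact: near_all.
- by apply: filterS gE.
- have := near_near gE; apply: filterS2 hx => y [_ hy2] gEy.
  apply/rowP => j; rewrite mxE; apply/esym; apply: partialE.
  apply: d1_near (hy2 i); last exact: near_all.
  by apply: filterS gEy => z <-; rewrite mxE.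
Qed.

Definition extend C F (x : 'rV[R]_n) : R := if `[< C x >] then F x else 0.

Lemma extendT C F x : C x -> extend C F x = F x.
Proof. by rewrite /extend => Cx; case: asboolP. Qed.

Lemma extendF C F x : ~ C x -> extend C F x = 0.
Proof. by rewrite /extend => Cx; case: asboolP. Qed.

(** The open sets C and the complement of K cover the space. On the first the extension is F, on the
    second it is locally zero. *)
Lemma extend_C2c C K F dF ddF : open C -> compact K -> K `<=` C ->
  (forall x, C x -> d2 F dF ddF x) -> (forall x, C x -> ~ K x -> F x = 0) ->
  [/\ C2c C (extend C F), forall x, C x -> laplacian (extend C F) x = trace ddF x &
      forall x, C x -> gradient (extend C F) x = dF x].
Proof.
move=> oC cK KC HF F0.
have near_in x : C x -> \forall y \near x, d2 (extend C F) dF ddF y.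
  move=> Cx; have CC := open_near oC Cx.
  have := near_near CC; apply: filterS2 CC => y Cy CCy.
  apply: d2_near (HF y Cy) => [||i]; try exact: near_all.
  by apply: filterS CCy => z Cz; rewrite extendT.
have zero x : ~ K x -> extend C F x = 0.
  by move=> nK; rewrite /extend; case: asboolP => // Cx; exact: F0.
split.
- split.
    apply: C2_local => x; have [Cx|Cx] := pselect (C x); first by exists dF, ddF; exact: near_in.
    have nK : ~ K x by move=> /KC.
    exists (fun=> 0), (fun _ _ => 0).
    have : \forall y \near x, (~` K) y.
      by apply: open_near nK; apply: closed_openC; exact: compact_rV_closed.
    move=> /near_near; apply: filterS => y hy.
    apply: d2_near (d2_cst 0 y) => [||i]; try exact: near_all.
    by apply: filterS hy => z /zero.
  by exists K.
- by move=> x Cx; apply: laplacianE; exact: near_in.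
- by move=> x Cx; apply: (d2_gradient (nbhs_singleton (near_in x Cx))).
Qed.

Lemma C2c_continuous C f : C2c C f -> continuous f.
Proof. by case=> [[]]. Qed.

Lemma C2c_supp0 C f x : C2c C f -> ~ C x -> f x = 0.
Proof. by case=> _ [K [_ KC] K0] nC; apply: K0 => /KC. Qed.

Lemma compact_max K f : compact K -> continuous f -> exists M, forall x, K x -> f x <= M.
Proof.
move=> cK cf; have [[x0 Kx0]|/set0P/negP/negPn/eqP K0] := pselect (K !=set0); last first.
  by exists 0 => x; rewrite K0.
have [||c _ hc] := @EVT_max_rV R n f K _ cK; first by exists x0.
  exact: continuous_subspaceT.
by exists (f c) => x Kx; apply: hc; rewrite inE.
Qed.

Lemma compact_min_gt0 K f : compact K -> continuous f -> (forall x, K x -> 0 < f x) ->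
  exists2 m, 0 < m & forall x, K x -> m <= f x.
Proof.
move=> cK cf f0; have [[x0 Kx0]|/set0P/negP/negPn/eqP K0] := pselect (K !=set0); last first.
  by exists 1 => // x; rewrite K0.
have [||c cK' hc] := @EVT_min_rV R n f K _ cK; first by exists x0.
  exact: continuous_subspaceT.
exists (f c) => [|x Kx]; last by apply: hc; rewrite inE.
by apply: f0; rewrite inE in cK'.
Qed.

Lemma supp_bounded K f : compact K -> continuous f -> (forall x, ~ K x -> f x = 0) ->
  exists M, forall x, `|f x| <= M.
Proof.
move=> cK cf f0; have [M hM] := @compact_max K (fun x => `|f x|) cK
  (fun x => continuous_comp (cf x) (@norm_continuous _ _ (f x))).
exists (Num.max M 0) => x; rewrite le_max; have [/hM->//|/f0->] := pselect (K x).
by rewrite normr0 lexx orbT.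
Qed.

Definition unif_cont f : Prop := forall e, 0 < e -> exists2 d, 0 < d &
  forall x y : 'rV[R]_n, `|x - y| < d -> `|f x - f y| <= e.

Lemma supp_unif_cont K f : compact K -> continuous f -> (forall x, ~ K x -> f x = 0) ->
  unif_cont f.
Proof.
move=> cK cf f0 e e0.
have : \forall d \near (0 : R)^'+, forall x, K x ->
    (fun d x => forall y : 'rV[R]_n, `|x - y| < d -> `|f x - f y| <= e) d x.
  have /compact_near_coveringP := cK; apply => x Kx.
  have e2 : 0 < e / 2 by rewrite divr_gt0.
  have /cvgrPdist_lt/(_ (e / 2) e2) := cf x.
  move=> /nbhs_ballP[r /= r0 hr].
  exists (ball x (r / 2), [set d : R | 0 < d < r / 2]) => /=.
    split; first by apply: nbhsx_ballx; rewrite divr_gt0.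
    by near=> d; apply/andP; split; near: d; [exact: nbhs_right_gt|apply: nbhs_right_lt; rewrite divr_gt0].
  move=> [x' d] /= [xx' /andP[d0 dr]] y xy.
  have xy' : ball x r y.
    rewrite -ball_normE /= -(subrKA x') (le_lt_trans (ler_normD _ _)) //.
    by rewrite (splitr r) ltrD // ?(lt_trans xy) //; rewrite -ball_normE in xx'.
  have xx2 : ball x r x' by apply: le_ball xx'; rewrite ler_pdivrMr // ler_peMr ?(ltW r0) // ler1n.
  have := hr _ xy'; have := hr _ xx2 => /= h1 h2.
  rewrite -(subrKA (f x)) (le_trans (ler_normD _ _)) // (splitr e) lerD // ?ltW //.
  by rewrite distrC.
move=> H.
have [d [d0 hd]] : exists d : R, 0 < d /\ forall x, K x ->
    forall y : 'rV[R]_n, `|x - y| < d -> `|f x - f y| <= e.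
  near (0 : R)^'+ => d; exists d; split; near: d; first exact: nbhs_right_gt.
  exact: H.
exists d => // x y xy; have [Kx|nKx] := pselect (K x); first exact: hd.
have [Ky|nKy] := pselect (K y); first by rewrite distrC; apply: hd => //; rewrite distrC.
by rewrite !f0 // subrr normr0 ltW.
Unshelve. all: by end_near. Qed.

End CompactSupport.

(** * Measures on Borel sets of row vectors *)

Section Density.
Local Open Scope ereal_scope.
Context {d : measure_display} {T : measurableType d} {R : realType}.
Variables (m k : {measure set T -> \bar R}) (f : T -> R).
Hypotheses (f0 : forall x, (0 <= f x)%R) (mf : measurable_fun setT f).
Hypothesis kE : forall A, measurable A -> k A = \int[m]_(x in A) (f x)%:E.

Import HBNNSimple.

Let density_nnsfun (h : {nnsfun T >-> R}) :
  \int[k]_x (h x)%:E = \int[m]_x ((h x)%:E * (f x)%:E).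
Proof.
have mfE : measurable_fun setT (EFin \o f) by apply/measurable_EFinP.
transitivity (\int[k]_x (\sum_(y \in range h) (y * \1_(h @^-1` [set y]) x)%:E)).
  by apply: eq_integral => x _; rewrite /= fimfunE -fsumEFin.
have ind r : measurable_fun setT (fun x => (r * \1_(h @^-1` [set r]) x)%:E).
  by apply/measurable_EFinP; exact: measurable_funM.
rewrite ge0_integral_fsum //; last by move=> y x _; exact: nnfun_muleindic_ge0.
transitivity (\int[m]_x (\sum_(y \in range h) (y * \1_(h @^-1` [set y]) x)%:E * (f x)%:E)).
  rewrite ge0_integral_fsum //; last 2 first.
  - by move=> y; exact: emeasurable_funM.
  - by move=> y x _; apply: mule_ge0; [rewrite EFinM; exact: nnfun_muleindic_ge0|rewrite lee_fin].
  apply: eq_fsbigr => r; rewrite inE => -[t _ <-].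
  under [LHS]eq_integral do rewrite EFinM.
  rewrite integralZl_indic_nnsfun // integral_indic // setIT kE //.
  under [RHS]eq_integral do rewrite EFinM -muleA.
  rewrite ge0_integralZl //; last by rewrite lee_fin.
  - congr (_ * _); rewrite integral_mkcond; apply: eq_integral => x _.
    by rewrite epatch_indic /= muleC.
  - by apply: emeasurable_funM => //; apply/measurable_EFinP.
  - by move=> x _; rewrite mule_ge0 ?lee_fin.
apply: eq_integral => x _; rewrite -ge0_mule_fsuml => [|y]; last exact: nnfun_muleindic_ge0.
by rewrite fsumEFin // -(fimfunE _ x).
Qed.

Lemma integral_density (g : T -> \bar R) : (forall x, 0 <= g x) -> measurable_fun setT g ->
  \int[k]_x g x = \int[m]_x (g x * (f x)%:E).
Proof.
move=> g0 mg; pose h := nnsfun_approx measurableT mg.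
have mfE : measurable_fun setT (EFin \o f) by apply/measurable_EFinP.
have mh n : measurable_fun setT (EFin \o h n).
  by apply/measurable_EFinP; exact/measurable_funP.
have ndh x : {homo (fun n => (h n x)%:E) : a b / (a <= b)%N >-> a <= b}.
  by move=> a b ab; rewrite lee_fin; exact/lefP/nd_nnsfun_approx.
have ndhf x : {homo (fun n => (h n x)%:E * (f x)%:E) : a b / (a <= b)%N >-> a <= b}.
  by move=> a b ab; apply: lee_wpmul2r; [rewrite lee_fin|exact: ndh].
have L1 := @cvg_monotone_convergence _ _ _ k setT measurableT (fun n x => (h n x)%:E) mh
  (fun n x _ => ltac:(by rewrite lee_fin)) (fun x _ => ndh x).
have L2 := @cvg_monotone_convergence _ _ _ m setT measurableT
  (fun n x => (h n x)%:E * (f x)%:E) (fun n => emeasurable_funM (mh n) mfE)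
  (fun n x _ => ltac:(by rewrite mule_ge0 ?lee_fin))
  (fun x _ => ndhf x).
have hg x : (h n x)%:E @[n --> \oo] --> g x by exact: cvg_nnsfun_approx.
have -> : \int[k]_x g x = \int[k]_x (limn (fun n => (h n x)%:E)).
  by apply: eq_integral => x _; apply/esym/cvg_lim => //; exact: hg.
have -> : \int[m]_x (g x * (f x)%:E) = \int[m]_x (limn (fun n => (h n x)%:E * (f x)%:E)).
  by apply: eq_integral => x _; apply/esym/cvg_lim => //; apply: cvgeZr => //; exact: hg.
apply/esym; move: L1; rewrite (_ : (fun n => _) = fun n => \int[m]_x ((h n x)%:E * (f x)%:E)).
  by move=> L1; have := cvg_unique _ L2 L1; apply.
by apply/funext => n; exact: density_nnsfun.
Qed.

End Density.

Section DensityMeasure.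
Local Open Scope ereal_scope.
Context {d : measure_display} {T : measurableType d} {R : realType}.
Variables (m : {measure set T -> \bar R}) (f : T -> R).
Hypotheses (f0 : forall x, (0 <= f x)%R) (mf : measurable_fun setT f).

Definition with_density (A : set T) := \int[m]_(x in A) (f x)%:E.

Let with_density0 : with_density set0 = 0.
Proof. exact: integral_set0. Qed.

Let with_density_ge0 A : 0 <= with_density A.
Proof. by apply: integral_ge0 => x _; rewrite lee_fin. Qed.

Let with_density_sigma_additive : semi_sigma_additive with_density.
Proof.
move=> F mF tF mUF; rewrite /with_density ge0_integral_bigcup //.
- by apply: is_cvg_ereal_nneg_natsum_cond => n _ _; exact: with_density_ge0.
- by apply: measurable_funTS; apply/measurable_EFinP.
- by move=> x _; rewrite lee_fin.
Qed.

HB.instance Definition _ := isMeasure.Build _ _ _ with_density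
  with_density0 with_density_ge0 with_density_sigma_additive.

Lemma exists_density : exists k : {measure set T -> \bar R}, forall A, k A = with_density A.
Proof. by exists with_density. Qed.

End DensityMeasure.

Section Pushforward.
Context {d1 d2 : measure_display} {T1 : measurableType d1} {T2 : measurableType d2}.
Context {R : realType}.

(** Stated as an existence, so that later proofs handle an abstract bundled measure together with
    this one equation. *)
Lemma exists_pushforward (m : {measure set T1 -> \bar R}) (f : T1 -> T2) :
  measurable_fun setT f -> exists mu : {measure set T2 -> \bar R},
    (mu : set T2 -> \bar R) = pushforward m f.
Proof.
by move=> mf; exists (measure_function_pushforward__canonical__measure_function_Measure m mf).
Qed.

End Pushforward.

Section SigmaFinite.
Context {d : measure_display} {T : measurableType d} {R : realType}.
Variables (mu : {measure set T -> \bar R}) (sf : sigma_finite setT mu).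

Let mus : set T -> \bar R := mu.

HB.instance Definition _ := Measure.on mus.

Let mus_sigma_finite : sigma_finite setT mus := sf.

HB.instance Definition _ := Measure_isSigmaFinite.Build _ _ _ mus mus_sigma_finite.

Lemma exists_sigma_finite : exists m : {sigma_finite_measure set T -> \bar R},
  (m : set T -> \bar R) = mu.
Proof. by exists mus. Qed.

End SigmaFinite.

(** * Borel sets of row vectors and their generation by rectangles *)

Section BorelRows.
Context {R : realType} {n : nat}.
Local Notation bT := (borel_rV R n).

Definition rect (I : 'I_n -> set R) : set bT := [set x : 'rV[R]_n | forall i, I i (x 0 i)].

Definition rects : set (set bT) :=
  [set A | exists2 I : 'I_n -> set R, (forall i, measurable (I i)) & A = rect I].

Lemma open_measurable_rV (U : set 'rV[R]_n) : open U -> measurable (U : set bT).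
Proof. by move=> oU; exact: sub_sigma_algebra. Qed.

Lemma continuous_measurable_rV (f : 'rV[R]_n -> R) : continuous f ->
  measurable_fun (setT : set bT) (f : bT -> R).
Proof.
move=> cf; apply: (measurability (@RGenOInfty.G R)); first exact: RGenOInfty.measurableE.
move=> _ [_ [a ->] <-].
rewrite setTI; apply: open_measurable_rV; apply: open_comp => // x _; exact: cf.
Qed.

Lemma coord_measurable i : measurable_fun (setT : set bT) (fun x : bT => (x : 'rV[R]_n) 0 i).
Proof. by apply: continuous_measurable_rV; exact: coord_continuous. Qed.

Lemma rects_setI : setI_closed rects.
Proof.
move=> _ _ [I mI ->] [J mJ ->]; exists (fun i => I i `&` J i) => [i|]; first exact: measurableI.
by apply/seteqP; split => [x [h1 h2] i //|x h]; split => i; have [] := h i.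
Qed.

Lemma rects_measurable : rects `<=` measurable.
Proof.
move=> _ [I mI ->].
have -> : rect I = \bigcap_(i in [set: 'I_n]) ((fun x : bT => (x : 'rV[R]_n) 0 i) @^-1` I i).
  by apply/seteqP; split => [x h i _|x h i]; exact: h.
apply: fin_bigcap_measurable => // i _; rewrite -[X in measurable X]setTI.
exact: coord_measurable.
Qed.

Lemma ball_rect (x : 'rV[R]_n) (r : R) : 0 < r ->
  (ball x r : set bT) = rect (fun i => `]x 0 i - r, x 0 i + r[%classic).
Proof.
move=> r0; apply/seteqP; split => y; rewrite -ball_normE /=.
  move=> h i /=; rewrite in_itv /=.
  have := le_lt_trans (coord_le_norm (x - y) i) h; rewrite !mxE ltr_norml.
  by move=> /andP[h1 h2]; apply/andP; split; lra.
move=> h; apply: norm_lt_coord => // i; have := h i; rewrite /= in_itv /= !mxE ltr_norml.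
by move=> /andP[h1 h2]; apply/andP; split; lra.
Qed.

Lemma open_bigcup_ball (U : set 'rV[R]_n) : open U ->
  exists F : nat -> set 'rV[R]_n, U = \bigcup_k F k /\
    forall k, F k = set0 \/ exists x r, 0 < r /\ F k = ball x r.
Proof.
move=> oU.
pose c (q : 'rV[rat]_n) : 'rV[R]_n := \row_i ratr (q 0 i).
(* All balls with rational centre and radius 1 / (m + 1) that are contained in U, enumerated by
   codes. Codes without meaning and balls not inside U give the empty set. *)
pose F k := match @choice.unpickle ('rV[rat]_n * nat)%type k with
  | Some (q, m) => if `[< ball (c q) m.+1%:R^-1 `<=` U >] then ball (c q) m.+1%:R^-1 else set0
  | None => set0 end.
exists F; split; last first.
  move=> k; rewrite /F; case: choice.unpickle => [[q m]|]; last by left.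
  by case: asboolP => _; [right; exists (c q), m.+1%:R^-1; rewrite invr_gt0|left].
apply/seteqP; split => x; last first.
  case=> k _; rewrite /F; case: choice.unpickle => [[q m]|//].
  by case: asboolP => // h; exact: h.
move=> Ux; have /nbhs_ballP[r /= r0 hr] : nbhs x U by apply: open_nbhs_nbhs.
have [m hm] : exists m : nat, m.+1%:R^-1 < r / 2.
  exists (Num.truncn (r / 2)^-1); rewrite -[ltRHS]invrK ltf_pV2 ?posrE ?invr_gt0 ?divr_gt0 //.
  exact: truncnS_gt.
have m0 : 0 < m.+1%:R^-1 :> R by rewrite invr_gt0.
have [q hq] : exists q : 'rV[rat]_n, ball (c q) m.+1%:R^-1 x.
  have /choice[q hq] : forall i : 'I_n, exists s : rat, `|(ratr s : R) - x 0 i| < m.+1%:R^-1.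
    move=> i; have [|s] := @rat_in_itvoo R (x 0 i - m.+1%:R^-1) (x 0 i + m.+1%:R^-1).
      by rewrite ltrBlDr -addrA ltrDl addr_gt0.
    rewrite in_itv /= => /andP[h1 h2]; exists s.
    rewrite ltr_norml; apply/andP; split; first by rewrite ltrBrDl; exact: h1.
    by rewrite ltrBlDl; exact: h2.
  exists (\row_i q i); rewrite -ball_normE /=; apply: norm_lt_coord => // i.
  by rewrite !mxE.
exists (choice.pickle (q, m)) => //; rewrite /F choice.pickleK; case: asboolP => // H; exfalso; apply: H.
move=> y hy; apply: hr; rewrite (splitr r).
apply: (ball_triangle (y := c q)).
  by apply: ball_sym; apply: le_ball hq; exact: ltW.
by apply: le_ball hy; exact: ltW.
Qed.

(** The norm is the sup norm, so balls are rectangles, and every open set is a countable union of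
    balls. *)
Lemma measurable_rects : (measurable : set (set bT)) = <<s rects >>.
Proof.
apply/seteqP; split; last first.
  by apply: smallest_sub; [exact: sigma_algebra_measurable|exact: rects_measurable].
apply: smallest_sub; first exact: smallest_sigma_algebra.
move=> U oU; have [F [-> hF]] := open_bigcup_ball oU.
have [_ _ bU] := smallest_sigma_algebra [set: bT] rects.
apply: bU => k; have [->|[x [r [r0 ->]]]] := hF k.
  by have [s0 _ _] := smallest_sigma_algebra [set: bT] rects.
apply: sub_sigma_algebra; rewrite (ball_rect _ r0).
by exists (fun i => `]x 0 i - r, x 0 i + r[%classic).
Qed.

Lemma measurable_fun_rV {d} {T : measurableType d} (f : T -> bT) :
  (forall i, measurable_fun setT (fun t => (f t : 'rV[R]_n) 0 i)) -> measurable_fun setT f.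
Proof.
move=> H; apply: (measurability rects); first exact: measurable_rects.
move=> _ [_ [I mI ->] <-].
rewrite setTI.
have -> : f @^-1` rect I = \bigcap_(i in [set: 'I_n]) ((fun t => (f t : 'rV[R]_n) 0 i) @^-1` I i).
  by apply/seteqP; split => [x h i _|x h i]; exact: h.
apply: fin_bigcap_measurable => // i _; rewrite -[X in measurable X]setTI.
exact: H.
Qed.

Lemma measurable_coord {d} {T : measurableType d} (f : T -> bT) i :
  measurable_fun setT f -> measurable_fun setT (fun t => (f t : 'rV[R]_n) 0 i).
Proof. by move=> mf; exact: (measurableT_comp (coord_measurable i) mf). Qed.

Lemma measurable_addrV {d} {T : measurableType d} (f g : T -> bT) :
  measurable_fun setT f -> measurable_fun setT g ->
  measurable_fun setT (fun t => ((f t : 'rV[R]_n) + (g t : 'rV[R]_n))%R : bT).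
Proof.
move=> mf mg; apply: measurable_fun_rV => i.
under eq_fun do rewrite mxE.
by apply: measurable_funD; exact: measurable_coord.
Qed.

Lemma finite_measure_rV_unique (m1 m2 : {measure set bT -> \bar R}) :
  (m1 setT < +oo)%E ->
  (forall I, (forall i, measurable (I i)) -> m1 (rect I) = m2 (rect I)) ->
  forall A, measurable A -> m1 A = m2 A.
Proof.
move=> m1T H; have rT : rects setT.
  by exists (fun=> setT) => //; apply/seteqP; split.
apply: (measure_unique rects (fun=> setT) measurable_rects rects_setI) => //.
- by rewrite bigcup_const.
- by move=> _ [I mI ->]; exact: H.
Qed.

End BorelRows.

(** * The iterated Lebesgue measure *)

Section LebesgueRows.
Context {R : realType}.

Lemma row_mx_const_coord (m : nat) (t : R) (v : 'rV[R]_m) (i : 'I_m.+1) :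
  (row_mx (const_mx t : 'rV[R]_1) v : 'rV[R]_m.+1) 0 i = oapp (fun j => v 0 j) t (unlift 0 i).
Proof.
rewrite mxE; case: splitP => j ij.
  have -> : i = 0 by apply: val_inj; rewrite /= ij (ord1 j).
  by rewrite unlift_none /= mxE.
have -> : i = lift 0 j by apply: val_inj; rewrite /= ij.
by rewrite liftK.
Qed.

Definition cube (n k : nat) : set (borel_rV R n) :=
  [set x : 'rV[R]_n | forall i, `|x 0 i| <= k%:R].

Arguments cube : clear implicits.

(** One step of the recursion is the image of a product measure under prepending a coordinate.
    Finiteness on cubes goes through the induction because it yields the sigma-finiteness required
    by the next product. *)
Lemma lebesgue_rV_measure n : exists m : {sigma_finite_measure set (borel_rV R n) -> \bar R},
  @lebesgue_rV R n = m /\ forall k : nat, (m (cube n k) < +oo)%E.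
Proof.
elim: n => [|n [m [mE mc]]].
  exists (dirac (0 : borel_rV R 0)); split => // k.
  by rewrite /= diracE; case: (_ \in _); rewrite ltry.
pose phi (p : R * borel_rV R n) : borel_rV R n.+1 :=
  row_mx (const_mx p.1 : 'rV[R]_1) (p.2 : 'rV[R]_n) : 'rV[R]_n.+1.
have mphi : measurable_fun setT phi.
  apply: measurable_fun_rV => i; rewrite /phi.
  under eq_fun do rewrite row_mx_const_coord.
  case: (unlift 0 i) => [j|] /=; last exact: measurable_fst.
  by apply: (measurable_coord (f := snd)); exact: measurable_snd.
have [mu muE] := exists_pushforward (product_measure1 (@lebesgue_measure R) m) mphi.
have lE : @lebesgue_rV R n.+1 = mu.
  rewrite muE; apply/funext => A; rewrite /pushforward /product_measure1 /= mE.
  apply: eq_integral => t _; congr (m _); apply/seteqP; split => v /=;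
    by rewrite /xsection /= inE.
have cubeE k : phi @^-1` cube n.+1 k = `[- k%:R, k%:R]%classic `*` cube n k.
  apply/seteqP; split => [[t v] h|[t v] [h1 h2] i].
    split => /=; first by have := h 0; rewrite row_mx_const_coord unlift_none /= in_itv /= ler_norml.
    by move=> i; have := h (lift 0 i); rewrite row_mx_const_coord liftK.
  rewrite /phi row_mx_const_coord; case: unliftP => [j _|_] /=; first exact: h2.
  by move: h1; rewrite /= in_itv /= ler_norml.
have mcube k : measurable (cube n k).
  have -> : cube n k = rect (fun=> `[- k%:R, k%:R]%classic).
    apply/seteqP; split => x h i; have := h i; rewrite /= in_itv /= ler_norml //.
  by apply: rects_measurable; exists (fun=> `[- k%:R, k%:R]%classic).
have muc k : (mu (cube n.+1 k) < +oo)%E.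
  rewrite muE /pushforward cubeE /=.
  have -> := product_measure1E (@lebesgue_measure R) m (measurable_itv `[- k%:R, k%:R]) (mcube k).
  pose I : set R := `[- k%:R, k%:R]%classic.
  have fin : (@lebesgue_measure R I < +oo)%E.
    by rewrite lebesgue_measure_itv /=; case: ifP => _; rewrite -?EFinB ltry.
  by apply: lte_mul_pinfty => //; rewrite ge0_fin_numE.
have sf : sigma_finite setT mu.
  exists (cube n.+1) => [|k].
    apply/seteqP; split => // x _; have [k hk] : exists k : nat, `|x : 'rV[R]_n.+1| <= k%:R.
      by exists (Num.truncn `|x : 'rV[R]_n.+1|).+1; rewrite ltW // truncnS_gt.
    by exists k => // i; apply: le_trans hk; exact: coord_le_norm.
  split; last exact: muc.
  have -> : cube n.+1 k = rect (fun=> `[- k%:R, k%:R]%classic).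
    apply/seteqP; split => x h i; have := h i; rewrite /= in_itv /= ler_norml //.
  by apply: rects_measurable; exists (fun=> `[- k%:R, k%:R]%classic).
have [m' m'E] := exists_sigma_finite sf.
by exists m'; rewrite m'E.
Qed.

End LebesgueRows.

(** * Moments of Brownian increments *)

Section BoundedIntegrals.
Context {d : measure_display} {T : measurableType d} {R : realType}.
Variable mu : {measure set T -> \bar R}.
Hypothesis muT : (mu setT <= 1)%E.
Implicit Types (f g : T -> R).

Definition bmeas f : Prop := measurable_fun setT f /\ exists M, forall x, `|f x| <= M.

Local Notation E f := (\int[mu]_(x in setT) f x).
Local Notation integ f := (mu.-integrable setT (EFin \o f)).

Lemma bmeas_integrable f : bmeas f -> integ f.
Proof.
move=> [mf [M hM]]; apply: measurable_bounded_integrable => //.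
  by apply: le_lt_trans muT _; rewrite ltry.
exists M; split; first exact: num_real.
by move=> x Mx y _; apply: le_trans (hM y) (ltW Mx).
Qed.

Lemma bmeas_cst (c : R) : bmeas (fun=> c).
Proof. by split=> //; exists `|c|. Qed.

Lemma bmeasD f g : bmeas f -> bmeas g -> bmeas (fun x => f x + g x).
Proof.
move=> [mf [M hM]] [mg [N hN]]; split; first exact: measurable_funD.
by exists (M + N) => x; apply: (le_trans (ler_normD _ _)); exact: lerD.
Qed.

Lemma bmeasM f g : bmeas f -> bmeas g -> bmeas (fun x => f x * g x).
Proof.
move=> [mf [M hM]] [mg [N hN]]; split; first exact: measurable_funM.
by exists (M * N) => x; rewrite normrM ler_pM.
Qed.

Lemma bmeasN f : bmeas f -> bmeas (fun x => - f x).
Proof.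
move=> [mf [M hM]]; split; first exact: measurableT_comp.
by exists M => x; rewrite normrN.
Qed.

Lemma bmeasB f g : bmeas f -> bmeas g -> bmeas (fun x => f x - g x).
Proof. by move=> bf bg; apply: bmeasD => //; exact: bmeasN. Qed.

Lemma bmeasZ (c : R) f : bmeas f -> bmeas (fun x => c * f x).
Proof. by move=> bf; apply: bmeasM => //; exact: bmeas_cst. Qed.

Lemma bmeas_sum (I : Type) (r : seq I) (F : I -> T -> R) :
  (forall i, bmeas (F i)) -> bmeas (fun x => \sum_(i <- r) F i x).
Proof.
move=> H; elim: r => [|i r IH].
  by under eq_fun do rewrite big_nil; exact: bmeas_cst.
by under eq_fun do rewrite big_cons; exact: bmeasD.
Qed.

Lemma bmeas_indic (A : set T) : measurable A -> bmeas (\1_A : T -> R).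
Proof.
move=> mA; split; first exact: measurable_indic.
by exists 1 => x; rewrite indicE; case: (_ \in _); rewrite ?normr1 ?normr0.
Qed.

Lemma bmeas_cvg (u : nat -> T -> R) f (M : R) : (forall k, measurable_fun setT (u k)) ->
  (forall k x, `|u k x| <= M) -> (forall x, u k x @[k --> \oo] --> f x) -> bmeas f.
Proof.
move=> mu_ hM cu; split.
  by apply: (measurable_fun_cvg mu_) => x _; exact: cu.
exists M => x; have : `|u k x| @[k --> \oo] --> `|f x| by exact: cvg_norm.
by move=> h; apply: (closed_cvg (fun y : R => y <= M)) h; [exact: closed_le|exact: nearW].
Qed.

Lemma expD f g : integ f -> integ g -> E (fun x => f x + g x) = E f + E g.
Proof. by move=> hf hg; rewrite RintegralD. Qed.

Lemma expB f g : integ f -> integ g -> E (fun x => f x - g x) = E f - E g.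
Proof. by move=> hf hg; rewrite RintegralB. Qed.

Lemma expZ (c : R) f : integ f -> E (fun x => c * f x) = c * E f.
Proof. by move=> hf; rewrite RintegralZl. Qed.

Lemma integZ (c : R) f : integ f -> integ (fun x => c * f x).
Proof.
move=> hf; apply: (eq_integrable measurableT) (integrableZl measurableT c hf) => x _.
by rewrite /= EFinM.
Qed.

Lemma integD f g : integ f -> integ g -> integ (fun x => f x + g x).
Proof.
move=> hf hg; apply: (eq_integrable measurableT) (integrableD measurableT hf hg) => x _.
by rewrite /= EFinD.
Qed.

Lemma integB f g : integ f -> integ g -> integ (fun x => f x - g x).
Proof.
move=> hf hg; apply: (eq_integrable measurableT) (integrableB measurableT hf hg) => x _.
by rewrite /= EFinB.
Qed.

Lemma integ_sum (I : Type) (r : seq I) (F : I -> T -> R) :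
  (forall i, integ (F i)) -> integ (fun x => \sum_(i <- r) F i x).
Proof.
move=> H; elim: r => [|i r IH].
  by under [X in integrable _ _ X]eq_fun do rewrite /= big_nil; exact: integrable0.
by under [X in integrable _ _ X]eq_fun do rewrite /= big_cons; exact: integD.
Qed.

Lemma exp_sum (I : Type) (r : seq I) (F : I -> T -> R) : (forall i, integ (F i)) ->
  E (fun x => \sum_(i <- r) F i x) = \sum_(i <- r) E (F i).
Proof.
move=> H; elim: r => [|i r IH].
  by under eq_Rintegral do rewrite big_nil; rewrite big_nil Rintegral_cst // mul0r.
under eq_Rintegral do rewrite big_cons.
by rewrite expD ?IH ?big_cons //; exact: integ_sum.
Qed.

Lemma exp_le f g : integ f -> integ g -> (forall x, f x <= g x) -> E f <= E g.
Proof. by move=> hf hg fg; apply: le_Rintegral. Qed.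

Lemma exp_ge0 f : (forall x, 0 <= f x) -> 0 <= E f.
Proof. by move=> hf; exact: Rintegral_ge0. Qed.

Lemma exp_norm f : integ f -> `|E f| <= E (fun x => `|f x|).
Proof. by move=> hf; exact: le_normr_Rintegral. Qed.

Lemma exp_cst_le (c : R) : 0 <= c -> E (fun=> c) <= c.
Proof.
move=> c0; rewrite Rintegral_cst // ler_piMr // -lee_fin fineK //.
by rewrite ge0_fin_numE // (le_lt_trans muT) // ltry.
Qed.

Lemma exp_bound f (M : R) : bmeas f -> (forall x, `|f x| <= M) -> `|E f| <= M.
Proof.
move=> bf hM; have M0 : 0 <= M.
  have [x|noT] := pselect (inhabited T); first by case: x => x; exact: le_trans (hM x).
  exact: le_trans (normr_ge0 _) (hM point).
apply: le_trans (exp_norm (bmeas_integrable bf)) _.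
apply: le_trans (exp_cst_le M0); apply: exp_le => //.
- by apply: bmeas_integrable; split; [exact: measurableT_comp bf.1|exists M => x; rewrite normr_id].
- by apply: bmeas_integrable; exact: bmeas_cst.
Qed.

Lemma exp_cvg (u : nat -> T -> R) f (M : R) : (forall k, measurable_fun setT (u k)) ->
  (forall k x, `|u k x| <= M) -> (forall x, u k x @[k --> \oo] --> f x) ->
  E (u k) @[k --> \oo] --> E f.
Proof.
move=> mu_ hM cu; have bf := bmeas_cvg mu_ hM cu.
have bu k : bmeas (u k) by split=> //; exists M.
have [|||||_ _ H] := @dominated_convergence _ _ _ mu setT measurableT
    (fun k x => (u k x)%:E) (fun x => (f x)%:E) (fun=> M%:E).
- by move=> k; exact/measurable_EFinP.
- exact/measurable_EFinP/bf.1.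
- by apply: aeW => x _; apply: cvg_EFin => //; [exact: nearW|exact: cu].
- exact: (bmeas_integrable (bmeas_cst M)).
- by apply: aeW => x k _; rewrite lee_fin.
have fin g : bmeas g -> (\int[mu]_x (g x)%:E = (E g)%:E)%E.
  move=> bg; rewrite /Rintegral fineK //.
  exact: (integrable_fin_num measurableT (bmeas_integrable bg)).
move: H; rewrite fin // (_ : (fun k => _) = fun k => (E (u k))%:E); last first.
  by apply/funext => k; rewrite fin.
by move=> /fine_cvgP[].
Qed.

Lemma EFin_exp f : integ f -> (E f)%:E = (\int[mu]_x (f x)%:E)%E.
Proof.
by move=> hf; rewrite /Rintegral fineK //; exact: (integrable_fin_num measurableT hf).
Qed.

End BoundedIntegrals.

(** * Second and fourth moments of the normal law *)

Section NormalMoments.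
Context {R : realType}.
Implicit Types (s t x : R).
Local Notation mu := (@lebesgue_measure R).

Lemma normal_integral s (g : R -> R) : s != 0 -> (forall x, 0 <= g x) -> measurable_fun setT g ->
  (\int[normal_prob 0 s]_x (g x)%:E = \int[mu]_x (g x * normal_pdf 0 s x)%:E)%E.
Proof.
move=> s0 g0 mg.
rewrite (@integral_density _ _ _ mu (normal_prob 0 s) (normal_pdf 0 s)) //.
- by move=> x; exact: normal_pdf_ge0.
- exact: measurable_normal_pdf.
- exact/measurable_EFinP.
Qed.

Lemma normal_peakE s : 0 < s -> normal_peak s = (s * Num.sqrt (pi *+ 2))^-1.
Proof.
move=> s0; rewrite /normal_peak -mulrnAr sqrtrM ?sqr_ge0 // sqrtr_sqr ger0_norm //.
exact: ltW.
Qed.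

(** The integrand turns the density with deviation s into t / s times the density with deviation t.
    This exact integral is the source of both moments: t > s dominates x^4, and t < s gives the
    Laplace transform of x^2. *)
Lemma normal_exp_ratio s t : 0 < s -> 0 < t ->
  (\int[normal_prob 0 s]_x (expR (x ^+ 2 / (s ^+ 2 *+ 2) - x ^+ 2 / (t ^+ 2 *+ 2)))%:E = (t / s)%:E)%E.
Proof.
move=> s0 t0; have mg : measurable_fun setT
    (fun x : R => expR (x ^+ 2 / (s ^+ 2 *+ 2) - x ^+ 2 / (t ^+ 2 *+ 2))).
  apply: measurableT_comp => //; apply: measurable_funB; apply: measurable_funM => //;
    exact: exprn_measurable.
rewrite (normal_integral (lt0r_neq0 s0) (fun x => expR_ge0 _) mg).
have h x : expR (x ^+ 2 / (s ^+ 2 *+ 2) - x ^+ 2 / (t ^+ 2 *+ 2)) * normal_pdf 0 s x =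
    (t / s) * normal_pdf 0 t x.
  rewrite !normal_pdfE ?gt_eqF // /normal_fun !subr0 !normal_peakE //.
  rewrite mulrCA -expRD.
  have -> : x ^+ 2 / (s ^+ 2 *+ 2) - x ^+ 2 / (t ^+ 2 *+ 2) + - x ^+ 2 / (s ^+ 2 *+ 2) =
            - x ^+ 2 / (t ^+ 2 *+ 2) by ring.
  rewrite [in RHS]mulrA; congr (_ * _).
  have p0 : Num.sqrt (pi *+ 2) != 0 :> R by rewrite gt_eqF // sqrtr_gt0 pmulrn_lgt0 // pi_gt0.
  by field; rewrite p0 !gt_eqF.
under eq_integral do rewrite h EFinM.
rewrite ge0_integralZl //.
- by rewrite integral_normal_pdf mule1.
- by apply/measurable_EFinP; exact: measurable_normal_pdf.
- by move=> x _; rewrite lee_fin normal_pdf_ge0.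
- by rewrite lee_fin divr_ge0 // ltW.
Qed.

Lemma measurable_exprn (k : nat) : measurable_fun setT (fun x : R => x ^+ k).
Proof. exact: exprn_measurable. Qed.

Lemma normal_moment4 s : 0 < s ->
  (\int[normal_prob 0 s]_x (x ^+ 4)%:E <= (128 * s ^+ 4)%:E)%E.
Proof.
(* With this t the exponent is z = x^2 / (4 s^2). From exp z >= (1 + z / 2)^2 >= z^2 / 4 follows x^4
   <= 64 s^4 exp z, and the expectation sqrt 2 of exp z is rounded up to 2. *)
move=> s0; pose t := Num.sqrt 2 * s.
have t0 : 0 < t by rewrite mulr_gt0 // sqrtr_gt0.
have tE : t ^+ 2 = 2 * s ^+ 2 by rewrite exprMn sqr_sqrtr.
have bd x : x ^+ 4 <= 64 * s ^+ 4 * expR (x ^+ 2 / (s ^+ 2 *+ 2) - x ^+ 2 / (t ^+ 2 *+ 2)).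
  pose z := x ^+ 2 / (4 * s ^+ 2).
  have z0 : 0 <= z by rewrite divr_ge0 ?sqr_ge0 // mulr_ge0 // sqr_ge0.
  have -> : x ^+ 2 / (s ^+ 2 *+ 2) - x ^+ 2 / (t ^+ 2 *+ 2) = z.
    by rewrite tE /z; field; rewrite gt_eqF.
  have -> : x ^+ 4 = 64 * s ^+ 4 * (z ^+ 2 / 4) by rewrite /z; field; rewrite gt_eqF.
  rewrite ler_wpM2l ?mulr_ge0 ?exprn_ge0 ?(ltW s0) //.
  have h := expR_ge1Dx (z / 2).
  have -> : expR z = expR (z / 2) * expR (z / 2) by rewrite -expRD -splitr.
  nra.
apply: (@le_trans _ _ (\int[normal_prob 0 s]_x (64 * s ^+ 4 *
    expR (x ^+ 2 / (s ^+ 2 *+ 2) - x ^+ 2 / (t ^+ 2 *+ 2)))%:E)%E).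
  apply: ge0_le_integral => //.
  - by move=> x _; rewrite lee_fin exprn_even_ge0.
  - by apply/measurable_EFinP; exact: measurable_exprn.
  - apply/measurable_EFinP; apply: measurable_funM => //; apply: measurableT_comp => //.
    by apply: measurable_funB; apply: measurable_funM => //; exact: measurable_exprn.
  - by move=> x _; rewrite lee_fin bd.
under eq_integral do rewrite EFinM.
rewrite ge0_integralZl //.
- rewrite normal_exp_ratio // -EFinM lee_fin /t mulfK ?gt_eqF //.
  have q2 : Num.sqrt (2 : R) ^+ 2 = 2 by rewrite sqr_sqrtr.
  have q0 := sqrtr_ge0 (2 : R).
  have : Num.sqrt (2 : R) <= 2 by nra.
  by have := exprn_ge0 4 (ltW s0); nra.
- apply/measurable_EFinP; apply: measurableT_comp => //.
  by apply: measurable_funB; apply: measurable_funM => //; exact: measurable_exprn.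
- by rewrite lee_fin mulr_ge0 // exprn_ge0 // ltW.
Qed.

Lemma expRN_taylor (z : R) : 0 <= z -> 1 - z <= expR (- z) <= 1 - z + z ^+ 2.
Proof.
move=> z0; have h1 := expR_ge1Dx (- z); have h2 := expR_ge1Dx z.
apply/andP; split; first by lra.
have : expR (- z) * expR z = 1 by rewrite -expRD addNr expR0.
have := expR_gt0 (- z); nra.
Qed.

(* The Laplace transform of x^2 at l is u := (1 + 2 l s^2)^(-1/2); its Taylor
   expansion at u = 1 yields the second moment. *)
Lemma normal_moment2 s : 0 < s ->
  (\int[normal_prob 0 s]_x (x ^+ 2)%:E = (s ^+ 2)%:E)%E.
Proof.
move=> s0; pose P : probability (measurableTypeR R) R := normal_prob 0 s.
have i4 : P.-integrable setT (EFin \o (fun x => x ^+ 4)).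
  apply/integrableP; split; first by apply/measurable_EFinP; exact: measurable_exprn.
  under eq_integral do rewrite /= ger0_norm ?exprn_even_ge0 //.
  by apply: le_lt_trans (normal_moment4 s0) _; rewrite ltry.
have i2 : P.-integrable setT (EFin \o (fun x => x ^+ 2)).
  have i14 := integD (bmeas_integrable (probability_le1 P measurableT) (bmeas_cst 1)) i4.
  apply: (le_integrable measurableT) i14; first by apply/measurable_EFinP; exact: measurable_exprn.
  move=> x _ /=; rewrite lee_fin !ger0_norm ?addr_ge0 ?exprn_even_ge0 //.
  by have : 0 <= (x ^+ 2 - 1) ^+ 2 by [rewrite sqr_ge0|]; nra.
rewrite -EFin_exp //; congr (_%:E); set V := Rintegral _ _ _.
have key u : 0 < u -> u < 1 ->
    `|2 * s ^+ 2 * u ^+ 2 / (1 + u) - V| <= 128 * s ^+ 4 * ((u ^- 2 - 1) / (2 * s ^+ 2)).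
  move=> u0 u1; pose l := (u ^- 2 - 1) / (2 * s ^+ 2).
  have l0 : 0 < l.
    by rewrite divr_gt0 ?mulr_gt0 ?exprn_gt0 // subr_gt0 invf_gt1 ?exprn_gt0 // expr_lt1 // ltW.
  pose e x : R := expR (- (l * x ^+ 2)).
  have me : measurable_fun setT e.
    apply: measurableT_comp => //; apply: measurableT_comp => //; apply: measurable_funM => //.
  have be : bmeas e.
    split=> //; exists 1 => x; rewrite ger0_norm ?expR_ge0 // -expR0 ler_expR oppr_le0.
    by rewrite mulr_ge0 ?(ltW l0) ?sqr_ge0.
  have PT : (P setT <= 1)%E by exact: probability_le1.
  have ie := bmeas_integrable PT be.
  have eE : Rintegral P setT e = u.
    apply: EFin_inj; rewrite EFin_exp //.
    have := normal_exp_ratio s0 (mulr_gt0 u0 s0); rewrite mulfK ?gt_eqF // => <-.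
    apply: eq_integral => x _; congr (expR _)%:E.
    by rewrite /l; field; rewrite !gt_eqF.
  have i1 := bmeas_integrable PT (bmeas_cst 1).
  have E1 : Rintegral P setT (fun=> 1) = 1.
    by rewrite Rintegral_cst //= (_ : P setT = 1%E) ?mulr1 //; exact: probability_setT.
  have up : u <= 1 - l * V + l ^+ 2 * Rintegral P setT (fun x => x ^+ 4).
    rewrite -eE -E1 -expZ // -expZ // -expB //; last exact: integZ.
    rewrite -expD //; [|apply: integB => //; exact: integZ|exact: integZ].
    apply: exp_le => //; first by apply: integD; [apply: integB => //|]; exact: integZ.
    move=> x; have /andP[_] := @expRN_taylor (l * x ^+ 2) ltac:(by rewrite mulr_ge0 ?(ltW l0) ?sqr_ge0).
    by rewrite exprMn -exprM.
  have dn : 1 - l * V <= u.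
    rewrite -eE -E1 -expZ // -expB //; last exact: integZ.
    apply: exp_le => //; first by apply: integB => //; exact: integZ.
    by move=> x; have /andP[] := @expRN_taylor (l * x ^+ 2) ltac:(by rewrite mulr_ge0 ?(ltW l0) ?sqr_ge0).
  have m4 : Rintegral P setT (fun x => x ^+ 4) <= 128 * s ^+ 4.
    by rewrite -lee_fin EFin_exp //; exact: normal_moment4.
  have lu : 2 * s ^+ 2 * u ^+ 2 / (1 + u) = (1 - u) / l.
    rewrite /l; field.
    have u2 : u ^+ 2 < 1 by rewrite expr_lt1 // ltW.
    by rewrite !gt_eqF //; [exact: addr_gt0|rewrite mulN1r subr_gt0].
  rewrite lu ler_norml; apply/andP; split.
    rewrite -subr_ge0 opprK -(pmulr_rge0 _ l0).
    have -> : l * ((1 - u) / l - V + 128 * s ^+ 4 * l) = 1 - u - l * V + l ^+ 2 * (128 * s ^+ 4).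
      by field; rewrite gt_eqF.
    by have : l ^+ 2 * Rintegral P setT (fun x => x ^+ 4) <= l ^+ 2 * (128 * s ^+ 4) by [rewrite ler_wpM2l ?sqr_ge0|]; lra.
  rewrite lerBlDr ler_pdivrMr // -/l.
  have : 0 <= 128 * s ^+ 4 * l * l by have := mulr_ge0 (mulr_ge0 (exprn_ge0 4 (ltW s0)) (ltW l0)) (ltW l0); lra.
  by have -> : (128 * s ^+ 4 * l + V) * l = 128 * s ^+ 4 * l * l + l * V by [ring|]; lra.
(* With w = 1 - u both errors are linear in w: 2 s^2 w for the main term, and 512 s^2 w for the
   fourth moment term, where u >= 1/2 gives (1 + u) / u^2 <= 8. Letting w tend to 0 identifies V. *)
have key2 (w : R) : 0 < w -> w <= 1 / 2 -> `|s ^+ 2 - V| <= 514 * s ^+ 2 * w.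
  move=> w0 w1; have [u wE] : exists u, w = 1 - u by exists (1 - w); ring.
  have u0 : 0 < u by lra.
  have u1 : u < 1 by lra.
  have h1 := key u u0 u1.
  have h2 : `|s ^+ 2 - 2 * s ^+ 2 * u ^+ 2 / (1 + u)| <= 2 * s ^+ 2 * w.
    have -> : s ^+ 2 - 2 * s ^+ 2 * u ^+ 2 / (1 + u) = s ^+ 2 * w * ((2 * u + 1) / (1 + u)).
      by rewrite wE; field; rewrite gt_eqF // addr_gt0.
    have q0 : 0 <= (2 * u + 1) / (1 + u) by rewrite divr_ge0 //; lra.
    have sw0 : 0 <= s ^+ 2 * w by rewrite mulr_ge0 ?sqr_ge0 // ltW.
    have -> : 2 * s ^+ 2 * w = s ^+ 2 * w * 2 by ring.
    rewrite ger0_norm ?(mulr_ge0 sw0 q0) //.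
    by apply: ler_wpM2l => //; rewrite ler_pdivrMr; lra.
  have h3 : 128 * s ^+ 4 * ((u ^- 2 - 1) / (2 * s ^+ 2)) <= 512 * s ^+ 2 * w.
    have -> : 128 * s ^+ 4 * ((u ^- 2 - 1) / (2 * s ^+ 2)) = 64 * s ^+ 2 * w * ((1 + u) / u ^+ 2).
      by rewrite wE; field; rewrite !gt_eqF.
    have -> : 512 * s ^+ 2 * w = 64 * s ^+ 2 * w * 8 by ring.
    have sw0 : 0 <= 64 * s ^+ 2 * w by rewrite mulr_ge0 ?mulr_ge0 ?sqr_ge0 // ltW.
    apply: ler_wpM2l => //; rewrite ler_pdivrMr ?exprn_gt0 //.
    have : 0 <= (u - 1 / 2) * (u + 1 / 2) by rewrite mulr_ge0 //; lra.
    by nra.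
  have := ler_distD (2 * s ^+ 2 * u ^+ 2 / (1 + u)) (s ^+ 2) V; lra.
apply/eqP; rewrite eq_sym -subr_eq0 -normr_eq0; apply: contraT => n0.
have np : 0 < `|s ^+ 2 - V| by rewrite lt_neqAle eq_sym n0 normr_ge0.
have [c [cE C0]] : exists c : R, c = 514 * s ^+ 2 /\ 0 < c.
  by exists (514 * s ^+ 2); split=> [//|]; have := exprn_gt0 2 s0; lra.
have C1 : 0 < 2 * c by lra.
pose w := Num.min (1 / 2) (`|s ^+ 2 - V| / (2 * c)).
have w0 : 0 < w by rewrite lt_min (divr_gt0 np C1) andbT; lra.
have w1 : w <= 1 / 2 by rewrite ge_min lexx.
have w2 : w * (2 * c) <= `|s ^+ 2 - V| by rewrite -ler_pdivlMr // ge_min lexx orbT.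
by have := key2 w w0 w1; rewrite -cE; lra.
Qed.

Lemma normal_opp s (A : set R) : s != 0 -> measurable A ->
  normal_prob 0 s (-%R @^-1` A) = normal_prob 0 s A.
Proof.
move=> s0 mA; rewrite /normal_prob.
have E x : normal_pdf 0 s (- x) = normal_pdf 0 s x.
  by rewrite !normal_pdfE // /normal_fun !subr0 sqrrN.
transitivity (\int[mu]_(x in -%R @^-1` A) (normal_pdf 0 s (- x))%:E)%E.
  by apply: eq_integral => x _; rewrite E.
have mN : measurable_fun setT (-%R : measurableTypeR R -> measurableTypeR R).
  by apply: continuous_measurable_fun; exact: opp_continuous.
have := @ge0_integral_pushforward _ _ _ _ R _ mN mu A (fun x => (normal_pdf 0 s x)%:E) mA.
move=> <-; last 2 first.
- by apply: measurable_funTS; apply/measurable_EFinP; exact: measurable_normal_pdf.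
- by move=> x _; rewrite lee_fin normal_pdf_ge0.
by apply: eq_measure_integral => D mD _; exact: lebesgue_measureN.
Qed.

End NormalMoments.

Section RestrictedMeasure.
Context {d : measure_display} {T : measurableType d} {R : realType}.

Lemma finite_sigma_finite (m : {measure set T -> \bar R}) : (m setT < +oo)%E ->
  exists m' : {sigma_finite_measure set T -> \bar R}, (m' : set T -> \bar R) = m.
Proof.
move=> mT; apply: exists_sigma_finite; exists (fun=> setT); first by rewrite bigcup_const.
by move=> _; split.
Qed.

Lemma exists_mrestr (m : {measure set T -> \bar R}) (E : set T) : measurable E ->
  exists m' : {measure set T -> \bar R}, forall A, m' A = m (A `&` E).
Proof. by move=> mE; exists (mrestr m mE). Qed.

End RestrictedMeasure.

Section FiniteMeasures.
Context {d d' : measure_display} {T : measurableType d} {T' : measurableType d'}.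
Context {R : realType}.

(** Tonelli's theorem under independence localized to an event E: by uniqueness of product measures,
    the law of (X, Y) restricted to E is the product of the restricted law of X with g. In this form
    it yields the Markov property on past events. *)
Lemma integral_product (m : {measure set T -> \bar R}) (E : set T) (X : T -> T') (Y : T -> T')
    (g : {measure set T' -> \bar R}) (F : T' * T' -> \bar R) :
  measurable E -> (m setT < +oo)%E -> (g setT < +oo)%E ->
  measurable_fun setT X -> measurable_fun setT Y ->
  (forall A D, measurable A -> measurable D ->
     m (E `&` X @^-1` A `&` Y @^-1` D) = (m (E `&` X @^-1` A) * g D)%E) ->
  measurable_fun setT F -> (forall z, 0 <= F z)%E ->
  (\int[m]_(w in E) F (X w, Y w) = \int[m]_(w in E) \int[g]_y F (X w, y))%E.
Proof.
move=> mE mT gT mX mY H mF F0.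
have [mr mrE] := exists_mrestr m mE.
have mrT : (mr setT < +oo)%E.
  by rewrite mrE setTI (le_lt_trans _ mT) // le_measure ?inE.
have mXY : measurable_fun setT (fun w => (X w, Y w)) by exact: measurable_fun_pair.
have [nu nuE] := exists_pushforward mr mX.
have [nu' nu'E] := exists_pushforward mr mXY.
have nuT : (nu setT < +oo)%E by rewrite nuE /pushforward preimage_setT.
have [nus nusE] := finite_sigma_finite nuT.
have [gs gsE] := finite_sigma_finite gT.
have prodE Z : measurable Z -> (nus \x gs)%E Z = nu' Z.
  apply: product_measure_unique => A D mA mD; rewrite nu'E nusE gsE nuE /pushforward !mrE.
  have -> : (fun w => (X w, Y w)) @^-1` (A `*` D) `&` E = E `&` X @^-1` A `&` Y @^-1` D.
    by apply/seteqP; split => w /= [] => [[? ?] ?|[? ?] ?].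
  by rewrite H // [X in m X]setIC.
have restr (h : T -> \bar R) : (forall w, 0 <= h w)%E -> measurable_fun setT h ->
    (\int[m]_(w in E) h w = \int[mr]_w h w)%E.
  move=> h0 mh; rewrite integral_mkcond.
  have -> : (\int[mr]_w h w = \int[m]_w (h w * (\1_E w)%:E))%E.
    apply: (@integral_density _ _ _ m mr (\1_E)) => //.
    by intros; rewrite mrE integral_indic // setIC.
  by apply: eq_integral => w _; rewrite patchE indicE; case: ifP => wE; rewrite ?mule1 ?mule0.
rewrite restr; last 2 first.
- by move=> w; exact: F0.
- exact: (measurableT_comp mF mXY).
have mG : measurable_fun setT (fun x => \int[gs]_y F (x, y))%E.
  exact: measurable_fun_fubini_tonelli_F.
transitivity (\int[nu']_z F z)%E.
  by rewrite nu'E ge0_integral_pushforward.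
transitivity (\int[(nus \x gs)%E]_z F z)%E.
  by apply: eq_measure_integral => A mA _; exact/esym/prodE.
rewrite fubini_tonelli1 //.
transitivity (\int[nu]_x \int[g]_y F (x, y))%E.
  have gg x : (\int[gs]_y F (x, y) = \int[g]_y F (x, y))%E.
    by apply: eq_measure_integral => A mA _; rewrite gsE.
  transitivity (\int[nus]_x \int[g]_y F (x, y))%E; first by apply: eq_integral => x _; exact: gg.
  by apply: eq_measure_integral => A mA _; rewrite nusE.
have mG' : measurable_fun setT (fun x => \int[g]_y F (x, y))%E.
  by move: mG; rewrite gsE.
rewrite nuE ge0_integral_pushforward //; last by move=> x _; exact: integral_ge0.
rewrite restr //; last first.
  exact: (measurableT_comp mG' mX).
by move=> w; exact: integral_ge0.
Qed.

End FiniteMeasures.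

(** * Independence and stationarity of the increments on a time grid *)

Section BrownianIncrements.
Context {R : realType} {n : nat} {d : measure_display} {T : measurableType d}.
Variables (P : probability T R) (B : R -> T -> 'rV[R]_n).
Hypothesis hB : brownian_motion P B.
Local Notation bT := (borel_rV R n).

Lemma brownian0 w : B 0 w = 0.
Proof. by case: hB. Qed.

Lemma brownian_measurable t : 0 <= t -> measurable_fun setT (B t : T -> bT).
Proof. by case: hB => -[h _] _ _; exact: h. Qed.

Section Grid.
Variable tau : nat -> R.
Hypotheses (tau0 : tau 0%N = 0) (tauS : forall k, tau k < tau k.+1).

Lemma grid_ge0 k : 0 <= tau k.
Proof. by elim: k => [|k IH]; [rewrite tau0|exact: le_trans IH (ltW (tauS k))]. Qed.

Definition incr k : T -> bT := fun w => (B (tau k.+1) w - B (tau k) w)%R.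

Lemma incr_measurable k : measurable_fun setT (incr k).
Proof.
apply: measurable_fun_rV => i; rewrite /incr.
under eq_fun do rewrite !mxE.
by apply: measurable_funB; apply: measurable_coord; apply: brownian_measurable; exact: grid_ge0.
Qed.

Definition past_rects (j : nat) : set (set T) :=
  [set E | exists2 A : nat -> 'I_n -> set R, (forall k i, measurable (A k i)) &
     E = [set w | forall (k : 'I_j) i, A k i ((incr k w : 'rV[R]_n) 0 i)]].

Definition past j : set (set T) := <<s past_rects j >>.

Lemma past_rects_setI j : setI_closed (past_rects j).
Proof.
move=> _ _ [A mA ->] [A' mA' ->]; exists (fun k i => A k i `&` A' k i).
  by move=> k i; exact: measurableI.
apply/seteqP; split => [w [h1 h2] k i //|w h]; by split => k i; have [] := h k i.
Qed.

Lemma past_rects_measurable j : past_rects j `<=` measurable.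
Proof.
move=> _ [A mA ->].
have -> : [set w | forall (k : 'I_j) i, A k i ((incr k w : 'rV[R]_n) 0 i)] =
  \bigcap_(k in [set: 'I_j]) \bigcap_(i in [set: 'I_n])
     ((fun w => (incr k w : 'rV[R]_n) 0 i) @^-1` A k i).
  by apply/seteqP; split => [w h k _ i _|w h k i]; apply: h.
apply: fin_bigcap_measurable => // k _; apply: fin_bigcap_measurable => // i _.
rewrite -[X in measurable X]setTI.
by apply: (measurable_coord i (incr_measurable k)).
Qed.

Lemma past_measurable j E : past j E -> measurable E.
Proof.
by move: E; apply: smallest_sub; [exact: sigma_algebra_measurable|exact: past_rects_measurable].
Qed.

Lemma past_setT j : past_rects j setT.
Proof. by exists (fun _ _ => setT) => //; apply/seteqP; split. Qed.

Lemma incr_rect k (A : 'I_n -> set R) : (forall i, measurable (A i)) ->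
  P (incr k @^-1` rect A) = (\prod_(i < n) normal_prob 0 (Num.sqrt (tau k.+1 - tau k)) (A i))%E.
Proof.
move=> mA; case: hB => _ _ /(_ 1%N (fun j => tau (j + k)%N) (fun _ => A)).
rewrite big_ord1 add0n add1n => <- //.
- congr (P _); apply/seteqP; split => w /= h; last exact: (h ord0).
  by move=> j i; rewrite (ord1 j); exact: h.
- exact: grid_ge0.
Qed.

(** As functions of E, both sides are finite measures agreeing on [past_rects], a family closed
    under intersection that generates [past j]. The set D is extended from rectangles to Borel sets
    in the same way in [past_indep]. *)
Lemma past_indep_rect j E (A : 'I_n -> set R) : past j E -> (forall i, measurable (A i)) ->
  P (E `&` incr j @^-1` rect A) = (P E * P (incr j @^-1` rect A))%E.
Proof.
move=> pE mA; set D := incr j @^-1` rect A.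
have mD : measurable D.
  rewrite -[X in measurable X]setTI; apply: incr_measurable => //.
  by apply: rects_measurable; exists A.
have [m1 m1E] := exists_mrestr P mD.
have PD0 : 0 <= fine (P D) by apply: fine_ge0.
pose m2 : {measure set T -> \bar R} := mscale (NngNum PD0) P.
have m2E F : m2 F = (P F * P D)%E.
  by rewrite /m2 /= /mscale /= fineK ?fin_num_measure // muleC.
rewrite -m1E -m2E.
apply: (@g_sigma_algebra_measure_unique _ _ _ (past_rects j) _ (fun=> setT)) pE.
- exact: past_rects_measurable.
- by move=> _; exact: past_setT.
- by rewrite bigcup_const.
- exact: past_rects_setI.
- move=> _ [A' mA' ->]; rewrite m1E m2E /D.
  case: hB => _ _ H.
  have := H j tau A' (grid_ge0 0) tauS mA'.
  rewrite -/(incr _) => ->.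
  (* With A inserted at index j, the product formula for j + 1 increments has the formula for j
     increments as a factor. *)
  pose A'' k := if k == j then A else A' k.
  have mA'' k i : measurable (A'' k i) by rewrite /A''; case: ifP.
  have := H j.+1 tau A'' (grid_ge0 0) tauS mA''.
  rewrite big_ord_recr /= [X in (_ * X)%E](_ : _ = P (incr j @^-1` rect A)); last first.
    by rewrite incr_rect //; apply: eq_bigr => i _; rewrite /A'' eqxx.
  move=> E1.
  transitivity (P [set w | forall (k : 'I_j.+1) i, A'' k i ((B (tau k.+1) w - B (tau k) w) 0 i)]).
    congr (P _); apply/seteqP; split => w /=.
      move=> [h1 h2] k i; rewrite /A''; case: eqP => [kj|/eqP kj]; first by rewrite kj; exact: h2.
      have kj' : (k < j)%N by rewrite ltn_neqAle kj -ltnS ltn_ord.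
      exact: (h1 (Ordinal kj')).
    move=> h; split => [k i|i].
      by have := h (widen_ord (leqnSn j) k) i; rewrite /A'' /= ltn_eqF.
    by have := h ord_max i; rewrite /A'' /= eqxx.
  rewrite E1.
  congr (_ * _)%E; apply: eq_bigr => k _; apply: eq_bigr => i _.
  by rewrite /A'' ltn_eqF.
- by move=> k; rewrite m1E setTI (le_lt_trans (probability_le1 P mD)) // ltry.
Qed.

Lemma past_indep j E (D : set bT) : past j E -> measurable D ->
  P (E `&` incr j @^-1` D) = (P E * P (incr j @^-1` D))%E.
Proof.
move=> pE mD; have mE := past_measurable pE.
have [mr mrE] := exists_mrestr P mE.
have [m1 m1E] := exists_pushforward mr (incr_measurable j).
have [m3 m3E] := exists_pushforward P (incr_measurable j).
have PE0 : 0 <= fine (P E) by apply: fine_ge0.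
pose m2 : {measure set bT -> \bar R} := mscale (NngNum PE0) m3.
have m2E F : m2 F = (P E * P (incr j @^-1` F))%E.
  by rewrite /m2 /= /mscale /= fineK ?fin_num_measure // m3E.
have m1E' F : m1 F = P (E `&` incr j @^-1` F) by rewrite m1E /pushforward mrE setIC.
rewrite -m2E -m1E'; apply: finite_measure_rV_unique mD.
  by rewrite m1E' setIT (le_lt_trans (probability_le1 P mE)) // ltry.
by move=> A mA; rewrite m1E' m2E past_indep_rect.
Qed.

(** The position at time tau k is the sum of the first k increments, hence measurable for the
    sigma-algebra that they generate. *)
Lemma past_brownian j k (D : set bT) : (k <= j)%N -> measurable D ->
  past j (B (tau k) @^-1` D).
Proof.
pose T' := g_sigma_algebraType (past_rects j).
have mi k' : (k' < j)%N -> measurable_fun setT (incr k' : T' -> bT).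
  move=> kj; apply: measurable_fun_rV => i _ A mA; rewrite setTI.
  apply: sub_sigma_algebra.
  exists (fun l i' => if (l == k') && (i' == i) then A else setT).
    by move=> l i'; case: ifP.
  apply/seteqP; split => w /=.
    by move=> h l i'; case: ifP => // /andP[/eqP-> /eqP->].
  by move=> /(_ (Ordinal kj) i) /=; rewrite !eqxx.
have mB : (k <= j)%N -> measurable_fun setT (B (tau k) : T' -> bT).
  elim: k => [_|k IH kj].
    have -> : B (tau 0%N) = fun=> 0 by apply/funext => w; rewrite tau0 brownian0.
    exact: measurable_cst.
  have -> : B (tau k.+1) = fun w => (B (tau k) w + (incr k w : 'rV[R]_n))%R.
    by apply/funext => w; rewrite /incr addrC subrK.
  by apply: measurable_addrV; [exact: IH (ltnW kj)|exact: mi].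
by move=> kj mD; have := mB kj measurableT D mD; rewrite setTI.
Qed.

End Grid.

Lemma incr_law (s r : R) (D : set bT) : 0 <= s -> 0 < r -> measurable D ->
  P [set w | D (B (s + r) w - B s w)] = P (B r @^-1` D).
Proof.
move=> s0 r0 mD.
have key t : 0 <= t -> exists2 m : {measure set bT -> \bar R},
    (forall F, m F = P [set w | F (B (t + r) w - B t w)]) &
    forall A, (forall i, measurable (A i)) ->
      m (rect A) = (\prod_(i < n) normal_prob 0 (Num.sqrt r) (A i))%E.
  move=> t0.
  have mf : measurable_fun setT (fun w => (B (t + r) w - B t w)%R : bT).
    apply: measurable_fun_rV => i; under eq_fun do rewrite !mxE.
    by apply: measurable_funB; apply: measurable_coord; apply: brownian_measurable; rewrite ?addr_ge0 // ltW.
  have [m mE] := exists_pushforward P mf.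
  exists m => [F|A mA]; first by rewrite mE.
  (* Only one increment matters, but the definition takes an infinite increasing sequence of
     times. *)
  rewrite mE /pushforward; case: hB => _ _ /(_ 1%N (fun j => t + j%:R * r) (fun _ => A)).
  rewrite big_ord1 mul0r addr0 mul1r addrAC subrr add0r => <- //.
  - congr (P _); apply/seteqP; split => w /= h; last first.
      by move=> i; have := h ord0 i; rewrite /= mul0r mul1r addr0.
    by move=> j i; rewrite (ord1 j) /= mul0r mul1r addr0; exact: h.
  - by move=> k; rewrite ltrD2l ltr_pM2r // ltr_nat.
have [m1 m1E m1r] := key s s0; have [m2 m2E m2r] := key 0 (lexx 0).
have -> : P (B r @^-1` D) = m2 D.
  by rewrite m2E; congr (P _); apply/seteqP; split => w /=; rewrite add0r brownian0 subr0.
rewrite -m1E; apply: finite_measure_rV_unique mD.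
  by rewrite m1E (_ : [set w | _] = setT) ?probability_setT ?ltry //; apply/seteqP; split.
by move=> A mA; rewrite m1r // m2r.
Qed.

Definition heat (r : R) (f : 'rV[R]_n -> R) (x : 'rV[R]_n) : R :=
  \int[P]_w f (x + B r w)%R.

End BrownianIncrements.

(** * The heat semigroup *)

Section Dini.
Context {R : realType}.

(* The infimum of {s | F s + e s <= F t + e t} is attained by right continuity,
   and cannot be positive. *)
Lemma dini_le (F : R -> R) (t : R) : 0 < t ->
  (forall s, 0 <= s -> s < t -> forall e, 0 < e -> exists2 d, 0 < d &
     forall r, 0 < r -> r < d -> s + r <= t -> `|F (s + r) - F s| <= e) ->
  (forall s, 0 < s -> s <= t -> forall e, 0 < e -> exists2 d, 0 < d &
     forall r, 0 < r -> r < d -> r <= s -> F (s - r) - F s <= e * r) ->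
  F 0 <= F t.
Proof.
move=> t0 rc ld; apply/ler_addgt0Pr => e' e'0.
pose e := e' / t; have e0 : 0 < e by rewrite divr_gt0.
have eE : e * t = e' by rewrite /e mulfVK // gt_eqF.
pose A : set R := [set s | 0 <= s <= t /\ F s + e * s <= F t + e * t].
have At : A t by split; rewrite ?(ltW t0) ?lexx.
have lbA : lbound A 0 by move=> s [/andP[]].
have hiA : has_inf A by split; [exists t|exists 0].
pose s := inf A.
have s0 : 0 <= s by apply: lb_le_inf => //; exists t.
have st : s <= t by apply: ge_inf => //; exists 0.
have As : A s.
  split; first by rewrite s0 st.
  have [->//|sneq] := eqVneq s t.
  have slt : s < t by rewrite lt_neqAle sneq.
  apply/ler_addgt0Pr => b b0.
  have b2 : 0 < b / 2 by rewrite divr_gt0.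
  have [d d0 hd] := rc s s0 slt (b / 2) b2.
  pose d' := Num.min d (b / 2 / (e + 1)).
  have e1 : 0 < e + 1 by lra.
  have d'0 : 0 < d' by rewrite lt_min d0 divr_gt0.
  have [u Au us] := inf_adherent d'0 hiA.
  have su : s <= u by apply: ge_inf => //; exists 0.
  have [<-|une] := eqVneq u s; first by case: Au => _; lra.
  have r0 : 0 < u - s by rewrite subr_gt0 lt_neqAle eq_sym une.
  have rd : u - s < d' by rewrite ltrBlDl.
  case: Au => /andP[_ ut] Fu.
  have rd' : u - s < d by apply: (lt_le_trans rd); rewrite ge_min lexx.
  have su' : s + (u - s) = u by ring.
  have := hd (u - s) r0 rd'; rewrite su' => /(_ ut) /ler_normlP[h _].
  have : (u - s) * (e + 1) <= b / 2.
    by rewrite -ler_pdivlMr // ltW // (lt_le_trans rd) // ge_min lexx orbT.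
  nra.
have s_eq0 : s = 0.
  apply/eqP; rewrite -[_ == _]negbK; apply/negP => sn.
  have sp : 0 < s by rewrite lt_neqAle eq_sym sn.
  have [d d0 hd] := ld s sp st e e0.
  pose r := Num.min (d / 2) s.
  have r0 : 0 < r by rewrite lt_min sp divr_gt0.
  have rd : r < d by rewrite gt_min; apply/orP; left; lra.
  have rs : r <= s by rewrite ge_min lexx orbT.
  have h := hd r r0 rd rs.
  have : s <= s - r; last by lra.
  apply: ge_inf; first by exists 0.
  case: As => _ hs; split; first by apply/andP; split; lra.
  nra.
by case: As; rewrite s_eq0 mulr0 addr0 eE.
Qed.

Lemma taylor_in (g dg ddg : R -> R) (M : R) :
  (forall s : R, is_derive s 1 g (dg s)) -> (forall s : R, is_derive s 1 dg (ddg s)) ->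
  (forall s, `|s| <= 1 -> `|ddg s| <= M) -> `|g 1 - g 0 - dg 0| <= M.
Proof.
move=> hg hdg hM.
have [c c1] := mvt 0 1 hg; rewrite !subr0 normr1 mulr1 in c1 * => ->.
have [c' c'1] := mvt 0 c hdg; rewrite !subr0 in c'1 * => ->.
have M0 : 0 <= M by apply: le_trans (hM 0 _); rewrite ?normr0.
rewrite normrM -[leRHS]mulr1 ler_pM //; apply: hM.
exact: le_trans c'1 c1.
Qed.

End Dini.

(** * Function classes preserved by the heat semigroup *)

Section UniformClasses.
Context {R : realType} {n : nat}.
Implicit Types (f g : 'rV[R]_n -> R) (df dg : 'rV[R]_n -> 'rV[R]_n).
Implicit Types (ddf : 'I_n -> 'rV[R]_n -> 'rV[R]_n) (x : 'rV[R]_n).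

Definition bounded f : Prop := exists M, forall x, `|f x| <= M.
(** The class [ubc] and its first- and second-order versions [U1] and [U2] are stable under
    averaging over translates and under linear substitutions, and uniform continuity makes Taylor
    remainders uniform in the base point. *)
Definition ubc f : Prop := bounded f /\ unif_cont f.
Definition U1 f df : Prop :=
  [/\ forall x, d1 f df x, bounded f & forall i, ubc (fun x => df x 0 i)].
Definition U2 f df ddf : Prop := U1 f df /\ forall i, U1 (fun x => df x 0 i) (ddf i).

Lemma bounded_gt0 f : bounded f -> exists2 M, 0 < M & forall x, `|f x| <= M.
Proof.
move=> [M hM]; exists (`|M| + 1); first by rewrite ltr_wpDl.
by move=> x; rewrite (le_trans (hM x)) // (le_trans (ler_norm M)) // lerDl.
Qed.

Lemma unif_cont_continuous f : unif_cont f -> continuous f.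
Proof.
move=> uf x; apply: continuous_atP => e e0; have [d d0 hd] := uf e e0.
by near=> y; apply: hd; near: y; exact: (near_normB x d0).
Unshelve. all: by end_near. Qed.

Lemma ubc_continuous f : ubc f -> continuous f.
Proof. by case=> _ /unif_cont_continuous. Qed.

Lemma U2_d2 f df ddf : U2 f df ddf -> forall x, d2 f df ddf x.
Proof. by move=> [[h1 _ _] h2] x; split => // i; case: (h2 i). Qed.

Lemma ubc_cst (c : R) : ubc (fun=> c).
Proof.
split; first by exists `|c|.
by move=> e e0; exists 1 => // x y _; rewrite subrr normr0 ltW.
Qed.

Lemma ubcD f g : ubc f -> ubc g -> ubc (fun x => f x + g x).
Proof.
move=> [[M hM] uf] [[N hN] ug]; split.
  by exists (M + N) => x; apply: (le_trans (ler_normD _ _)); exact: lerD.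
move=> e e0; have e2 : 0 < e / 2 by rewrite divr_gt0.
have [a a0 ha] := uf _ e2; have [b b0 hb] := ug _ e2.
exists (Num.min a b) => [|x y]; first by rewrite lt_min a0.
rewrite lt_min => /andP[/ha h1 /hb h2].
have -> : f x + g x - (f y + g y) = (f x - f y) + (g x - g y) by ring.
by apply: (le_trans (ler_normD _ _)); rewrite (splitr e) lerD.
Qed.

Lemma ubcZ (c : R) f : ubc f -> ubc (fun x => c * f x).
Proof.
move=> [[M hM] uf]; split.
  by exists (`|c| * M) => x; rewrite normrM ler_wpM2l.
move=> e e0; have c1 : 0 < `|c| + 1 by rewrite ltr_wpDl.
have [a a0 ha] := uf _ (divr_gt0 e0 c1); exists a => // x y /ha h.
rewrite -mulrBr normrM; apply: (@le_trans _ _ ((`|c| + 1) * (e / (`|c| + 1)))).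
  by apply: ler_pM => //; rewrite lerDl.
by rewrite mulrC mulfVK // gt_eqF.
Qed.

Lemma ubc_sum (I : Type) (r : seq I) (F : I -> 'rV[R]_n -> R) :
  (forall i, ubc (F i)) -> ubc (fun x => \sum_(i <- r) F i x).
Proof.
move=> H; elim: r => [|i r IH].
  by under eq_fun do rewrite big_nil; exact: ubc_cst.
by under eq_fun do rewrite big_cons; exact: ubcD.
Qed.

Lemma ubc_mulmx (w : 'M[R]_n) f : ubc f -> ubc (fun x => f (x *m w)).
Proof.
move=> [[M hM] uf]; split; first by exists M.
move=> e e0; have [a a0 ha] := uf _ e0.
have c1 : 0 < n%:R * `|w| + 1 by rewrite ltr_wpDl // mulr_ge0.
exists (a / (n%:R * `|w| + 1)) => [|x y xy]; first exact: divr_gt0.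
apply: ha; rewrite -mulmxBl; apply: (le_lt_trans (norm_mulmx _ _)).
move: xy; rewrite ltr_pdivlMr // => xy; apply: le_lt_trans xy.
by rewrite mulrC ler_wpM2l // lerDl.
Qed.

Lemma ubc_trace ddf : (forall i j, ubc (fun x => ddf i x 0 j)) -> ubc (trace ddf).
Proof. by move=> H; apply: ubc_sum => i; exact: H. Qed.

Lemma U1D f df g dg : U1 f df -> U1 g dg ->
  U1 (fun y => f y + g y) (fun y => df y + dg y).
Proof.
move=> [f1 [M hM] f3] [g1 [N hN] g3]; split.
- by move=> x; exact: d1D.
- by exists (M + N) => x; apply: (le_trans (ler_normD _ _)); exact: lerD.
- by move=> i; under eq_fun do rewrite mxE; exact: ubcD.
Qed.

Lemma U1Z (c : R) f df : U1 f df -> U1 (fun y => c * f y) (fun y => c *: df y).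
Proof.
move=> [f1 [M hM] f3]; split.
- by move=> x; exact: d1Z.
- by exists (`|c| * M) => x; rewrite normrM ler_wpM2l.
- by move=> i; under eq_fun do rewrite mxE; exact: ubcZ.
Qed.

Lemma U1_mulmx (w : 'M[R]_n) f df : U1 f df ->
  U1 (fun y => f (y *m w)) (fun y => df (y *m w) *m w^T).
Proof.
move=> [f1 [M hM] f3]; split.
- by move=> x; exact: d1_mulmx.
- by exists M.
- move=> i; under eq_fun do rewrite mxE; apply: ubc_sum => j.
  under eq_fun do rewrite mulrC; apply: ubcZ; exact: ubc_mulmx (f3 j).
Qed.

Lemma U1_cst (c : R) : U1 (fun=> c) (fun=> 0).
Proof.
split; [exact: d1_cst|by exists (`|c|)|move=> i].
by under eq_fun do rewrite mxE; exact: ubc_cst.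
Qed.

Lemma U1_sum (I : Type) (r : seq I) (F : I -> 'rV[R]_n -> R)
    (dF : I -> 'rV[R]_n -> 'rV[R]_n) : (forall i, U1 (F i) (dF i)) ->
  U1 (fun y => \sum_(i <- r) F i y) (fun y => \sum_(i <- r) dF i y).
Proof.
move=> H; elim: r => [|i r IH].
  under eq_fun do rewrite big_nil; under [X in U1 _ X]eq_fun do rewrite big_nil.
  exact: U1_cst.
under eq_fun do rewrite big_cons; under [X in U1 _ X]eq_fun do rewrite big_cons.
exact: U1D.
Qed.

Lemma U1_eq f df g dg : f =1 g -> df =1 dg -> U1 f df -> U1 g dg.
Proof. by move=> /funext-> /funext->. Qed.

Lemma U2_mulmx (w : 'M[R]_n) f df ddf : U2 f df ddf ->
  U2 (fun y => f (y *m w)) (fun y => df (y *m w) *m w^T)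
     (fun i y => \sum_(j < n) w i j *: (ddf j (y *m w) *m w^T)).
Proof.
move=> [h1 h2]; split; first exact: U1_mulmx.
move=> i; apply: (@U1_eq (fun y => \sum_(j < n) w i j * df (y *m w) 0 j)).
- by move=> y; rewrite mxE; apply: eq_bigr => j _; rewrite mxE mulrC.
- by move=> y; reflexivity.
- by apply: U1_sum => j; apply: U1Z; exact: (U1_mulmx w (h2 j)).
Qed.

Lemma U2_sum (I : Type) (r : seq I) (F : I -> 'rV[R]_n -> R)
    (dF : I -> 'rV[R]_n -> 'rV[R]_n) (ddF : I -> 'I_n -> 'rV[R]_n -> 'rV[R]_n) :
  (forall k, U2 (F k) (dF k) (ddF k)) ->
  U2 (fun y => \sum_(k <- r) F k y) (fun y => \sum_(k <- r) dF k y)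
     (fun i y => \sum_(k <- r) ddF k i y).
Proof.
move=> H; split; first by apply: U1_sum => k; case: (H k).
move=> i; apply: (@U1_eq (fun y => \sum_(k <- r) dF k y 0 i)) => [y|y|].
- by rewrite summxE.
- by [].
- by apply: U1_sum => k; case: (H k).
Qed.

Lemma U2Z (c : R) f df ddf : U2 f df ddf ->
  U2 (fun y => c * f y) (fun y => c *: df y) (fun i y => c *: ddf i y).
Proof.
move=> [h1 h2]; split; first exact: U1Z.
by move=> i; apply: (U1_eq _ _ (U1Z c (h2 i))) => y //; rewrite mxE.
Qed.

(** Uniformity in x lets the remainder survive averaging over x + B_r; this is how [heat_U1]
    differentiates under the expectation. *)
Lemma U1_unif f df : U1 f df -> forall e, 0 < e -> exists2 d, 0 < d &
  forall x h, `|h| < d -> `|f (h + x) - f x - dot (df x) h| <= e * `|h|.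
Proof.
move=> [f1 _ f3] e e0.
have c1 : 0 < n%:R + 1 :> R by rewrite ltr_wpDl.
have [d d0 hd] : exists2 d, 0 < d & forall x y, `|x - y| < d -> `|df x - df y| <= e / (n%:R + 1).
  suff H (s : seq 'I_n) : exists2 d, 0 < d &
      forall x y, `|x - y| < d -> forall i, i \in s -> `|df x 0 i - df y 0 i| <= e / (n%:R + 1).
    have [d d0 hd] := H (enum 'I_n); exists d => // x y xy; apply: norm_le_coord.
      by rewrite divr_ge0 // ltW.
    by move=> i; rewrite !mxE hd // mem_enum.
  elim: s => [|i s [d d0 hd]]; first by exists 1.
  have [d' d'0 hd'] := (f3 i).2 _ (divr_gt0 e0 c1).
  exists (Num.min d d') => [|x y]; first by rewrite lt_min d0.
  rewrite lt_min => /andP[xy xy'] j; rewrite inE => /orP[/eqP->|js]; first exact: hd'.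
  exact: hd.
exists d => // x h hh.
have hl (s : R) : is_derive s 1 (fun r => f (x + r *: h)) (dot (df (x + s *: h)) h).
  by apply: is_derive_line; apply: d1_is_derive.
have [t /andP[t0 t1]] := mvt01 hl; rewrite scale1r scale0r addr0 [h + x]addrC => ->.
rewrite -dotBl; apply: (le_trans (normr_dot _ _)).
apply: ler_wpM2r => //; have : `|df (x + t *: h) - df x| <= e / (n%:R + 1).
  apply: hd; rewrite addrC addKr normrZ ger0_norm // (le_lt_trans _ hh) //.
  by rewrite ler_piMl.
rewrite ler_pdivlMr // => H; apply: le_trans H; rewrite mulrC.
by apply: ler_wpM2l => //; rewrite lerDl.
Qed.

Lemma U1_lip f df : U1 f df -> exists2 L, 0 <= L & forall x y, `|f x - f y| <= L * `|x - y|.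
Proof.
move=> [h1 _ h3]; have /choice[M hM] : forall i, exists M, forall x, `|df x 0 i| <= M.
  by move=> i; case: (h3 i).
pose K := \sum_i `|M i|; have K0 : 0 <= K by apply: sumr_ge0.
have hK x : `|df x| <= K.
  apply: norm_le_coord => // i; rewrite (le_trans (hM i x)) // (le_trans (ler_norm _)) //.
  by rewrite /K (bigD1 i) //= lerDl sumr_ge0.
exists (n%:R * K) => [|x y]; first by rewrite mulr_ge0.
have hl (s : R) : is_derive s 1 (fun r => f (y + r *: (x - y))) (dot (df (y + s *: (x - y))) (x - y)).
  by apply: is_derive_line; apply: d1_is_derive.
have [t _] := mvt01 hl; rewrite scale1r scale0r addr0 [y + (x - y)]addrC subrK => ->.
by apply: (le_trans (normr_dot _ _)); rewrite ler_wpM2r // ler_wpM2l.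
Qed.

Lemma U1_ubc f df : U1 f df -> ubc f.
Proof.
move=> hf; split; first by case: hf.
have [L L0 hL] := U1_lip hf.
have c0 : 0 < L + 1 by rewrite ltr_wpDl.
move=> e e0; exists (e / (L + 1)) => [|x y]; first by rewrite divr_gt0.
rewrite ltr_pdivlMr // => h; apply: (le_trans (hL x y)); apply: le_trans (ltW h).
by rewrite mulrC ler_wpM2l // lerDl.
Qed.

Lemma partial_supp0 K f i : compact K -> (forall x, ~ K x -> f x = 0) ->
  forall x, ~ K x -> partial i f x = 0.
Proof.
move=> cK f0 x Kx.
have oK : open (~` K) by rewrite openC; exact: compact_rV_closed.
rewrite (@partialE _ _ f (fun=> 0)) ?mxE //.
apply: (@d1_near _ _ (fun=> 0) _ (fun=> 0)) (d1_cst 0 x); last exact: near_all.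
by apply: filterS (open_near oK Kx) => y /f0.
Qed.

Lemma C2c_U2 C f : C2c C f -> U2 f (gradient f) (fun i => gradient (partial i f)).
Proof.
move=> [C2f [K [cK _] f0]]; case: (C2f) => cf hf.
have key g : (forall x, ~ K x -> g x = 0) -> continuous g -> ubc g.
  by move=> g0 cg; split; [exact: supp_bounded g0|exact: supp_unif_cont g0].
have p0 i := @partial_supp0 K f i cK f0.
have pp0 i j := @partial_supp0 K (partial i f) j cK (p0 i).
split; last move=> i.
- split; first by move=> x; case: (C2_d2 x C2f).
    by case: (key f f0 cf).
  move=> i; rewrite (_ : (fun x => _) = partial i f); last by apply/funext => x; rewrite mxE.
  by apply: (key _ (p0 i)); case: (hf i).
- have -> : (fun x => gradient f x 0 i) = partial i f by apply/funext => x; rewrite mxE.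
  case: (hf i) => h1 h2 h3; split.
  + by move=> x; case: (C2_d2 x C2f) => _ /(_ i); under eq_fun do rewrite mxE.
  + by case: (key _ (p0 i) h2).
  + move=> j; rewrite (_ : (fun x => _) = partial j (partial i f)); last by apply/funext => x; rewrite mxE.
    by apply: (key _ (pp0 i j)); case: (h3 j).
Qed.

End UniformClasses.

Section Laws.
Context {d1 d2 d : measure_display} {T1 : measurableType d1} {T2 : measurableType d2}.
Context {T : measurableType d} {R : realType}.

Lemma integral_law (m1 : {measure set T1 -> \bar R}) (m2 : {measure set T2 -> \bar R})
    (X : T1 -> T) (Y : T2 -> T) (F : T -> \bar R) :
  measurable_fun setT X -> measurable_fun setT Y -> measurable_fun setT F ->
  (forall A, measurable A -> m1 (X @^-1` A) = m2 (Y @^-1` A)) ->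
  (\int[m1]_w F (X w) = \int[m2]_w F (Y w))%E.
Proof.
move=> mX mY mF H.
have pos G : measurable_fun setT G -> (forall z, 0 <= G z)%E ->
    (\int[m1]_w G (X w) = \int[m2]_w G (Y w))%E.
  move=> mG G0; have [n1 n1E] := exists_pushforward m1 mX.
  have [n2 n2E] := exists_pushforward m2 mY.
  transitivity (\int[n1]_z G z)%E; first by rewrite n1E ge0_integral_pushforward.
  transitivity (\int[n2]_z G z)%E; last by rewrite n2E ge0_integral_pushforward.
  by apply: eq_measure_integral => A mA _; rewrite n1E n2E; exact: H.
rewrite [LHS]integralE [RHS]integralE; congr (_ - _)%E.
- under eq_integral do rewrite -/((F \o X)^\+%E _) funepos_comp /=.
  under [RHS]eq_integral do rewrite -/((F \o Y)^\+%E _) funepos_comp /=.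
  by apply: pos => [|z]; [exact: measurable_funepos|exact: funepos_ge0].
- under eq_integral do rewrite -/((F \o X)^\-%E _) funeneg_comp /=.
  under [RHS]eq_integral do rewrite -/((F \o Y)^\-%E _) funeneg_comp /=.
  by apply: pos => [|z]; [exact: measurable_funeneg|exact: funeneg_ge0].
Qed.

End Laws.

(** * Moments of Brownian motion at a fixed time *)

Section Moments.
Context {R : realType} {n : nat} {d : measure_display} {T : measurableType d}.
Variables (P : probability T R) (B : R -> T -> 'rV[R]_n).
Hypothesis hB : brownian_motion P B.
Local Notation bT := (borel_rV R n).
Local Notation integ f := (P.-integrable setT (EFin \o f)).
Local Notation E f := (\int[P]_w f w).
Implicit Types (r : R).

Let PT : (P setT <= 1)%E. Proof. exact: probability_le1. Qed.

Lemma brownian_law_rect r (A : 'I_n -> set R) : 0 < r -> (forall i, measurable (A i)) ->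
  P (B r @^-1` rect A) = (\prod_(i < n) normal_prob 0 (Num.sqrt r) (A i))%E.
Proof.
move=> r0 mA; pose tau (k : nat) := k%:R * r.
have tau0 : tau 0%N = 0 by rewrite /tau mul0r.
have tauS k : tau k < tau k.+1 by rewrite /tau ltr_pM2r // ltr_nat.
have := incr_rect hB tau0 tauS 0 mA.
rewrite /tau mul0r mul1r subr0 => <-; congr (P _); apply/seteqP.
by split => w; rewrite /incr /= mul0r mul1r (brownian0 hB) subr0.
Qed.

Lemma brownian_law_coord r i (A : set R) : 0 < r -> measurable A ->
  P ((fun w => B r w 0 i) @^-1` A) = normal_prob 0 (Num.sqrt r) A.
Proof.
move=> r0 mA; pose A' j := if j == i then A else setT.
have mA' j : measurable (A' j) by rewrite /A'; case: ifP.
transitivity (P (B r @^-1` rect A')).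
  congr (P _); apply/seteqP; split => w /=.
    by move=> h j; rewrite /A'; case: eqP => // ->.
  by move=> /(_ i); rewrite /A' eqxx.
rewrite brownian_law_rect // (bigD1 i) //= {1}/A' eqxx big1 ?mule1 // => j ji.
by rewrite /A' (negbTE ji) -(@probability_setT _ _ R (normal_prob 0 (Num.sqrt r))).
Qed.

Lemma coord_meas r i : 0 < r -> measurable_fun setT (fun w => B r w 0 i).
Proof. by move=> r0; apply: measurable_coord; apply: (brownian_measurable hB); exact: ltW. Qed.

Lemma integral_coord r i (g : R -> R) : 0 < r -> measurable_fun setT g ->
  (\int[P]_w (g (B r w 0 i))%:E = \int[normal_prob 0 (Num.sqrt r)]_x (g x)%:E)%E.
Proof.
move=> r0 mg; apply: (@integral_law _ _ _ T (measurableTypeR R) (measurableTypeR R) R P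
  (normal_prob 0 (Num.sqrt r)) (fun w => B r w 0 i) idfun (EFin \o g)) => //.
- exact: coord_meas.
- exact: measurable_id.
- exact/measurable_EFinP.
- by move=> A mA; exact: brownian_law_coord.
Qed.

Lemma moment4 r i : 0 < r -> integ (fun w => B r w 0 i ^+ 4) /\ E (fun w => B r w 0 i ^+ 4) <= 128 * r ^+ 2.
Proof.
move=> r0; have s0 : 0 < Num.sqrt r by rewrite sqrtr_gt0.
have rE : Num.sqrt r ^+ 4 = r ^+ 2 by rewrite (exprM _ 2 2) sqr_sqrtr // ltW.
have h4 : (\int[P]_w (B r w 0 i ^+ 4)%:E <= (128 * r ^+ 2)%:E)%E.
  rewrite (integral_coord i r0 (g := fun x => x ^+ 4)); last exact: measurable_exprn.
  by rewrite -rE; exact: normal_moment4.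
have i4 : integ (fun w => B r w 0 i ^+ 4).
  apply/integrableP; split.
    by apply/measurable_EFinP; apply: (measurableT_comp (measurable_exprn 4)); exact: coord_meas.
  under eq_integral do rewrite /= ger0_norm ?exprn_even_ge0 //.
  by apply: le_lt_trans h4 _; rewrite ltry.
by split=> //; rewrite -lee_fin EFin_exp.
Qed.

Lemma integ_dom (f g : T -> R) : measurable_fun setT f -> integ g ->
  (forall w, `|f w| <= g w) -> integ f.
Proof.
move=> mf ig fg; apply: (le_integrable measurableT) ig; first exact/measurable_EFinP.
by move=> w _ /=; rewrite lee_fin (le_trans (fg w)) // ler_norm.
Qed.

Lemma integ_prod r i j : 0 < r -> integ (fun w => B r w 0 i * B r w 0 j).
Proof.
move=> r0; have [i4 _] := moment4 i r0; have [j4 _] := moment4 j r0.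
apply: (integ_dom (g := fun w => 1 + (B r w 0 i ^+ 4 + B r w 0 j ^+ 4))).
- by apply: measurable_funM; exact: coord_meas.
- by apply: integD; [exact: bmeas_integrable (bmeas_cst 1)|exact: integD].
- move=> w; set a := B r w 0 i; set b := B r w 0 j.
  have h1 := sqr_ge0 (a ^+ 2 - 1); have h2 := sqr_ge0 (b ^+ 2 - 1).
  have h3 := sqr_ge0 (a - b); have h4 := sqr_ge0 (a + b).
  by rewrite ler_norml; apply/andP; split; nra.
Qed.

Lemma integ_coord r i : 0 < r -> integ (fun w => B r w 0 i).
Proof.
move=> r0; apply: (integ_dom (g := fun w => 1 + B r w 0 i * B r w 0 i)).
- exact: coord_meas.
- by apply: integD; [exact: bmeas_integrable (bmeas_cst 1)|exact: integ_prod].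
- move=> w; set a := B r w 0 i; have h1 := sqr_ge0 (a - 1); have h2 := sqr_ge0 (a + 1).
  by rewrite ler_norml; apply/andP; split; nra.
Qed.

(** Changing the sign of one coordinate preserves the law of B_r, and so forces first moments and
    mixed second moments to equal their opposites. *)
Definition flip (i : 'I_n) (x : 'rV[R]_n) : 'rV[R]_n :=
  \row_j (if j == i then - x 0 j else x 0 j).

Lemma flip_meas i r : 0 < r -> measurable_fun setT (fun w => flip i (B r w) : bT).
Proof.
move=> r0; apply: measurable_fun_rV => j; under eq_fun do rewrite mxE.
by case: (j == i); [exact: (measurableT_comp _ (coord_meas j r0))|exact: coord_meas].
Qed.

Lemma flip_law i r (A : set bT) : 0 < r -> measurable A ->
  P ((fun w => flip i (B r w)) @^-1` A) = P (B r @^-1` A).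
Proof.
move=> r0 mA; have mB : measurable_fun setT (B r : T -> bT) by apply: (brownian_measurable hB); exact: ltW.
have [m1 m1E] := exists_pushforward P (flip_meas i r0); have [m2 m2E] := exists_pushforward P mB.
have <- : m2 A = P (B r @^-1` A) by rewrite m2E.
have <- : m1 A = P ((fun w => flip i (B r w)) @^-1` A) by rewrite m1E.
apply: finite_measure_rV_unique mA.
  by rewrite m1E /pushforward preimage_setT (le_lt_trans PT) // ltry.
move=> I mI; have -> : m2 (rect I) = (\prod_(i < n) normal_prob 0 (Num.sqrt r) (I i))%E.
  by rewrite m2E; exact: brownian_law_rect.
rewrite m1E.
pose I' j := if j == i then -%R @^-1` I j else I j.
have mI' j : measurable (I' j).
  rewrite /I'; case: ifP => // _; rewrite -[X in measurable X]setTI.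
  have mN : measurable_fun setT (-%R : measurableTypeR R -> measurableTypeR R).
    by apply: continuous_measurable_fun; exact: opp_continuous.
  exact: mN measurableT _ (mI j).
transitivity (P (B r @^-1` rect I')).
  by congr (P _); apply/seteqP; split => w /= h j; have := h j; rewrite /I' mxE; case: ifP.
rewrite brownian_law_rect //; apply: eq_bigr => j _; rewrite /I'; case: ifP => // _.
by rewrite normal_opp // sqrtr_eq0 -ltNge.
Qed.

Lemma exp_flip i r (F : 'rV[R]_n -> R) : 0 < r -> continuous F ->
  E (fun w => F (flip i (B r w))) = E (fun w => F (B r w)).
Proof.
move=> r0 cF; rewrite /Rintegral; congr fine.
apply: (integral_law (F := (EFin \o F : bT -> \bar R))) => //.
- exact: flip_meas.
- by apply: (brownian_measurable hB); exact: ltW.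
- by apply/measurable_EFinP; exact: continuous_measurable_rV.
- by move=> A mA; exact: flip_law.
Qed.

Lemma moment1 r i : 0 < r -> E (fun w => B r w 0 i) = 0.
Proof.
move=> r0; have := exp_flip i r0 (@coord_continuous R 1 n 0 i).
under eq_Rintegral do rewrite mxE eqxx -mulN1r.
by rewrite expZ; [lra|exact: integ_coord].
Qed.

Lemma moment11 r i j : 0 < r -> E (fun w => B r w 0 i * B r w 0 j) = (i == j)%:R * r.
Proof.
move=> r0; case: eqVneq => [->|ij].
  rewrite mul1r; apply: EFin_inj; rewrite EFin_exp; last exact: integ_prod.
  under eq_integral do rewrite -expr2.
  rewrite (integral_coord j r0 (g := fun x => x ^+ 2)); last exact: measurable_exprn.
  by rewrite normal_moment2 ?sqrtr_gt0 // sqr_sqrtr // ltW.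
have cF : continuous (fun x : 'rV[R]_n => x 0 i * x 0 j).
  by move=> x; apply: continuousM; exact: coord_continuous.
have := exp_flip i r0 cF.
under eq_Rintegral do rewrite !mxE eqxx (eq_sym j) (negbTE ij) mulNr -mulN1r.
by rewrite mul0r expZ; [lra|exact: integ_prod].
Qed.

(** Sums over coordinates that dominate the second and fourth powers of the sup norm, with
    expectations n r and O(r^2) at B_r. *)
Definition sq (y : 'rV[R]_n) : R := \sum_i y 0 i * y 0 i.
Definition qu (y : 'rV[R]_n) : R := \sum_i y 0 i ^+ 4.

Lemma sq_ge0 y : 0 <= sq y.
Proof. by apply: sumr_ge0 => i _; rewrite -expr2 sqr_ge0. Qed.

Lemma norm_sq (y : 'rV[R]_n) : `|y| ^+ 2 <= sq y.
Proof.
rewrite -(sqr_sqrtr (sq_ge0 y)) ler_sqr ?nnegrE ?sqrtr_ge0 //.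
apply: norm_le_coord => [|i]; first exact: sqrtr_ge0.
rewrite -sqrtr_sqr ler_wsqrtr // /sq (bigD1 i) //= -expr2 lerDl.
by apply: sumr_ge0 => j _; rewrite -expr2 sqr_ge0.
Qed.

Lemma norm_qu (y : 'rV[R]_n) : `|y| ^+ 4 <= qu y.
Proof.
have q0 : 0 <= qu y by apply: sumr_ge0 => i _; rewrite exprn_even_ge0.
rewrite (exprM _ 2 2) -(sqr_sqrtr q0) ler_sqr ?nnegrE ?sqrtr_ge0 ?sqr_ge0 //.
rewrite -[leRHS](sqr_sqrtr (sqrtr_ge0 _)) ler_sqr ?nnegrE ?sqrtr_ge0 //.
apply: norm_le_coord => [|i]; first exact: sqrtr_ge0.
rewrite -sqrtr_sqr ler_wsqrtr // -[leLHS]ger0_norm ?sqr_ge0 // -sqrtr_sqr ler_wsqrtr //.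
rewrite -exprM /qu (bigD1 i) //= lerDl.
by apply: sumr_ge0 => j _; rewrite exprn_even_ge0.
Qed.

Lemma integ_sq r : 0 < r -> integ (fun w => sq (B r w)).
Proof. by move=> r0; apply: integ_sum => i; exact: integ_prod. Qed.

Lemma exp_sq r : 0 < r -> E (fun w => sq (B r w)) = n%:R * r.
Proof.
move=> r0; rewrite exp_sum => [|i]; last exact: integ_prod.
under eq_bigr do rewrite moment11 // eqxx mul1r.
by rewrite sumr_const card_ord mulr_natl.
Qed.

Lemma integ_qu r : 0 < r -> integ (fun w => qu (B r w)).
Proof. by move=> r0; apply: integ_sum => i; case: (moment4 i r0). Qed.

Lemma exp_qu r : 0 < r -> E (fun w => qu (B r w)) <= n%:R * (128 * r ^+ 2).
Proof.
move=> r0; rewrite exp_sum => [|i]; last by case: (moment4 i r0).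
apply: (@le_trans _ _ (\sum_(i < n) 128 * r ^+ 2)).
  by apply: ler_sum => i _; case: (moment4 i r0).
by rewrite sumr_const card_ord -[leLHS]mulr_natl.
Qed.

End Moments.

(** * The heat operators and their generator *)

Section Heat.
Context {R : realType} {n : nat} {d : measure_display} {T : measurableType d}.
Variables (P : probability T R) (B : R -> T -> 'rV[R]_n).
Hypothesis hB : brownian_motion P B.
Local Notation bT := (borel_rV R n).
Local Notation integ f := (P.-integrable setT (EFin \o f)).
Local Notation E f := (\int[P]_w f w).
Local Notation G := (heat P B).
Implicit Types (r s : R) (f g : 'rV[R]_n -> R) (df : 'rV[R]_n -> 'rV[R]_n).
Implicit Types (ddf : 'I_n -> 'rV[R]_n -> 'rV[R]_n) (x : 'rV[R]_n).

Let PT : (P setT <= 1)%E. Proof. exact: probability_le1. Qed.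

Lemma shift_measurable r x : 0 <= r -> measurable_fun setT (fun w => (x + B r w)%R : bT).
Proof.
move=> r0; apply: measurable_addrV; first exact: measurable_cst.
exact: (brownian_measurable hB).
Qed.

Lemma heat_bmeas r f x : 0 <= r -> measurable_fun (setT : set bT) f -> bounded f ->
  bmeas (fun w => f (x + B r w)).
Proof.
move=> r0 mf [M hM]; split; last by exists M.
exact: (measurableT_comp (f := f : bT -> R) mf (shift_measurable x r0)).
Qed.

Lemma ubc_measurable f : ubc f -> measurable_fun (setT : set bT) f.
Proof. by move=> uf; apply: continuous_measurable_rV; exact: ubc_continuous. Qed.

Lemma ubc_bmeas r f x : 0 <= r -> ubc f -> bmeas (fun w => f (x + B r w)).
Proof. by move=> r0 uf; apply: heat_bmeas => //; [exact: ubc_measurable|case: uf]. Qed.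

Lemma ubc_integ r f x : 0 <= r -> ubc f -> integ (fun w => f (x + B r w)).
Proof. by move=> r0 uf; apply: bmeas_integrable => //; exact: ubc_bmeas. Qed.

Lemma exp_cst (c : R) : E (fun=> c) = c.
Proof.
by rewrite Rintegral_cst //= (_ : P setT = 1%E) ?mulr1 //; exact: probability_setT.
Qed.

Lemma heat0 f x : heat P B 0 f x = f x.
Proof.
rewrite /heat; under eq_Rintegral do rewrite (brownian0 hB) addr0.
exact: exp_cst.
Qed.

Lemma heat_bound r f (M : R) : 0 <= r -> ubc f -> (forall x, `|f x| <= M) ->
  forall x, `|G r f x| <= M.
Proof. by move=> r0 uf hM x; apply: exp_bound => //; exact: ubc_bmeas. Qed.

Lemma heat_dist r f g (M : R) : 0 <= r -> ubc f -> ubc g -> (forall x, `|f x - g x| <= M) ->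
  forall x, `|G r f x - G r g x| <= M.
Proof.
move=> r0 uf ug hM x; rewrite /heat -expB //; try exact: ubc_integ.
by apply: exp_bound => //; apply: bmeasB; exact: ubc_bmeas.
Qed.

Lemma heat_modulus_le r f (e a : R) : 0 <= r -> ubc f ->
  (forall x y, `|x - y| < a -> `|f x - f y| <= e) ->
  forall x y, `|x - y| < a -> `|G r f x - G r f y| <= e.
Proof.
move=> r0 uf hf x y xy; rewrite /heat -expB //; try exact: ubc_integ.
apply: exp_bound => //; first by apply: bmeasB; exact: ubc_bmeas.
by move=> w; apply: hf; rewrite opprD addrACA subrr addr0.
Qed.

Lemma heat_lip r f (L : R) : 0 <= r -> ubc f ->
  (forall x y, `|f x - f y| <= L * `|x - y|) -> forall x y, `|G r f x - G r f y| <= L * `|x - y|.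
Proof.
move=> r0 uf hf x y; rewrite /heat -expB //; try exact: ubc_integ.
apply: exp_bound => //; first by apply: bmeasB; exact: ubc_bmeas.
by move=> w; apply: le_trans (hf _ _) _; rewrite opprD addrACA subrr addr0.
Qed.

Lemma heat_ubc r f : 0 <= r -> ubc f -> ubc (G r f).
Proof.
move=> r0 uf; case: (uf) => -[M hM] cf; split; first by exists M; exact: heat_bound.
by move=> e e0; have [a a0 ha] := cf e e0; exists a => //; exact: heat_modulus_le.
Qed.

Lemma heatD r f g x : 0 <= r -> ubc f -> ubc g -> G r (fun y => f y + g y) x = G r f x + G r g x.
Proof. by move=> r0 uf ug; rewrite /heat expD //; exact: ubc_integ. Qed.

Lemma heatZ r (c : R) f x : 0 <= r -> ubc f -> G r (fun y => c * f y) x = c * G r f x.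
Proof. by move=> r0 uf; rewrite /heat expZ //; exact: ubc_integ. Qed.

Lemma heat_U1 r f df : 0 <= r -> U1 f df -> U1 (G r f) (fun x => \row_i G r (fun y => df y 0 i) x).
Proof.
move=> r0 hf; have uf := U1_ubc hf; case: (hf) => f1 f2 f3.
have udf i : ubc (G r (fun y => df y 0 i)) by exact: heat_ubc.
split; last 2 first.
- by case: (heat_ubc r0 uf).
- by move=> i; under eq_fun do rewrite mxE.
move=> x; split; last first.
  apply: rV_continuous => i; apply: (continuous_near (f := G r (fun y => df y 0 i))).
    by apply: near_all => y; rewrite mxE.
  exact: ubc_continuous.
apply/is_gradP => e e0; have [a a0 ha] := U1_unif hf e0.
apply: filterS (near_normB 0 a0) => h; rewrite sub0r normrN => hh.
have -> : G r f (h + x) - G r f x - dot (\row_i G r (fun y => df y 0 i) x) h =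
    E (fun w => f (h + (x + B r w)) - f (x + B r w) - \sum_i h 0 i * df (x + B r w) 0 i).
  have i1 i : integ (fun w => h 0 i * df (x + B r w) 0 i) by apply: integZ; exact: (ubc_integ x r0 (f3 i)).
  have i2 := ubc_integ x r0 uf.
  have i3 : integ (fun w => f (h + (x + B r w))).
    by under [X in integ X]eq_fun do rewrite addrA; exact: ubc_integ.
  rewrite expB; [|exact: integB|exact: integ_sum].
  rewrite expB //; congr (_ - _ - _).
    by rewrite /heat; apply: eq_Rintegral => w _; rewrite addrA.
  rewrite exp_sum // /dot; apply: eq_bigr => i _; rewrite mxE expZ; last exact: (ubc_integ x r0 (f3 i)).
  by rewrite mulrC.
apply: exp_bound => //.
  apply: bmeasB; last by apply: bmeas_sum => i; apply: bmeasZ; exact: (ubc_bmeas x r0 (f3 i)).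
  apply: bmeasB; last exact: ubc_bmeas.
  by under [X in bmeas X]eq_fun do rewrite addrA; exact: ubc_bmeas.
move=> w; have := ha (x + B r w) h hh; rewrite /dot.
by under eq_bigr do rewrite mulrC.
Qed.

Lemma heat_U2 r f df ddf : 0 <= r -> U2 f df ddf ->
  U2 (G r f) (fun x => \row_i G r (fun y => df y 0 i) x)
     (fun i x => \row_j G r (fun y => ddf i y 0 j) x).
Proof.
move=> r0 [h1 h2]; split; first exact: heat_U1.
move=> i; apply: (U1_eq _ _ (heat_U1 r0 (h2 i))) => x //; by rewrite mxE.
Qed.

Lemma U2_ubc_trace f df ddf : U2 f df ddf -> ubc (trace ddf).
Proof. by move=> [_ h]; apply: ubc_trace => i j; case: (h i) => _ _; exact. Qed.

(** Chebyshev's inequality used pointwise: when |B_r| >= a the trivial bound 2 M is at most 2 M sq /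
    a^2. The estimate sees f only through its bound and one pair of its modulus of continuity, which
    [heat] preserves, so it holds simultaneously for all heat evolutions of f. *)
Lemma heat_near_le r f (M e a : R) : 0 < r -> 0 <= e -> 0 < a -> ubc f -> (forall x, `|f x| <= M) ->
  (forall x y, `|x - y| < a -> `|f x - f y| <= e) ->
  forall x, `|G r f x - f x| <= e + 2 * M / a ^+ 2 * (n%:R * r).
Proof.
move=> r0 e0 a0 uf hM hf x; have M0 : 0 <= M := le_trans (normr_ge0 _) (hM 0).
have c0 : 0 <= 2 * M / a ^+ 2 by rewrite divr_ge0 ?sqr_ge0 // mulr_ge0.
have i1 := bmeas_integrable PT (bmeas_cst (R := R) 1).
have icst (c : R) := bmeas_integrable PT (bmeas_cst (T := T) c).
rewrite -[X in _ - X]exp_cst /heat -expB //; last by apply: ubc_integ => //; exact: ltW.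
have bf : bmeas (fun w => f (x + B r w) - f x).
  by apply: bmeasB; [apply: ubc_bmeas => //; exact: ltW|exact: bmeas_cst].
apply: (le_trans (exp_norm (bmeas_integrable PT bf))).
rewrite -(exp_sq hB r0) -[X in _ <= X + _]exp_cst -expZ; last exact: (integ_sq hB).
have is2 : integ (fun w => 2 * M / a ^+ 2 * sq (B r w)) by apply: integZ; exact: (integ_sq hB).
rewrite -expD //; apply: exp_le; [|exact: integD|].
  apply: bmeas_integrable => //; case: bf => m1 [K hK]; split.
    exact: measurableT_comp m1.
  by exists K => w; rewrite normr_id.
move=> w; have [small|big] := ltP `|B r w| a.
  have h : `|x + B r w - x| < a by rewrite addrAC subrr add0r.
  by apply: (le_trans (hf _ _ h)); rewrite lerDl mulr_ge0 // sq_ge0.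
apply: (@le_trans _ _ (2 * M)).
  by apply: (le_trans (ler_normB _ _)); have := hM x; have := hM (x + B r w); lra.
have h : 2 * M <= 2 * M / a ^+ 2 * sq (B r w).
  rewrite mulrAC ler_pdivlMr ?exprn_gt0 // ler_wpM2l // ?mulr_ge0 //.
  by apply: le_trans (norm_sq _); rewrite lerXn2r // nnegrE // ltW.
by rewrite -[leLHS]add0r lerD.
Qed.

Lemma heat_near f : ubc f -> forall e, 0 < e -> exists2 a, 0 < a &
  forall r, 0 < r -> r < a -> forall x, `|G r f x - f x| <= e.
Proof.
move=> uf e e0; case: (uf) => /bounded_gt0[M M0 hM] cf.
have e2 : 0 < e / 2 by rewrite divr_gt0.
have [a a0 ha] := cf _ e2.
have c0 : 0 < 2 * M / a ^+ 2 * n.+1%:R.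
  by rewrite mulr_gt0 ?ltr0n // divr_gt0 ?exprn_gt0 // mulr_gt0.
exists (e / 2 / (2 * M / a ^+ 2 * n.+1%:R)); first by rewrite divr_gt0.
move=> r r0; rewrite ltr_pdivlMr // => hr x.
apply: (le_trans (heat_near_le r0 (ltW e2) a0 uf hM ha x)).
have : 2 * M / a ^+ 2 * (n%:R * r) <= r * (2 * M / a ^+ 2 * n.+1%:R).
  have -> : 2 * M / a ^+ 2 * (n%:R * r) = r * (2 * M / a ^+ 2 * n%:R) by ring.
  apply: ler_wpM2l; first exact: ltW.
  by apply: ler_wpM2l; rewrite ?ler_nat // divr_ge0 ?sqr_ge0 // mulr_ge0 // ltW.
lra.
Qed.

(** For |y| < a the second derivatives vary by at most e; otherwise |y|^2 <= |y|^4 / a^2 moves the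
    error into [qu]. The expectation at B_r is then of order e r + r^2, which is o(r) because e is
    arbitrary. *)
Lemma second_order f df ddf (M e a : R) : U2 f df ddf -> 0 <= e -> 0 < a ->
  (forall i j x, `|ddf i x 0 j| <= M) ->
  (forall i j x y, `|x - y| < a -> `|ddf i x 0 j - ddf i y 0 j| <= e) ->
  forall x y, `|f (x + y) - f x - \sum_i df x 0 i * y 0 i -
     \sum_i \sum_j 2^-1 * ddf i x 0 j * (y 0 i * y 0 j)| <=
   n%:R ^+ 2 * (e * sq y + 2 * M / a ^+ 2 * qu y).
Proof.
move=> hf e0 a0 hM ha x y.
pose Q := \sum_i \sum_j ddf i x 0 j * (y 0 i * y 0 j).
pose D s := \sum_i \sum_j ddf i (x + s *: y) 0 j * (y 0 i * y 0 j).
have g1 (s : R) : is_derive s 1 (fun s => f (x + s *: y) - 2^-1 * Q * s ^+ 2)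
    (dot (df (x + s *: y)) y - Q * s).
  have h1 : is_derive s 1 (fun s => f (x + s *: y)) (dot (df (x + s *: y)) y).
    by apply: is_derive_line; apply: d1_is_derive; case: (U2_d2 hf (x + s *: y)).
  by apply: is_derive_eq; rewrite /= /GRing.scale /=; field.
have g2 (s : R) : is_derive s 1 (fun s => dot (df (x + s *: y)) y - Q * s) (D s - Q).
  have h1 i : is_derive s 1 (fun s => df (x + s *: y) 0 i * y 0 i) (dot (ddf i (x + s *: y)) y * y 0 i).
    have h2 : is_derive s 1 (fun s => df (x + s *: y) 0 i) (dot (ddf i (x + s *: y)) y).
      by apply: (@is_derive_line _ _ (fun z => df z 0 i)); apply: d1_is_derive; case: (U2_d2 hf (x + s *: y)).
    by apply: is_derive_eq; rewrite /= /GRing.scale /=; ring.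
  have h3 : is_derive s 1 (fun s => \sum_i df (x + s *: y) 0 i * y 0 i)
     (\sum_i dot (ddf i (x + s *: y)) y * y 0 i).
    rewrite (_ : (fun _ => _) = \sum_i (fun s => df (x + s *: y) 0 i * y 0 i)); last first.
      by apply/funext => u; rewrite fct_sumE.
    exact: is_derive_sum.
  apply: is_derive_eq; rewrite /= /GRing.scale /= mulr1; congr (_ - _).
  rewrite /D; apply: eq_bigr => i _; rewrite /dot mulr_suml; apply: eq_bigr => j _; ring.
have M0 i j : 0 <= M := le_trans (normr_ge0 _) (hM i j x).
have bd (s : R) : `|s| <= 1 -> `|D s - Q| <= n%:R ^+ 2 * (e * sq y + 2 * M / a ^+ 2 * qu y).
  move=> s1; rewrite /D /Q -sumrB.
  apply: (le_trans (ler_norm_sum _ _ _)).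
  have -> : n%:R ^+ 2 * (e * sq y + 2 * M / a ^+ 2 * qu y) =
      \sum_(i < n) \sum_(j < n) (e * sq y + 2 * M / a ^+ 2 * qu y).
    move: (_ + _) => q; rewrite sumr_const sumr_const card_ord.
    by rewrite -(mulr_natl (q *+ n)) -(mulr_natl q) mulrA expr2.
  apply: ler_sum => i _; rewrite -sumrB; apply: (le_trans (ler_norm_sum _ _ _)).
  apply: ler_sum => j _; rewrite -mulrBl normrM.
  have yy : `|y 0 i * y 0 j| <= `|y| ^+ 2 by rewrite normrM expr2 ler_pM // coord_le_norm.
  have sy : `|x + s *: y - x| <= `|y|.
    by rewrite addrAC subrr add0r normrZ -[leRHS]mul1r ler_wpM2r.
  have q0 : 0 <= 2 * M / a ^+ 2 by rewrite divr_ge0 ?sqr_ge0 // mulr_ge0 ?(M0 i j).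
  have [small|big] := ltP `|y| a.
    have h1 : `|ddf i (x + s *: y) 0 j - ddf i x 0 j| <= e by apply: ha; exact: le_lt_trans small.
    apply: (@le_trans _ _ (e * sq y)).
      by apply: ler_pM => //; exact: le_trans yy (norm_sq y).
    by rewrite lerDl mulr_ge0 // (le_trans _ (norm_qu y)) // exprn_ge0.
  have h1 : `|ddf i (x + s *: y) 0 j - ddf i x 0 j| <= 2 * M.
    by apply: (le_trans (ler_normB _ _)); rewrite -[2]/(1 + 1) mulrDl mul1r lerD.
  apply: (@le_trans _ _ (2 * M * `|y| ^+ 2)); first exact: ler_pM.
  have h2 : 2 * M * `|y| ^+ 2 <= 2 * M / a ^+ 2 * qu y.
    have -> : 2 * M / a ^+ 2 * qu y = 2 * M * (qu y / a ^+ 2) by ring.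
    apply: ler_wpM2l; first by rewrite mulr_ge0 ?(M0 i j).
    rewrite ler_pdivlMr ?exprn_gt0 //; apply: le_trans (norm_qu y); rewrite -[leRHS]/(`|y| ^+ (2 + 2)) exprD ler_wpM2l ?sqr_ge0 //.
    by rewrite lerXn2r // nnegrE // ltW.
  by rewrite -[leLHS]add0r lerD // mulr_ge0 // sq_ge0.
have := taylor_in g1 g2 bd.
rewrite scale1r !scale0r !addr0 expr1n mulr1 expr0n /= !mulr0 !subr0.
congr (`| _ | <= _); rewrite /dot.
have -> : \sum_i \sum_j 2^-1 * ddf i x 0 j * (y 0 i * y 0 j) = 2^-1 * Q.
  rewrite /Q mulr_sumr; apply: eq_bigr => i _; rewrite mulr_sumr; apply: eq_bigr => j _; ring.
ring.
Qed.

Lemma heat_generator_le f df ddf (M e a r : R) : U2 f df ddf -> 0 <= e -> 0 < a -> 0 < r ->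
  (forall i j x, `|ddf i x 0 j| <= M) ->
  (forall i j x y, `|x - y| < a -> `|ddf i x 0 j - ddf i y 0 j| <= e) ->
  forall x, `|G r f x - f x - r * (2^-1 * trace ddf x)| <=
   n%:R ^+ 2 * (e * (n%:R * r) + `|2 * M / a ^+ 2| * (n%:R * (128 * r ^+ 2))).
Proof.
move=> hf e0 a0 r0 hM ha x; have uf : ubc f by case: hf => /U1_ubc.
have icst (c : R) := bmeas_integrable PT (bmeas_cst (T := T) c).
pose Z y := f (x + y) - f x - \sum_i df x 0 i * y 0 i -
     \sum_i \sum_j 2^-1 * ddf i x 0 j * (y 0 i * y 0 j).
have i1 : integ (fun w => f (x + B r w)) by apply: ubc_integ => //; exact: ltW.
have i2 i : integ (fun w => df x 0 i * B r w 0 i) by apply: integZ; exact: (integ_coord hB).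
have i3 i j : integ (fun w => 2^-1 * ddf i x 0 j * (B r w 0 i * B r w 0 j)).
  by apply: integZ; exact: (integ_prod hB).
have i4 : integ (fun w => f (x + B r w) - f x) by apply: integB.
have i5 : integ (fun w => \sum_i df x 0 i * B r w 0 i) by exact: integ_sum.
have i6 i : integ (fun w => \sum_j 2^-1 * ddf i x 0 j * (B r w 0 i * B r w 0 j)).
  by apply: integ_sum => j.
have i7 : integ (fun w => \sum_i \sum_j 2^-1 * ddf i x 0 j * (B r w 0 i * B r w 0 j)).
  by apply: integ_sum => i.
have iZ : integ (fun w => Z (B r w)) by apply: integB => //; exact: integB.
have -> : G r f x - f x - r * (2^-1 * trace ddf x) = E (fun w => Z (B r w)).
  rewrite expB //; last exact: integB.
  rewrite expB // expB // exp_cst exp_sum // big1; last first.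
    by move=> i _; rewrite expZ ?(moment1 hB) ?mulr0 //; exact: (integ_coord hB).
  rewrite subr0; congr (_ - _); rewrite exp_sum // /trace 2!mulr_sumr.
  apply: eq_bigr => i _; rewrite exp_sum // (bigD1 i) //= big1 ?addr0; last first.
    move=> j ji; rewrite expZ; last exact: (integ_prod hB).
    by rewrite (moment11 hB) // eq_sym (negbTE ji) mul0r mulr0.
  rewrite expZ; last exact: (integ_prod hB).
  by rewrite (moment11 hB) // eqxx mul1r; ring.
apply: (le_trans (exp_norm iZ)).
pose c := `|2 * M / a ^+ 2|.
have isq := integ_sq hB r0; have iqu := integ_qu hB r0.
have i8 : integ (fun w => e * sq (B r w) + c * qu (B r w)) by apply: integD; exact: integZ.
apply: (@le_trans _ _ (E (fun w => n%:R ^+ 2 * (e * sq (B r w) + c * qu (B r w))))).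
  apply: exp_le; [|exact: integZ|].
    by have := integrable_abse iZ; congr (integrable _ _ _).
  move=> w; apply: (le_trans (second_order hf e0 a0 hM ha x (B r w))).
  rewrite ler_wpM2l ?exprn_ge0 // lerD2l ler_wpM2r ?ler_norm //.
  by apply: le_trans (norm_qu _); rewrite exprn_ge0.
rewrite expZ // ler_wpM2l ?exprn_ge0 // expD ?expZ //; try exact: integZ.
by rewrite (exp_sq hB r0) lerD2l; apply: ler_wpM2l (exp_qu hB r0); exact: normr_ge0.
Qed.

Lemma heat_generator f df ddf : U2 f df ddf -> forall e, 0 < e -> exists2 a, 0 < a &
  forall r, 0 < r -> r < a -> forall x, `|G r f x - f x - r * (2^-1 * trace ddf x)| <= e * r.
Proof.
move=> hf e e0; have [_ h2] := hf.
have /choice[M hM] : forall ij : 'I_n * 'I_n, exists M, forall x, `|ddf ij.1 x 0 ij.2| <= M.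
  by move=> [i j]; case: (h2 i) => _ _ /(_ j)[].
pose K := \sum_ij `|M ij|.
have hK i j x : `|ddf i x 0 j| <= K.
  rewrite (le_trans (hM (i, j) x)) // (le_trans (ler_norm _)) //.
  by rewrite /K (bigD1 (i, j)) //= lerDl sumr_ge0.
pose c := n%:R ^+ 3 + 1 : R.
have c0 : 0 < c by rewrite ltr_wpDl // exprn_ge0.
pose e' := e / 2 / c; have e'0 : 0 < e' by rewrite !divr_gt0.
have [a a0 ha] : exists2 a, 0 < a & forall i j x y, `|x - y| < a -> `|ddf i x 0 j - ddf i y 0 j| <= e'.
  suff H (s : seq ('I_n * 'I_n)) : exists2 a, 0 < a & forall ij, ij \in s ->
      forall x y, `|x - y| < a -> `|ddf ij.1 x 0 ij.2 - ddf ij.1 y 0 ij.2| <= e'.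
    have [a a0 ha] := H (enum {: 'I_n * 'I_n}); exists a => // i j; apply: (ha (i, j)).
    by rewrite mem_enum.
  elim: s => [|[i j] s [a a0 ha]]; first by exists 1.
  have [b b0 hb] : exists2 b, 0 < b & forall x y, `|x - y| < b -> `|ddf i x 0 j - ddf i y 0 j| <= e'.
    by case: (h2 i) => _ _ /(_ j)[_ /(_ _ e'0)].
  exists (Num.min a b) => [|ij ijs x y]; first by rewrite lt_min a0.
  rewrite lt_min => /andP[xa xb]; move: ijs; rewrite inE => /orP[/eqP->|/ha]; first exact: hb.
  exact.
pose k := n%:R ^+ 2 * (`|2 * K / a ^+ 2| * (n%:R * 128)) + 1.
have k0 : 0 < k by rewrite ltr_wpDl // !mulr_ge0 ?exprn_ge0.
exists (e / 2 / k) => [|r r0]; first by rewrite !divr_gt0.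
rewrite ltr_pdivlMr // => hr x.
apply: (le_trans (heat_generator_le hf (ltW e'0) a0 r0 hK ha x)).
have h1 : n%:R ^+ 2 * (e' * (n%:R * r)) <= e / 2 * r.
  have -> : n%:R ^+ 2 * (e' * (n%:R * r)) = (e' * n%:R ^+ 3) * r by ring.
  rewrite ler_wpM2r ?(ltW r0) // /e' -mulrA ler_piMr ?divr_ge0 ?(ltW e0) //.
  by rewrite mulrC ler_pdivrMr // mul1r lerDl.
have h2' : n%:R ^+ 2 * (`|2 * K / a ^+ 2| * (n%:R * (128 * r ^+ 2))) <= e / 2 * r.
  have -> : n%:R ^+ 2 * (`|2 * K / a ^+ 2| * (n%:R * (128 * r ^+ 2))) = (r * (k - 1)) * r.
    by rewrite /k; ring.
  by rewrite ler_wpM2r ?(ltW r0) //; lra.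
by rewrite mulrDr; lra.
Qed.

End Heat.

(** * Markov property, semigroup law and orthogonal invariance *)

Section HeatSemigroup.
Context {R : realType} {n : nat} {d : measure_display} {T : measurableType d}.
Variables (P : probability T R) (B : R -> T -> 'rV[R]_n).
Hypothesis hB : brownian_motion P B.
Local Notation bT := (borel_rV R n).
Local Notation E f := (\int[P]_w f w).
Local Notation G := (heat P B).
Implicit Types (r s t : R) (f g : 'rV[R]_n -> R) (df dg : 'rV[R]_n -> 'rV[R]_n).
Implicit Types (ddf ddg : 'I_n -> 'rV[R]_n -> 'rV[R]_n) (p x : 'rV[R]_n).

Let PT : (P setT <= 1)%E. Proof. exact: probability_le1. Qed.

Lemma integral_in_exp (D : set T) (f : T -> R) : measurable D -> bmeas f ->
  (\int[P]_(w in D) (f w)%:E)%E = (E (fun w => \1_D w * f w))%:E.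
Proof.
move=> mD bf; rewrite EFin_exp; last first.
  by apply: bmeas_integrable => //; apply: bmeasM => //; exact: bmeas_indic.
rewrite [LHS]integral_mkcond; apply: eq_integral => w _.
by rewrite patchE indicE; case: ifP => _; rewrite ?mul1r ?mul0r.
Qed.

Lemma dist_half (a b c e : R) : `|a - c| <= e / 2 -> `|b - c| <= e / 2 -> `|a - b| <= e.
Proof.
move=> h1 h2; have -> : a - b = (a - c) - (b - c) by ring.
by apply: (le_trans (ler_normB _ _)); rewrite (splitr e) lerD.
Qed.

Lemma dist_half3 (a b c c' e : R) :
  `|a - c - c'| <= e / 2 -> `|b - c - c'| <= e / 2 -> `|a - b| <= e.
Proof. by rewrite -!addrA -!opprD => h1 h2; exact: dist_half h1 h2. Qed.

Lemma heat_ext r f g x : (forall y, f y = g y) -> G r f x = G r g x.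
Proof. by move=> /funext->. Qed.

Lemma heat_time r s f x : r = s -> G r f x = G s f x.
Proof. by move=> ->. Qed.

Lemma past_setI (tau : nat -> R) j (D F : set T) :
  past B tau j D -> past B tau j F -> past B tau j (D `&` F).
Proof. exact: (@measurableI _ (g_sigma_algebraType (past_rects B tau j))). Qed.

Section Grid.
Variable tau : nat -> R.
Hypotheses (tau0 : tau 0%N = 0) (tauS : forall k, tau k < tau k.+1).
Let tau_ge0 := grid_ge0 tau0 tauS.

Lemma past_position j k x (A : set bT) : (k <= j)%N -> measurable A ->
  past B tau j ((fun w => (x + B (tau k) w)%R : bT) @^-1` A).
Proof.
move=> kj mA; pose A' : set bT := (fun y : bT => (x + (y : 'rV[R]_n))%R : bT) @^-1` A.
have mA' : measurable A'.
  rewrite -[X in measurable X]setTI.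
  have mx : measurable_fun setT (fun y : bT => (x + (y : 'rV[R]_n))%R : bT).
    by apply: measurable_addrV; [exact: measurable_cst|exact: measurable_id].
  exact: mx measurableT _ mA.
exact: (past_brownian hB tau0 kj mA').
Qed.

(** The Markov property at a grid time, on a past event D: the next increment is independent of D
    and of the present position, and integrating it out applies the heat operator. *)
Lemma markov_step j (D : set T) f x : past B tau j D -> ubc f ->
  E (fun w => \1_D w * f (x + B (tau j.+1) w)) =
  E (fun w => \1_D w * G (tau j.+1 - tau j) f (x + B (tau j) w)).
Proof.
move=> pD uf; have mD := past_measurable hB tau0 tauS pD.
set r := tau j.+1 - tau j.
have r0 : 0 < r by rewrite subr_gt0.
have mB s : 0 <= s -> measurable_fun setT (B s : T -> bT) by move=> s0; exact: (brownian_measurable hB).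
have [g gE] := exists_pushforward P (mB r (ltW r0)).
have gT : (g setT < +oo)%E.
  by rewrite gE /pushforward preimage_setT (le_lt_trans PT) // ltry.
have mX := shift_measurable hB x (tau_ge0 j).
have mY := incr_measurable hB tau0 tauS j.
have law A : measurable A -> P (incr B tau j @^-1` A) = g A.
  move=> mA; have e := incr_law hB (tau_ge0 j) r0 mA.
  have tr : tau j + r = tau j.+1 by rewrite /r addrC subrK.
  by rewrite tr in e; rewrite gE; exact: e.
have key (k : 'rV[R]_n -> R) : ubc k -> (forall y, 0 <= k y) ->
    E (fun w => \1_D w * k (x + B (tau j.+1) w)) = E (fun w => \1_D w * G r k (x + B (tau j) w)).
  move=> uk k0; apply: EFin_inj.
  rewrite -!integral_in_exp //; last 2 first.
  - by apply: (ubc_bmeas hB) => //; apply: (heat_ubc hB) => //; exact: ltW.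
  - exact: (ubc_bmeas hB).
  have mF : measurable_fun setT (fun z : bT * bT => (k ((z.1 : 'rV[R]_n) + (z.2 : 'rV[R]_n)))%:E).
    apply/measurable_EFinP; apply: (measurableT_comp (f := k : bT -> R)); first exact: ubc_measurable.
    by apply: measurable_addrV; [exact: measurable_fst|exact: measurable_snd].
  transitivity (\int[P]_(w in D) (k ((x + B (tau j) w) + (incr B tau j w : 'rV[R]_n)))%:E)%E.
    by apply: eq_integral => w _; rewrite /incr -addrA [_ + (_ - _)]addrC subrK.
  have PTo : (P setT < +oo)%E by rewrite (le_lt_trans PT) // ltry.
  rewrite (integral_product (X := fun w => (x + B (tau j) w)%R : bT) (Y := incr B tau j : T -> bT)
    (g := g) mD PTo gT mX mY _ mF) //; last 2 first.
  - move=> A A' mA mA'; rewrite -(law _ mA'); apply: (past_indep hB tau0 tauS _ mA').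
    by apply: past_setI => //; exact: past_position.
  - by move=> z; rewrite lee_fin.
  apply: eq_integral => w _; rewrite EFin_exp; last by apply: (ubc_integ hB) => //; exact: ltW.
  have mk : measurable_fun (setT : set bT) (fun y : bT => (k (x + B (tau j) w + (y : 'rV[R]_n)))%:E).
    apply/measurable_EFinP; apply: (measurableT_comp (f := k : bT -> R)); first exact: ubc_measurable.
    by apply: measurable_addrV; [exact: measurable_cst|exact: measurable_id].
  rewrite gE ge0_integral_pushforward ?preimage_setT //; first exact: mB _ (ltW r0).
  by move=> y _; rewrite lee_fin.
(* The argument with Tonelli's theorem covers nonnegative functions. Adding the constant M reduces f
   to that case, and its contribution cancels. *)
have [[M hM] _] := uf.
have ufM : ubc (fun y => f y + M) by apply: ubcD => //; exact: ubc_cst.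
have fM0 y : 0 <= f y + M by have := hM y; rewrite ler_norml; lra.
move: (key _ ufM fM0).
have bD : bmeas (\1_D : T -> R) by exact: bmeas_indic.
have b1 y : 0 <= y -> bmeas (fun w => \1_D w * f (x + B y w)) by move=> y0; apply: bmeasM => //; exact: (ubc_bmeas hB).
have b2 : bmeas (fun w => \1_D w * G r f (x + B (tau j) w)).
  by apply: bmeasM => //; apply: (ubc_bmeas hB) => //; apply: (heat_ubc hB) => //; exact: ltW.
have b3 : bmeas (fun w => \1_D w * M) by apply: bmeasM => //; exact: bmeas_cst.
under eq_Rintegral do rewrite mulrDr.
rewrite expD; try apply: (bmeas_integrable PT) => //; last exact: b1.
under [X in _ = X -> _]eq_Rintegral do
  rewrite (heatD hB _ (ltW r0) uf (ubc_cst M)) {2}/heat (exp_cst P) mulrDr.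
rewrite expD; try exact: (bmeas_integrable PT).
by move=> /addIr.
Qed.

End Grid.

Lemma heat_semigroup s r f x : 0 <= s -> 0 <= r -> ubc f -> G (s + r) f x = G s (G r f) x.
Proof.
rewrite le_eqVlt => /orP[/eqP<-|s0]; first by move=> r0 uf; rewrite add0r (heat0 hB).
rewrite le_eqVlt => /orP[/eqP<-|r0] uf.
  by rewrite addr0; apply: heat_ext => y; rewrite (heat0 hB).
(* A grid through 0, s and s + r; [markov_step] at its index 1, with the sure event, is the
   semigroup law. *)
pose tau (k : nat) := if k is k'.+1 then s + k'%:R * r else 0.
have tauS k : tau k < tau k.+1.
  case: k => [|k] /=; first by rewrite mul0r addr0.
  by rewrite ltrD2l ltr_pM2r // ltr_nat.
have pT : past B tau 1 setT by apply: sub_sigma_algebra; exact: past_setT.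
have := markov_step (erefl : tau 0%N = 0) tauS x pT uf.
rewrite /= mul0r addr0 mul1r [s + r - s]addrAC subrr add0r.
under eq_Rintegral do rewrite indicT mul1r.
under [X in _ = X -> _]eq_Rintegral do rewrite indicT mul1r.
exact.
Qed.

(* Both (heat r f) o w and heat r (f o w) are semigroups with generator half the
   Laplacian, so the interpolation between them is constant. *)
Lemma heat_mulmx (w : 'M[R]_n) f df ddf t x : w *m w^T = 1%:M -> w^T *m w = 1%:M ->
  U2 f df ddf -> 0 < t -> G t (fun y => f (y *m w)) x = G t f (x *m w).
Proof.
move=> wwT wTw hf t0.
pose S r g z := G r (fun y => g (y *m w)) (z *m w^T).
have uw g : ubc g -> ubc (fun y => g (y *m w)) by exact: ubc_mulmx.
have uS r g : 0 <= r -> ubc g -> ubc (S r g).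
  move=> r0 ug; apply: (ubc_mulmx w^T (f := G r _)).
  by apply: (heat_ubc hB) => //; exact: uw.
have Ssg s r g z : 0 <= s -> 0 <= r -> ubc g -> S (s + r) g z = S s (S r g) z.
  move=> s0 r0 ug; rewrite /S (heat_semigroup _ s0 r0 (uw _ ug)).
  by apply: heat_ext => y; rewrite -mulmxA wwT mulmx1.
have uf : ubc f by case: hf => /U1_ubc.
have Sdist s g k (M : R) z : 0 <= s -> ubc g -> ubc k -> (forall y, `|g y - k y| <= M) ->
    `|S s g z - S s k z| <= M.
  by move=> s0 ug uk h; apply: (heat_dist hB) => //; exact: uw.
(* Here S is the heat semigroup conjugated by w. F runs from pure heat flow at s = 0 to pure
   conjugated flow at s = t, and its increments compare the two generators on a single function. *)
pose F z s := S s (G (t - s) f) z.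
have F0 z : F z 0 = G t f z.
  by rewrite /F /S (heat0 hB) subr0 -mulmxA wTw mulmx1.
have Ft z : F z t = G t (fun y => f (y *m w)) (z *m w^T).
  rewrite /F /S subrr; apply: heat_ext => y; exact: (heat0 hB).
have rc z s : 0 <= s -> s < t -> forall e, 0 < e -> exists2 a, 0 < a &
     forall r, 0 < r -> r < a -> s + r <= t -> `|F z (s + r) - F z s| <= e.
  move=> s0 st e e0; have e2 : 0 < e / 2 by rewrite divr_gt0.
  case: (uf) => /bounded_gt0[M M0 hM] cf.
  have e4 : 0 < e / 4 by rewrite divr_gt0.
  have [a a0 ha] := cf _ e4; have [b b0 hb] := (uw _ uf).2 _ e4.
  pose c := n%:R * `|w| + 1; have c0 : 0 < c by rewrite ltr_wpDl // mulr_ge0.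
  (* The function g below depends on r, so its modulus must not: a is one for every heat evolution
     of f, and a / c is one after composition with w, which stretches lengths by at most c. *)
  pose k := Num.min a (a / c); have k0 : 0 < k by rewrite lt_min a0 divr_gt0.
  have K0 : 0 < 2 * M / k ^+ 2 * n%:R + 1.
    by rewrite ltr_wpDl // mulr_ge0 // divr_ge0 ?sqr_ge0 // mulr_ge0 // ltW.
  exists (e / 4 / (2 * M / k ^+ 2 * n%:R + 1)) => [|r r0]; first by rewrite divr_gt0.
  rewrite ltr_pdivlMr // => hr srt.
  have tsr : 0 <= t - (s + r) by rewrite subr_ge0.
  pose g := G (t - (s + r)) f; have ug : ubc g by exact: (heat_ubc hB).
  have gM y : `|g y| <= M by exact: (heat_bound hB).
  have gmod y y' : `|y - y'| < a -> `|g y - g y'| <= e / 4.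
    by apply: (heat_modulus_le hB).
  have Fsr : F z (s + r) = S s (S r g) z by rewrite /F (Ssg _ _ _ _ s0 (ltW r0) ug).
  have Fs : F z s = S s (G r g) z.
    rewrite /F /g; apply: heat_ext => y; rewrite -(heat_semigroup (y *m w) (ltW r0) tsr uf).
    by apply: heat_time; ring.
  rewrite Fsr Fs; apply: (Sdist _ _ _ _ _ s0 (uS _ _ (ltW r0) ug) (heat_ubc hB (ltW r0) ug)).
  move=> y.
  have bd q : 0 <= q -> q <= 2 * M / k ^+ 2 * (n%:R * r) -> e / 4 + q <= e / 2.
    move=> q0 hq; have qE : 2 * M / k ^+ 2 * (n%:R * r) = r * (2 * M / k ^+ 2 * n%:R + 1) - r by ring.
    by rewrite qE in hq; clear -e0 r0 hr hq; lra.
  have q0 : 0 <= 2 * M / k ^+ 2 * (n%:R * r).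
    apply: mulr_ge0; last by apply: mulr_ge0 => //; exact: ltW.
    by apply: divr_ge0; [apply: mulr_ge0 => //; exact: ltW|exact: sqr_ge0].
  have h1 : `|G r g y - g y| <= e / 2.
    apply: le_trans (bd _ q0 (lexx _)).
    apply: (heat_near_le hB r0 (ltW e4) k0 ug gM) => p q pq.
    by apply: gmod; apply: (lt_le_trans pq); rewrite ge_min lexx.
  have h2 : `|S r g y - g y| <= e / 2.
    rewrite /S -[in X in _ - g X](mulmx1 y) -wTw mulmxA.
    apply: le_trans (bd _ q0 (lexx _)).
    apply: (heat_near_le hB r0 (ltW e4) k0 (uw _ ug) (fun y => gM (y *m w))) => p q pq.
    apply: gmod; rewrite -mulmxBl; apply: (le_lt_trans (norm_mulmx _ _)).
    have pqc : `|p - q| < a / c by apply: (lt_le_trans pq); rewrite ge_min lexx orbT.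
    rewrite (ltr_pdivlMr _ _ c0) mulrC in pqc; apply: le_lt_trans pqc.
    by apply: ler_wpM2r; [exact: normr_ge0|rewrite lerDl].
  exact: dist_half h2 h1.
have ld z s : 0 < s -> s <= t -> forall e, 0 < e -> exists2 a, 0 < a &
     forall r, 0 < r -> r < a -> r <= s -> `|F z (s - r) - F z s| <= e * r.
  move=> s0 st e e0; have e2 : 0 < e / 2 by rewrite divr_gt0.
  have ts : 0 <= t - s by rewrite subr_ge0.
  pose g := G (t - s) f.
  have [dg [ddg hg]] : exists dg ddg, U2 g dg ddg by do 2!eexists; exact: (heat_U2 hB ts hf).
  have ug : ubc g by exact: (heat_ubc hB).
  have [a a0 ha] := heat_generator hB hg e2.
  have [b b0 hb] := heat_generator hB (U2_mulmx w hg) e2.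
  exists (Num.min a b) => [|r r0]; first by rewrite lt_min a0.
  rewrite lt_min => /andP[ra rb] rs.
  have sr : 0 <= s - r by rewrite subr_ge0.
  have -> : F z s = S (s - r) (S r g) z by rewrite /F -(Ssg (s - r) r g z sr (ltW r0) ug) subrK.
  have -> : F z (s - r) = S (s - r) (G r g) z.
    rewrite /F /g; apply: heat_ext => y; rewrite -(heat_semigroup (y *m w) (ltW r0) ts uf).
    by apply: heat_time; ring.
  apply: (Sdist _ _ _ _ _ sr (heat_ubc hB (ltW r0) ug) (uS _ _ (ltW r0) ug)).
  move=> y; have h1 := ha r r0 ra y; have h2 := hb r r0 rb (y *m w^T).
  rewrite trace_mulmx // in h2; rewrite -mulmxA wTw mulmx1 in h2.
  have e2r : e / 2 * r = e * r / 2 by rewrite mulrAC.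
  rewrite e2r in h1 h2; exact: dist_half3 h1 h2.
have le z : F z 0 <= F z t.
  apply: dini_le => //; first by move=> s s0 st e e0; exact: rc.
  move=> s s0 st e e0; have [a a0 ha] := ld z s s0 st e e0; exists a => // r r0 ra rs.
  exact: le_trans (ler_norm _) (ha r r0 ra rs).
have ge z : F z t <= F z 0.
  rewrite -lerN2; apply: (dini_le (F := fun s => - F z s)) => //.
    move=> s s0 st e e0; have [a a0 ha] := rc z s s0 st e e0; exists a => // r r0 ra rs.
    by rewrite -opprD normrN; exact: ha.
  move=> s s0 st e e0; have [a a0 ha] := ld z s s0 st e e0; exists a => // r r0 ra rs.
  by apply: le_trans (ha r r0 ra rs); rewrite -opprD -normrN ler_norm.
have FE z : F z 0 = F z t by apply: le_anti; apply/andP; split; [exact: le|exact: ge].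
rewrite -F0 FE Ft -mulmxA wwT mulmx1; reflexivity.
Qed.

End HeatSemigroup.

(** * Killed Brownian motion and the method of images *)

Section KilledPaths.
Context {R : realType} {n : nat} {W : set 'M[R]_n} {C : set 'rV[R]_n}.
Context {pos : {fset 'rV[R]_n}} {hcox : reflection_chamber W C pos}.
Context {d : measure_display} {T : measurableType d}.
Variables (P : probability T R) (B : R -> T -> 'rV[R]_n).
Hypothesis hB : brownian_motion P B.
Local Notation bT := (borel_rV R n).
Implicit Types (t s r : R) (x y : 'rV[R]_n) (w : T).

Lemma path_continuous s x a w : 0 <= s -> forall e, 0 < e -> exists2 u, 0 < u &
  forall r, 0 <= r -> `|r - s| < u -> `|dot a (x + B r w) - dot a (x + B s w)| < e.
Proof.
move=> s0 e e0; case: hB => -[_ cB] _ _.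
have /(_ s) := (@subspace_continuousP _ _ _ (fun r => B r w)).1 (cB w).
have ms : (`[0, +oo[%classic : set R) s by rewrite /= in_itv /= s0.
move=> /(_ ms) cs.
have c0 : 0 < n%:R * `|a| + 1 by rewrite ltr_wpDl // mulr_ge0.
have /cvgrPdist_lt/(_ _ (divr_gt0 e0 c0)) := cs.
rewrite near_withinE => /nbhs_ballP[u /= u0 hu]; exists u => // r r0 rs.
have {}hu : `|B s w - B r w| < e / (n%:R * `|a| + 1).
  by apply: hu; rewrite /= ?in_itv /= ?r0 // /ball /= distrC.
rewrite -dotBr opprD addrACA subrr add0r -normrN -dotNr opprB.
apply: (le_lt_trans (normr_dot _ _)).
move: hu; rewrite ltr_pdivlMr // => hu; apply: le_lt_trans hu.
by rewrite mulrC ler_wpM2l // lerDl.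
Qed.

Definition above (e : R) (y : 'rV[R]_n) : Prop := forall a, a \in pos -> e < dot a y.

Definition mesh t (k : nat) : R := t / (2 ^ k)%:R.

(* A countable reformulation of t < exit_time (see [stay_exit]), from which joint
   measurability in (x, w) is apparent. *)
Definition stay_on (m k : nat) t x w : Prop :=
  forall i, (i <= 2 ^ k)%N -> above m.+1%:R^-1 (x + B (i%:R * mesh t k) w).

Definition stay t x w : Prop := exists m, forall k, stay_on m k t x w.

Lemma mesh_gt0 t k : 0 < t -> 0 < mesh t k.
Proof. by move=> t0; rewrite divr_gt0 // ltr0n expn_gt0. Qed.

Lemma mesh_total t k : (2 ^ k)%:R * mesh t k = t.
Proof. by rewrite mulrC mulfVK // pnatr_eq0 -lt0n expn_gt0. Qed.

Lemma stay_on_le m k l t x w : (k <= l)%N -> stay_on m l t x w -> stay_on m k t x w.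
Proof.
move=> kl h i ik; have := h (i * 2 ^ (l - k))%N.
have e : (2 ^ l = 2 ^ k * 2 ^ (l - k))%N by rewrite -expnD subnKC.
rewrite {1}e leq_mul2r ik orbT => /(_ isT).
have -> : (i * 2 ^ (l - k))%:R * mesh t l = i%:R * mesh t k; last by [].
rewrite /mesh e !natrM; field.
by rewrite !pnatr_eq0 -!lt0n !expn_gt0.
Qed.

Lemma stay_on_mono m m' k t x w : (m <= m')%N -> stay_on m k t x w -> stay_on m' k t x w.
Proof.
move=> mm h i ik a ap; apply: le_lt_trans (h i ik a ap).
by rewrite lef_pV2 ?posrE ?ltr0n // ler_nat ltnS.
Qed.

Lemma mesh_lt t e : 0 < t -> 0 < e -> exists k, mesh t k < e.
Proof.
move=> t0 e0; have [k] := ltr_add_invr (y := 0) (x := e / t) ltac:(by rewrite divr_gt0).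
rewrite add0r => hk; exists k; rewrite ltr_pdivrMr ?ltr0n ?expn_gt0 //.
have k1 : t < e * k.+1%:R.
  move: hk; rewrite ltr_pdivlMr // mulrC ltr_pdivrMr // ?ltr0n //.
apply: (lt_le_trans k1); rewrite ler_wpM2l ?(ltW e0) // ler_nat; exact: ltn_expl.
Qed.

Lemma mesh_approx t s e : 0 < t -> 0 <= s <= t -> 0 < e -> exists k i, (i <= 2 ^ k)%N /\
  `|i%:R * mesh t k - s| < e.
Proof.
move=> t0 /andP[s0 st] e0; have [k hk] := mesh_lt t0 e0.
have m0 := mesh_gt0 k t0.
pose i := Num.truncn (s / mesh t k); exists k, i.
have sm0 : 0 <= s / mesh t k by rewrite divr_ge0 // ltW.
have /andP[h1 h2] := truncn_itv sm0.
have h3 : i%:R * mesh t k <= s by rewrite -ler_pdivlMr.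
have h4 : s < i.+1%:R * mesh t k by rewrite -ltr_pdivrMr.
split.
  rewrite -(ler_nat R) -(ler_pM2r m0) mesh_total; exact: le_trans h3 st.
rewrite ler0_norm ?subr_le0 // opprB; apply: le_lt_trans hk.
rewrite -natr1 mulrDl mul1r in h4; lra.
Qed.

(** A margin at dyadic times extends by continuity to all of [0, t]. Conversely, each root attains a
    positive minimum on the compact interval [0, t] while the path is in C, and finitely many minima
    leave a common margin. *)
Lemma stay_exit t x w : 0 < t ->
  stay t x w <-> (t%:E < exit_time C (fun s w' => (x + B s w')%R) w)%E.
Proof.
move=> t0; split.
- move=> [m hm]; have m0 : 0 < m.+1%:R^-1 :> R by rewrite invr_gt0 ltr0n.
  have ab s : 0 <= s <= t -> forall a, a \in pos -> m.+1%:R^-1 <= dot a (x + B s w).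
    move=> hs a ap; rewrite leNgt; apply/negP => h.
    have h' : 0 < m.+1%:R^-1 - dot a (x + B s w) by rewrite subr_gt0.
    have s0 : 0 <= s by case/andP: hs.
    have [u u0 hu] := path_continuous x a w s0 h'.
    have [k [i [ik his]]] := mesh_approx t0 hs u0.
    have i0 : 0 <= i%:R * mesh t k by rewrite mulr_ge0 // ltW // mesh_gt0.
    have := hu _ i0 his => /(le_lt_trans (ler_norm _)); rewrite ltrD2r.
    by move=> /(lt_trans (hm k i ik a ap)); rewrite ltxx.
  have [u u0 hu] : exists2 u, 0 < u & forall r, 0 <= r -> `|r - t| < u -> C (x + B r w).
    suff H (s : seq 'rV[R]_n) : {subset s <= pos} -> exists2 u, 0 < u &
        forall r, 0 <= r -> `|r - t| < u -> forall a, a \in s -> 0 < dot a (x + B r w).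
      have [u u0 hu] := H _ (fun a => id); exists u => // r r0 rt.
      by rewrite (chamberE (hcox := hcox)) => a; exact: hu.
    elim: s => [|a s IH] sp; first by exists 1.
    have [|u u0 hu] := IH; first by move=> b bs; apply: sp; rewrite inE bs orbT.
    have ap : a \in pos by apply: sp; rewrite inE eqxx.
    have [v v0 hv] := path_continuous x a w (ltW t0) m0.
    exists (Num.min u v) => [|r r0]; first by rewrite lt_min u0.
    rewrite lt_min => /andP[ru rv] b; rewrite inE => /orP[/eqP->|]; last exact: hu.
    have t1 : 0 <= t <= t by rewrite lexx andbT ltW.
    have := hv r r0 rv; have := ab t t1 a ap; move: (_^-1) => e; rewrite ltr_norml; lra.
  apply: (@lt_le_trans _ _ (t + u)%:E); first by rewrite lte_fin ltrDl.
  apply: le_ereal_inf_tmp => _ [s [s0 Cs] <-]; rewrite lee_fin leNgt; apply/negP => stu.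
  apply: Cs; have [st|ts] := leP s t.
    rewrite (chamberE (hcox := hcox)) => a ap; apply: lt_le_trans (ab s _ a ap) => //.
    by rewrite s0.
  by apply: hu => //; rewrite ger0_norm; lra.
- move=> tE.
  have Cs s : 0 <= s <= t -> C (x + B s w).
    move=> /andP[s0 st]; apply: contrapT => nC.
    have : (exit_time C (fun s w' => (x + B s w')%R) w <= s%:E)%E.
      by apply: ereal_inf_lbound; exists s.
    by move=> /(lt_le_trans tE); rewrite lte_fin ltNge st.
  have [e e0 he] : exists2 e, 0 < e & forall a, a \in pos -> forall s, 0 <= s <= t -> e < dot a (x + B s w).
    suff H (l : seq 'rV[R]_n) : {subset l <= pos} -> exists2 e, 0 < e &
        forall a, a \in l -> forall s, 0 <= s <= t -> e < dot a (x + B s w).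
      by have [e e0 he] := H _ (fun a => id); exists e.
    elim: l => [|a l IH] sp; first by exists 1.
    have [|e e0 he] := IH; first by move=> b bs; apply: sp; rewrite inE bs orbT.
    have ap : a \in pos by apply: sp; rewrite inE eqxx.
    have cw : {within `[0, t], continuous (fun s => dot a (x + B s w))}.
      apply/subspace_continuousP => s; rewrite /= in_itv /= => hs.
      have s0 : 0 <= s by case/andP: hs.
      apply/cvgrPdist_lt => q q0; have [u u0 hu] := path_continuous x a w s0 q0.
      rewrite near_withinE; apply/nbhs_ballP; exists u => //= r; rewrite /ball /= => rs.
      by rewrite in_itv /= => /andP[r0 _]; rewrite distrC; apply: hu => //; rewrite distrC.
    have [c] := EVT_min (ltW t0) cw; rewrite in_itv /= => hc hmin.
    have dc : 0 < dot a (x + B c w) by apply: (chamber_dot (hcox := hcox)) => //; exact: Cs.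
    exists (Num.min e (dot a (x + B c w) / 2)) => [|b].
      by rewrite lt_min e0 divr_gt0.
    rewrite inE => /orP[/eqP->|bl] s hs.
      rewrite gt_min; apply/orP; right; have := hmin s; rewrite in_itv /= => /(_ hs); lra.
    by rewrite gt_min he.
  have [m hm] := ltr_add_invr (y := 0) (x := e) e0; rewrite add0r in hm.
  exists m => k i ik a ap; apply: (lt_trans hm); apply: he => //.
  rewrite mulr_ge0 ?(ltW (mesh_gt0 k t0)) //= -[leRHS](mesh_total t k).
  by rewrite ler_pM2r ?ler_nat // mesh_gt0.
Qed.

Lemma stay_chamber t x w : 0 < t -> stay t x w -> C x /\ C (x + B t w).
Proof.
move=> t0 [m hm]; have m0 : 0 < m.+1%:R^-1 :> R by rewrite invr_gt0 ltr0n.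
split; rewrite (chamberE (hcox := hcox)) => a ap; apply: (lt_trans m0).
  by have := hm 0%N 0%N isT a ap; rewrite mul0r (brownian0 hB) addr0.
by have := hm 0%N 1%N isT a ap; rewrite mul1r /mesh expn0 divr1.
Qed.

Lemma above_measurable (e : R) : measurable ([set y | above e y] : set bT).
Proof.
have -> : ([set y | above e y] : set bT) =
    \bigcap_(a in [set` pos]) (dot a @^-1` `]e, +oo[%classic : set bT).
  by apply/seteqP; split => y /= h a ap; have := h a ap; rewrite /= in_itv /= andbT.
apply: fin_bigcap_measurable; first exact: finite_fset.
move=> a _; rewrite -[X in measurable X]setTI.
have md := continuous_measurable_rV (@dot_continuous R n a).
exact: (md measurableT `]e, +oo[%classic (measurable_itv _)).
Qed.

Lemma joint_measurable s : 0 <= s ->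
  measurable_fun setT (fun z : bT * T => ((z.1 : 'rV[R]_n) + B s z.2)%R : bT).
Proof.
move=> s0; apply: measurable_addrV; first exact: measurable_fst.
exact: (measurableT_comp (brownian_measurable hB s0)).
Qed.

Lemma stay_on_measurable m k t : 0 < t ->
  measurable [set z : bT * T | stay_on m k t z.1 z.2].
Proof.
move=> t0.
have -> : [set z : bT * T | stay_on m k t z.1 z.2] =
    \bigcap_(i in [set i | (i <= 2 ^ k)%N])
      ((fun z : bT * T => ((z.1 : 'rV[R]_n) + B (i%:R * mesh t k) z.2)%R : bT) @^-1`
        [set y | above m.+1%:R^-1 y]).
  by apply/seteqP; split => z /= h i ik; exact: h.
apply: bigcap_measurable; first by exists 0%N.
move=> i _; rewrite -[X in measurable X]setTI.
apply: joint_measurable => //; last exact: above_measurable.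
by rewrite mulr_ge0 // ltW // mesh_gt0.
Qed.

Lemma stay_joint t : 0 < t -> measurable [set z : bT * T | stay t z.1 z.2].
Proof.
move=> t0.
have -> : [set z : bT * T | stay t z.1 z.2] =
    \bigcup_m \bigcap_k [set z : bT * T | stay_on m k t z.1 z.2].
  apply/seteqP; split => z /= [m]; first by move=> h; exists m => // k _; exact: h.
  by move=> _ h; exists m => k; exact: h k I.
apply: bigcup_measurable => m _; apply: bigcapT_measurable => k; exact: stay_on_measurable.
Qed.

Lemma slice_measurable (A : set (bT * T)) x : measurable A -> measurable [set w | A (x, w)].
Proof.
move=> mA; rewrite -[X in measurable X]setTI.
have mp : measurable_fun setT (fun w : T => ((x : bT), w)).
  by apply: measurable_fun_pair; [exact: measurable_cst|exact: measurable_id].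
exact: mp measurableT _ mA.
Qed.

Lemma stay_measurable t x : 0 < t -> measurable [set w | stay t x w].
Proof. by move=> t0; exact: (slice_measurable x (stay_joint t0)). Qed.

End KilledPaths.

(** * The formula of images *)

Section Images.
Context {R : realType} {n : nat} {W : set 'M[R]_n} {C : set 'rV[R]_n}.
Context {pos : {fset 'rV[R]_n}} {hcox : reflection_chamber W C pos}.
Context {d : measure_display} {T : measurableType d}.
Variables (P : probability T R) (B : R -> T -> 'rV[R]_n).
Hypothesis hB : brownian_motion P B.
Local Notation bT := (borel_rV R n).
Local Notation integ f := (P.-integrable setT (EFin \o f)).
Local Notation E f := (\int[P]_w f w).
Local Notation G := (heat P B).
Implicit Types (t r : R) (x y : 'rV[R]_n) (f u : 'rV[R]_n -> R).

Let PT : (P setT <= 1)%E. Proof. exact: probability_le1. Qed.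

Lemma heat_antisymmetric t u du ddu : 0 <= t -> U2 u du ddu ->
  antisymmetric (W := W) (C := C) (pos := pos) u ->
  antisymmetric (W := W) (C := C) (pos := pos) (G t u).
Proof.
rewrite le_eqVlt => /orP[/eqP<-|t0] hu au w x Ww.
  by rewrite !(heat0 hB) au.
have uu : ubc u by case: hu => /U1_ubc.
rewrite -(heat_mulmx hB x (group_orth (hcox := hcox) Ww) (group_orthT (hcox := hcox) Ww) hu t0).
rewrite -(heatZ hB _ _ (ltW t0) uu); apply: heat_ext => y; exact: au.
Qed.

(** Antisymmetry gives u (y s_a) = - u y, so 2 u y is a difference of values of u over a
    displacement proportional to (a, y). *)
Lemma wall_bound u (L : R) a y : a \in pos ->
  antisymmetric (W := W) (C := C) (pos := pos) u ->
  (forall x y, `|u x - u y| <= L * `|x - y|) ->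
  `|u y| <= L * (`|a| / dot a a) * `|dot a y|.
Proof.
move=> ap au hL.
have ra : is_root W a by exact: (pos_root (hcox := hcox)).
have a0 : 0 < dot a a by apply: dot_gt0; exact: (pos_neq0 (hcox := hcox)).
have Wa : W (refl a) by case: ra.
have e : u (y *m refl a) = - u y by rewrite au // (sgnW_refl (hcox := hcox)) // mulN1r.
have := hL y (y *m refl a); rewrite e opprK -mulr2n normrMn reflE opprB addrCA subrr addr0.
rewrite normrZ normrM normrM normfV ger0_norm // (ger0_norm (ltW a0)).
have -> : L * (2 * `|dot a y| / dot a a * `|a|) = (L * (`|a| / dot a a) * `|dot a y|) *+ 2.
  by rewrite -mulr_natl; ring.
by rewrite lerMn2r.
Qed.

(** Sums over all positive roots, as bounds valid for whichever root is crossed. *)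
Definition root_sum : R := \sum_(a <- pos) (`|a| / dot a a).
Definition root_norm : R := \sum_(a <- pos) `|a|.

Lemma le_root_sum (F : 'rV[R]_n -> R) a : a \in pos -> (forall b, b \in pos -> 0 <= F b) ->
  F a <= \sum_(b <- pos) F b.
Proof.
move=> ap F0; rewrite (big_fsetD1 a) //= lerDl big_seq; apply: sumr_ge0 => b.
by rewrite !inE => /andP[_ /F0].
Qed.

Lemma wall_bound_sum u (L : R) a y : a \in pos -> 0 <= L ->
  antisymmetric (W := W) (C := C) (pos := pos) u ->
  (forall x y, `|u x - u y| <= L * `|x - y|) ->
  `|u y| <= L * root_sum * `|dot a y|.
Proof.
move=> ap L0 au hL; apply: (le_trans (wall_bound y ap au hL)).
rewrite ler_wpM2r // ler_wpM2l //.
apply: (le_root_sum (F := fun a => `|a| / dot a a)) => // b bp.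
by rewrite divr_ge0 // dot_ge0.
Qed.

Lemma root_sum_ge0 : 0 <= root_sum.
Proof. by apply: sumr_ge0 => a _; rewrite divr_ge0 // dot_ge0. Qed.

Lemma root_norm_ge0 : 0 <= root_norm.
Proof. by apply: sumr_ge0. Qed.

Lemma stop_cst_ge0 (L e D : R) : 0 <= L -> 0 < e -> 0 < D ->
  0 <= L * root_sum * (e + n%:R * root_norm * D).
Proof.
move=> L0 e0 D0; apply: mulr_ge0; first exact: mulr_ge0 L0 root_sum_ge0.
apply: addr_ge0 (ltW e0) _; apply: mulr_ge0 (ltW D0).
by apply: mulr_ge0 root_norm_ge0; exact: ler0n.
Qed.

Lemma indic1 (D : set T) w : D w -> \1_D w = 1 :> R.
Proof. by move=> h; rewrite indicE mem_set. Qed.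

Lemma indic0 (D : set T) w : ~ D w -> \1_D w = 0 :> R.
Proof. by move=> h; rewrite indicE memNset. Qed.

Lemma exp_split (I J V Q : T -> R) (K c q : R) :
  bmeas I -> bmeas J -> bmeas V -> integ Q -> E Q <= q -> 0 <= c ->
  (forall w, `|J w * V w - I w * V w| <= K * (I w - J w) + c * Q w) ->
  `|E (fun w => J w * V w) - E (fun w => I w * V w)| <= K * (E I - E J) + c * q.
Proof.
move=> bI bJ bV iQ Qq c0 h.
have bIV := bmeasM bI bV; have bJV := bmeasM bJ bV.
have iI := bmeas_integrable PT bI; have iJ := bmeas_integrable PT bJ.
have iIV := bmeas_integrable PT bIV; have iJV := bmeas_integrable PT bJV.
have iIJ := integB iI iJ; have iD := integB iJV iIV.
have iK : integ (fun w => K * (I w - J w)) by exact: integZ.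
have ic : integ (fun w => c * Q w) by exact: integZ.
rewrite -expB //; apply: (le_trans (exp_norm iD)).
apply: (@le_trans _ _ (E (fun w => K * (I w - J w) + c * Q w))).
  apply: exp_le => //; last exact: integD.
  by have := integrable_abse iD; congr (integrable _ _ _).
by rewrite expD // expZ // expZ // expB // lerD2l ler_wpM2l.
Qed.

Lemma law_integ (X Y : T -> bT) (F : bT -> R) : measurable_fun setT X -> measurable_fun setT Y ->
  measurable_fun setT F -> (forall A, measurable A -> P (X @^-1` A) = P (Y @^-1` A)) ->
  (forall y, 0 <= F y) -> integ (fun w => F (Y w)) ->
  integ (fun w => F (X w)) /\ E (fun w => F (X w)) = E (fun w => F (Y w)).
Proof.
move=> mX mY mF law F0 iY.
have h : (\int[P]_w (F (X w))%:E = \int[P]_w (F (Y w))%:E)%E.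
  by apply: (integral_law (F := EFin \o F)) => //; exact/measurable_EFinP.
split; last by rewrite /Rintegral h.
apply/integrableP; split; first by apply/measurable_EFinP; exact: measurableT_comp mX.
under eq_integral do rewrite /= ger0_norm //.
by rewrite h -EFin_exp // ltry.
Qed.

(* The walk jumps from {dot a > e} across {dot a <= e}: unless the jump is large,
   it lands close to the wall of a, where v is small. *)
Lemma overshoot v (L M e D : R) a y z : a \in pos -> 0 <= L -> 0 < e -> 0 < D ->
  antisymmetric (W := W) (C := C) (pos := pos) v ->
  (forall x y, `|v x - v y| <= L * `|x - y|) -> (forall y, `|v y| <= M) ->
  above (pos := pos) e y -> dot a z <= e ->
  `|v z| <= L * root_sum * (e + n%:R * root_norm * D) + M / D ^+ 4 * qu (z - y).
Proof.
move=> ap L0 e0 D0 av vL vM ye ze.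
have RS0 := root_sum_ge0; have RN0 := root_norm_ge0.
have M0 : 0 <= M := le_trans (normr_ge0 _) (vM 0).
have q0 : 0 <= qu (z - y) by apply: sumr_ge0 => i _; rewrite exprn_even_ge0.
have MD0 : 0 <= M / D ^+ 4 := divr_ge0 M0 (exprn_ge0 4 (ltW D0)).
have K0 := stop_cst_ge0 L0 e0 D0.
have [small|big] := leP `|z - y| D.
  apply: ler_wpDr; first exact: mulr_ge0.
  apply: (le_trans (wall_bound_sum z ap L0 av vL)).
  apply: ler_wpM2l; first exact: mulr_ge0.
  have hi : `|dot a (z - y)| <= n%:R * root_norm * D.
    apply: (le_trans (normr_dot _ _)); apply: ler_pM => //.
    apply: ler_wpM2l; first exact: ler0n.
    exact: (le_root_sum (F := fun a => `|a|)).
  have ei : dot a z = dot a y + dot a (z - y) by rewrite -dotDr [y + _]addrC subrK.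
  have hy := ye a ap.
  rewrite ei in ze *; move: hi; rewrite !ler_norml => /andP[hi1 hi2].
  by apply/andP; split; lra.
apply: (le_trans (vM _)); apply: ler_wpDl => //.
rewrite mulrAC ler_pdivlMr ?exprn_gt0 // ler_wpM2l //.
apply: le_trans (norm_qu _); rewrite lerXn2r ?nnegrE ?normr_ge0 ?(ltW D0) //; exact: ltW.
Qed.

Section Stopping.
Variables (t e : R) (x : 'rV[R]_n) (N : nat) (u : 'rV[R]_n -> R).
Variables (du : 'rV[R]_n -> 'rV[R]_n) (ddu : 'I_n -> 'rV[R]_n -> 'rV[R]_n) (L M : R).
Hypotheses (t0 : 0 < t) (e0 : 0 < e) (N0 : (0 < N)%N) (L0 : 0 <= L).
Hypotheses (hu : U2 u du ddu) (au : antisymmetric (W := W) (C := C) (pos := pos) u).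
Hypotheses (uL : forall x y, `|u x - u y| <= L * `|x - y|) (uM : forall y, `|u y| <= M).
Local Notation r := (t / N%:R).
Let tau (j : nat) : R := j%:R * r.

Let r0 : 0 < r. Proof. by rewrite divr_gt0 // ltr0n. Qed.
Let tau0 : tau 0%N = 0. Proof. by rewrite /tau mul0r. Qed.
Let tauS k : tau k < tau k.+1. Proof. by rewrite /tau ltr_pM2r // ltr_nat. Qed.
Let tau_ge0 k : 0 <= tau k. Proof. exact: (grid_ge0 tau0 tauS). Qed.
Let tau_step k : tau k.+1 - tau k = r.
Proof. by rewrite /tau -natr1 mulrDl mul1r addrC addKr. Qed.
Let uu : ubc u. Proof. by case: hu => /U1_ubc. Qed.

Definition stay_until (j : nat) : set T :=
  [set w | forall i, (i <= j)%N -> above (pos := pos) e (x + B (tau i) w)].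

Let stay_past j : past B tau j (stay_until j).
Proof.
have H k : (k <= j)%N -> past B tau j (stay_until k).
  elim: k => [|k IH] kj.
    have -> : stay_until 0 = (fun w => (x + B (tau 0%N) w)%R : bT) @^-1` [set y | above (pos := pos) e y].
      by apply/seteqP; split => w /= h; [exact: h|move=> i; rewrite leqn0 => /eqP->].
    by apply: (past_position hB tau0) => //; exact: above_measurable.
  have -> : stay_until k.+1 = stay_until k `&`
      (fun w => (x + B (tau k.+1) w)%R : bT) @^-1` [set y | above (pos := pos) e y].
    apply/seteqP; split => w /=.
      by move=> h; split => [i ik|]; apply: h => //; exact: leqW.
    by move=> [h1 h2] i; rewrite leq_eqVlt => /orP[/eqP->//|]; rewrite ltnS; exact: h1.
  apply: past_setI; first exact: IH (ltnW kj).
  by apply: (past_position hB tau0) => //; exact: above_measurable.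
exact: H.
Qed.

Lemma stay_until_measurable j : measurable (stay_until j).
Proof. exact: (past_measurable hB tau0 tauS (@stay_past j)). Qed.

(** The sequence [a_] interpolates between the free expectation (j = 0) and the one killed at grid
    times (j = N), and [p_] is the survival probability. The cost of leaving at step j is
    proportional to p_ j - p_ (j + 1), so these costs telescope to at most one unit. *)
Let a_ (j : nat) : R := E (fun w => \1_(stay_until j) w * G (t - tau j) u (x + B (tau j) w)).
Let p_ (j : nat) : R := E (fun w => \1_(stay_until j) w).

Let stay_step (D : R) j : 0 < D -> (j < N)%N ->
  `|a_ j.+1 - a_ j| <= L * root_sum * (e + n%:R * root_norm * D) * (p_ j - p_ j.+1)
     + M / D ^+ 4 * (n%:R * (128 * r ^+ 2)).
Proof.
move=> D0 jN; pose v := G (t - tau j.+1) u.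
have tN : t = tau N by rewrite /tau mulrC mulfVK // pnatr_eq0 -lt0n.
have tj : 0 <= t - tau j.+1 by rewrite subr_ge0 tN /tau ler_pM2r // ler_nat.
have uv : ubc v by exact: (heat_ubc hB).
have vM y : `|v y| <= M by exact: (heat_bound hB).
have vL : forall y z, `|v y - v z| <= L * `|y - z| by exact: (heat_lip hB).
have av : antisymmetric (W := W) (C := C) (pos := pos) v by exact: heat_antisymmetric hu au.
have aE : a_ j = E (fun w => \1_(stay_until j) w * v (x + B (tau j.+1) w)).
  rewrite (markov_step hB tau0 tauS x (@stay_past j) uv) tau_step /a_ /v.
  apply: eq_Rintegral => w _; congr (_ * _).
  rewrite -(heat_semigroup hB _ (ltW r0) tj uu); apply: heat_time.
  by rewrite -(tau_step j); ring.
have bI k : bmeas (\1_(stay_until k) : T -> R) by apply: bmeas_indic; exact: stay_until_measurable.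
have bv : bmeas (fun w => v (x + B (tau j.+1) w)) by exact: (ubc_bmeas hB).
have M0 : 0 <= M := le_trans (normr_ge0 _) (uM 0).
pose K := L * root_sum * (e + n%:R * root_norm * D).
have RS0 := root_sum_ge0; have RN0 := root_norm_ge0.
have K0 : 0 <= K by exact: stop_cst_ge0.
have lawq A : measurable A -> P (incr B tau j @^-1` A) = P (B r @^-1` A).
  move=> mA; have h := incr_law hB (tau_ge0 j) r0 mA.
  have tr : tau j + r = tau j.+1 by rewrite -(tau_step j) addrC subrK.
  by rewrite tr in h; exact: h.
have mq : measurable_fun (setT : set bT) (fun y : bT => qu y).
  apply: measurable_sum => i.
  by apply: (measurableT_comp (measurable_exprn 4)); exact: coord_measurable.
have q0 (y : bT) : 0 <= qu y by apply: sumr_ge0 => i _; rewrite exprn_even_ge0.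
have [iq eqq] := law_integ (incr_measurable hB tau0 tauS j) (brownian_measurable hB (ltW r0))
  mq lawq q0 (integ_qu hB r0).
have eq : E (fun w => qu (incr B tau j w)) <= n%:R * (128 * r ^+ 2).
  by rewrite eqq; exact: (exp_qu hB r0).
have MD0 : 0 <= M / D ^+ 4 := divr_ge0 M0 (exprn_ge0 4 (ltW D0)).
rewrite aE; apply: (exp_split (bI j) (bI j.+1) bv iq eq MD0).
move=> w; rewrite -mulrBl.
set Q := qu _; have {}q0 : 0 <= Q := q0 _.
have [h1|h1] := pselect (stay_until j.+1 w).
  have h2 : stay_until j w by move=> i ij; apply: h1; exact: leqW.
  by rewrite (indic1 h1) (indic1 h2) subrr mul0r normr0 mulr0 add0r mulr_ge0.
have [h2|h2] := pselect (stay_until j w); last first.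
  by rewrite (indic0 h1) (indic0 h2) subrr mul0r normr0 mulr0 add0r mulr_ge0.
rewrite (indic1 h2) (indic0 h1) sub0r subr0 mulN1r normrN mulr1.
have [a ap ha] : exists2 a, a \in pos & dot a (x + B (tau j.+1) w) <= e.
  apply: contrapT => H; apply: h1 => i; rewrite leq_eqVlt => /orP[/eqP->|]; last by rewrite ltnS; exact: h2.
  by move=> a ap; rewrite ltNge; apply/negP => h; apply: H; exists a.
have := overshoot ap L0 e0 D0 av vL vM (h2 j (leqnn j)) ha.
by rewrite opprD addrACA subrr add0r.
Qed.

(** Sum of [stay_step] over the grid: the exits cost at most the bound near the wall once, and the N
    large-jump errors, of order r^2 each, add up to order t r. *)
Lemma discrete_images (D : R) : 0 < D -> above (pos := pos) e x ->
  `|E (fun w => \1_(stay_until N) w * u (x + B t w)) - G t u x| <=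
     L * root_sum * (e + n%:R * root_norm * D) + M / D ^+ 4 * (n%:R * (128 * t * r)).
Proof.
move=> D0 xe.
have tN : t = tau N by rewrite /tau mulrC mulfVK // pnatr_eq0 -lt0n.
have K0 := stop_cst_ge0 L0 e0 D0.
have step := @stay_step D ^~ D0.
move: K0 step; move: (L * root_sum * _) => K K0.
have [Z ZE] : exists Z, Z = M / D ^+ 4 * (n%:R * (128 * r ^+ 2)) by eexists.
rewrite -ZE => step.
have H j : (j <= N)%N -> `|a_ j - a_ 0%N| <= K * (p_ 0%N - p_ j) + j%:R * Z.
  elim: j => [_|j IH jN]; first by rewrite !subrr normr0 mulr0 mul0r addr0.
  rewrite -(subrK (a_ j) (a_ j.+1)) -addrA.
  apply: (le_trans (ler_normD _ _)); apply: (le_trans (lerD (step j jN) (IH (ltnW jN)))).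
  rewrite -[j.+1%:R]natr1.
  generalize (p_ j) (p_ j.+1) (p_ 0%N) (j%:R : R).
  by move=> p1 p2 p3 m; lra.
have := H N (leqnn N).
have -> : a_ N = E (fun w => \1_(stay_until N) w * u (x + B t w)).
  by rewrite /a_ -tN subrr; apply: eq_Rintegral => w _; rewrite (heat0 hB).
have s0 : stay_until 0 = setT.
  apply/seteqP; split => // w _ i; rewrite leqn0 => /eqP->.
  by rewrite tau0 (brownian0 hB) addr0.
have -> : a_ 0%N = G t u x.
  rewrite /a_ s0 -[RHS](exp_cst P); apply: eq_Rintegral => w _.
  by rewrite indicT mul1r tau0 subr0 (brownian0 hB) addr0.
move=> h; apply: (le_trans h); apply: lerD.
  rewrite ler_piMr // lerBlDr; apply: (@le_trans _ _ 1).
    rewrite /p_ s0 -[leRHS](exp_cst P) le_eqVlt; apply/orP; left; apply/eqP.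
    by apply: eq_Rintegral => w _; rewrite indicT.
  by rewrite lerDl; apply: exp_ge0 => w; rewrite indicE.
have -> : N%:R * Z = M / D ^+ 4 * (n%:R * (128 * (N%:R * r) * r)) by rewrite ZE; ring.
by rewrite -[N%:R * r]tN.
Qed.

End Stopping.

Definition kill t u x : R := E (fun w => \1_[set w | stay (pos := pos) B t x w] w * u (x + B t w)).

(** The limits in [discrete_images] come in this order: the mesh tends to 0 with the level 1 / (m +
    1) and the jump size D fixed, then D tends to 0, and last the level does. *)
Lemma images t u du ddu x : 0 < t -> C x -> U2 u du ddu ->
  antisymmetric (W := W) (C := C) (pos := pos) u -> kill t u x = G t u x.
Proof.
move=> t0 Cx hu au; have [L L0 uL] := U1_lip hu.1; have uu := U1_ubc hu.1.
have [[M uM] _] := uu.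
have mA m k : measurable [set w | stay_on (pos := pos) B m k t x w].
  exact: (slice_measurable x (stay_on_measurable hB m k t0)).
have bu : bmeas (fun w => u (x + B t w)) by apply: (ubc_bmeas hB) => //; exact: ltW.
have bd (D : set T) w : `|\1_D w * u (x + B t w)| <= M.
  rewrite normrM indicE; case: (_ \in _); rewrite ?normr1 ?mul1r // normr0 mul0r.
  exact: le_trans (uM 0).
have step m : above (pos := pos) m.+1%:R^-1 x ->
    `|E (fun w => \1_[set w | forall k, stay_on (pos := pos) B m k t x w] w * u (x + B t w)) - G t u x|
      <= L * root_sum * m.+1%:R^-1.
  move=> xm; apply/ler_addgt0Pr => q q0.
  have m0 : 0 < m.+1%:R^-1 :> R by rewrite invr_gt0 ltr0n.
  pose c := L * root_sum * (n%:R * root_norm).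
  have c0 : 0 <= c.
    apply: mulr_ge0 (mulr_ge0 L0 root_sum_ge0) (mulr_ge0 _ root_norm_ge0); exact: ler0n.
  have c1 : 0 < c + 1 by rewrite ltr_wpDl.
  (* Makes the jump term c D at most q / 2; the other half of q is for the mesh term Z / 2^k. *)
  pose D := q / 2 / (c + 1); have D0 : 0 < D by rewrite !divr_gt0.
  have cD : c * D <= q / 2.
    have -> : c * D = q / 2 * (c / (c + 1)) by rewrite /D; ring.
    by rewrite ler_piMr ?divr_ge0 ?(ltW q0) // ler_pdivrMr // mul1r lerDl.
  have cv : E (fun w => \1_[set w | stay_on (pos := pos) B m k t x w] w * u (x + B t w)) @[k --> \oo] -->
     E (fun w => \1_[set w | forall k, stay_on (pos := pos) B m k t x w] w * u (x + B t w)).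
    apply: (exp_cvg PT (M := M)) => [k|k w|w].
    - by apply: measurable_funM; [exact: measurable_indic|case: bu].
    - exact: bd.
    apply: cvgM; last exact: cvg_cst.
    have [h|h] := pselect (forall k, stay_on (pos := pos) B m k t x w).
      rewrite (indic1 h); apply: cvg_near_cst; apply: nearW => k.
      by apply: indic1; exact: h.
    rewrite (indic0 h); move/existsNP: h => [k hk].
    apply: cvg_near_cst; exists k => // l /= kl.
    apply: indic0 => hl; apply: hk; exact: stay_on_le hl.
  pose Z := M / D ^+ 4 * (n%:R * (128 * t * t)).
  have M0 : 0 <= M := le_trans (normr_ge0 _) (uM 0).
  have Z0 : 0 <= Z by rewrite /Z !mulr_ge0 ?invr_ge0 ?exprn_ge0 // ltW.
  have Z1 : 0 < Z + 1 by rewrite ltr_wpDl.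
  have cv1 : `|E (fun w => \1_[set w | stay_on (pos := pos) B m k t x w] w * u (x + B t w)) - G t u x|
      @[k --> \oo] -->
     `|E (fun w => \1_[set w | forall k, stay_on (pos := pos) B m k t x w] w * u (x + B t w)) - G t u x|.
    by apply: cvg_norm; apply: cvgB => //; exact: cvg_cst.
  apply: (closed_cvg (fun z : R => z <= L * root_sum / m.+1%:R + q)) cv1; first exact: closed_le.
  have [k0 hk0] := mesh_lt ltr01 (divr_gt0 (divr_gt0 q0 (ltr0n _ 2)) Z1).
  exists k0 => // k /= kk.
  have N0 : (0 < 2 ^ k)%N by rewrite expn_gt0.
  have := discrete_images t0 m0 N0 L0 hu au uL uM D0 xm.
  rewrite -/c => h; apply: (le_trans h).
  have -> : L * root_sum * (m.+1%:R^-1 + n%:R * root_norm * D) =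
      L * root_sum * m.+1%:R^-1 + c * D by rewrite /c; ring.
  rewrite -addrA lerD2l (splitr q) lerD //.
  have -> : M / D ^+ 4 * (n%:R * (128 * t * (t / (2 ^ k)%:R))) = Z / (2 ^ k)%:R by rewrite /Z; ring.
  rewrite ler_pdivrMr ?ltr0n //.
  move: hk0; rewrite /mesh ltr_pdivrMr ?ltr0n ?expn_gt0 // mulrAC ltr_pdivlMr // mul1r.
  move=> /ltW /(le_trans _) hh; apply: (@le_trans _ _ (Z + 1)); first by rewrite lerDl.
  apply: (le_trans (hh _ (lexx _))); rewrite ler_wpM2l ?divr_ge0 ?(ltW q0) // ler_nat leq_exp2l //.
have cv : E (fun w => \1_[set w | forall k, stay_on (pos := pos) B m k t x w] w * u (x + B t w)) @[m --> \oo] -->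
     kill t u x.
  have mAm m : measurable [set w | forall k, stay_on (pos := pos) B m k t x w].
    have -> : [set w | forall k, stay_on (pos := pos) B m k t x w] =
        \bigcap_k [set w | stay_on (pos := pos) B m k t x w].
      by apply/seteqP; split => w /= h k; [move=> _; exact: h|exact: h].
    exact: bigcapT_measurable.
  apply: (exp_cvg PT (M := M)) => [m|m w|w].
  - by apply: measurable_funM; [exact: measurable_indic|case: bu].
  - exact: bd.
  apply: cvgM; last exact: cvg_cst.
  have [[m hm]|h] := pselect (stay (pos := pos) B t x w).
    rewrite indic1; last by exists m.
    apply: cvg_near_cst; exists m => // l /= ml; apply: indic1 => k.
    exact: stay_on_mono (hm k).
  rewrite (indic0 h); apply: cvg_near_cst; apply: nearW => m.
  by apply: indic0 => hm; apply: h; exists m.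
have [e e0 he] : exists2 e, 0 < e & forall a, a \in pos -> e < dot a x.
  suff H (l : seq 'rV[R]_n) : {subset l <= pos} -> exists2 e, 0 < e & forall a, a \in l -> e < dot a x.
    by have [e e0 he] := H _ (fun a => id); exists e.
  elim: l => [|a l IH] sp; first by exists 1.
  have [|e e0 he] := IH; first by move=> b bs; apply: sp; rewrite inE bs orbT.
  have dc : 0 < dot a x by apply: (chamber_dot (hcox := hcox)) => //; apply: sp; rewrite inE eqxx.
  exists (Num.min e (dot a x / 2)) => [|b]; first by rewrite lt_min e0 divr_gt0.
  rewrite inE gt_min => /orP[/eqP->|bl]; last by rewrite he.
  by apply/orP; right; lra.
have [m0 hm0] := ltr_add_invr (y := 0) (x := e) e0; rewrite add0r in hm0.
have cv0 : L * root_sum * m.+1%:R^-1 @[m --> \oo] --> L * root_sum * 0.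
  by apply: cvgM; [exact: cvg_cst|exact: cvg_harmonic].
have cv1 : `|E (fun w => \1_[set w | forall k, stay_on (pos := pos) B m k t x w] w * u (x + B t w)) - G t u x|
    @[m --> \oo] --> `|kill t u x - G t u x|.
  by apply: cvg_norm; apply: cvgB => //; exact: cvg_cst.
apply/eqP; rewrite -subr_eq0 -normr_le0 -(mulr0 (L * root_sum)).
apply: ler_cvg_to cv1 cv0 _; exists m0 => // m /= mm; apply: step => a ap.
apply: lt_trans (he a ap); apply: le_lt_trans hm0.
by rewrite lef_pV2 ?posrE ?ltr0n // ler_nat ltnS.
Qed.

End Images.

(** * Comparison of sub-Markov semigroups *)

Section Inverse.
Context {R : realType}.

Lemma inv_derive (z : R) : z != 0 -> is_derive z 1 (fun r : R => r^-1) (- z ^- 2).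
Proof.
move=> z0; have := is_deriveV z0 (is_derive_id z 1).
by rewrite /GRing.scale /= mulr1.
Qed.

Lemma inv_derive2 (z : R) : z != 0 -> is_derive z 1 (fun r : R => - r ^- 2) (2 * z ^- 3).
Proof.
move=> z0; have z2 : z ^+ 2 != 0 by rewrite expf_neq0.
have h1 : is_derive z 1 (fun r : R => r ^+ 2) (2 * z).
  by apply: is_derive_eq; rewrite /= /GRing.scale /=; ring.
have := is_deriveN (is_deriveV (f := fun r : R => r ^+ 2) z2 h1).
by congr is_derive; rewrite /GRing.scale /=; field.
Qed.

Lemma inv3_continuous (z : R) : z != 0 -> {for z, continuous (fun r : R => 2 * r ^- 3)}.
Proof.
move=> z0; apply: continuousM; first exact: cst_continuous.
apply: continuousV; first by rewrite expf_neq0.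
exact: exprn_continuous.
Qed.

Lemma trunc_lip (e a b : R) : 0 < e -> `|trunc e b - trunc e a| <= `|b - a|.
Proof.
move=> e0; have [c _ ->] := mvt a b (fun s => trunc_derive s e0).
rewrite normrM ler_piMl //; have [_ _ _ /andP[h1 h2] _] := trunc_bounds c e0.
by rewrite ger0_norm.
Qed.

Lemma trunc_taylor (e a b : R) : 0 < e ->
  `|trunc e b - trunc e a - dtrunc e a * (b - a)| <= e^-1 * (b - a) ^+ 2.
Proof.
move=> e0; apply: (@taylor1 R (trunc e) (dtrunc e) (ddtrunc e)) => z.
- exact: trunc_derive.
- exact: dtrunc_derive.
- by have [_ _ _ _ /andP[z0 z1]] := trunc_bounds z e0; rewrite ger0_norm.
Qed.

End Inverse.

(** * The comparison principle for semigroups on C *)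

Section Comparison.
Context {R : realType} {n : nat}.
Variable C : set 'rV[R]_n.
Hypothesis oC : open C.
Local Notation bT := (borel_rV R n).
Implicit Types (t s r : R) (x y : 'rV[R]_n) (f g : 'rV[R]_n -> R).

(* [sg_le] says at once that S t is monotone, sub-Markov, and blind to values
   outside C. *)
Record semigroup (S : R -> ('rV[R]_n -> R) -> 'rV[R]_n -> R)
    (LL : ('rV[R]_n -> R) -> 'rV[R]_n -> R) : Prop := Semigroup {
  sg_le : forall t x f g M, 0 < t -> C x -> bmeas (f : bT -> R) -> bmeas (g : bT -> R) ->
    0 <= M -> (forall y, C y -> g y <= f y + M) -> S t g x <= S t f x + M;
  sg_comp : forall s r f x, 0 < s -> 0 < r -> C2c C f -> C x -> S (s + r) f x = S s (S r f) x;
  sg_bmeas : forall r f, 0 < r -> C2c C f -> bmeas (S r f : bT -> R);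
  sg_gen : forall f, C2c C f -> forall e, 0 < e -> exists2 a, 0 < a &
    forall r, 0 < r -> r < a -> forall x, C x -> `|S r f x - f x - r * LL f x| <= e * r;
  sg_bounded : forall f, C2c C f -> exists M, forall x, C x -> `|LL f x| <= M }.

Lemma C2c_bmeas f : C2c C f -> bmeas (f : bT -> R).
Proof.
move=> hf; split; first exact: continuous_measurable_rV (C2c_continuous hf).
by case: (C2c_U2 hf) => -[].
Qed.

Section Semigroup.
Variables (S : R -> ('rV[R]_n -> R) -> 'rV[R]_n -> R) (LL : ('rV[R]_n -> R) -> 'rV[R]_n -> R).
Hypothesis sg : semigroup S LL.

Lemma sg_dist t x f g M : 0 < t -> C x -> bmeas (f : bT -> R) -> bmeas (g : bT -> R) ->
  0 <= M -> (forall y, C y -> `|f y - g y| <= M) -> `|S t f x - S t g x| <= M.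
Proof.
move=> t0 Cx bf bg M0 h.
have h1 : S t g x <= S t f x + M.
  by apply: (sg_le sg) => // y Cy; have := h y Cy; rewrite ler_norml => /andP[]; lra.
have h2 : S t f x <= S t g x + M.
  by apply: (sg_le sg) => // y Cy; have := h y Cy; rewrite ler_norml => /andP[]; lra.
by rewrite ler_norml; apply/andP; split; lra.
Qed.

Lemma sg_near f : C2c C f -> forall e, 0 < e -> exists2 a, 0 < a &
  forall r, 0 < r -> r < a -> forall x, C x -> `|S r f x - f x| <= e.
Proof.
move=> hf e e0; have [M hM] := sg_bounded sg hf.
have [a a0 ha] := sg_gen sg hf ltr01.
have c0 : 0 < `|M| + 1 by rewrite ltr_wpDl.
exists (Num.min a (e / (`|M| + 1))) => [|r r0]; first by rewrite lt_min a0 divr_gt0.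
rewrite lt_min ltr_pdivlMr // => /andP[ra re] x Cx.
have h1 := ha r r0 ra x Cx.
have h2 : `|r * LL f x| <= r * `|M|.
  by rewrite normrM (gtr0_norm r0) ler_wpM2l ?(ltW r0) // (le_trans (hM x Cx)) // ler_norm.
have -> : S r f x - f x = (S r f x - f x - r * LL f x) + r * LL f x by ring.
by apply: (le_trans (ler_normD _ _)); lra.
Qed.

(** Formally the derivative of S_s (f s) x in s is S_s applied to the time derivative of f plus LL
    f. The last hypothesis says, with backward differences, that this sum is nonnegative; the one
    before supplies the right continuity wanted by [dini_le]. *)
Lemma comparison (f : R -> 'rV[R]_n -> R) t x : 0 < t -> C x ->
  (forall s, 0 <= s <= t -> C2c C (f s)) ->
  (forall s, 0 <= s -> s < t -> forall e, 0 < e -> exists2 a, 0 < a &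
     forall r, 0 < r -> r < a -> s + r <= t -> forall y, C y -> `|f (s + r) y - f s y| <= e) ->
  (forall s, 0 < s -> s <= t -> forall e, 0 < e -> exists2 a, 0 < a &
     forall r, 0 < r -> r < a -> r <= s -> forall y, C y ->
       - (e * r) <= f s y - f (s - r) y + r * LL (f s) y) ->
  f 0 x <= S t (f t) x.
Proof.
move=> t0 Cx hf rc ld.
(* The record constrains S at positive times only, so the value at 0 is put in by hand. *)
pose F s := if s == 0 then f 0 x else S s (f s) x.
have F0 : F 0 = f 0 x by rewrite /F eqxx.
have Fp s : 0 < s -> F s = S s (f s) x by move=> s0; rewrite /F gt_eqF.
rewrite -F0 -Fp //; apply: dini_le => //.
  move=> s s0 st e e0; have e2 : 0 < e / 2 by rewrite divr_gt0.
  have [a a0 ha] := rc s s0 st _ e2.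
  have Cs : C2c C (f s) by apply: hf; rewrite s0 ltW.
  have [b b0 hb] := sg_near Cs e2.
  exists (Num.min a b) => [|r r0]; first by rewrite lt_min a0.
  rewrite lt_min => /andP[ra rb] srt.
  have Csr : C2c C (f (s + r)) by apply: hf; rewrite srt andbT addr_ge0 // ltW.
  have key y : C y -> `|S r (f (s + r)) y - f s y| <= e.
    move=> Cy; have h1 : `|S r (f (s + r)) y - S r (f s) y| <= e / 2.
      apply: sg_dist => //; try exact: C2c_bmeas; first exact: ltW.
      by move=> z Cz; exact: ha.
    have h2 := hb r r0 rb y Cy.
    have -> : S r (f (s + r)) y - f s y =
      (S r (f (s + r)) y - S r (f s) y) + (S r (f s) y - f s y) by ring.
    by apply: (le_trans (ler_normD _ _)); rewrite (splitr e) lerD.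
  move: s0; rewrite le_eqVlt => /orP[/eqP s0|s0].
    by subst s; move: key; rewrite add0r F0 Fp // => /(_ x Cx).
  rewrite !Fp ?addr_gt0 // (sg_comp sg) //.
  by apply: sg_dist => //; [exact: (sg_bmeas sg)|exact: C2c_bmeas|exact: ltW].
move=> s s0 st e e0; have e2 : 0 < e / 2 by rewrite divr_gt0.
have [a a0 ha] := ld s s0 st _ e2.
have Cs : C2c C (f s) by apply: hf; rewrite (ltW s0).
have [b b0 hb] := sg_gen sg Cs e2.
exists (Num.min a b) => [|r r0]; first by rewrite lt_min a0.
rewrite lt_min => /andP[ra rb] rs.
have key y : C y -> f (s - r) y <= S r (f s) y + e * r.
  move=> Cy; have h1 := ha r r0 ra rs y Cy.
  by have := hb r r0 rb y Cy; rewrite ler_norml => /andP[h2 _]; lra.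
rewrite lerBlDl; move: rs; rewrite le_eqVlt => /orP[/eqP rs|rs].
  by subst r; move: (key x Cx); rewrite subrr F0 Fp.
have sr : 0 < s - r by rewrite subr_gt0.
have Csr : C2c C (f (s - r)) by apply: hf; rewrite (ltW sr) /=; lra.
rewrite !Fp //; have -> : S s (f s) x = S (s - r) (S r (f s)) x.
  by rewrite -(sg_comp sg) // subrK.
apply: (sg_le sg) => //; [exact: (sg_bmeas sg)|exact: C2c_bmeas|].
by rewrite mulr_ge0 // ltW.
Qed.

(** The generator is half the Laplacian conjugated by rho. Two cases are used: rho = 1 for the
    killed semigroup and rho = h for a semigroup with the repulsive drift. *)
Variables (rho : 'rV[R]_n -> R) (drho : 'rV[R]_n -> 'rV[R]_n) (ddrho : 'I_n -> 'rV[R]_n -> 'rV[R]_n).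
Hypotheses (rho2 : forall x, d2 rho drho ddrho x) (rho0 : forall x, C x -> 0 < rho x).
Hypothesis LLE : forall f x, C2c C f -> C x ->
  rho x * LL f x = 2^-1 * laplacian (fun y => rho y * f y) x.

(* Apply [comparison] to trunc e (v s) / rho: since v s is caloric and trunc e is
   convex, this is a subsolution. *)
Lemma caloric_comparison (v : R -> 'rV[R]_n -> R) (dv : R -> 'rV[R]_n -> 'rV[R]_n)
    (ddv : R -> 'I_n -> 'rV[R]_n -> 'rV[R]_n) (K : set 'rV[R]_n) e t x :
  0 < e -> 0 < t -> C x -> compact K -> K `<=` C ->
  (forall s y, d2 (v s) (dv s) (ddv s) y) ->
  (forall s y, 0 <= s <= t -> C y -> ~ K y -> v s y <= e) ->
  (forall s, 0 < s -> s <= t -> exists M, forall y, K y -> `|2^-1 * trace (ddv s) y| <= M) ->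
  (forall s, 0 <= s -> s < t -> forall q, 0 < q -> exists2 a, 0 < a &
     forall r, 0 < r -> r < a -> s + r <= t -> forall y, K y -> `|v (s + r) y - v s y| <= q) ->
  (forall s, 0 < s -> s <= t -> forall q, 0 < q -> exists2 a, 0 < a &
     forall r, 0 < r -> r < a -> r <= s -> forall y, K y ->
       `|v s y - v (s - r) y + r * (2^-1 * trace (ddv s) y)| <= q * r) ->
  trunc e (v 0 x) / rho x <= S t (extend C (fun y => trunc e (v t y) / rho y)) x.
Proof.
move=> e0 t0 Cx cK KC v2 vK vM vr vl.
pose F s y := trunc e (v s y) / rho y.
have crho : continuous rho by move=> y; apply: d1_continuous; exact: (rho2 y).1.
have [c c0 hc] : exists2 c, 0 < c & forall y, K y -> c <= rho y.
  by apply: compact_min_gt0 => // y /KC; exact: rho0.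
have t2 s y := d2_comp (v2 s y) (trunc_derive (v s y) e0) (dtrunc_derive (v s y) e0)
  (ddtrunc_continuous (x := v s y)).
have i2 y (Cy : C y) := let ry := lt0r_neq0 (rho0 Cy) in
  d2_comp (rho2 y) (inv_derive ry) (inv_derive2 ry) (inv3_continuous ry).
have F2 s y (Cy : C y) := d2M (t2 s y) (i2 y Cy).
pose f s := extend C (F s).
have Fz s y : v s y <= e -> F s y = 0.
  by move=> h; rewrite /F; have [-> _ _] := trunc_eq0 e0 h; rewrite mul0r.
have fE s y : C y -> f s y = F s y by exact: extendT.
have C2f s : 0 <= s <= t -> C2c C (f s).
  move=> hs; have [] := extend_C2c oC cK KC (fun y Cy => F2 s y Cy) => // y Cy Ky.
  by apply: Fz; exact: vK.
have LLf s y : 0 <= s <= t -> C y -> rho y * LL (f s) y =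
    2^-1 * (dtrunc e (v s y) * trace (ddv s) y + ddtrunc e (v s y) * dot (dv s y) (dv s y)).
  move=> hs Cy; rewrite (LLE (C2f s hs) Cy) -(trace_comp (dtrunc e) (ddtrunc e)); congr (_ * _).
  apply: laplacianE.
  have eqC : \forall z \near y, trunc e (v s z) = rho z * f s z.
    apply: filterS (open_near oC Cy) => z Cz; rewrite fE // /F mulrC divfK //.
    by rewrite gt_eqF // rho0.
  apply: filterS (near_near eqC) => z hz.
  by apply: (d2_near hz _ _ (t2 s z)) => [|i]; exact: near_all.
have <- : f 0 x = trunc e (v 0 x) / rho x by rewrite fE.
apply: (comparison t0 Cx C2f).
  move=> s s0 st q q0; have [a a0 ha] := vr s s0 st _ (mulr_gt0 q0 c0).
  exists a => // r r0 ra srt y Cy; rewrite !fE //.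
  have [Ky|Ky] := pselect (K y); last first.
    rewrite !Fz ?subrr ?normr0 ?(ltW q0) //; first by apply: vK; rewrite // s0 ltW.
    by apply: vK => //; rewrite srt andbT addr_ge0 // ltW.
  have ry := rho0 Cy; rewrite /F -mulrBl normrM (gtr0_norm (x := _^-1)) ?invr_gt0 //.
  rewrite ler_pdivrMr //; apply: (le_trans (trunc_lip _ _ e0)).
  by apply: (le_trans (ha r r0 ra srt y Ky)); rewrite ler_wpM2l ?(ltW q0) // hc.
move=> s s0 st q q0; have [M hM] := vM s s0 st.
have hs : 0 <= s <= t by rewrite (ltW s0).
(* One share for the defect in the heat equation and one for the Taylor remainder of the truncation;
   the factor c appears because the inequality is multiplied by rho >= c. *)
pose q1 := q * c / 2; have q10 : 0 < q1 by rewrite !mulr_gt0.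
have [a a0 ha] := vl s s0 st _ q10.
(* The remainder is at most D^2 / e with |D| <= r (|M| + q1), so r <= q1 / k bounds it by q1 r. *)
pose k := (`|M| + q1) ^+ 2 / e + 1.
have k0 : 0 < k by rewrite ltr_wpDl // divr_ge0 ?sqr_ge0 // ltW.
exists (Num.min a (q1 / k)) => [|r r0]; first by rewrite lt_min a0 divr_gt0.
rewrite lt_min ltr_pdivlMr // => /andP[ra rk] rs y Cy.
have hsr : 0 <= s - r <= t by lra.
rewrite !fE //; have [Ky|Ky] := pselect (K y); last first.
  have v1 := vK s y hs Cy Ky; have v2' := vK (s - r) y hsr Cy Ky.
  rewrite !Fz // subrr add0r.
  have : rho y * LL (f s) y = 0.
    by rewrite LLf //; have [_ -> ->] := trunc_eq0 e0 v1; rewrite !mul0r addr0 mulr0.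
  move=> /eqP; rewrite mulf_eq0 gt_eqF ?rho0 //= => /eqP->.
  by rewrite mulr0 oppr_le0 mulr_ge0 // ltW.
(* After multiplication by rho the quotients disappear. What remains is the defect of v in the heat
   equation ([T1]), the Taylor remainder ([T2]), and the convexity term ([rd]), which has the
   favourable sign. *)
have ry := rho0 Cy; rewrite -(ler_pM2l ry) mulrDr mulrBr.
have -> : rho y * (r * LL (f s) y) = r * (rho y * LL (f s) y) by ring.
rewrite LLf // /F ![rho y * (_ / _)]mulrC !divfK ?gt_eqF //.
have [_ _ _ /andP[p0 p1] /andP[pp0 _]] := trunc_bounds (v s y) e0.
set p := dtrunc e (v s y) in p0 p1 *; set pp := ddtrunc e (v s y) in pp0 *.
have ty : `|trunc e (v (s - r) y) - trunc e (v s y) - p * (v (s - r) y - v s y)| <=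
    e^-1 * (v (s - r) y - v s y) ^+ 2.
  exact: (trunc_taylor (v s y) (v (s - r) y) e0).
have h1 := ha r r0 ra rs y Ky.
set tr := 2^-1 * trace (ddv s) y in h1; have trM : `|tr| <= `|M|.
  by apply: le_trans (hM y Ky) (ler_norm M).
set D := v (s - r) y - v s y in ty.
have h1' : `|D - r * tr| <= q1 * r.
  by rewrite -normrN (_ : - (D - r * tr) = v s y - v (s - r) y + r * tr) // /D; ring.
have DM : `|D| <= r * (`|M| + q1).
  have -> : D = (D - r * tr) + r * tr by ring.
  apply: (le_trans (ler_normD _ _)); rewrite mulrDr addrC (mulrC r q1) lerD //.
  by rewrite normrM (gtr0_norm r0) ler_wpM2l // ltW.
have D2 : D ^+ 2 <= r ^+ 2 * (`|M| + q1) ^+ 2.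
  rewrite -exprMn -[D ^+ 2]ger0_norm ?sqr_ge0 // normrX lerXn2r ?nnegrE //.
  by rewrite mulr_ge0 ?(ltW r0) // addr_ge0 // ltW.
have dd0 : 0 <= pp * dot (dv s y) (dv s y) by rewrite mulr_ge0 // dot_ge0.
have T1 : - (q1 * r) <= p * (r * tr - D).
  have : `|p * (r * tr - D)| <= q1 * r.
    rewrite normrM (ger0_norm p0) distrC; apply: le_trans h1'.
    by rewrite ler_piMl.
  by rewrite ler_norml => /andP[].
have T2 : e^-1 * D ^+ 2 <= q1 * r.
  apply: (@le_trans _ _ (r * k * r)); last by rewrite ler_wpM2r ?(ltW r0) // ltW.
  apply: (@le_trans _ _ (e^-1 * (r ^+ 2 * (`|M| + q1) ^+ 2))).
    by rewrite ler_wpM2l // invr_ge0 ltW.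
  have -> : r * k * r = e^-1 * (r ^+ 2 * (`|M| + q1) ^+ 2) + r ^+ 2 by rewrite /k; ring.
  by rewrite lerDl sqr_ge0.
have hq : 2 * q1 * r <= rho y * (q * r).
  have -> : 2 * q1 * r = c * (q * r) by rewrite /q1; field.
  by rewrite ler_wpM2r ?hc // mulr_ge0 // ltW.
have rd : 0 <= r * (2^-1 * (pp * dot (dv s y) (dv s y))).
  by rewrite mulr_ge0 ?(ltW r0) // mulr_ge0 // invr_ge0.
move: ty; rewrite ler_norml => /andP[_ ty].
have -> : r * (2^-1 * (p * trace (ddv s) y + pp * dot (dv s y) (dv s y))) =
   p * (r * tr) + r * (2^-1 * (pp * dot (dv s y) (dv s y))) by rewrite /tr; ring.
rewrite mulrN mulrBr in T1 *; lra.
Qed.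

End Semigroup.
End Comparison.

(** * Smooth cutoffs of polyhedral regions *)

Section Cutoffs.
Context {R : realType} {n : nat}.
Implicit Types (x y : 'rV[R]_n) (l : seq ('rV[R]_n * R)%type) (k : R).

(** A cutoff of class C^2 with explicit derivatives: it vanishes up to 1, is positive beyond 2, and
    tends to 1 at infinity without reaching it, so indicators are obtained as limits. *)
Definition chi (s : R) : R := 1 - expR (- trunc 1 s).
Definition dchi (s : R) : R := dtrunc 1 s * expR (- trunc 1 s).
Definition ddchi (s : R) : R := (ddtrunc 1 s - dtrunc 1 s ^+ 2) * expR (- trunc 1 s).

Lemma chi_derive (s : R) : is_derive s 1 chi (dchi s).
Proof.
have h := trunc_derive s (ltr01 : 0 < 1 :> R).
have h2 : is_derive s 1 (fun s : R => - trunc 1 s) (- dtrunc 1 s) by exact: is_deriveN.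
have h3 := @is_derive1_comp R expR (fun s => - trunc 1 s) s _ _ (is_derive_expR _) h2.
have h4 := is_deriveB (is_derive_cst (1 : R) s 1) h3.
by apply: (is_derive_eq h4); rewrite /dchi; ring.
Qed.

Lemma dchi_derive (s : R) : is_derive s 1 dchi (ddchi s).
Proof.
have h := trunc_derive s (ltr01 : 0 < 1 :> R).
have h2 : is_derive s 1 (fun s : R => - trunc 1 s) (- dtrunc 1 s) by exact: is_deriveN.
have h3 := @is_derive1_comp R expR (fun s => - trunc 1 s) s _ _ (is_derive_expR _) h2.
have h4 := is_deriveM (dtrunc_derive s (ltr01 : 0 < 1 :> R)) h3.
by apply: (is_derive_eq h4); rewrite /ddchi /GRing.scale /=; ring.
Qed.

Lemma ddchi_continuous : continuous ddchi.
Proof.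
move=> s; have ct : {for s, continuous (trunc (1 : R))}.
  apply: differentiable_continuous; apply/derivable1_diffP.
  by have [] := trunc_derive s (ltr01 : 0 < 1 :> R).
have cd : {for s, continuous (dtrunc (1 : R))}.
  apply: differentiable_continuous; apply/derivable1_diffP.
  by have [] := dtrunc_derive s (ltr01 : 0 < 1 :> R).
suff : {for s, continuous (fun s : R => (ddtrunc 1 s - dtrunc 1 s ^+ 2) * expR (- trunc 1 s))} by [].
apply: continuousM.
  apply: continuousB; first exact: ddtrunc_continuous.
  apply: (continuous_comp (f := dtrunc 1) (g := fun z : R => z ^+ 2)); first exact: cd.
  exact: exprn_continuous.
apply: (continuous_comp (f := fun s : R => - trunc 1 s)); first exact: continuousN.
exact: continuous_expR.
Qed.

Lemma chi_bounds (s : R) : 0 <= chi s <= 1.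
Proof.
have [t0 _ _ _ _] := trunc_bounds s (ltr01 : 0 < 1 :> R).
have e1 : expR (- trunc 1 s) <= 1 by rewrite expR_le1 oppr_le0.
by have := expR_ge0 (- trunc 1 s); rewrite /chi => e0; apply/andP; split; lra.
Qed.

Lemma chi0 (s : R) : s <= 1 -> chi s = 0.
Proof. by move=> h; rewrite /chi; have [-> _ _] := trunc_eq0 ltr01 h; rewrite oppr0 expR0 subrr. Qed.

Lemma chi_gt0 (s : R) : 2 < s -> 0 < chi s.
Proof.
move=> s2; rewrite /chi subr_gt0 expR_lt1 oppr_lt0.
by have [_ h _ _ _] := trunc_bounds s (ltr01 : 0 < 1 :> R); lra.
Qed.

Lemma chi_near1 (e : R) : 0 < e -> exists N, forall s, N <= s -> `|1 - chi s| <= e.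
Proof.
move=> e0; exists (2 + e^-1) => s hs; have [_ h _ _ _] := trunc_bounds s (ltr01 : 0 < 1 :> R).
rewrite /chi opprB addrC subrK ger0_norm ?expR_ge0 // expRN.
have e'0 : 0 < e^-1 by rewrite invr_gt0.
rewrite -[leRHS]invrK lef_pV2 ?posrE ?expR_gt0 //.
by apply: le_trans (expR_ge1Dx _); lra.
Qed.

Lemma chi_cvg (u : R) (c : nat -> R) : 0 < u -> (forall j : nat, j%:R * u <= c j) ->
  chi (c j) @[j --> \oo] --> (1 : R).
Proof.
move=> u0 hc; apply/cvgrPdist_le => e e0; have [N hN] := chi_near1 e0.
have [k0 hk0] : exists k0 : nat, N / u <= k0%:R.
  exists (Num.bound `|N / u|).
  exact: le_trans (ler_norm _) (ltW (archi_boundP (normr_ge0 _))).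
exists k0 => // k /= kk; apply: hN; apply: le_trans (hc k).
rewrite -ler_pdivrMr //; apply: (le_trans hk0); by rewrite ler_nat.
Qed.

Definition cut l k y : R := \prod_(q <- l) chi (k * (dot q.1 y + q.2)).

Lemma cut_d2 l k : exists df ddf, forall x, d2 (cut l k) df ddf x.
Proof.
elim: l => [|q l [df [ddf h]]].
  exists (fun=> 0), (fun _ _ => 0) => x.
  by apply: (d2_near _ _ _ (d2_cst 1 x)) => [||i]; apply: near_all => y; rewrite /cut ?big_nil.
do 2!eexists; move=> x.
have a2 y := d2Z k (d2D (d2_dot q.1 y) (d2_cst q.2 y)).
have c2 := d2_comp (a2 x) (chi_derive _) (dchi_derive _) (ddchi_continuous (x := _)).
apply: (d2_near _ _ _ (d2M c2 (h x))) => [||i]; [|exact: near_all|exact: near_all].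
by apply: near_all => y; rewrite /cut big_cons.
Qed.

Lemma cut_bounds l k y : 0 <= cut l k y <= 1.
Proof.
rewrite /cut; elim: l => [|q l /andP[h1 h2]]; first by rewrite big_nil ler01 lexx.
have /andP[c1 c2] := chi_bounds (k * (dot q.1 y + q.2)).
by rewrite big_cons mulr_ge0 //= mulr_ile1.
Qed.

Lemma cut0 l k y q : q \in l -> k * (dot q.1 y + q.2) <= 1 -> cut l k y = 0.
Proof. by move=> ql h; rewrite /cut (big_rem q) //= chi0 // mul0r. Qed.

Lemma cut_gt0 l k y : (forall q, q \in l -> 2 < k * (dot q.1 y + q.2)) -> 0 < cut l k y.
Proof. by move=> h; rewrite /cut big_seq; apply: prodr_gt0 => q /h; exact: chi_gt0. Qed.

Lemma bounded_closed_rV (A : set 'rV[R]_n) (b : R) : closed A -> (forall y, A y -> `|y| <= b) -> compact A.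
Proof.
move=> cA hA; apply: bounded_closed_compact => //.
by exists b; split; [exact: num_real|move=> x bx y Ay; apply: le_trans (hA y Ay) (ltW bx)].
Qed.

Lemma ge_closed (f : 'rV[R]_n -> R) (c : R) : continuous f -> closed [set y | c <= f y].
Proof. by move=> cf; apply: (@preimage_closed _ _ f [set z | c <= z]) => //; exact: closed_ge. Qed.

Lemma forms_closed l (c : R) : closed [set y | forall q, q \in l -> c <= dot q.1 y + q.2].
Proof.
elim: l => [|q l IH].
  by rewrite (_ : [set y | _] = setT); [exact: closedT|apply/seteqP; split].
have -> : [set y | forall q', q' \in q :: l -> c <= dot q'.1 y + q'.2] =
    [set y | c <= dot q.1 y + q.2] `&` [set y | forall q, q \in l -> c <= dot q.1 y + q.2].
  apply/seteqP; split => y /=.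
    by move=> h; split => [|q' ql]; apply: h; rewrite inE ?eqxx // ql orbT.
  by move=> [h1 h2] q'; rewrite inE => /orP[/eqP->//|]; exact: h2.
apply: closedI => //; apply: ge_closed => y.
by apply: continuousD; [exact: dot_continuous|exact: cst_continuous].
Qed.

(** Where the cutoff does not vanish every form exceeds 1 / k. The region where all forms are at
    least 1 / k is closed, bounded and inside the open polyhedron. *)
Lemma cut_C2c (C : set 'rV[R]_n) l k (b : R) : 0 < k ->
  (forall y, (forall q, q \in l -> 0 < dot q.1 y + q.2) -> C y /\ `|y| <= b) -> C2c C (cut l k).
Proof.
move=> k0 h; split.
  by have [df [ddf hd]] := cut_d2 l k; exact: (@d2_C2 _ _ _ df ddf).
exists [set y | forall q, q \in l -> k^-1 <= dot q.1 y + q.2].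
  have pos y : (forall q, q \in l -> k^-1 <= dot q.1 y + q.2) -> forall q, q \in l -> 0 < dot q.1 y + q.2.
    by move=> hy q /hy; apply: lt_le_trans; rewrite invr_gt0.
  split; last by move=> y /pos /h[].
  by apply: (bounded_closed_rV (b := b)); [exact: forms_closed|move=> y /pos /h[]].
move=> y /existsNP[q /not_implyP[ql hq]]; apply: (cut0 ql).
by move/negP: hq; rewrite -ltNge => /ltW; rewrite -(ler_pM2l k0) mulfV // gt_eqF.
Qed.

Definition box_forms (a b : 'rV[R]_n) : seq ('rV[R]_n * R)%type :=
  [seq (delta_mx 0 i, - a 0 i) | i <- enum 'I_n] ++
  [seq (- delta_mx 0 i, b 0 i) | i <- enum 'I_n].

Lemma box_formsP a b y : (forall q, q \in box_forms a b -> 0 < dot q.1 y + q.2) <->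
  forall i, a 0 i < y 0 i < b 0 i.
Proof.
split=> [h i|h q].
  have h1 : 0 < dot (delta_mx 0 i) y + - a 0 i.
    apply: (h (delta_mx 0 i, - a 0 i)); rewrite mem_cat; apply/orP; left.
    by apply/mapP; exists i; rewrite ?mem_enum.
  have h2 : 0 < dot (- delta_mx 0 i) y + b 0 i.
    apply: (h (- delta_mx 0 i, b 0 i)); rewrite mem_cat; apply/orP; right.
    by apply/mapP; exists i; rewrite ?mem_enum.
  by move: h1 h2; rewrite dotNl dot_delta; lra.
rewrite mem_cat => /orP[] /mapP[i _ ->] /=; rewrite ?dotNl dot_delta; have := h i; lra.
Qed.

Definition open_box (a b : 'rV[R]_n) : set 'rV[R]_n := [set y | forall i, a 0 i < y 0 i < b 0 i].

Lemma open_box_bounded a b y : open_box a b y -> `|y| <= `|a| + `|b|.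
Proof.
move=> h; apply: norm_le_coord => [|i]; first by rewrite addr_ge0.
have /andP[h1 h2] := h i; have a1 := coord_le_norm a i; have b1 := coord_le_norm b i.
have := ler_norm (b 0 i); have := ler_norm (- a 0 i); rewrite normrN => h3 h4.
by rewrite ler_norml; apply/andP; split; have := normr_ge0 a; have := normr_ge0 b; lra.
Qed.

End Cutoffs.

(** * Measures on the chamber are determined by test functions *)

Section Determination.
Context {R : realType} {n : nat} {W : set 'M[R]_n} {C : set 'rV[R]_n}.
Context {pos : {fset 'rV[R]_n}} {hcox : reflection_chamber W C pos}.
Local Notation bT := (borel_rV R n).
Implicit Types (x y : 'rV[R]_n).

Definition wall_forms : seq ('rV[R]_n * R)%type := [seq (a, 0) | a <- pos].

Lemma wall_formsP y : (forall q, q \in wall_forms -> 0 < dot q.1 y + q.2) <-> C y.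
Proof.
rewrite (chamberE (hcox := hcox)); split=> [h a ap|h q /mapP[a ap ->]] /=; last by rewrite addr0; exact: h.
by have := h (a, 0); rewrite /= addr0; apply; apply/mapP; exists a.
Qed.

Definition box_cut (a b : 'rV[R]_n) (k : nat) : 'rV[R]_n -> R :=
  cut (wall_forms ++ box_forms a b) k.+1%:R.

Lemma box_cutP a b y : (forall q, q \in wall_forms ++ box_forms a b -> 0 < dot q.1 y + q.2) <->
  C y /\ open_box a b y.
Proof.
split=> [h|[/wall_formsP h1 /box_formsP h2] q].
  by split; [apply/wall_formsP|apply/box_formsP] => q ql; apply: h; rewrite mem_cat ql ?orbT.
by rewrite mem_cat => /orP[/h1|/h2].
Qed.

Lemma box_cut_C2c a b k : C2c C (box_cut a b k).
Proof.
apply: (cut_C2c (b := `|a| + `|b|)); first by rewrite ltr0n.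
by move=> y /box_cutP[Cy hy]; split=> //; exact: open_box_bounded.
Qed.

Lemma box_cut_bounds a b k y : 0 <= box_cut a b k y <= 1.
Proof. exact: cut_bounds. Qed.

Lemma cut_cvg1 l (c : nat -> 'rV[R]_n * R -> R) (F : nat -> R) :
  (forall q, q \in l -> chi (c k q) @[k --> \oo] --> (1 : R)) ->
  (forall k, F k = \prod_(q <- l) chi (c k q)) -> F k @[k --> \oo] --> (1 : R).
Proof.
move=> h /funext->; elim: l h => [|q l IH] h.
  by under eq_fun do rewrite big_nil; exact: cvg_cst.
under eq_fun do rewrite big_cons.
have h1 := h q (mem_head q l).
have h2 := IH (fun q' ql => h q' (mem_behead (s := q :: l) ql)).
have h3 : chi (c k q) * \prod_(q <- l) chi (c k q) @[k --> \oo] --> (1 * 1 : R) by exact: cvgM.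
by rewrite mulr1 in h3.
Qed.

Lemma box_cut_cvg a b y : box_cut a b k y @[k --> \oo] --> (\1_(C `&` open_box a b) y : R).
Proof.
have [Cy|nCy] := pselect ((C `&` open_box a b) y).
  rewrite indicE mem_set //; move/box_cutP: Cy => Cy.
  apply: (cut_cvg1 (c := fun k q => k.+1%:R * (dot q.1 y + q.2))) => // q /Cy h.
  by apply: (chi_cvg h) => j; rewrite ler_wpM2r ?(ltW h) // ler_nat.
rewrite indicE memNset //; apply: cvg_near_cst; apply: nearW => k.
have /existsNP[q /not_implyP[ql hq]] : ~ forall q, q \in wall_forms ++ box_forms a b -> 0 < dot q.1 y + q.2.
  by move/box_cutP.
apply: (cut0 ql); rewrite (@le_trans _ _ 0) //.
by rewrite mulr_ge0_le0 // leNgt; apply/negP.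
Qed.

Definition exhaust (k : nat) : 'rV[R]_n -> R := box_cut (const_mx (- k.+1%:R)) (const_mx k.+1%:R) k.

Lemma exhaust_C2c k : C2c C (exhaust k).
Proof. exact: box_cut_C2c. Qed.

Lemma exhaust_bounds k y : 0 <= exhaust k y <= 1.
Proof. exact: cut_bounds. Qed.

Lemma exhaust_cvg y : C y -> exhaust k y @[k --> \oo] --> (1 : R).
Proof.
move=> Cy.
have h1 : cut wall_forms k.+1%:R y @[k --> \oo] --> (1 : R).
  apply: (cut_cvg1 (c := fun k q => k.+1%:R * (dot q.1 y + q.2))) => // q ql.
  have h := (wall_formsP y).2 Cy q ql.
  by apply: (chi_cvg h) => j; rewrite ler_wpM2r ?(ltW h) // ler_nat.
have h2 : cut (box_forms (const_mx (- k.+1%:R)) (const_mx k.+1%:R)) k.+1%:R y @[k --> \oo] --> (1 : R).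
  (* The box grows with k, so its list of forms varies. With the constants set to 0 the list is
     fixed, and the growing part k + 1 moves into the argument of [chi]. *)
  pose l := [seq (delta_mx 0 i, 0) | i <- enum 'I_n] ++ [seq (- delta_mx 0 i, 0) | i <- enum 'I_n] : seq ('rV[R]_n * R).
  apply: (cut_cvg1 (l := l) (c := fun k q => k.+1%:R * (dot q.1 y + k.+1%:R))) => [q|k]; last first.
    rewrite /cut /box_forms /l !big_cat !big_map /=.
    by congr (_ * _); apply: eq_bigr => i _; rewrite ?mxE ?opprK.
  move=> ql; apply/cvgrPdist_le => e e0; have [N hN] := chi_near1 e0.
  exists (Num.bound (`|N| + `|dot q.1 y|)) => // k /= kk; apply: hN.
  have hb : `|N| + `|dot q.1 y| <= k.+1%:R.
    apply: le_trans (ltW (archi_boundP _)) _; first by rewrite addr_ge0.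
    by rewrite ler_nat leqW.
  have h3 : `|N| <= dot q.1 y + k.+1%:R.
    by have := ler_norm (- dot q.1 y); rewrite normrN; lra.
  apply: (le_trans (ler_norm N)); apply: (le_trans h3).
  by rewrite ler_peMl ?ler1n // (le_trans _ h3).
have -> : (fun k => exhaust k y) = fun k => cut wall_forms k.+1%:R y *
    cut (box_forms (const_mx (- k.+1%:R)) (const_mx k.+1%:R)) k.+1%:R y.
  by apply/funext => k; rewrite /exhaust /box_cut /cut big_cat.
have h3 : cut wall_forms k.+1%:R y *
    cut (box_forms (const_mx (- k.+1%:R)) (const_mx k.+1%:R)) k.+1%:R y @[k --> \oo] --> (1 * 1 : R).
  exact: cvgM.
by rewrite mulr1 in h3.
Qed.

Lemma compact_cut (K : set 'rV[R]_n) : compact K -> K `<=` C ->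
  exists f, [/\ C2c C f, forall y, 0 <= f y & forall y, K y -> 1 <= f y].
Proof.
move=> cK KC; have [b hb] : exists b, forall y, K y -> `|y| <= b.
  have [b hb] := compact_max cK (@norm_continuous _ 'rV[R]_n); by exists b.
have [m m0 hm] : exists2 m, 0 < m & forall y, K y -> forall q, q \in wall_forms -> m <= dot q.1 y + q.2.
  suff H (l : seq 'rV[R]_n) : {subset l <= pos} -> exists2 m, 0 < m & forall y, K y -> forall a, a \in l -> m <= dot a y.
    have [m m0 hm] := H _ (fun a => id); exists m => // y Ky q /mapP[a ap ->] /=.
    by rewrite addr0; exact: hm.
  elim: l => [|a l IH] sp; first by exists 1.
  have [|m m0 hm] := IH; first by move=> c cs; apply: sp; rewrite inE cs orbT.
  have [m' m'0 hm'] := compact_min_gt0 cK (@dot_continuous R n a)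
    (fun y Ky => chamber_dot (hcox := hcox) (sp a (mem_head a l)) (KC y Ky)).
  exists (Num.min m m') => [|y Ky c]; first by rewrite lt_min m0.
  by rewrite inE ge_min => /orP[/eqP->|cl]; [rewrite hm' ?orbT|rewrite hm].
pose B := `|b| + 1; pose l := wall_forms ++ box_forms (const_mx (- B)) (const_mx B).
pose m' := Num.min m 1; have m'0 : 0 < m' by rewrite lt_min m0 ltr01.
have hK y : K y -> forall q, q \in l -> m' <= dot q.1 y + q.2.
  move=> Ky q; rewrite mem_cat => /orP[ql|]; first by rewrite ge_min hm.
  have yb i : `|y 0 i| <= `|b| := le_trans (coord_le_norm y i) (le_trans (hb y Ky) (ler_norm b)).
  rewrite ge_min mem_cat => /orP[] /mapP[i _ ->] /=; apply/orP; right;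
    rewrite ?dotNl dot_delta !mxE /B; have := yb i; rewrite ler_norml; lra.
(* All forms are at least m' on K, so every argument of [chi] there is at least 3, in the range
   where [chi] is positive. Dividing by the minimum over K then gives values at least 1. *)
pose k := 3 / m'; have k0 : 0 < k by rewrite divr_gt0.
have hc : C2c C (cut l k).
  apply: (cut_C2c (b := `|const_mx (- B) : 'rV[R]_n| + `|const_mx B : 'rV[R]_n|) k0).
  by move=> y /box_cutP[Cy hy]; split=> //; exact: open_box_bounded.
have cut0 y : K y -> 0 < cut l k y.
  move=> Ky; apply: cut_gt0 => q ql; apply: (@lt_le_trans _ _ 3); first by lra.
  by rewrite /k mulrAC ler_pdivlMr // ler_pM2l //; exact: hK.
have [c c0 hcc] := compact_min_gt0 cK (C2c_continuous hc) cut0.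
exists (fun y => c^-1 * cut l k y); split.
- case: hc => _ [K' [cK' K'C] K'0]; split; last by exists K' => // y /K'0 ->; rewrite mulr0.
  have [df [ddf hd]] := cut_d2 l k.
  by apply: (@d2_C2 _ _ _ (fun y => c^-1 *: df y) (fun i y => c^-1 *: ddf i y)) => x; exact: d2Z.
- by move=> y; rewrite mulr_ge0 ?invr_ge0 ?(ltW c0) //; case/andP: (cut_bounds l k y).
- by move=> y Ky; rewrite mulrC ler_pdivlMr // mul1r hcc.
Qed.

Lemma chamber_open_set : open C.
Proof.
rewrite (chamberE (hcox := hcox)) -[X in open X]setCK openC.
have -> : ~` [set x | forall a, a \in pos -> 0 < dot a x] =
    \bigcup_(a in [set` pos]) [set x | 0 <= dot (- a) x].
  apply/seteqP; split => y /=.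
    move=> /existsNP[a /not_implyP[ap /negP]]; rewrite -leNgt => h.
    by exists a => //=; rewrite dotNl oppr_ge0.
  by move=> [a ap] /=; rewrite dotNl oppr_ge0 leNgt => /negP h /(_ a ap).
apply: closed_bigcup; first exact: finite_fset.
by move=> a _; apply: ge_closed; exact: dot_continuous.
Qed.

Lemma chamber_measurable : measurable (C : set bT).
Proof. exact: open_measurable_rV chamber_open_set. Qed.

Definition open_boxes : set (set bT) := [set A | exists a b, A = open_box a b].

(** The functions [box_cut] converge boundedly to the indicator of the part of an open box in C, and
    open boxes generate the Borel sets and are closed under intersection. *)
Lemma measure_unique (m1 m2 : {measure set bT -> \bar R}) :
  (m1 setT <= 1)%E -> (m2 setT <= 1)%E -> m1 (~` (C : set bT)) = 0%E -> m2 (~` (C : set bT)) = 0%E ->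
  (forall f, C2c C f -> (forall y, 0 <= f y) -> \int[m1]_y f y = \int[m2]_y f y) ->
  forall A, measurable A -> m1 A = m2 A.
Proof.
move=> m1T m2T m1C m2C H.
have mC := chamber_measurable.
have mbox a b : measurable (open_box a b : set bT).
  have -> : open_box a b = rect (fun i => `]a 0 i, b 0 i[%classic) :> set bT.
    by apply/seteqP; split => y /= h i; have := h i; rewrite /= in_itv.
  by apply: rects_measurable; exists (fun i => `]a 0 i, b 0 i[%classic) => // i; exact: measurable_itv.
have restr (m : {measure set bT -> \bar R}) (D : set bT) : m (~` (C : set bT)) = 0%E -> measurable D -> m D = m ((C : set bT) `&` D).
  move=> m0 mD; have mCc := measurableC mC; have mD' := measurableI _ _ mD mCc.
  have e : m (D `&` ~` (C : set bT)) = 0%E.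
    apply/eqP; rewrite eq_le measure_ge0 andbT -m0.
    by apply: le_measure; rewrite ?inE //; exact: subIsetr.
  rewrite -{1}(setIT D) -(setUv (C : set bT)) setIUr measureU //.
  - by rewrite setIC; rewrite [X in (_ + X)%E]e adde0.
  - exact: measurableI.
  - by rewrite setIACA setICr setI0.
have boxE a b : m1 (open_box a b) = m2 (open_box a b).
  rewrite (restr m1) // (restr m2) //.
  have mCb : measurable (C `&` open_box a b : set bT) by exact: measurableI.
  have ind (m : {measure set bT -> \bar R}) : (m setT <= 1)%E ->
      \int[m]_y box_cut a b k y @[k --> \oo] --> \int[m]_y \1_(C `&` open_box a b : set bT) y.
    move=> mT; apply: (exp_cvg mT (M := 1)) => [k|k y|y].
    - by apply: continuous_measurable_rV; apply: C2c_continuous; exact: box_cut_C2c.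
    - by have /andP[h0 h1] := box_cut_bounds a b k y; rewrite ger0_norm.
    - exact: box_cut_cvg.
  have e : \int[m1]_y \1_(C `&` open_box a b : set bT) y = \int[m2]_y \1_(C `&` open_box a b : set bT) y.
    have h1 := ind m1 m1T; have h2 := ind m2 m2T.
    have ee : (fun k => \int[m1]_y box_cut a b k y) = fun k => \int[m2]_y box_cut a b k y.
      by apply/funext => k; apply: H => [|y]; [exact: box_cut_C2c|by case/andP: (box_cut_bounds a b k y)].
    by rewrite ee in h1; exact: (cvg_unique _ h1 h2).
  have fin (m : {measure set bT -> \bar R}) : (m setT <= 1)%E ->
      (\int[m]_y \1_(C `&` open_box a b : set bT) y)%:E = m (C `&` open_box a b).
    move=> mT; rewrite EFin_exp; last by apply: bmeas_integrable => //; exact: bmeas_indic.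
    by rewrite integral_indic // setIT.
  by rewrite -(fin m1) // -(fin m2) // e.
move=> A mA.
apply: (@g_sigma_algebra_measure_unique _ _ _ open_boxes _
  (fun k => open_box (const_mx (- k%:R)) (const_mx k%:R)) _ _ m1 m2).
- by move=> _ [a [b ->]].
- by move=> k; do 2!eexists.
- apply/seteqP; split => // y _; exists (Num.bound `|y|) => // i.
  rewrite !mxE; have := coord_le_norm y i; have := archi_boundP (normr_ge0 y).
  by move=> h1 h2; rewrite -ltr_norml; exact: le_lt_trans h2 h1.
- move=> _ _ [a [b ->]] [a' [b' ->]].
  exists (\row_i Num.max (a 0 i) (a' 0 i)), (\row_i Num.min (b 0 i) (b' 0 i)).
  apply/seteqP; split => y /=.
    by move=> [h1 h2] i; rewrite !mxE gt_max lt_min; have /andP[-> ->] := h1 i; have /andP[-> ->] := h2 i.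
  by move=> h; split => i; have := h i; rewrite !mxE gt_max lt_min => /andP[/andP[? ?] /andP[? ?]]; apply/andP.
- by move=> _ [a [b ->]].
- move=> k; apply: le_lt_trans (ltry 1); apply: le_trans m1T; apply: le_measure; rewrite ?inE //.
- move: A mA; apply: smallest_sub; first exact: smallest_sigma_algebra.
  move=> U oU; have [F [-> hF]] := open_bigcup_ball oU.
  have [_ _ bU] := smallest_sigma_algebra [set: bT] open_boxes.
  apply: bU => k; have [->|[x [r [r0 ->]]]] := hF k.
    by have [s0 _ _] := smallest_sigma_algebra [set: bT] open_boxes.
  apply: sub_sigma_algebra; exists (\row_i (x 0 i - r)), (\row_i (x 0 i + r)).
  rewrite (ball_rect _ r0); apply/seteqP; split => y /= h i; have := h i; by rewrite /= in_itv /= !mxE.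
Qed.

End Determination.

(** * Semigroup properties of the killed motion *)

Section KilledSemigroup.
Context {R : realType} {n : nat} {W : set 'M[R]_n} {C : set 'rV[R]_n}.
Context {pos : {fset 'rV[R]_n}} {hcox : reflection_chamber W C pos}.
Context {d : measure_display} {T : measurableType d}.
Variables (P : probability T R) (B : R -> T -> 'rV[R]_n).
Hypothesis hB : brownian_motion P B.
Local Notation bT := (borel_rV R n).
Local Notation integ f := (P.-integrable setT (EFin \o f)).
Local Notation E f := (\int[P]_w f w).
Local Notation G := (heat P B).
Local Notation kl := (kill (pos := pos) P B).
Local Notation asym := (antisym (W := W) (C := C) (pos := pos)).
Local Notation live t x := [set w | stay (pos := pos) B t x w].
Implicit Types (t s r : R) (x y : 'rV[R]_n) (f g u : 'rV[R]_n -> R).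

Let PT : (P setT <= 1)%E. Proof. exact: probability_le1. Qed.
Let oC : open C. Proof. exact: (chamber_open_set (hcox := hcox)). Qed.

Lemma antisym_U2 f : C2c C f -> exists du ddu, U2 (asym f) du ddu /\
  forall x, C x -> trace ddu x = laplacian f x.
Proof.
move=> hf; have h2 := C2c_U2 hf.
have hu := U2_sum (enum_fset (fset_set W)) (fun w => U2Z (sgnW (hcox := hcox) w) (U2_mulmx w h2)).
do 2!eexists; split; first exact: hu.
move=> x Cx; symmetry; apply: laplacianE.
have h : \forall y \near x, asym f y = f y.
  apply: filterS (open_near oC Cx) => y Cy.
  by apply: (antisym_chamber (hcox := hcox)) => // z nCz; exact: (C2c_supp0 hf nCz).
apply: filterS (near_near h) => y hy.
by apply: (d2_near hy _ _ (U2_d2 hu y)) => [|i]; exact: near_all.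
Qed.

Lemma antisym_C f y : C2c C f -> C y -> asym f y = f y.
Proof. by move=> hf; apply: (antisym_chamber (hcox := hcox)) => z nCz; exact: (C2c_supp0 hf nCz). Qed.

Lemma kill_eq t f g x : 0 < t -> (forall y, C y -> f y = g y) -> kl t f x = kl t g x.
Proof.
move=> t0 fg; apply: eq_Rintegral => w _; have [h|h] := pselect (live t x w).
  by rewrite fg //; case: (stay_chamber (hcox := hcox) hB t0 h).
by rewrite (indic0 h) !mul0r.
Qed.

Lemma kill_images t f x : 0 < t -> C x -> C2c C f -> kl t f x = G t (asym f) x.
Proof.
move=> t0 Cx hf; have [du [ddu [hu _]]] := antisym_U2 hf.
rewrite -(images (hcox := hcox) hB t0 Cx hu); last exact: antisym_antisymmetric.
by apply: kill_eq => // y Cy; rewrite antisym_C.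
Qed.

Lemma kill_outside t f x : 0 < t -> ~ C x -> kl t f x = 0.
Proof.
move=> t0 nCx; rewrite -[RHS](exp_cst P 0); apply: eq_Rintegral => w _.
rewrite indic0 ?mul0r // => h; by case: (stay_chamber (hcox := hcox) hB t0 h).
Qed.

Lemma live_measurable t x : 0 < t -> measurable (live t x).
Proof. exact: (stay_measurable hB). Qed.

Lemma kill_bmeasw t f x : 0 < t -> bmeas (f : bT -> R) -> bmeas (fun w => \1_(live t x) w * f (x + B t w)).
Proof.
move=> t0 [mf bf]; apply: bmeasM; first by apply: bmeas_indic; exact: live_measurable.
by apply: (heat_bmeas hB) => //; exact: ltW.
Qed.

(** The laws are carried over from the heat semigroup acting on antisymmetrizations. For
    composition, heat evolution keeps the function antisymmetric and on C it equals the killed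
    expectation, so the formula of images applies a second time. *)
Lemma kill_semigroup : semigroup C kl (fun f x => 2^-1 * laplacian f x).
Proof.
split.
- move=> t x f g M t0 Cx bf bg M0 h.
  have bI : bmeas (\1_(live t x) : T -> R) by apply: bmeas_indic; exact: live_measurable.
  have i1 := bmeas_integrable PT (kill_bmeasw x t0 bf).
  have i2 := bmeas_integrable PT (kill_bmeasw x t0 bg).
  have i3 := bmeas_integrable PT bI.
  have i4 : integ (fun w => M * \1_(live t x) w) by exact: integZ.
  apply: (@le_trans _ _ (E (fun w => \1_(live t x) w * f (x + B t w) + M * \1_(live t x) w))).
    apply: exp_le => // [|w]; first exact: integD.
    have [hw|hw] := pselect (live t x w); last by rewrite (indic0 hw) !mul0r mulr0 addr0.
    by rewrite (indic1 hw) !mul1r mulr1; apply: h; case: (stay_chamber (hcox := hcox) hB t0 hw).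
  rewrite expD // expZ // lerD2l ler_piMr //.
  apply: le_trans (ler_norm _) _; apply: (exp_bound PT bI) => w.
  by rewrite indicE; case: (_ \in _); rewrite ?normr1 ?normr0.
- move=> s r f x s0 r0 hf Cx; have [du [ddu [hu _]]] := antisym_U2 hf.
  have au : antisymmetric (W := W) (C := C) (pos := pos) (asym f) by exact: antisym_antisymmetric.
  have uu := U1_ubc hu.1.
  rewrite (kill_images (addr_gt0 s0 r0) Cx hf) (heat_semigroup hB x (ltW s0) (ltW r0) uu).
  rewrite -(images (hcox := hcox) hB s0 Cx (heat_U2 hB (ltW r0) hu)); last first.
    exact: (heat_antisymmetric (hcox := hcox) hB (ltW r0) hu au).
  by apply: kill_eq => // y Cy; rewrite kill_images.
- move=> r f r0 hf; have [du [ddu [hu _]]] := antisym_U2 hf; have uu := U1_ubc hu.1.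
  have -> : kl r f = fun x => \1_(C : set bT) x * G r (asym f) x.
    apply/funext => x; have [Cx|Cx] := pselect (C x).
      by rewrite indicE mem_set // mul1r kill_images.
    by rewrite indicE memNset // mul0r kill_outside.
  apply: bmeasM; first by apply: bmeas_indic; exact: (chamber_measurable (hcox := hcox)).
  have ug := heat_ubc hB (ltW r0) uu.
  by split; [exact: ubc_measurable|case: ug].
- move=> f hf e e0; have [du [ddu [hu tr]]] := antisym_U2 hf.
  have [a a0 ha] := heat_generator hB hu e0; exists a => // r r0 ra x Cx.
  by have := ha r r0 ra x; rewrite tr // kill_images // antisym_C.
- move=> f hf; have [du [ddu [hu tr]]] := antisym_U2 hf.
  have [[M hM] _] := U2_ubc_trace hu; exists (2^-1 * M) => x Cx.
  by rewrite -tr // normrM gtr0_norm // ler_wpM2l.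
Qed.

Lemma antisym_support f : C2c C f -> exists2 b, 0 <= b & forall y, b < `|y| -> asym f y = 0.
Proof.
move=> hf; case: (hf) => _ [K [cK _] K0].
have [b hb] := compact_max cK (@norm_continuous _ 'rV[R]_n).
pose c := \sum_(w <- fset_set W) (n%:R * `|w^T| * `|b|).
exists c => [|y cy]; first by apply: sumr_ge0 => w _; rewrite !mulr_ge0.
rewrite /antisym big_seq big1 // => w ww; rewrite K0 ?mulr0 // => Ky.
have Ww : W w by exact/(mem_groupP (hcox := hcox)).
have h1 : `|y| <= n%:R * `|w^T| * `|y *m w|.
  by rewrite -{1}(mulmx1 y) -(group_orth (hcox := hcox) Ww) mulmxA norm_mulmx.
have h2 : n%:R * `|w^T| * `|y *m w| <= c.
  apply: (@le_trans _ _ (n%:R * `|w^T| * `|b|)).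
    by rewrite ler_wpM2l ?mulr_ge0 // (le_trans (hb _ Ky)) // ler_norm.
  by rewrite /c (big_fsetD1 w) //= lerDl; apply: sumr_ge0 => w' _; rewrite !mulr_ge0.
by move: cy; rewrite ltNge (le_trans h1 h2).
Qed.

(** One compact set serves all times up to t. Near a wall the value is small by antisymmetry and a
    Lipschitz constant that heat flow does not increase; far away, the motion would have to travel a
    distance D to reach the support. *)
Lemma heat_support f t e : C2c C f -> 0 < t -> 0 < e -> exists K, [/\ compact K, K `<=` C &
  forall s y, 0 <= s <= t -> C y -> ~ K y -> `|G s (asym f) y| <= e].
Proof.
move=> hf t0 e0; have [du [ddu [hu _]]] := antisym_U2 hf.
have au : antisymmetric (W := W) (C := C) (pos := pos) (asym f) by exact: antisym_antisymmetric.
have hb0 := antisym_support hf; move: hu au hb0; move: (asym f) => u hu au hb0.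
have uu := U1_ubc hu.1; have [L L0 uL] := U1_lip hu.1; case: (uu) => /bounded_gt0[M M0 uM] _.
have [b b0 hb] := hb0.
(* Chebyshev's inequality gives M n s / D^2, which is at most e because M n t = e q and q <= (q +
   1)^2. *)
pose q := M * n%:R * t / e; have q0 : 0 <= q by rewrite divr_ge0 ?mulr_ge0 // ltW.
pose D := q + 1; have D0 : 0 < D by rewrite ltr_wpDl.
have far s y : 0 <= s <= t -> b + D < `|y| -> `|G s u y| <= e.
  move=> /andP[s0 st] hy; move: s0; rewrite le_eqVlt => /orP[/eqP<-|s0].
    by rewrite (heat0 hB) hb ?normr0 ?(ltW e0) //; apply: lt_trans hy; rewrite ltrDl.
  have iu := ubc_integ hB y (ltW s0) uu.
  have isq : integ (fun w => M / D ^+ 2 * sq (B s w)) by apply: integZ; exact: (integ_sq hB).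
  apply: (le_trans (exp_norm iu)); apply: (@le_trans _ _ (E (fun w => M / D ^+ 2 * sq (B s w)))).
    apply: exp_le => //; first by have := integrable_abse iu; congr (integrable _ _ _).
    move=> w; have c0 : 0 <= M / D ^+ 2 by rewrite divr_ge0 ?sqr_ge0 // ltW.
    have [small|big] := leP `|B s w| D.
      rewrite hb ?normr0; first exact: mulr_ge0 c0 (sq_ge0 _).
      have := ler_normB (y + B s w) (B s w); rewrite addrK; lra.
    apply: (le_trans (uM _)); rewrite mulrAC ler_pdivlMr ?exprn_gt0 // ler_wpM2l ?(ltW M0) //.
    by apply: le_trans (norm_sq _); rewrite lerXn2r ?nnegrE // ltW.
  rewrite expZ; last exact: (integ_sq hB).
  rewrite (exp_sq hB s0) mulrAC ler_pdivrMr ?exprn_gt0 //.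
  have h1 : M * (n%:R * s) <= e * q.
    have -> : e * q = M * n%:R * t by rewrite /q; field; rewrite gt_eqF.
    by rewrite mulrA ler_wpM2l // mulr_ge0 // ltW.
  apply: (le_trans h1); rewrite ler_wpM2l ?(ltW e0) // /D; nra.
have RS0 := root_sum_ge0 (pos := pos).
pose k := L * root_sum (pos := pos) + 1.
have k0 : 0 < k by rewrite ltr_wpDl // mulr_ge0.
pose K1 : set 'rV[R]_n := [set y | forall q, q \in wall_forms (pos := pos) -> e / k <= dot q.1 y + q.2].
have K1P y : K1 y <-> forall a, a \in pos -> e / k <= dot a y.
  split=> [h a ap|h p /mapP[a ap ->]] /=; last by rewrite addr0; exact: h.
  by have := h (a, 0); rewrite /= addr0; apply; apply/mapP; exists a.
exists (K1 `&` [set y | - (b + D) <= - `|y|]); split.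
- apply: (bounded_closed_rV (b := b + D)); last by move=> y [_ /=]; rewrite lerN2.
  apply: closedI; first exact: forms_closed.
  apply: ge_closed => y; apply: continuousN; exact: norm_continuous.
- move=> y [/K1P h _]; rewrite (chamberE (hcox := hcox)) => a ap.
  by apply: lt_le_trans (h a ap); rewrite divr_gt0.
- move=> s y hs Cy nK; have [hy|hy] := ltP (b + D) `|y|; first exact: far.
  have /existsNP[a /not_implyP[ap ha]] : ~ forall a, a \in pos -> e / k <= dot a y.
    by move=> h; apply: nK; split; [exact/K1P|rewrite /= lerN2].
  have s0 : 0 <= s by case/andP: hs.
  have av := heat_antisymmetric (hcox := hcox) hB s0 hu au.
  have vL := heat_lip hB s0 uu uL.
  apply: (le_trans (wall_bound_sum (hcox := hcox) y ap L0 av vL)).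
  move/negP: ha; rewrite -ltNge ltr_pdivlMr // => ha.
  have dy := chamber_dot (hcox := hcox) ap Cy; rewrite (gtr0_norm dy).
  by apply: le_trans (ltW ha); rewrite mulrC ler_wpM2l ?(ltW dy) // /k lerDl.
Qed.

Section HeatComparison.
Variables (S : R -> ('rV[R]_n -> R) -> 'rV[R]_n -> R) (LL : ('rV[R]_n -> R) -> 'rV[R]_n -> R).
Hypothesis sg : semigroup C S LL.
Variables (rho : 'rV[R]_n -> R) (drho : 'rV[R]_n -> 'rV[R]_n) (ddrho : 'I_n -> 'rV[R]_n -> 'rV[R]_n).
Hypotheses (rho2 : forall x, d2 rho drho ddrho x) (rho0 : forall x, C x -> 0 < rho x).
Hypothesis LLE : forall f x, C2c C f -> C x ->
  rho x * LL f x = 2^-1 * laplacian (fun y => rho y * f y) x.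
(** A harmonic correction to the heat flow: 0 when a Markov semigroup is bounded below by the killed
    one, and -h when the killed semigroup is bounded above by h. Its sign keeps the set where the
    solution exceeds e inside the compact set of [heat_support]. *)
Variables (k : 'rV[R]_n -> R) (dk : 'rV[R]_n -> 'rV[R]_n) (ddk : 'I_n -> 'rV[R]_n -> 'rV[R]_n).
Hypotheses (k2 : forall x, d2 k dk ddk x) (k0 : forall x, C x -> k x <= 0).
Hypothesis (trk : forall x, C x -> trace ddk x = 0).

Lemma heat_comparison g t e x : C2c C g -> 0 < t -> 0 < e -> C x ->
  trunc e (G t (asym g) x + k x) / rho x <=
  S t (extend C (fun y => trunc e (asym g y + k y) / rho y)) x.
Proof.
move=> hg t0 e0 Cx; have [du [ddu [hu _]]] := antisym_U2 hg; set u := asym g in hu *.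
have uu := U1_ubc hu.1.
(* The comparison asks for a spatially smooth v at every s, so the remaining time t - s is cut off
   at 0. *)
pose m s := pos1 (t - s).
have m0 s : 0 <= m s by rewrite /m /pos1 le_max lexx orbT.
have mE s : s <= t -> m s = t - s by move=> st; rewrite /m /pos1 max_l // subr_ge0.
pose v s y := G (m s) u y + k y.
have hG s := heat_U2 hB (m0 s) hu.
have v2 s y := d2D (U2_d2 (hG s) y) (k2 y).
have [K [cK KC hK]] := heat_support hg t0 e0.
have v0 : v 0 x = G t u x + k x by rewrite /v mE ?subr0 // ltW.
have vt : (fun y => trunc e (u y + k y) / rho y) = (fun y => trunc e (v t y) / rho y).
  by apply/funext => y; rewrite /v mE // subrr (heat0 hB).
rewrite vt -v0.
apply: (caloric_comparison oC sg rho2 rho0 LLE e0 t0 Cx cK KC v2).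
- move=> s y /andP[s0 st] Cy nK; rewrite /v mE //.
  have := hK (t - s) y _ Cy nK; rewrite subr_ge0 st /= lerBlDr lerDl s0 => /(_ isT) h.
  by have := k0 Cy; have := ler_norm (G (t - s) u y); rewrite -/u in h; lra.
- move=> s s0 st; have [[M hM] _] := U2_ubc_trace (hG s); exists (2^-1 * M) => y Ky.
  rewrite traceD (trk (KC y Ky)) addr0 normrM gtr0_norm // ler_wpM2l //; exact: hM.
- move=> s s0 st q q0; have [a a0 ha] := heat_near hB uu q0; exists a => // r r0 ra srt y _.
  have h1 : 0 <= t - (s + r) by rewrite subr_ge0.
  have -> : v (s + r) y - v s y = - (G (t - s) u y - G (t - (s + r)) u y).
    by rewrite /v mE // mE ?(ltW st) //; ring.
  rewrite normrN.
  have -> : G (t - s) u y = G (t - (s + r)) (G r u) y.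
    rewrite -(heat_semigroup hB y h1 (ltW r0) uu); apply: heat_time; ring.
  by apply: (heat_dist hB) => //; [exact: (heat_ubc hB (ltW r0) uu)|move=> z; exact: ha].
- move=> s s0 st q q0; have [a a0 ha] := heat_generator hB (hG s) q0.
  exists a => // r r0 ra rs y Ky; have srt : s - r <= t by lra.
  have h1 : 0 <= t - s by rewrite subr_ge0.
  have e1 : v (s - r) y = G r (G (m s) u) y + k y.
    rewrite /v mE // (mE s) // -(heat_semigroup hB y (ltW r0) h1 uu); congr (_ + _).
    by apply: heat_time; ring.
  rewrite -/(v (s - r) y) e1 traceD (trk (KC y Ky)) addr0 -normrN.
  have := ha r r0 ra y; congr (`| _ | <= _); ring.
Qed.

End HeatComparison.

End KilledSemigroup.

(** * The conditioned motion *)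

Section ConditionedSemigroup.
Context {R : realType} {n : nat} {W : set 'M[R]_n} {C : set 'rV[R]_n}.
Context {pos : {fset 'rV[R]_n}} {hcox : reflection_chamber W C pos}.
Context {d : measure_display} {T : measurableType d}.
Variables (P : probability T R) (B : R -> T -> 'rV[R]_n).
Hypothesis hB : brownian_motion P B.
Local Notation bT := (borel_rV R n).
Local Notation E f := (\int[P]_w f w).
Local Notation G := (heat P B).
Local Notation kl := (kill (pos := pos) P B).
Local Notation asym := (antisym (W := W) (C := C) (pos := pos)).
Local Notation live t x := [set w | stay (pos := pos) B t x w].
Local Notation h := (root_prod pos).
Implicit Types (t s r e : R) (x y : 'rV[R]_n) (f g u : 'rV[R]_n -> R).

Let PT : (P setT <= 1)%E. Proof. exact: probability_le1. Qed.
Let oC : open C. Proof. exact: (chamber_open_set (hcox := hcox)). Qed.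
Local Notation dh := (lgrad pos).
Local Notation ddh := (fun i y => \sum_(a <- pos) a 0 i *: lgrad (rest pos a) y).

Lemma sqr_le_lin (z k : R) : 0 <= k -> z ^+ 2 <= k -> z <= k + 1.
Proof. by move=> k0 zk; nra. Qed.

Lemma root_prod_d2 x : d2 h dh ddh x.
Proof.
have hE : \forall y \near x, lprod pos y = h y by apply: near_all => y; rewrite root_prodE.
apply: (d2_near hE _ _ (d2_lprod x (fset_uniq pos))); last by move=> i; exact: near_all.
exact: near_all.
Qed.

Lemma root_prod_trace x : C x -> trace ddh x = 0.
Proof. by move=> Cx; rewrite trace_lprod (llap0 (hcox := hcox)). Qed.

Lemma root_prod_continuous : continuous h.
Proof. by move=> x; apply: d1_continuous; exact: (root_prod_d2 x).1. Qed.

Lemma chamber_root_prod x : C x -> 0 < h x.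
Proof. exact: (root_prod_gt0 (hcox := hcox)). Qed.

Lemma kill_bmeas_le t f g x : 0 < t -> C x -> bmeas (f : bT -> R) -> bmeas (g : bT -> R) ->
  (forall y, C y -> f y <= g y) -> kl t f x <= kl t g x.
Proof.
move=> t0 Cx bf bg fg; rewrite -[leRHS]addr0.
by apply: (sg_le (kill_semigroup hB)) => // y Cy; rewrite addr0 fg.
Qed.

Lemma kill0 t x : 0 < t -> kl t (fun=> 0) x = 0.
Proof.
move=> t0; rewrite -[RHS](exp_cst P 0); apply: eq_Rintegral => w _; exact: mulr0.
Qed.

(** With the correction -h the solution at the final time is g - h <= 0, so its truncation vanishes;
    comparison makes the truncation of kl t g - h vanish as well, which bounds it by 2 e. *)
Lemma kill_le_h g t x : C2c C g -> 0 < t -> C x -> (forall y, C y -> g y <= h y) ->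
  kl t g x <= h x.
Proof.
move=> hg t0 Cx gh.
have k2 y := d2Z (-1) (root_prod_d2 y).
have k0 y : C y -> -1 * h y <= 0 by move=> /chamber_root_prod; lra.
have trk y : C y -> trace (fun i z => -1 *: ddh i z) y = 0.
  by move=> Cy; rewrite traceZ root_prod_trace // mulr0.
have LLE f y : C2c C f -> C y ->
    1 * (2^-1 * laplacian f y) = 2^-1 * laplacian (fun z => 1 * f z) y.
  move=> _ _; have e1 : (fun z => 1 * f z) = f by apply/funext => z; exact: mul1r.
  by rewrite e1; exact: mul1r.
suff H e : 0 < e -> kl t g x <= h x + 2 * e.
  apply/ler_addgt0Pr => e e0; have := H (e / 2); rewrite divr_gt0 // => /(_ isT).
  by rewrite mulrC divfK.
move=> e0; have rho0 (y : 'rV[R]_n) : C y -> 0 < (1 : R) by move=> _; exact: ltr01.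
have := heat_comparison (hcox := hcox) hB (kill_semigroup (hcox := hcox) hB) (d2_cst 1) rho0 LLE k2 k0 trk hg t0 e0 Cx.
rewrite divr1 (kill_images hB t0 Cx hg).
rewrite (@kill_eq _ _ _ _ _ hcox _ _ _ _ hB t _ (fun=> 0) x t0) ?kill0 //.
  by have [_ b1 _ _ _] := trunc_bounds (G t (asym g) x + -1 * h x) e0; lra.
move=> y Cy; rewrite extendT // (antisym_C (hcox := hcox)) //.
have gy : g y + -1 * h y <= e by have := gh y Cy; lra.
by have [-> _ _] := trunc_eq0 e0 gy; rewrite mul0r.
Qed.

(* Compare h with the compactly supported truncation of
   v s y = h y (1 - (|y|^2 + c (t - s)) / k), which is caloric for c = n + 2 N
   because h is harmonic and homogeneous of degree N; then let k grow. *)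
Lemma kill_ge_h t x e : 0 < t -> C x -> 0 < e -> exists f,
  [/\ C2c C f, forall y, C y -> 0 <= f y, forall y, C y -> f y <= h y & h x - e <= kl t f x].
Proof.
move=> t0 Cx e0.
pose N : R := (size pos)%:R; pose c : R := n%:R + 2 * N.
have c0 : 0 <= c by rewrite addr_ge0 // mulr_ge0.
(* The loss e is split evenly: truncating at e1 costs 2 e1 = e / 2, and k makes the correction h x
   (|x|^2 + c t) / k at most e / 2. *)
pose e1 := e / 4; have e10 : 0 < e1 by rewrite divr_gt0.
pose k := h x * (dot x x + c * t) * 2 / e + 1.
have hx := chamber_root_prod Cx.
have k0 : 0 < k by rewrite ltr_wpDl // divr_ge0 ?(ltW e0) // !mulr_ge0 ?addr_ge0 ?dot_ge0 ?mulr_ge0 // ltW.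
have ki0 : 0 < k^-1 by rewrite invr_gt0.
pose q s y : R := (1 - k^-1 * (c * (t - s))) + (- k^-1) * dot y y.
have q2 s y := d2D (d2_cst (1 - k^-1 * (c * (t - s))) y) (d2Z (- k^-1) (d2_dotxx y)).
pose v s y := h y * q s y.
have v2 s y := d2M (root_prod_d2 y) (q2 s y).
pose ddv s (i : 'I_n) (y : 'rV[R]_n) : 'rV[R]_n :=
  h y *: (0 + - k^-1 *: (2 *: delta_mx 0 i)) + (0 + - k^-1 *: (2 *: y)) 0 i *: dh y +
  ((1 - k^-1 * (c * (t - s)) + - k^-1 * dot y y) *: ddh i y + dh y 0 i *: (0 + - k^-1 *: (2 *: y))).
have {}v2 s y : d2 (v s) _ (ddv s) y := v2 s y.
have tr s y : C y -> 2^-1 * trace (ddv s) y = - (k^-1 * c * h y).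
  move=> Cy; rewrite /ddv traceM root_prod_trace // traceD traceZ trace_dotxx.
  rewrite {1}/trace big1 => [|i _]; last by rewrite mxE.
  rewrite !add0r mulr0 addr0 dotZr dotZr dotC (lgrad_euler y (fset_uniq pos)) -root_prodE /c /N.
  by field; rewrite gt_eqF.
(* The condition h >= e1 keeps this part of the closed chamber away from the walls, where h
   vanishes. *)
pose K : set 'rV[R]_n := [set y | forall p, p \in wall_forms (pos := pos) -> 0 <= dot p.1 y + p.2] `&`
  ([set y | - k <= - dot y y] `&` [set y | e1 <= h y]).
have cdot : continuous (fun y : 'rV[R]_n => dot y y).
  by move=> y; apply: d1_continuous; exact: (d2_dotxx y).1.
have cK : compact K.
  apply: (bounded_closed_rV (b := k + 1)).
    apply: closedI; first exact: forms_closed.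
    apply: closedI; last by apply: ge_closed; exact: root_prod_continuous.
    apply: ge_closed => y; apply: (continuousN (f := fun y : 'rV[R]_n => dot y y)); exact: cdot.
  move=> y [_ [/= yk _]]; apply: sqr_le_lin; first exact: ltW.
  by apply: (le_trans (norm_sq y)); rewrite lerN2 in yk.
have KC : K `<=` C.
  move=> y [Ky [_ /= hy]]; rewrite (chamberE (hcox := hcox)) => a ap.
  have h1 : 0 <= dot a y + 0 by apply: (Ky (a, 0)); apply/mapP; exists a.
  rewrite addr0 in h1; rewrite lt_neqAle h1 andbT; apply/eqP => h0.
  by move: hy; rewrite root_prodE (lprod0 ap (esym h0)) leNgt e10.
have qle s y : s <= t -> q s y <= 1.
  move=> st; have h1 : 0 <= k^-1 * (c * (t - s)) by rewrite !mulr_ge0 ?(ltW ki0) // subr_ge0.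
  have h2 : 0 <= k^-1 * dot y y by rewrite mulr_ge0 ?dot_ge0 // ltW.
  by rewrite /q mulNr; lra.
have vle s y : s <= t -> C y -> v s y <= h y.
  move=> st Cy; have hy := chamber_root_prod Cy.
  by rewrite /v ler_piMr ?(ltW hy) //; exact: qle.
have vK s y : 0 <= s <= t -> C y -> ~ K y -> v s y <= e1.
  move=> /andP[s0 st] Cy nK; have hy := chamber_root_prod Cy.
  have [hy1|hy1] := ltP (h y) e1; first exact: le_trans (vle s y st Cy) (ltW hy1).
  have h1 : 0 <= k^-1 * (c * (t - s)) by rewrite !mulr_ge0 ?(ltW ki0) // subr_ge0.
  have yk : k < dot y y.
    rewrite ltNge; apply/negP => yk; apply: nK; split; last by split; rewrite /= ?lerN2.
    move=> p /mapP[a ap ->] /=; rewrite addr0; apply: ltW; exact: (chamber_dot (hcox := hcox) ap Cy).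
  have h2 : 1 <= k^-1 * dot y y by rewrite mulrC ler_pdivlMr // mul1r ltW.
  apply: (@le_trans _ _ 0); last exact: ltW.
  by rewrite /v mulr_ge0_le0 ?(ltW hy) // /q mulNr; lra.
have [M hM] := compact_max cK root_prod_continuous.
have hK y : K y -> 0 <= h y <= `|M|.
  move=> Ky; rewrite (ltW (chamber_root_prod (KC y Ky))) /=.
  exact: le_trans (hM y Ky) (ler_norm M).
have ck0 : 0 <= k^-1 * c by rewrite mulr_ge0 // ltW.
have sg := kill_semigroup (hcox := hcox) hB.
have LLE f y : C2c C f -> C y ->
    1 * (2^-1 * laplacian f y) = 2^-1 * laplacian (fun z => 1 * f z) y.
  move=> _ _; have ee : (fun z => 1 * f z) = f by apply/funext => z; exact: mul1r.
  by rewrite ee; exact: mul1r.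
have rho0 (y : 'rV[R]_n) : C y -> 0 < (1 : R) by move=> _; exact: ltr01.
have vM s : 0 < s -> s <= t -> exists M, forall y, K y -> `|2^-1 * trace (ddv s) y| <= M.
  move=> _ _; exists (k^-1 * c * `|M|) => y Ky; have /andP[h0 h1] := hK y Ky.
  rewrite tr; last exact: KC.
  rewrite normrN ger0_norm; first exact: ler_wpM2l.
  exact: mulr_ge0.
have vd s r y : v (s + r) y - v s y = k^-1 * c * h y * r by rewrite /v /q; ring.
have vr s : 0 <= s -> s < t -> forall p, 0 < p -> exists2 a, 0 < a &
    forall r, 0 < r -> r < a -> s + r <= t -> forall y, K y -> `|v (s + r) y - v s y| <= p.
  move=> _ _ p p0; have c10 : 0 < k^-1 * c * `|M| + 1 by rewrite ltr_wpDl // mulr_ge0.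
  exists (p / (k^-1 * c * `|M| + 1)); first exact: divr_gt0.
  move=> r r0; rewrite ltr_pdivlMr // => rp _ y Ky; have /andP[h0 h1] := hK y Ky.
  rewrite vd ger0_norm; last by rewrite !mulr_ge0 // ltW.
  apply: le_trans (ltW rp); rewrite mulrC ler_wpM2l ?(ltW r0) //.
  by apply: ler_wpDr => //; exact: ler_wpM2l.
have vl s : 0 < s -> s <= t -> forall p, 0 < p -> exists2 a, 0 < a &
    forall r, 0 < r -> r < a -> r <= s -> forall y, K y ->
       `|v s y - v (s - r) y + r * (2^-1 * trace (ddv s) y)| <= p * r.
  move=> _ _ p p0; exists 1 => // r r0 _ _ y Ky.
  rewrite tr; last exact: KC.
  have -> : v s y - v (s - r) y = k^-1 * c * h y * r by rewrite -(vd (s - r) r) subrK.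
  by rewrite (_ : _ + _ = 0) ?normr0 ?mulr_ge0 // ?ltW //; ring.
have main := caloric_comparison oC sg (d2_cst 1) rho0 LLE e10 t0 Cx cK KC v2 vK vM vr vl.
pose F := extend C (fun y => trunc e1 (v t y) / 1).
have FE y : C y -> F y = trunc e1 (v t y) by move=> Cy; rewrite /F extendT // divr1.
exists F; split.
- have F2 y (Cy : C y) := d2_comp (v2 t y) (trunc_derive (v t y) e10) (dtrunc_derive (v t y) e10)
    (ddtrunc_continuous (x := v t y)).
  have -> : F = extend C (fun y => trunc e1 (v t y)).
    by apply/funext => y; rewrite /F /extend divr1.
  have [] := extend_C2c oC cK KC F2 => // y Cy nK.
  have ht : 0 <= t <= t by rewrite lexx ltW.
  by have [-> _ _] := trunc_eq0 e10 (vK t y ht Cy nK).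
- by move=> y Cy; rewrite FE //; have [] := trunc_bounds (v t y) e10.
- move=> y Cy; rewrite FE //; have [_ _ b _ _] := trunc_bounds (v t y) e10.
  apply: (le_trans b); have hy := chamber_root_prod Cy.
  by rewrite /pos1 ge_max (ltW hy) andbT; exact: vle.
- apply: le_trans main; rewrite divr1; have [_ b _ _ _] := trunc_bounds (v 0 x) e10.
  apply: le_trans b; have -> : v 0 x = h x - h x * (dot x x + c * t) / k.
    by rewrite /v /q subr0; field; rewrite gt_eqF.
  have : h x * (dot x x + c * t) / k <= e / 2.
    rewrite ler_pdivrMr //; have -> : e / 2 * k = h x * (dot x x + c * t) + e / 2.
      by rewrite /k; field; rewrite gt_eqF.
    by rewrite lerDl divr_ge0 // ltW.
  by rewrite /e1; lra.
Qed.

Lemma C2cM u f : C2 u -> C2c C f -> C2c C (fun y => u y * f y).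
Proof.
move=> C2u [C2f [K [cK KC] f0]]; split.
  by apply: d2_C2 => y; exact: (d2M (C2_d2 y C2u) (C2_d2 y C2f)).
by exists K => // y nK; rewrite f0 // mulr0.
Qed.

Lemma root_prod_C2c f : C2c C f -> C2c C (fun y => h y * f y).
Proof. by apply: C2cM; apply: d2_C2; exact: root_prod_d2. Qed.

Definition weight t x w : R := \1_(live t x) w * (h (x + B t w) / h x).

Lemma weight_ge0 t x w : 0 < t -> 0 <= weight t x w.
Proof.
move=> t0; rewrite /weight; have [hw|hw] := pselect (live t x w); last by rewrite (indic0 hw) mul0r.
have [Cx Cy] := stay_chamber (hcox := hcox) hB t0 hw.
by rewrite (indic1 hw) mul1r divr_ge0 // ltW // chamber_root_prod.
Qed.

Lemma weight_measurable t x : 0 < t -> measurable_fun setT (weight t x).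
Proof.
move=> t0; apply: measurable_funM; first exact: (measurable_indic (live_measurable hB x t0)).
apply: measurable_funM => //.
apply: (measurableT_comp (f := h : bT -> R)).
  exact: continuous_measurable_rV root_prod_continuous.
exact: (shift_measurable hB x (ltW t0)).
Qed.

(** The function h is not a test function, so [kill_le_h] is applied to h times the cutoffs
    [exhaust] and the bound passes to h by Fatou's lemma. *)
Lemma weight_le1 t x : 0 < t -> C x -> (\int[P]_w (weight t x w)%:E <= 1)%E.
Proof.
move=> t0 Cx; have hx := chamber_root_prod Cx.
pose u (k : nat) w : \bar R := (\1_(live t x) w * (h (x + B t w) * exhaust (pos := pos) k (x + B t w)) / h x)%:E.
have hk k : C2c C (fun y => h y * exhaust (pos := pos) k y).
  by apply: root_prod_C2c; exact: (exhaust_C2c (hcox := hcox) k).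
have bk k := kill_bmeasw (pos := pos) hB x t0 (C2c_bmeas (hk k)).
have bku k : bmeas (fun w => \1_(live t x) w * (h (x + B t w) * exhaust (pos := pos) k (x + B t w)) / h x).
  by apply: (@bmeasM _ _ _ _ (fun=> (h x)^-1)) => //; exact: bmeas_cst.
have mu k : measurable_fun setT (u k) by apply/measurable_EFinP; exact: (bku k).1.
have u0 k w : setT w -> (0 <= u k w)%E.
  move=> _; rewrite lee_fin; have [hw|hw] := pselect (live t x w); last by rewrite (indic0 hw) !mul0r.
  have [_ Cy] := stay_chamber (hcox := hcox) hB t0 hw.
  have /andP[e0 _] := exhaust_bounds (pos := pos) k (x + B t w).
  by rewrite (indic1 hw) mul1r divr_ge0 ?(ltW hx) // mulr_ge0 // ltW // chamber_root_prod.
have ul w : u ^~ w @ \oo --> (weight t x w)%:E.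
  apply: cvg_EFin; first exact: nearW.
  change ((\1_(live t x) w * (h (x + B t w) * exhaust (pos := pos) k (x + B t w)) / h x) @[k --> \oo] -->
    weight t x w).
  have [hw|hw] := pselect (live t x w); last first.
    rewrite /weight (indic0 hw) mul0r; under eq_fun do rewrite !mul0r.
    exact: cvg_cst.
  have [_ Cy] := stay_chamber (hcox := hcox) hB t0 hw.
  rewrite /weight (indic1 hw) mul1r; under eq_fun do rewrite !mul1r.
  apply: cvgMl; rewrite -[X in _ --> X]mulr1; apply: cvgMr.
  exact: (exhaust_cvg (hcox := hcox) Cy).
apply: (@le_trans _ _ (\int[P]_w limn_einf (u ^~ w))%E).
  rewrite (eq_integral (fun w => limn_einf (u ^~ w))) // => w _.
  by have [-> _] := cvg_limn_einf_sup (ul w).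
apply: (le_trans (fatou P measurableT mu u0)).
have ule k : (\int[P]_w u k w <= 1)%E.
  rewrite -(EFin_exp (bmeas_integrable PT (bku k))) lee_fin.
  have -> : E (fun w => \1_(live t x) w * (h (x + B t w) * exhaust (pos := pos) k (x + B t w)) / h x) =
     kl t (fun y => h y * exhaust (pos := pos) k y) x / h x.
    rewrite [RHS]mulrC /kill -expZ; last exact: (bmeas_integrable PT (bk k)).
    by apply: eq_Rintegral => w _; rewrite [RHS]mulrC.
  rewrite ler_pdivrMr // mul1r; apply: (kill_le_h (hk k)) => // y Cy.
  have /andP[_ e1] := exhaust_bounds (pos := pos) k y.
  by rewrite ler_piMr // ltW // chamber_root_prod.
rewrite limn_einf_lim; apply: lime_le; first exact: is_cvg_einfs.
apply: nearW => k; apply: le_trans (ule k); apply: ereal_inf_lbound; exists k => //=.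
Qed.

Lemma weight_integral t x : 0 < t -> C x -> (\int[P]_w (weight t x w)%:E = 1)%E.
Proof.
move=> t0 Cx; have hx := chamber_root_prod Cx.
apply/eqP; rewrite eq_le weight_le1 //=; apply/lee_addgt0Pr => e e0.
have [f [hf f0 fh fe]] := kill_ge_h t0 Cx (mulr_gt0 e0 hx).
have b1 := kill_bmeasw (pos := pos) hB x t0 (C2c_bmeas hf).
have le1 : ((kl t f x / h x)%:E <= \int[P]_w (weight t x w)%:E)%E.
  have bk : bmeas (fun w => (h x)^-1 * (\1_(live t x) w * f (x + B t w))) by exact: bmeasZ.
  have -> : kl t f x / h x = E (fun w => (h x)^-1 * (\1_(live t x) w * f (x + B t w))).
    by rewrite expZ; [exact: mulrC|exact: (bmeas_integrable PT b1)].
  rewrite (EFin_exp (bmeas_integrable PT bk)).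
  apply: ge0_le_integral => //.
  - move=> w _; rewrite lee_fin; have [hw|hw] := pselect (live t x w); last by rewrite (indic0 hw) mul0r mulr0.
    have [_ Cy] := stay_chamber (hcox := hcox) hB t0 hw.
    by rewrite (indic1 hw) mul1r mulr_ge0 ?f0 // invr_ge0 ltW.
  - by apply/measurable_EFinP; exact: bk.1.
  - by apply/measurable_EFinP; exact: weight_measurable.
  - move=> w _; rewrite lee_fin /weight.
    have [hw|hw] := pselect (live t x w); last by rewrite (indic0 hw) !mul0r mulr0.
    have [_ Cy] := stay_chamber (hcox := hcox) hB t0 hw.
    by rewrite (indic1 hw) !mul1r mulrC ler_wpM2r ?fh // invr_ge0 ltW.
apply: (@le_trans _ _ ((kl t f x / h x)%:E + e%:E)%E); last exact: leeD2r.
rewrite -EFinD lee_fin -(ler_pM2r hx) mul1r mulrDl divfK ?gt_eqF //; lra.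
Qed.

End ConditionedSemigroup.

(** * Probability kernels and the operators they define *)

Section ProbabilityKernels.
Context {d d' : measure_display} {X : measurableType d} {Y : measurableType d'} {R : realType}.

Section Build.
Variable k : X -> {measure set Y -> \bar R}.
Hypothesis mk : forall U, measurable U -> measurable_fun setT (k ^~ U).
Hypothesis k1 : forall x, k x setT = 1%E.

Let kk := k.
HB.instance Definition _ := isKernel.Build _ _ X Y R kk mk.
HB.instance Definition _ := Kernel_isProbability.Build _ _ X Y R kk k1.

Lemma exists_pkernel : exists Q : R.-pker X ~> Y, forall x, Q x = k x.
Proof. by exists kk. Qed.

End Build.

Lemma pkernel_exp_measurable (Q : R.-pker X ~> Y) (f : Y -> R) : bmeas f ->
  bmeas (fun x => \int[Q x]_y f y).
Proof.
move=> [mf [M fM]]; have T1 x : (Q x setT <= 1)%E by rewrite prob_kernel.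
split; last by exists M => x; apply: (exp_bound (T1 x)) => //; split=> //; exists M.
pose g y := f y + `|M|.
have g0 y : 0 <= g y by have := fM y; rewrite ler_norml /g => /andP[h _]; have := ler_norm M; lra.
have bg : bmeas g by apply: bmeasD; [split=> //; exists M|exact: bmeas_cst].
have -> : (fun x => \int[Q x]_y f y) = fun x => fine (\int[Q x]_y (g y)%:E)%E - `|M|.
  apply/funext => x; rewrite -(EFin_exp (bmeas_integrable (T1 x) bg)) /= /g.
  rewrite expD; last 2 first.
  - by apply: bmeas_integrable => //; split=> //; exists M.
  - by apply: bmeas_integrable => //; exact: bmeas_cst.
  by rewrite [\int[Q x]_y `|M|]Rintegral_cst // prob_kernel mulr1 addrK.
apply: measurable_funB => //; apply: measurableT_comp => //.
apply: measurable_fun_integral_kernel; first by move=> U mU; exact: measurable_kernel.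
- by move=> y; rewrite lee_fin.
- by apply/measurable_EFinP; exact: bg.1.
Qed.

End ProbabilityKernels.

Section KernelComposition.
Context {d : measure_display} {X : measurableType d} {R : realType}.
Implicit Types (Q : R.-pker X ~> X) (f : X -> R).

Lemma kernel_bind Q1 Q2 x : exists m : {measure set X -> \bar R},
  (forall A, m A = \int[Q1 x]_y Q2 y A)%E /\
  forall f : X -> \bar R, (forall y, 0 <= f y)%E -> measurable_fun setT f ->
    (\int[m]_z f z = \int[Q1 x]_y \int[Q2 y]_z f z)%E.
Proof.
exists (mkcomp Q1 (kernel.kernel_snd Q2) x); split=> // f f0 mf.
exact: (integral_kcomp Q1 (kernel.kernel_snd Q2)).
Qed.

Lemma exp_bind Q1 Q2 x (m : {measure set X -> \bar R}) f :
  (forall g : X -> \bar R, (forall y, 0 <= g y)%E -> measurable_fun setT g ->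
    (\int[m]_z g z = \int[Q1 x]_y \int[Q2 y]_z g z)%E) ->
  m setT = 1%E -> bmeas f ->
  \int[m]_z f z = \int[Q1 x]_y \int[Q2 y]_z f z.
Proof.
move=> H m1 [mf [M fM]].
have T1 (Q : R.-pker X ~> X) y : (Q y setT <= 1)%E by rewrite prob_kernel.
have mT1 : (m setT <= 1)%E by rewrite m1.
(* The composition identity is available for nonnegative integrands; all measures here have mass
   one, so a shift by |M| extends it to bounded f. *)
pose g y := f y + `|M|.
have bf : bmeas f by split=> //; exists M.
have bM : bmeas (fun _ : X => `|M|) by exact: bmeas_cst.
have g0 y : 0 <= g y by have := fM y; rewrite ler_norml /g => /andP[h _]; have := ler_norm M; lra.
have bg : bmeas g by exact: bmeasD.
have gE (p : {measure set X -> \bar R}) : p setT = 1%E -> \int[p]_z g z = \int[p]_z f z + `|M|.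
  move=> p1; have pT : (p setT <= 1)%E by rewrite p1.
  rewrite expD; [|exact: (bmeas_integrable pT bf)|exact: (bmeas_integrable pT bM)].
  by rewrite Rintegral_cst // p1 mulr1.
have : \int[m]_z g z = \int[Q1 x]_y \int[Q2 y]_z g z.
  apply: EFin_inj; have b2 := pkernel_exp_measurable Q2 bg.
  rewrite (EFin_exp (bmeas_integrable mT1 bg)) (EFin_exp (bmeas_integrable (T1 Q1 x) b2)) H.
  - by apply: eq_integral => y _; rewrite -(EFin_exp (bmeas_integrable (T1 Q2 y) bg)).
  - by move=> y; rewrite lee_fin.
  - by apply/measurable_EFinP; exact: bg.1.
rewrite gE //; have -> : \int[Q1 x]_y \int[Q2 y]_z g z = \int[Q1 x]_y (\int[Q2 y]_z f z + `|M|).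
  by apply: eq_Rintegral => y _; rewrite gE // prob_kernel.
have b2 := pkernel_exp_measurable Q2 bf.
rewrite expD; [|exact: (bmeas_integrable (T1 Q1 x) b2)|exact: (bmeas_integrable (T1 Q1 x) bM)].
rewrite [\int[Q1 x]_y `|M|]Rintegral_cst // prob_kernel mulr1; exact: addIr.
Qed.

End KernelComposition.

Section MarkovOperators.
Context {R : realType} {n : nat}.
Variable C : set 'rV[R]_n.
Local Notation bT := (borel_rV R n).
Hypothesis mC : measurable (C : set bT).
Implicit Types (Q : R -> R.-pker bT ~> bT).

Lemma exp_supported (m : {measure set bT -> \bar R}) (f g : bT -> R) : (m setT <= 1)%E ->
  m (~` (C : set bT)) = 0%E -> bmeas f -> bmeas g -> (forall y, C y -> f y = g y) ->
  \int[m]_y f y = \int[m]_y g y.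
Proof.
move=> mT m0 bf bg fg.
have b1 := bmeas_integrable mT bf; have b2 := bmeas_integrable mT bg.
congr fine; apply: ae_eq_integral => //; first by case/integrableP: b1.
  by case/integrableP: b2.
exists (~` (C : set bT)); split=> //; first exact: measurableC.
by move=> y /= h Cy; apply: h => _ /=; rewrite fg.
Qed.

Lemma pkernel_outside (K : R.-pker bT ~> bT) x : K x C = 1%E -> K x (~` (C : set bT)) = 0%E.
Proof.
move=> h; have := prob_kernel (s := K) x; rewrite -(setvU (C : set bT)) measureU //; last 2 first.
- exact: measurableC.
- exact: setICl.
rewrite [X in (_ + X)%E]h => h1.
suff key (a : \bar R) : (a + 1 = 1)%E -> a = 0%E by exact: key h1.
by case: a => [r| |] //= -[r1]; congr EFin; lra.
Qed.

Lemma uniform_right0P (F : R -> 'rV[R]_n -> R) (L : 'rV[R]_n -> R) :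
  {uniform C, F @ 0^'+ --> L} <-> forall e, 0 < e -> exists2 a, 0 < a &
    forall r, 0 < r -> r < a -> forall x, C x -> `|F r x - L x| <= e.
Proof.
split=> [h e e0|h P].
  have : (F @ 0^'+) [set g | forall y, C y -> `|L y - g y| < e].
    apply: h; apply/uniform_nbhs; exists [set p | ball p.1 e p.2]; split=> //.
    exact: entourage_ball (PosNum e0).
  case/nbhs_ballP => a /= a0 ha; exists a => // r r0 ra x Cx.
  rewrite distrC; apply: ltW; apply: ha => //.
  by rewrite /ball /= sub0r normrN gtr0_norm.
case/uniform_nbhs => E []; rewrite -entourage_ballE => -[e /= e0 eE] EP.
have e20 : 0 < e / 2 by rewrite divr_gt0.
have [a a0 ha] := h _ e20; apply/nbhs_ballP; exists a => //= r.
rewrite /ball /= sub0r normrN => ra r0; apply: EP => y Cy; apply: eE.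
rewrite gtr0_norm // in ra.
rewrite /= /ball /= distrC; apply: le_lt_trans (ha r r0 ra y Cy) _.
by rewrite ltr_pdivrMr // ltr_pMr // ltr1n.
Qed.

Section Operators.
Variable Q : R -> R.-pker bT ~> bT.
Hypothesis hQ : markov_semigroup C Q.
Definition mop t f x : R := \int[Q t x]_y f y.

Let T1 t x : (Q t x setT <= 1)%E. Proof. by rewrite prob_kernel. Qed.

Lemma mop_comp s r f x : 0 < s -> 0 < r -> bmeas (f : bT -> R) -> C x ->
  mop (s + r) f x = mop s (mop r f) x.
Proof.
move=> s0 r0 bf Cx; have [m [mE mI]] := kernel_bind (Q s) (Q r) x.
have m1 : m setT = 1%E.
  by rewrite mE; under eq_integral do rewrite prob_kernel; rewrite integral_cst // mul1e prob_kernel.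
rewrite /mop -(exp_bind mI m1 bf); congr fine; apply: eq_measure_integral => A mA _.
rewrite mE (hQ.2 s r x A s0 r0 Cx mA).
rewrite [RHS](@ge0_negligible_integral _ _ _ _ _ (~` (C : set bT))) //.
- by rewrite setTD setCK.
- exact: measurableC.
- exact: measurable_kernel.
- by apply: pkernel_outside; apply: hQ.1.
Qed.

Lemma mop_le t x f g M : 0 < t -> C x -> bmeas (f : bT -> R) -> bmeas (g : bT -> R) ->
  0 <= M -> (forall y, C y -> g y <= f y + M) -> mop t g x <= mop t f x + M.
Proof.
move=> t0 Cx bf bg M0 fg; have Q0 := pkernel_outside (hQ.1 t x t0 Cx).
have bI : bmeas (\1_(C : set bT) : bT -> R) by exact: bmeas_indic.
have bM : bmeas (fun _ : bT => M) by exact: bmeas_cst.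
have b1 := bmeasM bI bg; have b2 := bmeasM bI (bmeasD bf bM).
have e1 : mop t g x = \int[Q t x]_y (\1_(C : set bT) y * g y).
  by apply: (exp_supported (T1 t x)) => // y Cy; rewrite (indic1 Cy) mul1r.
have e2 : mop t f x + M = \int[Q t x]_y (\1_(C : set bT) y * (f y + M)).
  have -> : mop t f x + M = \int[Q t x]_y (f y + M).
    rewrite expD; [|exact: (bmeas_integrable (T1 t x) bf)|exact: (bmeas_integrable (T1 t x) bM)].
    by rewrite [\int[Q t x]_y M]Rintegral_cst // prob_kernel mulr1.
  apply: (exp_supported (T1 t x)) => //; first exact: bmeasD.
  by move=> y Cy; rewrite (indic1 Cy) mul1r.
rewrite e1 e2; apply: exp_le; [exact: (bmeas_integrable (T1 t x) b1)|exact: (bmeas_integrable (T1 t x) b2)|].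
move=> y; have [Cy|nCy] := pselect ((C : set bT) y); last by rewrite (indic0 nCy) !mul0r.
by rewrite (indic1 Cy) !mul1r fg.
Qed.

Lemma mop_semigroup L : has_generator C Q L ->
  (forall f, C2c C f -> exists M, forall x, C x -> `|L f x| <= M) -> semigroup C mop L.
Proof.
move=> hL hM; split=> //.
- exact: mop_le.
- by move=> s r f x s0 r0 hf Cx; apply: mop_comp => //; exact: C2c_bmeas hf.
- by move=> r f r0 hf; apply: pkernel_exp_measurable; exact: C2c_bmeas hf.
- move=> f hf e e0; have /uniform_right0P/(_ e e0)[a a0 ha] := hL f hf.
  exists a => // r r0 ra x Cx; have := ha r r0 ra x Cx.
  have -> : mop r f x - f x - r * L f x = ((mop r f x - f x) / r - L f x) * r.
    by field; rewrite gt_eqF.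
  by rewrite normrM (gtr0_norm r0) ler_pM2r.
Qed.

End Operators.
End MarkovOperators.

(** * The transition kernels of the h-transform *)

Section ConditionedKernel.
Context {R : realType} {n : nat} {W : set 'M[R]_n} {C : set 'rV[R]_n}.
Context {pos : {fset 'rV[R]_n}} {hcox : reflection_chamber W C pos}.
Context {d : measure_display} {T : measurableType d}.
Variables (P : probability T R) (B : R -> T -> 'rV[R]_n).
Hypothesis hB : brownian_motion P B.
Local Notation bT := (borel_rV R n).
Local Notation E f := (\int[P]_w f w).
Local Notation kl := (kill (pos := pos) P B).
Local Notation live t x := [set w | stay (pos := pos) B t x w].
Local Notation h := (root_prod pos).
Local Notation wt := (weight (pos := pos) B).
Implicit Types (t s r : R) (x y : 'rV[R]_n) (f g : 'rV[R]_n -> R) (K : R.-pker bT ~> bT).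

Let PT : (P setT <= 1)%E. Proof. exact: probability_le1. Qed.
Let mC : measurable (C : set bT). Proof. exact: (chamber_measurable (hcox := hcox)). Qed.
Let h_gt0 x : C x -> 0 < h x. Proof. exact: (chamber_root_prod (hcox := hcox)). Qed.

Definition conditioned t K : Prop := forall x, C x -> forall f : bT -> \bar R,
  (forall y, 0 <= f y)%E -> measurable_fun setT f ->
  (\int[K x]_y f y = \int[P]_w (f (x + B t w)%R * (wt t x w)%:E))%E.

Lemma weight_law t x : 0 < t -> C x -> exists m : {measure set bT -> \bar R},
  forall f : bT -> \bar R, (forall y, 0 <= f y)%E -> measurable_fun setT f ->
  (\int[m]_y f y = \int[P]_w (f (x + B t w)%R * (wt t x w)%:E))%E.
Proof.
move=> t0 Cx; have w0 := weight_ge0 (hcox := hcox) hB x ^~ t0.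
have wm := weight_measurable (pos := pos) hB x t0.
have sm := shift_measurable hB x (ltW t0).
have [k kE] := exists_density P w0 wm.
have [m mE] := exists_pushforward k sm.
exists m => f f0 mf.
rewrite (_ : (\int[m]_y f y = \int[pushforward k (fun w => (x + B t w)%R : bT)]_y f y)%E); last first.
  by apply: eq_measure_integral => A mA _; rewrite mE.
rewrite ge0_integral_pushforward // preimage_setT.
have kE' A : measurable A -> k A = (\int[P]_(w in A) (wt t x w)%:E)%E by move=> _; rewrite kE.
exact: (integral_density w0 wm kE' (g := fun w => f (x + B t w)%R) (fun w => f0 _)
  (measurableT_comp mf sm)).
Qed.

Lemma weight_joint t (U : set bT) : 0 < t -> measurable U ->
  measurable_fun setT (fun z : bT * T => (\1_U ((z.1 : 'rV[R]_n) + B t z.2)%R * wt t z.1 z.2)%:E).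
Proof.
move=> t0 mU; apply/measurable_EFinP; apply: measurable_funM.
  apply: (measurableT_comp (f := \1_U : bT -> R)) => //; exact: (joint_measurable hB (ltW t0)).
have mh : measurable_fun setT (h : bT -> R).
  exact: continuous_measurable_rV (root_prod_continuous (pos := pos)).
(* On the event of survival h is positive, so 1 / h may be written as the power -1 of h, a
   measurable function; off this event the indicator vanishes. *)
have -> : (fun z : bT * T => wt t z.1 z.2) = fun z =>
    \1_[set z : bT * T | stay (pos := pos) B t z.1 z.2] z *
    (h ((z.1 : 'rV[R]_n) + B t z.2) * (h z.1) `^ (-1)).
  apply/funext => z; rewrite /weight; have [hz|hz] := pselect (live t z.1 z.2); last first.
    by rewrite (indic0 hz) indic0 // !mul0r.
  rewrite (indic1 hz) indic1 // powR_inv1 //.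
  by have [Cz _] := stay_chamber (hcox := hcox) hB t0 hz; exact/ltW/h_gt0.
apply: measurable_funM; first by apply: measurable_indic; exact: (stay_joint hB t0).
apply: measurable_funM.
  apply: (measurableT_comp (f := h : bT -> R)) => //; exact: (joint_measurable hB (ltW t0)).
apply: (measurableT_comp (f := fun r : R => r `^ (-1))); first exact: measurable_powR.
exact: (measurableT_comp (f := h : bT -> R)).
Qed.

Lemma exists_conditioned t : 0 < t -> exists K, conditioned t K.
Proof.
move=> t0.
(* Outside C the kernel is completed by Dirac masses, so that it is a probability kernel on the
   whole space. *)
have law x : exists m : {measure set bT -> \bar R},
    (C x -> forall f : bT -> \bar R, (forall y, 0 <= f y)%E -> measurable_fun setT f ->
      (\int[m]_y f y = \int[P]_w (f (x + B t w)%R * (wt t x w)%:E))%E) /\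
    (~ C x -> m = \d_(x : bT)).
  have [Cx|nCx] := pselect (C x); last by exists \d_(x : bT).
  by have [m hm] := weight_law t0 Cx; exists m.
pose k (x : bT) := projT1 (cid (law x)).
have kC x Cx := (projT2 (cid (law x))).1 Cx.
have kN x nCx : k x = \d_(x : bT) := (projT2 (cid (law x))).2 nCx.
have kA x (A : set bT) : C x -> measurable A ->
    k x A = (\int[P]_w (\1_A (x + B t w)%R * wt t x w)%:E)%E.
  move=> Cx mA; rewrite -[A in LHS]setIT -integral_indic //.
  rewrite (kC x Cx (fun y => (\1_A y)%:E)); first by apply: eq_integral => w _; rewrite EFinM.
    by move=> y; rewrite lee_fin.
  by apply/measurable_EFinP; exact: measurable_indic.
have mk U : measurable U -> measurable_fun setT (k ^~ U).
  move=> mU.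
  have -> : k ^~ U = fun x => (fubini_F P (fun z : bT * T =>
      (\1_U ((z.1 : 'rV[R]_n) + B t z.2)%R * wt t z.1 z.2)%:E) x + (\1_(U `&` ~` (C : set bT)) x)%:E)%E.
    apply/funext => x; have [Cx|nCx] := pselect (C x).
      by rewrite kA // (indic0 (D := U `&` ~` (C : set bT))) ?adde0 // => -[].
    rewrite kN //= diracE /fubini_F /= integral0_eq ?add0e; last first.
      move=> w _; rewrite /weight indic0 ?mul0r ?mulr0 // => hw.
      by have [] := stay_chamber (hcox := hcox) hB t0 hw.
    rewrite indicE in_setI; congr (nat_of_bool _)%:R%:E.
    by rewrite [X in _ && X]mem_set // andbT.
  apply: emeasurable_funD.
    apply: measurable_fun_fubini_tonelli_F; first exact: weight_joint.
    by move=> z; rewrite lee_fin mulr_ge0 // (weight_ge0 (hcox := hcox) hB).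
  by apply/measurable_EFinP; apply: measurable_indic; apply: measurableI => //; exact: measurableC.
have k1 x : k x setT = 1%E.
  have [Cx|nCx] := pselect (C x); last by rewrite kN //= diracE in_setT.
  rewrite kA // -(weight_integral (hcox := hcox) hB t0 Cx).
  by apply: eq_integral => w _; rewrite indicE in_setT mul1r.
have [K KE] := exists_pkernel mk k1.
by exists K => x Cx f f0 mf; rewrite KE kC.
Qed.

Section Conditioned.
Variables (t : R) (K : R.-pker bT ~> bT).
Hypotheses (t0 : 0 < t) (hK : conditioned t K).

Lemma conditioned_setE x (A : set bT) : C x -> measurable A ->
  K x A = (\int[P]_w (\1_A (x + B t w)%R * wt t x w)%:E)%E.
Proof.
move=> Cx mA; rewrite -[A in LHS]setIT -integral_indic //.
rewrite (hK Cx (f := fun y => (\1_A y)%:E)); first by apply: eq_integral => w _; rewrite EFinM.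
  by move=> y; rewrite lee_fin.
by apply/measurable_EFinP; exact: measurable_indic.
Qed.

Lemma conditioned_chamber x : C x -> K x C = 1%E.
Proof.
move=> Cx; rewrite conditioned_setE // -(weight_integral (hcox := hcox) hB t0 Cx).
apply: eq_integral => w _; have [hw|hw] := pselect (live t x w).
  have [_ Cy] := stay_chamber (hcox := hcox) hB t0 hw.
  by rewrite (indic1 (D := (C : set bT)) Cy) mul1r.
by rewrite /weight (indic0 hw) !mul0r mulr0.
Qed.

Lemma conditioned_exp_ge0 x f : C x -> bmeas (f : bT -> R) -> bmeas (fun y : bT => h y * f y) ->
  (forall y, 0 <= f y) -> \int[K x]_y f y = kl t (fun y => h y * f y) x / h x.
Proof.
move=> Cx bf bhf f0; have hx := h_gt0 Cx.
have K1 : (K x setT <= 1)%E by rewrite prob_kernel.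
have b1 : bmeas (fun w => (h x)^-1 * (\1_(live t x) w * (h (x + B t w) * f (x + B t w)))).
  apply: bmeasZ; exact: (kill_bmeasw (pos := pos) hB x t0 bhf).
have b2 := kill_bmeasw (pos := pos) hB x t0 bhf.
have -> : kl t (fun y => h y * f y) x / h x =
    E (fun w => (h x)^-1 * (\1_(live t x) w * (h (x + B t w) * f (x + B t w)))).
  by rewrite expZ; [exact: mulrC|exact: (bmeas_integrable PT b2)].
apply: EFin_inj; rewrite (EFin_exp (bmeas_integrable K1 bf)) (EFin_exp (bmeas_integrable PT b1)).
rewrite (hK Cx (f := fun y => (f y)%:E)); first last.
- by apply/measurable_EFinP; exact: bf.1.
- by move=> y; rewrite lee_fin.
by apply: eq_integral => w _; rewrite -EFinM /weight; congr EFin; ring.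
Qed.

Lemma conditioned_exp x f : C x -> bmeas (f : bT -> R) -> bmeas (fun y : bT => h y * f y) ->
  \int[K x]_y f y = kl t (fun y => h y * f y) x / h x.
Proof.
move=> Cx bf bhf.
have K1 : (K x setT <= 1)%E by rewrite prob_kernel.
have bn (g : bT -> R) : bmeas g -> bmeas (fun y : bT => `|g y|).
  move=> [mg [M gM]]; split; last by exists M => y; rewrite normr_id.
  have := measurableT_comp (@measurable_realfun.normr_measurable R setT) mg; exact.
(* The split f = (|f| + f) - |f| reduces to nonnegative integrands. Both parts are cut off outside
   C, since on C the sign of h makes h |f| = |h f|, a bounded function. *)
pose fn y := `|f y|; pose fp y := fn y + f y.
have bfn : bmeas (fn : bT -> R) by exact: bn.
have bfp : bmeas (fp : bT -> R) by exact: bmeasD.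
have nC (g : bT -> R) : bmeas (fun y : bT => h y * g y) ->
    bmeas (fun y : bT => \1_(C : set bT) y * (h y * g y)).
  by move=> bg; apply: bmeasM => //; exact: bmeas_indic.
have c0 (g : 'rV[R]_n -> R) y : C y -> \1_(C : set bT) y * g y = g y.
  by move=> Cy; rewrite (indic1 (D := (C : set bT)) Cy) mul1r.
pose gn y := \1_(C : set bT) y * fn y; pose gp y := \1_(C : set bT) y * fp y.
have bI : bmeas (\1_(C : set bT) : bT -> R) by exact: bmeas_indic.
have bgn : bmeas (gn : bT -> R) by exact: bmeasM.
have bgp : bmeas (gp : bT -> R) by exact: bmeasM.
have hgnE y : h y * gn y = \1_(C : set bT) y * `|h y * f y|.
  rewrite /gn; have [Cy|Cy] := pselect ((C : set bT) y); last by rewrite (indic0 Cy) !mul0r mulr0.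
  by rewrite (indic1 Cy) !mul1r normrM (gtr0_norm (h_gt0 Cy)).
have bhgn : bmeas (fun y : bT => h y * gn y).
  under eq_fun do rewrite hgnE; by apply: bmeasM => //; exact: bn.
have bhgp : bmeas (fun y : bT => h y * gp y).
  have -> : (fun y : bT => h y * gp y) = fun y => h y * gn y + \1_(C : set bT) y * (h y * f y).
    by apply/funext => y; rewrite /gp /gn /fp; ring.
  by apply: bmeasD => //; exact: bmeasM.
have i0 y : 0 <= \1_(C : set bT) y :> R by rewrite indicE ler0n.
have gn0 y : 0 <= gn y by apply: mulr_ge0; [exact: i0|exact: normr_ge0].
have gp0 y : 0 <= gp y.
  by apply: mulr_ge0; [exact: i0|rewrite /fp /fn; have := ler_norm (- f y); rewrite normrN; lra].
have -> : \int[K x]_y f y = \int[K x]_y (gp y - gn y).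
  apply: (exp_supported mC K1) => //; last by move=> y Cy; rewrite /gp /gn !c0 // /fp addrC addKr.
  - by apply: pkernel_outside => //; exact: conditioned_chamber.
  - exact: bmeasB.
rewrite expB; [|exact: (bmeas_integrable K1 bgp)|exact: (bmeas_integrable K1 bgn)].
rewrite !conditioned_exp_ge0 // -mulrBl; congr (_ / _).
have b1 := kill_bmeasw (pos := pos) hB x t0 bhgp; have b2 := kill_bmeasw (pos := pos) hB x t0 bhgn.
rewrite /kill -expB; [|exact: (bmeas_integrable PT b1)|exact: (bmeas_integrable PT b2)].
apply: eq_Rintegral => w _; have [hw|hw] := pselect (live t x w); last by rewrite (indic0 hw) !mul0r subrr.
have [_ Cy] := stay_chamber (hcox := hcox) hB t0 hw.
by rewrite /gp /gn !c0 // /fp; ring.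
Qed.

Lemma conditioned_C2c x f : C x -> C2c C f -> \int[K x]_y f y = kl t (fun y => h y * f y) x / h x.
Proof.
move=> Cx hf; apply: conditioned_exp => //; first exact: C2c_bmeas hf.
apply: C2c_bmeas; exact: (root_prod_C2c hf).
Qed.

Lemma conditioned_unique K' x (A : set bT) : C x -> K' x C = 1%E ->
  (forall f, C2c C f -> (forall y, 0 <= f y) -> \int[K' x]_y f y = kl t (fun y => h y * f y) x / h x) ->
  measurable A -> K' x A = K x A.
Proof.
move=> Cx K'C hf mA; apply: (measure_unique (hcox := hcox)) => //.
- by rewrite prob_kernel.
- by rewrite prob_kernel.
- exact: pkernel_outside.
- by apply: pkernel_outside => //; exact: conditioned_chamber.
- by move=> f Cf f0; rewrite hf // conditioned_C2c.
Qed.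

End Conditioned.

(** The Chapman-Kolmogorov equation is an identity of measures carried by C, so it suffices to test
    it on C^2 functions with compact support, where it becomes the composition law of the killed
    semigroup. *)
Lemma exists_conditioned_semigroup : exists Q : R -> R.-pker bT ~> bT,
  markov_semigroup C Q /\ forall t, 0 < t -> conditioned t (Q t).
Proof.
have ex t : exists K, 0 < t -> conditioned t K.
  have [t0|t0] := ltP 0 t; last by have [K _] := exists_conditioned ltr01; exists K.
  by have [K hK] := exists_conditioned t0; exists K.
pose Q t := projT1 (cid (ex t)).
have hQ t : 0 < t -> conditioned t (Q t) := projT2 (cid (ex t)).
exists Q; split=> //; split; first by move=> t x t0 Cx; exact: (conditioned_chamber t0 (hQ t t0)).
move=> s t x A s0 t0 Cx mA; have st0 := addr_gt0 s0 t0.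
have [m [mE mI]] := kernel_bind (Q s) (Q t) x.
have m1 : m setT = 1%E.
  by rewrite mE; under eq_integral do rewrite prob_kernel; rewrite integral_cst // mul1e prob_kernel.
have cC r y : 0 < r -> C y -> Q r y C = 1%E.
  by move=> r0 Cy; exact: (conditioned_chamber r0 (hQ r r0)).
have out (U : set bT) : measurable U -> (\int[Q s x]_y Q t y U = \int[Q s x]_(y in C) Q t y U)%E.
  move=> mU; rewrite (@ge0_negligible_integral _ _ _ _ _ (~` (C : set bT))) //.
  - by rewrite setTD setCK.
  - exact: measurableC.
  - exact: measurable_kernel.
  - by apply: pkernel_outside => //; exact: cC.
rewrite -(out A mA) -mE; apply: (measure_unique (hcox := hcox)) => //.
- by rewrite prob_kernel.
- by rewrite m1.
- by apply: pkernel_outside => //; exact: cC.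
- rewrite mE out; last exact: measurableC.
  apply: integral0_eq => y Cy; apply: pkernel_outside => //; exact: cC.
move=> f hf _; have bf := C2c_bmeas hf.
rewrite (exp_bind mI m1 bf) (conditioned_C2c st0 (hQ _ st0) Cx hf).
have bI : bmeas (\1_(C : set bT) : bT -> R) by exact: bmeas_indic.
have b2 := pkernel_exp_measurable (Q t) bf.
have b3 := bmeasM bI b2.
have hg := root_prod_C2c (pos := pos) hf.
have bk := sg_bmeas (kill_semigroup (hcox := hcox) hB) t0 hg.
(* The factor h of the outer transform cancels the denominator of the inner one, and off C both
   sides are zero. *)
have e1 : (fun y : bT => h y * (\1_(C : set bT) y * \int[Q t y]_z f z)) = kl t (fun y => h y * f y).
  apply/funext => y; have [Cy|Cy] := pselect ((C : set bT) y); last first.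
    by rewrite (indic0 Cy) mul0r mulr0 (kill_outside (hcox := hcox) hB).
  rewrite (indic1 Cy) mul1r (conditioned_C2c t0 (hQ _ t0) Cy hf) mulrC divfK // gt_eqF //.
  exact: h_gt0.
have Q1 : (Q s x setT <= 1)%E by rewrite prob_kernel.
have -> : \int[Q s x]_y (\int[Q t y]_z f z) = \int[Q s x]_y (\1_(C : set bT) y * \int[Q t y]_z f z).
  apply: (exp_supported mC Q1) => //; first by apply: pkernel_outside => //; exact: cC.
  by move=> y Cy; rewrite (indic1 (D := (C : set bT)) Cy) mul1r.
rewrite (conditioned_exp s0 (hQ _ s0) Cx b3); last by rewrite e1.
by rewrite e1 (sg_comp (kill_semigroup (hcox := hcox) hB)).
Qed.

End ConditionedKernel.

(** * Generator and uniqueness *)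

Section DriftGenerator.
Context {R : realType} {n : nat} {W : set 'M[R]_n} {C : set 'rV[R]_n}.
Context {pos : {fset 'rV[R]_n}} {hcox : reflection_chamber W C pos}.
Context {d : measure_display} {T : measurableType d}.
Variables (P : probability T R) (B : R -> T -> 'rV[R]_n).
Hypothesis hB : brownian_motion P B.
Local Notation bT := (borel_rV R n).
Local Notation E f := (\int[P]_w f w).
Local Notation kl := (kill (pos := pos) P B).
Local Notation live t x := [set w | stay (pos := pos) B t x w].
Local Notation h := (root_prod pos).
Local Notation cond := (conditioned (C := C) (pos := pos) P B).
Local Notation L := (diffusion_op (repulsive_drift W C)).
Implicit Types (t s r e : R) (x y : 'rV[R]_n) (f g u : 'rV[R]_n -> R) (K : R.-pker bT ~> bT).
Implicit Types (Q : R -> R.-pker bT ~> bT).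

Let PT : (P setT <= 1)%E. Proof. exact: probability_le1. Qed.
Let mC : measurable (C : set bT). Proof. exact: (chamber_measurable (hcox := hcox)). Qed.
Let h_gt0 x : C x -> 0 < h x. Proof. exact: (chamber_root_prod (hcox := hcox)). Qed.

(** In the Laplacian of h f the term with the Laplacian of h vanishes, and the cross term is twice
    the product of the gradients, where grad h = h mu. *)
Lemma drift_generatorE f x : C2c C f -> C x ->
  h x * L f x = 2^-1 * laplacian (fun y => h y * f y) x.
Proof.
move=> hf Cx; have hx := lt0r_neq0 (h_gt0 Cx).
have F2 y := d2M (root_prod_d2 (pos := pos) y) (C2_d2 y hf.1).
rewrite (laplacianE (near_all x F2)) traceM (root_prod_trace (hcox := hcox)) // mulr0 addr0.
rewrite /diffusion_op (repulsive_driftE (hcox := hcox)) // (root_driftE (hcox := hcox)) // dotZl.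
have -> : trace (fun i => gradient (partial i f)) x = laplacian f x.
  by apply: eq_bigr => i _; rewrite mxE.
by field.
Qed.

Lemma laplacian_supp0 (K : set 'rV[R]_n) f : compact K -> (forall x, ~ K x -> f x = 0) ->
  forall x, ~ K x -> laplacian f x = 0.
Proof.
move=> cK f0 x nK; apply: big1 => i _; apply: (partial_supp0 i cK) => //.
exact: (partial_supp0 i cK).
Qed.

Lemma half_laplacian_bounded f : C2c C f -> exists2 M, 0 < M & forall x, C x -> `|2^-1 * laplacian f x| <= M.
Proof.
move=> hf; have [M hM] := sg_bounded (kill_semigroup (hcox := hcox) hB) hf.
exists (`|M| + 1) => [|x Cx]; first by rewrite ltr_wpDl.
by apply: (le_trans (hM x Cx)); have := ler_norm M; lra.
Qed.

(** On the compact set K the function h has a positive minimum, so a bounded function that vanishes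
    off K is O(h). *)
Lemma half_laplacian_le (K : set 'rV[R]_n) f : C2c C f -> compact K -> K `<=` C ->
  (forall x, ~ K x -> f x = 0) -> exists2 c, 0 < c &
  forall x, C x -> (K x -> `|2^-1 * laplacian f x| <= c * h x) /\ (~ K x -> 2^-1 * laplacian f x = 0).
Proof.
move=> hf cK KC f0; have [M M0 hM] := half_laplacian_bounded hf.
have [m m0 hm] : exists2 m, 0 < m & forall y, K y -> m <= h y.
  apply: compact_min_gt0 => //; first exact: root_prod_continuous.
  by move=> y /KC; exact: h_gt0.
exists (M / m) => [|x Cx]; first exact: divr_gt0.
split=> [Kx|nK]; last by rewrite (laplacian_supp0 cK f0 nK) mulr0.
apply: (le_trans (hM x Cx)); rewrite mulrAC ler_pdivlMr // ler_wpM2l ?(ltW M0) //; exact: hm.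
Qed.

Lemma drift_generator_bounded f : C2c C f -> exists M, forall x, C x -> `|L f x| <= M.
Proof.
move=> hf; have hg := root_prod_C2c (pos := pos) hf; case: (hf) => _ [K [cK KC] f0].
have g0 x : ~ K x -> h x * f x = 0 by move=> nK; rewrite f0 // mulr0.
have [c c0 hc] := half_laplacian_le hg cK KC g0.
exists c => x Cx; have hx := h_gt0 Cx; have [h1 h2] := hc x Cx.
rewrite -(ler_pM2r hx) -{1}(gtr0_norm hx) -normrM mulrC drift_generatorE //.
have [Kx|nK] := pselect (K x); first exact: h1.
by rewrite h2 // normr0 mulr_ge0 ?ltW.
Qed.

Lemma conditioned_eq t K K' : cond t K ->
  (forall x, C x -> forall A : set bT, measurable A -> K' x A = K x A) -> cond t K'.
Proof.
move=> hK KK x Cx f f0 mf; rewrite -(hK x Cx f f0 mf).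
by apply: eq_measure_integral => A mA _; exact: KK.
Qed.

Section Backward.
Variable Q : R -> R.-pker bT ~> bT.
Hypotheses (hQ : markov_semigroup C Q) (hL : has_generator C Q L).

(** Comparison with rho = h and no correction. The truncated data at the final time, trunc e (h f) /
    h, is at most f, so Q applied to it is at most Q applied to f. *)
Lemma markov_ge t f x : 0 < t -> C x -> C2c C f -> (forall y, 0 <= f y) ->
  kl t (fun y => h y * f y) x / h x <= mop Q t f x.
Proof.
move=> t0 Cx hf f0; have hx := h_gt0 Cx; have hg := root_prod_C2c (pos := pos) hf.
have sg := mop_semigroup mC hQ hL drift_generator_bounded.
have k0 y : C y -> (0 : R) <= 0 by [].
have trk y : C y -> trace (fun (_ : 'I_n) (_ : 'rV[R]_n) => (0 : 'rV[R]_n)) y = 0.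
  by move=> _; rewrite /trace big1 // => i _; rewrite mxE.
suff H e : 0 < e -> kl t (fun y => h y * f y) x <= mop Q t f x * h x + 2 * e.
  rewrite ler_pdivrMr //; apply/ler_addgt0Pr => e e0.
  have := H (e / 2); rewrite divr_gt0 // => /(_ isT).
  by have -> : 2 * (e / 2) = e by field.
move=> e0; have := heat_comparison (hcox := hcox) hB sg (root_prod_d2 (pos := pos)) h_gt0
  drift_generatorE (d2_cst 0) k0 trk hg t0 e0 Cx.
rewrite addr0 ler_pdivrMr // -(kill_images (hcox := hcox) hB t0 Cx hg) => main.
have [_ b1 _ _ _] := trunc_bounds (kl t (fun y => h y * f y) x) e0.
set F := extend C _ in main.
suff H : mop Q t F x <= mop Q t f x.
  have := le_trans main (ler_wpM2r (ltW hx) H); lra.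
have FE y : C y -> F y = trunc e (h y * f y) / h y.
  by move=> Cy; rewrite /F extendT // addr0 (antisym_C (hcox := hcox) hg Cy).
have Fb y : 0 <= F y <= f y.
  have [Cy|nCy] := pselect (C y); last by rewrite /F extendF // lexx f0.
  have hy := h_gt0 Cy; rewrite FE //.
  have [b2 _ b3 _ _] := trunc_bounds (h y * f y) e0.
  rewrite divr_ge0 ?(ltW hy) //= ler_pdivrMr // [f y * _]mulrC; apply: (le_trans b3).
  by rewrite /pos1 ge_max lexx mulr_ge0 // ltW.
have [M fM] := (C2c_bmeas hf).2.
rewrite -[leRHS]addr0; apply: (mop_le mC hQ) => //; first exact: C2c_bmeas hf.
- split; last by exists M => y; have /andP[c1 c2] := Fb y; rewrite ger0_norm // (le_trans c2) // (le_trans (ler_norm _)).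
  have -> : F = fun y => \1_(C : set bT) y * (trunc e (h y * f y) * (h y) `^ (-1)).
    apply/funext => y; have [Cy|nCy] := pselect ((C : set bT) y); last first.
      by rewrite /F extendF // (indic0 nCy) mul0r.
    by rewrite FE // (indic1 Cy) mul1r powR_inv1 // ltW // h_gt0.
  apply: measurable_funM; first exact: measurable_indic.
  apply: measurable_funM.
    apply: (measurableT_comp (f := trunc e)); last exact: (C2c_bmeas hg).1.
    apply: continuous_measurable_fun => s; apply: differentiable_continuous; apply/derivable1_diffP.
    by have [] := trunc_derive s e0.
  apply: (measurableT_comp (f := fun r : R => r `^ (-1))); first exact: measurable_powR.
  exact: continuous_measurable_rV (root_prod_continuous (pos := pos)).
- by move=> y _; rewrite addr0; case/andP: (Fb y).
Qed.

Lemma generator_conditioned t : 0 < t -> cond t (Q t).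
Proof.
move=> t0; have [K hK] := exists_conditioned (hcox := hcox) hB t0.
apply: (conditioned_eq hK) => x Cx A mA; have QC := hQ.1 t x t0 Cx.
apply: (conditioned_unique (hcox := hcox) hB t0 hK Cx QC) => // f hf f0.
rewrite -(conditioned_C2c (hcox := hcox) hB t0 hK Cx hf).
have KC := conditioned_chamber (hcox := hcox) hB t0 hK Cx.
have le u : C2c C u -> (forall y, 0 <= u y) -> \int[K x]_y u y <= \int[Q t x]_y u y.
  by move=> hu u0; rewrite (conditioned_C2c (hcox := hcox) hB t0 hK Cx hu); exact: markov_ge.
apply/eqP; rewrite eq_le le // andbT.
have bf := C2c_bmeas hf; have [M M0 fM] := bounded_gt0 bf.2.
pose u y := M + -1 * f y.
have u0 y : 0 <= u y by have := le_trans (ler_norm _) (fM y); rewrite /u; lra.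
have uM y : u y <= 2 * M by have := fM y; rewrite ler_norml => /andP[]; rewrite /u; lra.
have C2u : C2 u.
  by apply: d2_C2 => y; exact: (d2D (d2_cst M y) (d2Z (-1) (C2_d2 y hf.1))).
(* The function M - f lacks compact support. The cutoffs make it a test function, and are removed by
   dominated convergence for both probability measures. *)
pose g k y := u y * exhaust (pos := pos) k y.
have hg k : C2c C (g k) by exact: (C2cM C2u (exhaust_C2c (hcox := hcox) k)).
have g0 k y : 0 <= g k y <= 2 * M.
  have /andP[e1 e2] := exhaust_bounds (pos := pos) k y.
  by rewrite mulr_ge0 //= (le_trans _ (uM y)) // ler_piMr.
have gl y : g k y @[k --> \oo] --> \1_(C : set bT) y * u y.
  have [Cy|nCy] := pselect ((C : set bT) y).
    rewrite (indic1 Cy) mul1r -[X in _ --> X]mulr1; apply: cvgMr.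
    exact: (exhaust_cvg (hcox := hcox) Cy).
  rewrite (indic0 nCy) mul0r; under eq_fun do rewrite (C2c_supp0 (hg _) nCy).
  exact: cvg_cst.
have T1 (K' : R.-pker bT ~> bT) y : (K' y setT <= 1)%E by rewrite prob_kernel.
have lim (K' : R.-pker bT ~> bT) : K' x C = 1%E ->
    \int[K' x]_y g k y @[k --> \oo] --> M - \int[K' x]_y f y.
  move=> K'C; have bM : bmeas (fun _ : bT => M) by exact: bmeas_cst.
  have bu : bmeas (u : bT -> R) by apply: bmeasD => //; exact: bmeasZ.
  have <- : \int[K' x]_y (\1_(C : set bT) y * u y) = M - \int[K' x]_y f y.
    have -> : \int[K' x]_y (\1_(C : set bT) y * u y) = \int[K' x]_y (M - f y).
      apply: (exp_supported mC (T1 K' x)) => //.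
      - exact: pkernel_outside.
      - by apply: bmeasM => //; exact: bmeas_indic.
      - exact: bmeasB.
      - by move=> y Cy; rewrite (indic1 (D := (C : set bT)) Cy) mul1r /u mulN1r.
    rewrite expB; [|exact: (bmeas_integrable (T1 K' x) bM)|exact: (bmeas_integrable (T1 K' x) bf)].
    by rewrite [\int[K' x]_y M]Rintegral_cst // prob_kernel mulr1.
  apply: (exp_cvg (T1 K' x) (M := 2 * M)) => // [k|k y].
    by apply: continuous_measurable_rV; exact: C2c_continuous (hg k).
  by have /andP[c1 c2] := g0 k y; rewrite ger0_norm.
have := ler_cvg_to (lim K KC) (lim (Q t) QC).
rewrite lerD2l lerN2; apply; apply: nearW => k; apply: le => // y; by case/andP: (g0 k y).
Qed.

End Backward.

(** The law of x + B_t on survival has density b with respect to Lebesgue measure; the weight h (y)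
    / h (x) depends on the end point only and is carried along by the image measure. *)
Lemma conditioned_density (b : R -> 'rV[R]_n -> 'rV[R]_n -> R) t K x (A : set bT) :
  killed_density P B C b -> 0 < t -> cond t K -> C x -> measurable A ->
  K x A = (\int[@lebesgue_rV R n]_(y in A `&` C) (doob_transform h b t x y)%:E)%E.
Proof.
move=> hb t0 hK Cx mA; have [mb b0 bE] := hb t x t0 Cx; have hx := h_gt0 Cx.
have [leb [lebE _]] := @lebesgue_rV_measure R n; rewrite lebE in bE *.
have sm := shift_measurable hB x (ltW t0).
have ml := live_measurable (pos := pos) hB x t0.
have i0 w : 0 <= \1_(live t x) w :> R by rewrite indicE ler0n.
have im : measurable_fun setT (\1_(live t x) : T -> R) by exact: measurable_indic.
have [k kE] := exists_density P i0 im.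
have kE' D : measurable D -> k D = (\int[P]_(w in D) (\1_(live t x) w)%:E)%E by move=> _; rewrite kE.
have [m mE] := exists_pushforward k sm.
have mD (D : set bT) : measurable D -> m D = (\int[leb]_(y in D) (b t x y)%:E)%E.
  move=> mD; have mpre : measurable ((fun w => (x + B t w)%R : bT) @^-1` D).
    by rewrite -[X in measurable X]setTI; exact: sm.
  rewrite mE /pushforward kE' // integral_indic // -bE //; congr (P _).
  by apply/seteqP; split => w /= [h1 h2]; split=> //; apply/(stay_exit (hcox := hcox) hB).
(* The absolute value makes the integrand nonnegative everywhere; on C it is h itself. *)
pose g (y : bT) : \bar R := (\1_(A `&` C : set bT) y * (`|h y| / h x))%:E.
have mh : measurable_fun setT (h : bT -> R).
  exact: continuous_measurable_rV (root_prod_continuous (pos := pos)).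
have g0 y : (0 <= g y)%E by rewrite lee_fin mulr_ge0 ?indicE ?ler0n // divr_ge0 // ltW.
have mg : measurable_fun setT g.
  apply/measurable_EFinP; apply: measurable_funM.
    by apply: measurable_indic; exact: measurableI.
  apply: measurable_funM => //.
  by have := measurableT_comp (@measurable_realfun.normr_measurable R setT) mh; exact.
transitivity (\int[m]_y g y)%E.
  rewrite (conditioned_setE hK) //.
  rewrite (_ : (\int[m]_y g y = \int[pushforward k (fun w => (x + B t w)%R : bT)]_y g y)%E); last first.
    by apply: eq_measure_integral => D _ _; rewrite mE.
  rewrite ge0_integral_pushforward // preimage_setT.
  have := integral_density i0 im kE' (g := fun w => g (x + B t w)%R) (fun w => g0 _) (measurableT_comp mg sm).
  move=> e1; apply: (etrans _ (esym e1)); apply: eq_integral => w _.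
  rewrite -EFinM; congr EFin; rewrite /weight.
  have [hw|hw] := pselect (live t x w); last by rewrite (indic0 hw) mul0r !mulr0.
  have [_ Cy] := stay_chamber (hcox := hcox) hB t0 hw.
  rewrite (indic1 hw) mul1r mulr1 (gtr0_norm (h_gt0 Cy)); congr (_ * _).
  by rewrite !indicE in_setI (mem_set (A := (C : set bT)) Cy) andbT.
have e2 := @integral_density _ _ _ leb m (b t x) b0 mb mD g g0 mg.
rewrite e2 [RHS]integral_mkcond; apply: eq_integral => y _.
rewrite patchE -EFinM; case: ifPn => [|/negP nAC].
  move/set_mem => hy; rewrite (indic1 hy) mul1r gtr0_norm //; apply: h_gt0; exact: hy.2.
by rewrite indic0 ?mul0r // => h1; apply: nAC; exact: mem_set.
Qed.

(** Each property determines the kernels on C at positive times, and some kernel has both, so each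
    implies the other. *)
Lemma density_conditioned (b : R -> 'rV[R]_n -> 'rV[R]_n -> R) Q :
  killed_density P B C b ->
  has_transition_density C Q (doob_transform h b) <-> (forall t, 0 < t -> cond t (Q t)).
Proof.
move=> hb; split=> [hQ t t0|hQ t x A t0 Cx mA]; last exact: conditioned_density (hQ t t0) Cx mA.
have [K hK] := exists_conditioned (hcox := hcox) hB t0.
apply: (conditioned_eq hK) => x Cx A mA.
by rewrite hQ // (conditioned_density hb t0 hK Cx mA).
Qed.

Lemma kill_scale c t f x : 0 < t -> bmeas (f : bT -> R) -> kl t (fun y => c * f y) x = c * kl t f x.
Proof.
move=> t0 bf; have b1 := kill_bmeasw (pos := pos) hB x t0 bf.
rewrite -expZ; last exact: (bmeas_integrable PT b1).
by apply: eq_Rintegral => w _; ring.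
Qed.

(** Formally the derivative of kl s f x in s is the killed expectation of half the Laplacian of f,
    which is at most kl s g x <= A. The integrated inequality comes from [dini_le] applied to A s -
    kl s f x. *)
Lemma kill_growth t f g x (A : R) : 0 < t -> C x -> C2c C f -> bmeas (g : bT -> R) ->
  (forall y, C y -> 2^-1 * laplacian f y <= g y) -> g x <= A ->
  (forall s, 0 < s -> s < t -> kl s g x <= A) -> kl t f x <= f x + A * t.
Proof.
move=> t0 Cx hf bg fg gA hA; have sg := kill_semigroup (hcox := hcox) hB.
have bf := C2c_bmeas hf.
pose v s := if s == 0 then f x else kl s f x.
have v0 : v 0 = f x by rewrite /v eqxx.
have vp s : 0 < s -> v s = kl s f x by move=> s0; rewrite /v gt_eqF.
pose F s := A * s - v s.
suff : F 0 <= F t by rewrite /F v0 vp // mulr0; lra.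
apply: dini_le => // [s s0 st e e0|s s0 st e e0].
  have e2 : 0 < e / 2 by rewrite divr_gt0.
  have [a a0 ha] := sg_near sg hf e2.
  have A1 : 0 < `|A| + 1 by rewrite ltr_wpDl.
  exists (Num.min a (e / 2 / (`|A| + 1))) => [|r r0]; first by rewrite lt_min a0 divr_gt0.
  rewrite lt_min ltr_pdivlMr // => /andP[ra re] srt.
  have dv : `|v (s + r) - v s| <= e / 2.
    rewrite vp ?ltr_wpDl //; move: s0; rewrite le_eqVlt => /orP[/eqP s0|s0].
      by rewrite -s0 v0 add0r; exact: ha.
    rewrite vp // (sg_comp sg) //; apply: (sg_dist sg) => //.
    - exact: (sg_bmeas sg).
    - exact: ltW.
    - by move=> y Cy; exact: ha.
  have -> : F (s + r) - F s = A * r - (v (s + r) - v s) by rewrite /F; ring.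
  apply: (le_trans (ler_normB _ _)); rewrite [leRHS](splitr e) lerD //.
  by rewrite normrM (gtr0_norm r0); apply: le_trans (ltW re); rewrite mulrC ler_wpM2l ?(ltW r0) // lerDl.
have [a a0 ha] := sg_gen sg hf e0; exists a => // r r0 ra rs.
suff : v s <= v (s - r) + r * A + e * r by rewrite /F; lra.
have key y : C y -> kl r f y <= f y + r * g y + e * r.
  move=> Cy; have := ha r r0 ra y Cy; rewrite ler_norml => /andP[_ h1].
  have := ler_wpM2l (ltW r0) (fg y Cy); lra.
rewrite vp //; move: rs; rewrite le_eqVlt => /orP[/eqP rs|rs].
  rewrite rs subrr v0; rewrite rs in key; apply: (le_trans (key x Cx)).
  by rewrite lerD2r lerD2l ler_wpM2l // ltW.
have sr : 0 < s - r by rewrite subr_gt0.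
have bgr : bmeas (fun y : bT => r * g y) by exact: bmeasZ.
rewrite vp // -[in kl s](subrK r s) (sg_comp sg) //.
have h1 : kl (s - r) (kl r f) x <= kl (s - r) (fun y => f y + r * g y) x + e * r.
  apply: (sg_le sg) => //; [exact: bmeasD|exact: (sg_bmeas sg)|by rewrite mulr_ge0 // ltW].
apply: (le_trans h1); rewrite lerD2r.
have -> : kl (s - r) (fun y => f y + r * g y) x = kl (s - r) f x + kl (s - r) (fun y => r * g y) x.
  have b1 := kill_bmeasw (pos := pos) hB x sr bf; have b2 := kill_bmeasw (pos := pos) hB x sr bgr.
  rewrite -expD; [|exact: (bmeas_integrable PT b1)|exact: (bmeas_integrable PT b2)].
  by apply: eq_Rintegral => w _; rewrite mulrDr.
rewrite lerD2l kill_scale // ler_wpM2l ?(ltW r0) //; apply: hA => //; lra.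
Qed.

(* Started outside the support of f, the killed motion reaches it before time t
   only with probability O(t) relative to h, and squaring this estimate gives a
   bound in t^2. *)
Lemma kill_far (K : set 'rV[R]_n) : compact K -> K `<=` C -> exists (K' : set 'rV[R]_n) (c : R),
  [/\ compact K', K' `<=` C, 0 < c &
  forall f (M : R), C2c C f -> 0 <= M -> (forall y, K y -> f y <= M) -> (forall y, ~ K y -> f y = 0) ->
  forall t x, 0 < t -> C x -> ~ K' x ->
  kl t (fun y => h y * f y) x <= M * c * h x * t ^+ 2].
Proof.
move=> cK KC.
have next (K0 : set 'rV[R]_n) : compact K0 -> K0 `<=` C -> exists (K1 : set 'rV[R]_n) u, [/\ compact K1, K1 `<=` C & [/\ C2c C u,
    forall y, 0 <= u y, forall y, K0 y -> 1 <= u y & forall y, ~ K1 y -> u y = 0]].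
  by move=> c0 s0; have [u [hu u0 u1]] := compact_cut (hcox := hcox) c0 s0; case: (hu) => _ [K1 [c1 s1] z1]; exists K1, u.
(* Nested shells: each u_i is at least 1 on the preceding compact set and supported in the next one,
   so half the Laplacian of h u_i is at most a constant times h u_(i+1) on C. *)
have [K1 [u1 [cK1 KC1 [hu1 u10 u1K u1z]]]] := next K cK KC.
have [K2 [u2 [cK2 KC2 [hu2 u20 u2K u2z]]]] := next K1 cK1 KC1.
have [K3 [u3 [cK3 KC3 [hu3 u30 u3K u3z]]]] := next K2 cK2 KC2.
have hg1 := root_prod_C2c (pos := pos) hu1; have hg2 := root_prod_C2c (pos := pos) hu2.
have hg3 := root_prod_C2c (pos := pos) hu3.
have z1 y : ~ K1 y -> h y * u1 y = 0 by move=> nK; rewrite u1z // mulr0.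
have z2 y : ~ K2 y -> h y * u2 y = 0 by move=> nK; rewrite u2z // mulr0.
have [c1 c10 hc1] := half_laplacian_le hg1 cK1 KC1 z1.
have [c2 c20 hc2] := half_laplacian_le hg2 cK2 KC2 z2.
have [M3 M30 hM3] := bounded_gt0 (C2c_bmeas hu3).2.
have bnd (K0 : set 'rV[R]_n) u v c y : C y -> (forall y, 0 <= v y) -> 0 < c -> (forall y, K0 y -> 1 <= v y) ->
    (K0 y -> `|2^-1 * laplacian u y| <= c * h y) /\ (~ K0 y -> 2^-1 * laplacian u y = 0) ->
    2^-1 * laplacian u y <= c * (h y * v y).
  move=> Cy v0 cp v1 [h1 h2]; have hy := h_gt0 Cy.
  have [Ky|nK] := pselect (K0 y); last by rewrite h2 // !mulr_ge0 // ltW.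
  apply: (le_trans (ler_norm _)); apply: (le_trans (h1 Ky)).
  by rewrite mulrA ler_peMr ?v1 // mulr_ge0 // ltW.
(* Started outside K2, h u2 is initially zero and grows at a rate bounded by kl r (h u3), which
   [kill_le_h] bounds by M3 h x after scaling u3 below 1. *)
have step2 s x : 0 < s -> C x -> ~ K2 x -> kl s (fun y => h y * u2 y) x <= c2 * M3 * h x * s.
  move=> s0 Cx nK; have hx := h_gt0 Cx; rewrite -[leRHS]add0r -(z2 x nK).
  have b3 := C2c_bmeas hg3.
  apply: (kill_growth (g := fun y => c2 * (h y * u3 y))) => //.
  - exact: bmeasZ.
  - by move=> y Cy; exact: (bnd K2 _ u3 c2 y Cy u30 c20 u3K (hc2 y Cy)).
  - rewrite -mulrA ler_wpM2l ?(ltW c20) // mulrC ler_wpM2r ?(ltW hx) //.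
    exact: le_trans (ler_norm _) (hM3 x).
  - move=> r r0 _; rewrite kill_scale // -mulrA ler_wpM2l ?(ltW c20) //.
    have hg : C2c C (fun y => M3^-1 * (h y * u3 y)).
      by apply: C2cM => //; apply: d2_C2 => y; exact: d2_cst.
    have : kl r (fun y => M3^-1 * (h y * u3 y)) x <= h x.
      apply: (kill_le_h (hcox := hcox) hB hg r0 Cx) => y Cy; have hy := h_gt0 Cy.
      rewrite mulrC ler_pdivrMr // ler_wpM2l ?(ltW hy) //; exact: le_trans (ler_norm _) (hM3 y).
    by rewrite kill_scale // mulrC ler_pdivrMr // mulrC.
exists K2, (c1 * (c2 * M3)); split=> //; first by rewrite !mulr_gt0.
move=> f M hf M0 fM f0 t x t0 Cx nK2; have hx := h_gt0 Cx.
have nK1 : ~ K1 x by move=> h1; apply: nK2; apply: contrapT => /u2z h2; have := u2K x h1; rewrite h2 ler10.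
have b1 := C2c_bmeas hg1; have b2 := C2c_bmeas hg2.
(* The growth rate of h u1 is controlled by kl s (h u2), which [step2] has just shown to be of order
   t; a second integration in time gives t^2. *)
have le1 : kl t (fun y => h y * u1 y) x <= 0 + (c1 * (c2 * M3 * h x * t)) * t.
  rewrite -(z1 x nK1); apply: (kill_growth (g := fun y => c1 * (h y * u2 y))) => //.
  - exact: bmeasZ.
  - by move=> y Cy; exact: (bnd K1 _ u2 c1 y Cy u20 c10 u2K (hc1 y Cy)).
  - by rewrite z2 // mulr0 !mulr_ge0 // ltW.
  - move=> s s0 st; rewrite kill_scale // ler_wpM2l ?(ltW c10) //.
    apply: (le_trans (step2 s x s0 Cx nK2)); rewrite ler_wpM2l ?(ltW st) //.
    by rewrite !mulr_ge0 // ltW.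
have hg := root_prod_C2c (pos := pos) hf.
apply: (@le_trans _ _ (kl t (fun y => M * (h y * u1 y)) x)).
  apply: (kill_bmeas_le (hcox := hcox) hB t0 Cx); [exact: C2c_bmeas hg|exact: bmeasZ|].
  move=> y Cy; have hy := h_gt0 Cy; rewrite mulrCA ler_wpM2l ?(ltW hy) //.
  have [Ky|nKy] := pselect (K y); last by rewrite f0 // mulr_ge0.
  by apply: (le_trans (fM y Ky)); rewrite ler_peMr // u1K.
rewrite kill_scale //.
have -> : M * (c1 * (c2 * M3)) * h x * t ^+ 2 = M * (c1 * (c2 * M3 * h x * t) * t) by ring.
by rewrite ler_wpM2l //; rewrite add0r in le1.
Qed.

Lemma conditioned_generator Q : (forall t, 0 < t -> cond t (Q t)) -> has_generator C Q L.
Proof.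
move=> hQ f hf; apply/uniform_right0P => e e0.
have hg := root_prod_C2c (pos := pos) hf; case: (hf) => _ [K [cK KC] f0].
have [K' [c [cK' KC' c0 far]]] := kill_far cK KC.
have [M M0 fM] := bounded_gt0 (C2c_bmeas hf).2.
have [m m0 hm] : exists2 m, 0 < m & forall y, (K `|` K') y -> m <= h y.
  apply: compact_min_gt0; first exact: compactU.
  - exact: root_prod_continuous.
  - by move=> y [/KC|/KC']; exact: h_gt0.
(* The tolerance e m becomes at most e after division by h >= m on the two compact sets. *)
have [a a0 ha] := sg_gen (kill_semigroup (hcox := hcox) hB) hg (mulr_gt0 e0 m0).
have Mc : 0 < M * c by rewrite mulr_gt0.
exists (Num.min a (e / (M * c))) => [|t t0]; first by rewrite lt_min a0 divr_gt0.
rewrite lt_min => /andP[ta te] x Cx; have hx := h_gt0 Cx.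
rewrite ltr_pdivlMr // in te.
have QE : \int[Q t x]_y f y = kl t (fun y => h y * f y) x / h x.
  exact: (conditioned_C2c (hcox := hcox) hB t0 (hQ t t0) Cx hf).
rewrite QE.
have -> : (kl t (fun y => h y * f y) x / h x - f x) / t - L f x =
    (kl t (fun y => h y * f y) x - h x * f x - t * (2^-1 * laplacian (fun y => h y * f y) x)) / (h x * t).
  by rewrite -(drift_generatorE hf Cx); field; rewrite !gt_eqF.
rewrite normrM normfV (gtr0_norm (mulr_gt0 hx t0)) ler_pdivrMr ?mulr_gt0 //.
have [KKx|nK] := pselect ((K `|` K') x).
  apply: (le_trans (ha t t0 ta x Cx)); rewrite mulrA ler_wpM2r ?(ltW t0) //.
  by rewrite ler_wpM2l ?(ltW e0) //; exact: hm.
have nK1 : ~ K x by move=> h1; apply: nK; left.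
have nK2 : ~ K' x by move=> h1; apply: nK; right.
have z y : ~ K y -> h y * f y = 0 by move=> h1; rewrite f0 // mulr0.
rewrite (laplacian_supp0 cK z nK1) f0 // !mulr0 !subr0.
have fK y : K y -> f y <= M by move=> _; exact: le_trans (ler_norm _) (fM y).
have h1 := far f M hf (ltW M0) fK f0 t x t0 Cx nK2.
(* The bound of [kill_far] is one-sided, so it is applied to -f as well. *)
have hf' : C2c C (fun y => -1 * f y).
  by apply: C2cM => //; apply: d2_C2 => y; exact: d2_cst.
have fK' y : K y -> -1 * f y <= M by move=> _; have := fM y; rewrite ler_norml => /andP[]; lra.
have f0' y : ~ K y -> -1 * f y = 0 by move=> nKy; rewrite f0 // mulr0.
have h2 := far _ M hf' (ltW M0) fK' f0' t x t0 Cx nK2.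
have e1 : kl t (fun y => h y * (-1 * f y)) x = -1 * kl t (fun y => h y * f y) x.
  rewrite -(kill_scale (-1) x t0 (C2c_bmeas hg)).
  by apply: (kill_eq (hcox := hcox) hB) => // y _; ring.
rewrite e1 in h2.
have h3 : M * c * h x * t ^+ 2 <= e * (h x * t).
  have -> : M * c * h x * t ^+ 2 = t * (M * c) * (h x * t) by ring.
  by rewrite ler_wpM2r ?(ltW te) // mulr_ge0 // ltW.
by rewrite ler_norml; apply/andP; split; lra.
Qed.

End DriftGenerator.

Theorem theorem8 (R : realType) (n : nat)
  (W : set 'M[R]_n) (C : set 'rV[R]_n) (pos : {fset 'rV[R]_n})
  (d : measure_display) (T : measurableType d) (P : probability T R)
  (B : R -> T -> 'rV[R]_n) (b : R -> 'rV[R]_n -> 'rV[R]_n -> R)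
  (hW : finite_reflection_group W)
  (hC : open_chamber W C)
  (hpos : positive_roots W C pos)
  (hB : brownian_motion P B)
  (hb : killed_density P B C b) :
  [/\ forall x, C x -> repulsive_drift W C x = root_drift pos x,
      exists2 Q : R -> R.-pker (borel_rV R n) ~> (borel_rV R n),
        markov_semigroup C Q &
        has_transition_density C Q (doob_transform (root_prod pos) b),
      forall Q : R -> R.-pker (borel_rV R n) ~> (borel_rV R n),
        markov_semigroup C Q ->
        (has_transition_density C Q (doob_transform (root_prod pos) b) <->
         has_generator C Q (diffusion_op (repulsive_drift W C))) &
      forall (d' : measure_display) (T' : measurableType d')
             (P' : probability T' R) (X : R -> T' -> 'rV[R]_n),
        conditioned_brownian_motion P' X C b (root_prod pos) <->
        diffusion P' X C (repulsive_drift W C)].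
Proof.
pose hcox : reflection_chamber W C pos := ReflectionChamber hW hC hpos.
have key Q : markov_semigroup C Q ->
    has_transition_density C Q (doob_transform (root_prod pos) b) <->
    has_generator C Q (diffusion_op (repulsive_drift W C)).
  move=> hQ; split=> [/(density_conditioned (hcox := hcox) hB Q hb)|hL].
    exact: (conditioned_generator (hcox := hcox) hB).
  apply/(density_conditioned (hcox := hcox) hB Q hb) => t.
  exact: (generator_conditioned (hcox := hcox) hB hQ hL).
split=> //.
- by move=> x; exact: (repulsive_driftE (hcox := hcox)).
- have [Q [hQ Qt]] := exists_conditioned_semigroup (hcox := hcox) hB.
  by exists Q => //; apply/(density_conditioned (hcox := hcox) hB Q hb).
- move=> d' T' P' X; split=> -[Q hX hQ]; exists Q => //; apply/key => //; by case: hX.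
Qed.
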